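(* Let $A_1,A_2$ be separable unital C*-algebras with a common unital C*-subalgebra $B$ and conditional expectations $E_k:A_k\to B$, $k=1,2$ (not assumed GNS-faithful). Let $A_f=A_1\underset{B}{*}A_2$ be the full amalgamated free product, let $A=A_1\overset{v}{\underset{B}{*}}A_2$ be the vertex-reduced amalgamated free product, and let $\lambda:A_f\to A$ be the canonical surjective unital $*$-homomorphism. Then $[\lambda]\in KK(A_f,A)$ is invertible.
   Context: All C*-algebras and Hilbert modules are separable. $\mathcal L_C(H)$ denotes the adjointable operators of a Hilbert $C$-module $H$. $A_1,A_2$ are viewed as subalgebras of the full amalgamated free product $A_f$. Construction of the vertex-reduced amalgamated free product. Let $A_k^\circ=\ker E_k$ and let $(K_k,\rho_k,\eta_k)$ be the GNS construction of $E_k$: $K_k$ is a Hilbert $B$-module, $\eta_k\in K_k$, $\rho_k:A_k\to\mathcal L_B(K_k)$ is a unital $*$-homomorphism, $K_k=\overline{\rho_k(A_k)\eta_k\cdot B}$, $\langle\eta_k,\rho_k(a)\eta_k\rangle=E_k(a)$. One has $K_k=\eta_k\cdot B\oplus K_k^\circ$ with $K_k^\circ=\overline{\mathrm{Span}}\{\rho_k(a)\eta_k\cdot b: a\in A_k^\circ,b\in B\}$, and $\rho_k(B)$ preserves $K_k^\circ$. Write $\overline 1=2$, $\overline 2=1$. Let $I$ be the set of finite sequences $\underline i=(i_1,\dots,i_n)\in\{1,2\}^n$, $n\ge1$, with $i_s\ne i_{s+1}$ for all $s$. For $\underline i\in I$ let $H_{\underline i}$ be the Hilbert $A_{i_n}$-module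 $K_{i_1}\otimes_B K_{i_2}^\circ\otimes_B\cdots\otimes_B K_{i_{n-1}}^\circ\otimes_B A_{i_n}$ if $n\ge3$, $K_{i_1}\otimes_B A_{i_2}$ if $n=2$, $A_{i_1}$ if $n=1$; $A_{i_1}$ acts on the left by $\lambda_{\underline i}=\rho_{i_1}\otimes\mathrm{id}$ if $n\ge 2$ and by left multiplication if $n=1$. Let $H_{k,l}=\bigoplus H_{\underline i}$ and $\lambda_{k,l}=\bigoplus\lambda_{\underline i}:A_k\to\mathcal L_{A_l}(H_{k,l})$, the sums being over $\underline i\in I$ with $i_1=k$, $i_n=l$. Let $u_{k,k}:H_{k,k}\to H_{\overline k,k}$ be the unitary with $u_{k,k}\xi=\eta_{\overline k}\otimes\xi$ for $\xi\in A_k=H_{(k)}$, and, for $\underline i=(k,\underline i')$ with $n\ge2$ and $\xi=\rho_k(a)\eta_k\otimes\xi'\in H_{\underline i}$, where $\xi'\in K_{i_2}^\circ\otimes_B\cdots\otimes_B A_k\subset H_{\underline i'}$, $u_{k,k}\xi=\eta_{\overline k}\otimes\xi$ if $a\in A_k^\circ$ and $u_{k,k}\xi=\lambda_{\underline i'}(a)\xi'$ if $a\in B$. Let $\pi_k:A_f\to\mathcal L_{A_k}(H_{k,k})$ be the unique unital $*$-homomorphism with $\pi_k(a)=\lambda_{k,k}(a)$ for $a\in A_k$ and $\pi_k(a)=u_{k,k}^*\lambda_{\overline k,k}(a)u_{k,k}$ for $a\in A_{\overline k}$. The vertex-reduced amalgamated free product is the separation-completion of $A_f$ for the C*-seminorm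 $\|x\|_v=\max\{\|\pi_1(x)\|,\|\pi_2(x)\|\}$, and $\lambda$ is the canonical quotient map onto it. *)

(* Defs.v *)
From HB Require Import structures.
From mathcomp Require Import all_boot all_order all_algebra.
From mathcomp Require Import complex.
From mathcomp Require Import all_classical all_reals topology normedtype.

Set Implicit Arguments.
Unset Strict Implicit.
Unset Printing Implicit Defensive.

Import Order.TTheory GRing.Theory Num.Theory.
Import numFieldNormedType.Exports.

Local Open Scope classical_set_scope.
Local Open Scope complex_scope.
Local Open Scope ring_scope.

(* Unital C*-algebras.  The norm of a normed module over R[i] takes its values
   in R[i] (in fact in its nonnegative reals).  The product is a field of the
   mixin because the hierarchy has no structure above both normed modules and
   rings that numeric domains inherit from, so that the two cannot be joined;
   the zero algebra is allowed. *)
HB.mixin Record isCStarAlgebra (R : realType) A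
    of CompleteNormedModule R[i] A := {
  cmul : A -> A -> A;
  cone : A;
  star : A -> A;
  cmulA : associative cmul;
  cmul1l : left_id cone cmul;
  cmul1r : right_id cone cmul;
  cmulDl : forall a b c, cmul (a + b) c = cmul a c + cmul b c;
  cmulDr : forall a b c, cmul a (b + c) = cmul a b + cmul a c;
  cmulZl : forall (z : R[i]) a b, cmul (z *: a) b = z *: cmul a b;
  cmulZr : forall (z : R[i]) a b, cmul a (z *: b) = z *: cmul a b;
  starD : forall a b, star (a + b) = star a + star b;
  starZ : forall (z : R[i]) a, star (z *: a) = z^* *: star a;
  starM : forall a b, star (cmul a b) = cmul (star b) (star a);
  starK : involutive star;
  cnorm_mul : forall a b : A, `|cmul a b| <= `|a| * `|b|;
  cnorm_star : forall a : A, `|cmul (star a) a| = `|a| ^+ 2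
}.

#[short(type="cstarAlgType")]
HB.structure Definition CStarAlgebra (R : realType) :=
  {A of CompleteNormedModule R[i] A & isCStarAlgebra R A}.

Reserved Notation "a ** b" (at level 40, left associativity).
Notation "a ** b" := (cmul a b) : ring_scope.

Record starHom (R : realType) (A D : cstarAlgType R) := StarHom {
  shom_fun :> {linear A -> D};
  shomM : forall a b, shom_fun (a ** b) = shom_fun a ** shom_fun b;
  shom1 : shom_fun cone = cone;
  shom_star : forall a, shom_fun (star a) = star (shom_fun a)
}.

Definition separable (T : topologicalType) : Prop :=
  exists2 S : set T, countable S & dense S.

Section CStarAlgebras.
Context {R : realType}.
Implicit Types A B D : cstarAlgType R.

Definition cpos A (a : A) : Prop := exists b : A, a = star b ** b.

(* A is regarded as an overalgebra of B through iota. *)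
Definition conditional_expectation A B (iota : B -> A) (E : {linear A -> B}) :
    Prop :=
  [/\ forall b, E (iota b) = b,
      forall b a b', E (iota b ** a ** iota b') = b ** E a ** b'
    & forall a, cpos a -> cpos (E a)].

(* ID is C([0,1], D), with evaluation maps ev t for t in [0,1]; the values of
   ev outside [0,1] are irrelevant. *)
Definition is_path_algebra D (ID : cstarAlgType R)
    (ev : R -> starHom ID D) : Prop :=
  [/\ forall f : ID, {within `[0, 1], continuous (fun t => ev t f)},
      forall f g : ID, (forall t, t \in `[0, 1]%R -> ev t f = ev t g) -> f = g
    & forall g : R -> D, {within `[0, 1], continuous g} ->
        exists f : ID, forall t, t \in `[0, 1]%R -> ev t f = g t].

Definition is_full_amalgam (B : cstarAlgType R) (A : bool -> cstarAlgType R)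
    (iota : forall k, starHom B (A k))
    (Af : cstarAlgType R) (inj : forall k, starHom (A k) Af) : Prop :=
  (forall b, inj true (iota true b) = inj false (iota false b)) /\
  forall (D : cstarAlgType R) (f : forall k, starHom (A k) D),
    (forall b, f true (iota true b) = f false (iota false b)) ->
    exists2 g : starHom Af D, (forall k a, g (inj k a) = f k a) &
      forall g' : starHom Af D, (forall k a, g' (inj k a) = f k a) -> g' =1 g.

(* lambda exhibits A as the separation-completion of Af for the C*-seminorm N;
   it is then surjective, the image of a *-homomorphism being closed. *)
Definition is_separation_completion (Af A : cstarAlgType R)
    (N : Af -> R) (lambda : starHom Af A) : Prop :=
  (forall x, `|lambda x| = (N x)%:C) /\ dense (range lambda).

End CStarAlgebras.

(* Right modules; the inner product is linear in its second variable. *)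
HB.mixin Record isHilbertModule (R : realType) (D : cstarAlgType R) E
    of CompleteNormedModule R[i] E := {
  ract : E -> D -> E;
  hdot : E -> E -> D;
  ractDl : forall x y d, ract (x + y) d = ract x d + ract y d;
  ractDr : forall x d e, ract x (d + e) = ract x d + ract x e;
  ractZl : forall (c : R[i]) x d, ract (c *: x) d = c *: ract x d;
  ractZr : forall (c : R[i]) x d, ract x (c *: d) = c *: ract x d;
  ractM : forall x d e, ract x (d ** e) = ract (ract x d) e;
  ract1 : forall x, ract x cone = x;
  hdotDr : forall x y z, hdot x (y + z) = hdot x y + hdot x z;
  hdotZr : forall (c : R[i]) x y, hdot x (c *: y) = c *: hdot x y;
  hdotMr : forall x y d, hdot x (ract y d) = hdot x y ** d;
  hdotC : forall x y, hdot y x = star (hdot x y);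
  hdot_pos : forall x, cpos (hdot x x);
  hnorm_sqr : forall x : E, `|x| ^+ 2 = `|hdot x x|
}.

#[short(type="hilbertModType")]
HB.structure Definition HilbertModule (R : realType) (D : cstarAlgType R) :=
  {E of CompleteNormedModule R[i] E & isHilbertModule R D E}.

(* D as a Hilbert D-module, with <x, y> = x^* y. *)
Definition cself (R : realType) (D : cstarAlgType R) : Type := D.

Section CSelf.
Variables (R : realType) (D : cstarAlgType R).

HB.instance Definition _ := CompleteNormedModule.copy (cself D) D.

Let cract (x : cself D) (d : D) : cself D := (x : D) ** d.
Let chdot (x y : cself D) : D := star (x : D) ** y.

Fact cself_ractDl x y d : cract (x + y) d = cract x d + cract y d.
Proof. exact: cmulDl. Qed.
Fact cself_ractDr x d e : cract x (d + e) = cract x d + cract x e.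
Proof. exact: cmulDr. Qed.
Fact cself_ractZl (c : R[i]) x d : cract (c *: x) d = c *: cract x d.
Proof. by rewrite /cract cmulZl. Qed.
Fact cself_ractZr (c : R[i]) x d : cract x (c *: d) = c *: cract x d.
Proof. by rewrite /cract cmulZr. Qed.
Fact cself_ractM x d e : cract x (d ** e) = cract (cract x d) e.
Proof. exact: cmulA. Qed.
Fact cself_ract1 x : cract x cone = x.
Proof. exact: cmul1r. Qed.
Fact cself_hdotDr x y z : chdot x (y + z) = chdot x y + chdot x z.
Proof. exact: cmulDr. Qed.
Fact cself_hdotZr (c : R[i]) x y : chdot x (c *: y) = c *: chdot x y.
Proof. by rewrite /chdot cmulZr. Qed.
Fact cself_hdotMr x y d : chdot x (cract y d) = chdot x y ** d.
Proof. exact: cmulA. Qed.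
Fact cself_hdotC x y : chdot y x = star (chdot x y).
Proof. by rewrite /chdot starM starK. Qed.
Fact cself_hdot_pos x : cpos (chdot x x).
Proof. by exists (x : D). Qed.
Fact cself_hnorm_sqr (x : cself D) : `|x| ^+ 2 = `|chdot x x|.
Proof. by rewrite /chdot cnorm_star. Qed.

HB.instance Definition _ := isHilbertModule.Build R D (cself D)
  cself_ractDl cself_ractDr cself_ractZl cself_ractZr cself_ractM cself_ract1
  cself_hdotDr cself_hdotZr cself_hdotMr cself_hdotC cself_hdot_pos
  cself_hnorm_sqr.

End CSelf.

Section HilbertModules.
Context {R : realType}.

Definition lspan (E : lmodType R[i]) (X : set E) : set E :=
  [set v | exists n (c : 'I_n -> R[i]) (x : 'I_n -> E),
             (forall i, X (x i)) /\ v = \sum_(i < n) c i *: x i].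

Definition clspan (E : completeNormedModType R[i]) (X : set E) : set E :=
  closure (lspan X).

Section Operators.
Context {D : cstarAlgType R}.
Implicit Types E : hilbertModType D.

Definition adjoint_pair E E' (T : E -> E') (S : E' -> E) : Prop :=
  forall x y, hdot (T x) y = hdot x (S y).

Definition adjointable E E' (T : E -> E') : Prop :=
  exists S, adjoint_pair T S.

(* Norm limits of finite sums of the operators z |-> x <y, z>. *)
Definition compact_op E E' (T : E -> E') : Prop :=
  adjointable T /\
  forall eps : R[i], 0 < eps ->
    exists n (x : 'I_n -> E') (y : 'I_n -> E),
      forall z, `|T z - \sum_(i < n) ract (x i) (hdot (y i) z)| <= eps * `|z|.

Definition opnorm E (T : E -> E) : R :=
  sup [set complex.Re `|T x| | x in [set x | `|x| <= 1]].

(* phi is a *-homomorphism from A to the adjointable operators of E *)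
Definition star_rep (A : cstarAlgType R) E (phi : A -> E -> E) : Prop :=
  [/\ forall (c : R[i]) a b x, phi (c *: a + b) x = c *: phi a x + phi b x,
      forall a b x, phi (a ** b) x = phi a (phi b x)
    & forall a, adjoint_pair (phi a) (phi (star a))].

Definition unital_rep (A : cstarAlgType R) E (phi : A -> E -> E) : Prop :=
  star_rep phi /\ forall x, phi cone x = x.

Definition is_unitary E E' (u : E -> E') (v : E' -> E) : Prop :=
  [/\ adjoint_pair u v, cancel u v & cancel v u].

(* S is the Hilbert module direct sum of the H i, over those i with P i. *)
Definition is_hilbert_sum (I : Type) (P : I -> Prop) (H : I -> hilbertModType D)
    (S : hilbertModType D) (inc : forall i, H i -> S) : Prop :=
  [/\ forall i x y, P i -> hdot (inc i x) (inc i y) = hdot x y,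
      forall i j x y, P i -> P j -> i <> j -> hdot (inc i x) (inc j y) = 0
    & clspan [set z | exists i x, P i /\ z = inc i x] = setT].

End Operators.

(* T, with the map j, is the internal tensor product of E with Y over D, where
   Y is a closed submodule of the Hilbert C-module E' that is invariant under
   the left action phi of D.  The inner product formula forces j to be additive
   in each variable, D-balanced and C-linear, and T is determined up to
   unitary equivalence. *)
Definition is_tensor (D C : cstarAlgType R) (E : hilbertModType D)
    (E' : hilbertModType C) (phi : D -> E' -> E') (Y : set E')
    (T : hilbertModType C) (j : E -> E' -> T) : Prop :=
  (forall x x' y y', Y y -> Y y' ->
     hdot (j x y) (j x' y') = hdot y (phi (hdot x x') y')) /\
  clspan [set z | exists x y, Y y /\ z = j x y] = setT.

End HilbertModules.

Section KK.
Context {R : realType}.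
Implicit Types A D C : cstarAlgType R.

(* C*-algebras are trivially graded; a Z/2-grading of the module is encoded by
   the operator cgrad that is 1 on even and -1 on odd vectors. *)
Record cycle A D := Cycle {
  cmod : hilbertModType D;
  cgrad : cmod -> cmod;
  crep : A -> cmod -> cmod;
  cop : cmod -> cmod
}.
Arguments cgrad {A D} c x.
Arguments crep {A D} c a x.
Arguments cop {A D} c x.

Definition is_kasparov A D (e : cycle A D) : Prop :=
  let F := cop e in
  [/\ separable (cmod e),
      adjoint_pair (cgrad e) (cgrad e) /\ involutive (cgrad e),
      star_rep (crep e) /\
        (forall a x, cgrad e (crep e a x) = crep e a (cgrad e x)),
      forall x, F (cgrad e x) = - cgrad e (F x)
    & exists2 F', adjoint_pair F F' &
        forall a,
          [/\ compact_op (fun x => F (crep e a x) - crep e a (F x)),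
              compact_op (fun x => F (F (crep e a x)) - crep e a x)
            & compact_op (fun x => F (crep e a x) - F' (crep e a x))]].

(* z is, up to unitary equivalence, the image of e under f : D -> C. *)
Definition is_pushforward A D C (f : D -> C) (e : cycle A D) (z : cycle A C) :
    Prop :=
  exists j : cmod e -> cself C -> cmod z,
    [/\ is_tensor (fun d (c : cself C) => f d ** (c : C) : cself C) setT j,
        forall x c, cgrad z (j x c) = j (cgrad e x) c,
        forall a x c, crep z a (j x c) = j (crep e a x) c
      & forall x c, cop z (j x c) = j (cop e x) c].

(* Equality of the classes of x and y in KK(A, D). *)
Definition kk_eq A D (x y : cycle A D) : Prop :=
  [/\ is_kasparov x, is_kasparov y
    & exists (ID : cstarAlgType R) (ev : R -> starHom ID D),
        is_path_algebra ev /\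
        exists w : cycle A ID,
          [/\ is_kasparov w, is_pushforward (ev 0) w x
            & is_pushforward (ev 1) w y]].

(* The operator F on the tensor product (E1 (x) E2, j) is an F2-connection for
   E1.  With T_x y = j x y, the usual condition for homogeneous x has the sign
   (-1)^(deg x) in front of F T_x; as j (g1 x) = (-1)^(deg x) T_x, the form
   below covers all x by linearity. *)
Definition is_connection D C (E1 : hilbertModType D) (g1 : E1 -> E1)
    (E2 : hilbertModType C) (F2 : E2 -> E2)
    (E : hilbertModType C) (j : E1 -> E2 -> E) (F : E -> E) : Prop :=
  forall x,
    compact_op (fun y => j x (F2 y) - F (j (g1 x) y)) /\
    exists S S' : E -> E2,
      [/\ adjoint_pair (j x) S, adjoint_pair (j (g1 x)) S'
        & compact_op (fun z => F2 (S z) - S' (F z))].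

(* The Connes-Skandalis characterization of the Kasparov modules z which
   represent the Kasparov product of x and y over D; in the last item G is
   F1 (x) 1, the graded commutator of the odd operators G and F is G F + F G,
   and positivity modulo compact operators means being of the form S^* S up to
   a compact operator. *)
Definition is_kasparov_product A D C (x : cycle A D) (y : cycle D C)
    (z : cycle A C) : Prop :=
  let F := cop z in
  is_kasparov z /\
  exists j : cmod x -> cmod y -> cmod z,
    [/\ is_tensor (crep y) setT j,
        forall v w, cgrad z (j v w) = j (cgrad x v) (cgrad y w),
        forall a v w, crep z a (j v w) = j (crep x a v) w,
        is_connection (cgrad x) (cop y) j F
      & exists G : cmod z -> cmod z,
          [/\ adjointable G, forall v w, G (j v w) = j (cop x v) w
            & forall a, exists S S' : cmod z -> cmod z, adjoint_pair S S' /\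
                compact_op (fun v =>
                  crep z a (G (F (crep z (star a) v)) +
                            F (G (crep z (star a) v))) - S' (S v))]].

(* The cycle (D, f, 0) defining the class [f] of a *-homomorphism f. *)
Definition hom_cycle A D (f : A -> D) : cycle A D :=
  @Cycle A D (cself D) id (fun a d => f a ** (d : D) : cself D) (fun=> 0).

Definition kk_invertible A D (x : cycle A D) : Prop :=
  is_kasparov x /\
  exists2 y : cycle D A, is_kasparov y &
    (exists2 z, is_kasparov_product x y z & kk_eq z (hom_cycle idfun)) /\
    (exists2 w, is_kasparov_product y x w & kk_eq w (hom_cycle idfun)).

End KK.

(* The indices 1, 2 are the booleans, so that k-bar is ~~ k. *)

Section VertexReduced.
Context {R : realType} {B : cstarAlgType R} {A : bool -> cstarAlgType R}.
Variable iota : forall k, starHom B (A k).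
Variable E : forall k, {linear A k -> B}.

Record gns (k : bool) := Gns {
  gmod : hilbertModType B;
  grep : A k -> gmod -> gmod;
  gvec : gmod;
  grep_unital : unital_rep grep;
  gvec_cyclic :
    clspan [set z | exists a b, z = ract (grep a gvec) b] = setT;
  gvec_expect : forall a, hdot gvec (grep a gvec) = E k a
}.

Variable K : forall k, gns k.

Definition gcore k : set (gmod (K k)) :=
  clspan [set z | exists a b,
            E k a = 0 /\ z = ract (grep a (gvec (K k))) b].

(* The sequence (i_1, ..., i_n) is represented by l = i_n and
   s = (i_1, ..., i_(n-1)); then i_1 = head l s, and the length-one sequence
   (l) has s = [::].  word_idx k l selects those sequences in I with i_1 = k
   and i_n = l. *)
Definition word_idx (k l : bool) (s : seq bool) : bool :=
  sorted (fun p q => p != q) (rcons s l) && (head l s == k).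

(* The modules H_(i_1, ..., i_n); T l k s is the one for (k, s, l). *)
Definition word_mod (T : forall l : bool, bool -> seq bool -> hilbertModType (A l))
    (l : bool) (s : seq bool) : hilbertModType (A l) :=
  if s is k :: s' then T l k s' else cself (A l).

(* The closed submodule of H_(i_1, ..., i_n) in which the first factor K_(i_1)
   is replaced by its core, for n >= 2; all of A_(i_1) for n = 1. *)
Fixpoint word_core T
    (tens : forall l k s, gmod (K k) -> word_mod T l s -> word_mod T l (k :: s))
    (l : bool) (s : seq bool) : set (word_mod T l s) :=
  if s is k :: s' then
    clspan [set z | exists x h,
              [/\ @gcore k x, word_core tens h & z = tens l k s' x h]]
  else setT.

(* The modules H_i, with H_(k, i') = K_k (x)_B (core of H_i'), where B acts on
   H_i' through A_(i'_1), and the left actions lambda_i.  wact k l s is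
   meaningful only when k is the first letter of the word. *)
Record words := Words {
  wfam : forall l : bool, bool -> seq bool -> hilbertModType (A l);
  wtens : forall l k s,
    gmod (K k) -> word_mod wfam l s -> word_mod wfam l (k :: s);
  wact : forall k l s, A k -> word_mod wfam l s -> word_mod wfam l s;
  wtens_tensor : forall l k s, word_idx k l (k :: s) ->
    is_tensor (fun b => wact (iota (head l s) b)) (word_core wtens (l:=l) (s:=s))
      (@wtens l k s);
  wact_rep : forall k l s, word_idx k l s -> unital_rep (@wact k l s);
  wact_nil : forall l (a x : A l), @wact l l [::] a x = a ** x;
  wact_cons : forall l k s a x h, word_idx k l (k :: s) ->
    word_core wtens h ->
    @wact k l (k :: s) a (@wtens l k s x h) = wtens (grep a x) h
}.

(* H_(k, l) = whsum k l, with lambda_(k, l) = whact and u_(k, k) = whu k. *)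
Record word_sums (W : words) := WordSums {
  whsum : forall k l : bool, hilbertModType (A l);
  whinc : forall k l s, word_mod (wfam W) l s -> whsum k l;
  whact : forall k l, A k -> whsum k l -> whsum k l;
  whu : forall k, whsum k k -> whsum (~~ k) k;
  whu_adj : forall k, whsum (~~ k) k -> whsum k k;
  whinc_sum : forall k l, is_hilbert_sum (word_idx k l) (@whinc k l);
  whact_rep : forall k l, unital_rep (@whact k l);
  whact_inc : forall k l s a x, word_idx k l s ->
    @whact k l a (@whinc k l s x) = whinc k (wact a x);
  whu_unitary : forall k, is_unitary (@whu k) (@whu_adj k);
  whu_nil : forall k (x : A k),
    whu (@whinc k k [::] x) =
    @whinc (~~ k) k [:: ~~ k] (@wtens W k (~~ k) [::] (gvec (K (~~ k))) x);
  whu_core : forall k s a (h : word_mod (wfam W) k s),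
    word_idx k k (k :: s) -> word_core (@wtens W) h -> E k a = 0 ->
    let xi := @wtens W k k s (grep a (gvec (K k))) h in
    whu (@whinc k k (k :: s) xi) =
    @whinc (~~ k) k [:: ~~ k, k & s]
      (@wtens W k (~~ k) (k :: s) (gvec (K (~~ k))) xi);
  whu_base : forall k s b (h : word_mod (wfam W) k s),
    word_idx k k (k :: s) -> word_core (@wtens W) h ->
    whu (@whinc k k (k :: s)
           (@wtens W k k s (grep (iota k b) (gvec (K k))) h)) =
    @whinc (~~ k) k s (wact (iota (~~ k) b) h)
}.

(* p k is the representation pi_k of the full amalgamated free product Af. *)
Definition is_vertex_rep (W : words) (H : word_sums W) (Af : cstarAlgType R)
    (inj : forall k, starHom (A k) Af)
    (p : forall k, Af -> whsum H k k -> whsum H k k) : Prop :=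
  forall k,
    [/\ unital_rep (p k),
        forall a x, p k (inj k a) x = whact a x
      & forall a x, p k (inj (~~ k) a) x = whu_adj (whact a (whu x))].

Definition vertex_norm (W : words) (H : word_sums W) (Af : cstarAlgType R)
    (p : forall k, Af -> whsum H k k -> whsum H k k) (x : Af) : R :=
  Num.max (opnorm (p true x)) (opnorm (p false x)).

End VertexReduced.

(* Main.v *)
Require Import Defs.
From HB Require Import structures.
From mathcomp Require Import all_boot all_order all_algebra.
From mathcomp Require Import complex ring lra.
From mathcomp Require Import all_classical all_reals topology normedtype.

Set Implicit Arguments.
Unset Strict Implicit.
Unset Printing Implicit Defensive.

Import Order.TTheory GRing.Theory Num.Theory.
Import numFieldNormedType.Exports.

Local Open Scope classical_set_scope.
Local Open Scope complex_scope.
Local Open Scope ring_scope.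

(* Write e_k for the compression of pi_k to its vacuum vector, with values in A_k,
   and E = E_1 e_1 : A_f -> B.  E vanishes on all reduced words, and e_k on those that
   are not of length one with letter in A_k.  For a *-homomorphism q : A_f -> Q, let K be
   the Hilbert Q-module generated by A_f with <x, y> = q(E(x^* y)), and M = Q + K, with
   the unit vectors v1 = 1 in Q and v2 = the class of 1 in K.  Let A_f act on M by
   left multiplication, but with A_2 conjugated by a rotation of the plane spanned by
   v1 and v2, which commutes with B.

   The exchange of v1 and v2 yields a representation on M that factors through the
   vertex-reduced free product A, even for Q = A_f: |s(x) z| <= |lambda(x)| |z| holds
   as soon as |s(x) z| <= C_z |lambda(x)| for a total set of z, and such z are found
   among the vectors whose coefficient x |-> <z, s(x) z> is e_k or factors through E.
   For Q = A all the rotations have this property, which is seen after tensoring M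
   with the modules H_(k, k).

   Together with left multiplication on a second copy of K and the operator F that
   exchanges the two copies of K, this is a Kasparov cycle: F^2 - 1 has rank one, and
   F commutes with A_1 exactly and with A_2 up to finite rank operators.  For Q = A_f
   it is the inverse of [lambda].  Its products with [lambda] are the cycles of the
   same shape over A_f and over A.  Rotating back to the identity, along paths whose
   components in the two copies of K vanish at the end, connects them to the cycles
   (A_f, id, 0) and (A, id, 0). *)

(** * Real-valued norms and sequences *)

(** The obstacle is that over [Af] the rotated representations need not factor through the
    vertex-reduced free product: without rotation, left multiplication on the summand [Af] itself
    remains. At the exchange both v1 and v2 acquire coefficients dominated by |lambda(x)|, so the
    inverse is built there. The homotopies to the identity use a whole arc of angles, but in them
    the acting algebra and the coefficient algebra coincide: over [Af] the bound is trivial, over A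
    it is the main estimate.

    The constants C_z may depend on z because of a spectral radius argument: in the powers T^(2^n)
    of a selfadjoint T only the growth matters, so every such bound improves itself to the constant
    1.

    At the identity, the two copies of K with F between them form a degenerate cycle. Paths that
    vanish there at the end contract this summand within the homotopy itself. The price is that v2
    is no longer a constant path of the module. The rational parametrization of the quarter circle
    by the tangent of the half angle pays it: every coefficient that involves v2 contains this
    tangent, which is 0 at the end, as a factor. *)

Section ComplexModulus.
Context {R : realType}.

(* Norms take values in R[i]; cn and nr are the corresponding real numbers. *)
Definition cn (c : R[i]) : R := complex.Re `|c|.

Lemma cnE c : `|c| = (cn c)%:C.
Proof. by rewrite /cn RRe_real// ger0_real. Qed.

Lemma cn_ge0 c : 0 <= cn c.
Proof. by rewrite -ler0c -cnE. Qed.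

Lemma cnM c d : cn (c * d) = cn c * cn d.
Proof. by apply: (@complexI R); rewrite rmorphM/= -!cnE normrM. Qed.

Lemma cnR (r : R) : cn r%:C = `|r|.
Proof.
by rewrite /cn normc_def /= expr0n/= addr0 sqrtr_sqr.
Qed.

Lemma cn_eq0 c : (cn c == 0) = (c == 0).
Proof.
apply/eqP/eqP => [c0|->]; last by rewrite /cn normr0.
by apply/eqP; rewrite -normr_eq0 cnE c0.
Qed.

Lemma cnN1 : cn (-1) = 1.
Proof. by rewrite /cn normrN1. Qed.

Lemma cn1 : cn 1 = 1.
Proof. by rewrite /cn normr1. Qed.

Lemma posC (e : R[i]) : 0 < e -> exists2 r : R, 0 < r & e = r%:C.
Proof.
move=> e0; exists (complex.Re e); last by rewrite RRe_real// gtr0_real.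
by rewrite -ltcR RRe_real// gtr0_real.
Qed.

End ComplexModulus.

Section RealNorm.
Context {R : realType} {V : normedModType R[i]}.
Implicit Types x y : V.

Definition nr x : R := complex.Re `|x|.

Lemma nrE x : `|x| = (nr x)%:C.
Proof. by rewrite /nr RRe_real// ger0_real. Qed.

Lemma nr_ge0 x : 0 <= nr x.
Proof. by rewrite -ler0c -nrE. Qed.

Lemma nr0 : nr (0 : V) = 0.
Proof. by rewrite /nr normr0. Qed.

Lemma nr_eq0 x : (nr x == 0) = (x == 0).
Proof.
apply/eqP/eqP => [x0|->]; last by rewrite nr0.
by apply/eqP; rewrite -normr_eq0 nrE x0.
Qed.

Lemma nr_le0 x : nr x <= 0 -> x = 0.
Proof.
by move=> x0; apply/eqP; rewrite -nr_eq0 eq_le x0 nr_ge0.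
Qed.

Lemma nrD x y : nr (x + y) <= nr x + nr y.
Proof. by rewrite -lecR rmorphD/= -!nrE ler_normD. Qed.

Lemma nrZ c x : nr (c *: x) = cn c * nr x.
Proof. by apply: (@complexI R); rewrite rmorphM/= -nrE -cnE normrZ nrE. Qed.

Lemma nrZR (r : R) x : nr (r%:C *: x) = `|r| * nr x.
Proof. by rewrite nrZ cnR. Qed.

Lemma nrN x : nr (- x) = nr x.
Proof. by rewrite /nr normrN. Qed.

Lemma nr_dist x y : nr (x - y) = nr (y - x).
Proof. by rewrite -nrN opprB. Qed.

Lemma nr_tri x y z : nr (x - z) <= nr (x - y) + nr (y - z).
Proof. by have := nrD (x - y) (y - z); rewrite addrA subrK. Qed.

Lemma nr_rev x y : nr x - nr y <= nr (x - y).
Proof. by rewrite lerBlDr; have := nrD (x - y) y; rewrite subrK. Qed.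

Lemma nr_sum (I : Type) (r : seq I) (P : pred I) (F : I -> V) :
  nr (\sum_(i <- r | P i) F i) <= \sum_(i <- r | P i) nr (F i).
Proof.
elim/big_ind2: _ => [|x1 x2 y1 y2 h1 h2|//]; first by rewrite nr0.
by apply: le_trans (nrD _ _) _; apply: lerD.
Qed.

Lemma nr_small x : (forall e : R, 0 < e -> nr x <= e) -> x = 0.
Proof.
move=> h; apply: nr_le0; apply/ler_addgt0Pr => e e0.
by rewrite add0r h.
Qed.

Lemma closureP (S : set V) x :
  closure S x <-> forall e : R, 0 < e -> exists2 y, S y & nr (x - y) < e.
Proof.
split=> [clx e e0|h].
  have e0' : 0 < e%:C :> R[i] by rewrite ltcR.
  have [y [Sy]] := clx _ (nbhsx_ballx x e%:C e0').
  rewrite -ball_normE/= nrE ltcR => ?; by exists y.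
move=> B /nbhs_ballP[e /= e0 sB].
have [r r0 er] := posC e0; have [y Sy xy] := h r r0.
exists y; split=> //; apply: sB; rewrite -ball_normE/=.
by rewrite nrE er ltcR.
Qed.

Lemma denseP (S : set V) :
  dense S <-> forall x (e : R), 0 < e -> exists2 y, S y & nr (x - y) < e.
Proof.
split=> [dS x e e0|h].
  have e0' : 0 < e%:C :> R[i] by rewrite ltcR.
  have := dS (interior (ball x e%:C)) _ (@open_interior _ _).
  case=> [|y [/interior_subset]].
    by exists x; apply: (nbhsx_ballx x e%:C e0').
  rewrite -ball_normE/= nrE ltcR => ? ?; by exists y.
move=> O [x Ox] oO.
have /nbhs_ballP[e /= e0 sB] : nbhs x O by apply: open_nbhs_nbhs.
have [r r0 er] := posC e0; have [y Sy xy] := h x r r0.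
exists y; split=> //; apply: sB; rewrite -ball_normE/=.
by rewrite nrE er ltcR.
Qed.

Definition cvs (u : nat -> V) (l : V) :=
  forall e : R, 0 < e -> exists N, forall n, (N <= n)%N -> nr (u n - l) < e.

Definition cauchys (u : nat -> V) :=
  forall e : R, 0 < e -> exists N, forall m n, (N <= m)%N -> (N <= n)%N ->
    nr (u m - u n) < e.

End RealNorm.

Lemma inv_succ_lt {R : realType} (e : R) : 0 < e ->
  exists N, forall n, (N <= n)%N -> n.+1%:R^-1 < e.
Proof.
move=> e0; exists (Num.truncn e^-1).+1 => n Nn.
have en : e^-1 < n.+1%:R.
  by apply: (lt_le_trans (truncnS_gt _)); rewrite ler_nat ltnW// ltnS.
by rewrite invf_plt ?posrE ?ltr0n.
Qed.

Section CauchyConvergence.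
Context {R : realType} {V : completeNormedModType R[i]}.
Implicit Types u : nat -> V.

Lemma cvs_ex u : cauchys u -> exists l, cvs u l.
Proof.
move=> cu.
have : cvg (u @ \oo).
  apply: cauchy_cvg; apply: cauchy_exP => _ /posC[e e0 ->].
  have [N hN] := cu e e0; exists (u N).
  exists N => // n /= Nn; rewrite -ball_normE/= nrE ltcR; exact: hN.
move=> /cvg_ex[l ul]; exists l => e e0.
have /ul [N _ hN] : nbhs l (ball l (e%:C : R[i])).
  by apply: nbhsx_ballx; rewrite ltcR.
exists N => n /hN; rewrite -ball_normE/= nrE ltcR nr_dist; exact.
Qed.

End CauchyConvergence.

Section CvsTheory.
Context {R : realType} {V : normedModType R[i]}.
Implicit Types u v : nat -> V.

Lemma cvs_cauchy u l : cvs u l -> cauchys u.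
Proof.
move=> ul e e0; have e2 : 0 < e / 2 by rewrite divr_gt0.
have [N hN] := ul _ e2; exists N => m n /hN hm /hN hn.
apply: le_lt_trans (nr_tri _ l _) _; rewrite (nr_dist l).
by rewrite (splitr e) ltrD.
Qed.

Lemma cvs_uniq u (l l' : V) : cvs u l -> cvs u l' -> l = l'.
Proof.
move=> ul ul'; apply/eqP; rewrite -subr_eq0; apply/eqP/nr_small => e e0.
have e2 : 0 < e / 2 by rewrite divr_gt0.
have [N hN] := ul _ e2; have [N' hN'] := ul' _ e2.
have := hN (maxn N N') (leq_maxl _ _); have := hN' (maxn N N') (leq_maxr _ _).
move=> h1 h2; apply/ltW/(le_lt_trans (nr_tri _ (u (maxn N N')) _)).
by rewrite (nr_dist l) (splitr e) ltrD.
Qed.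

Lemma cvs_le u l (e : R) : cvs u l -> 
  (exists N, forall n, (N <= n)%N -> nr (u n) <= e) -> nr l <= e.
Proof.
move=> ul [N hN]; apply/ler_addgt0Pr => d d0.
have [M hM] := ul _ d0.
have := hM (maxn N M) (leq_maxr _ _); have := hN (maxn N M) (leq_maxl _ _).
have := nr_rev l (u (maxn N M)); rewrite nr_dist.
lra.
Qed.

Lemma cvs_cst (l : V) : cvs (fun=> l) l.
Proof. by move=> e e0; exists 0%N => n _; rewrite subrr nr0. Qed.

Lemma cvs_lip {W : normedModType R[i]} (f : V -> W) (C : R) u l :
  (forall x y, nr (f x - f y) <= C * nr (x - y)) -> cvs u l -> cvs (f \o u) (f l).
Proof.
move=> fC ul e e0; have C0 : 0 < `|C| + 1 by rewrite ltr_pwDr.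
have [|N hN] := ul (e / (`|C| + 1)); first by rewrite divr_gt0.
exists N => n /hN; rewrite ltr_pdivlMr// => h.
apply: le_lt_trans (fC _ _) _; apply: le_lt_trans h.
rewrite [leRHS]mulrC; apply: ler_wpM2r; first exact: nr_ge0.
by have := ler_norm C; lra.
Qed.

Lemma cvsD u v l m : cvs u l -> cvs v m -> cvs (fun n => u n + v n) (l + m).
Proof.
move=> ul vm e e0; have e2 : 0 < e / 2 by rewrite divr_gt0.
have [N hN] := ul _ e2; have [N' hN'] := vm _ e2.
exists (maxn N N') => n; rewrite geq_max => /andP[/hN h /hN' h'].
rewrite opprD addrACA; apply: le_lt_trans (nrD _ _) _.
by rewrite (splitr e) ltrD.
Qed.

Lemma closure_cvs (S : set V) l :
  closure S l -> exists2 u, (forall n, S (u n)) & cvs u l.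
Proof.
move=> /closureP cl.
have /choice[u hu] : forall n : nat, exists y, S y /\ nr (l - y) < n.+1%:R^-1.
  by move=> n; have [|y ? ?] := cl n.+1%:R^-1; [rewrite invr_gt0|exists y].
exists u => [n|e e0]; first by case: (hu n).
have [N hN] := inv_succ_lt e0; exists N => n /hN; apply: lt_trans.
by rewrite nr_dist; case: (hu n).
Qed.

Lemma cvs_closure (S : set V) u l : (forall n, S (u n)) -> cvs u l -> closure S l.
Proof.
move=> Su ul; apply/closureP => e e0.
have [N hN] := ul e e0; exists (u N) => //; rewrite nr_dist; exact: hN.
Qed.

End CvsTheory.

(** The spaces below come with a real-valued norm and sequential completeness; the hierarchy asks
    for a norm with values in [R[i]] and completeness for filters. *)
HB.factory Record Lmodule_isCompleteNormed (R : realType) V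
    of GRing.Lmodule R[i] V := {
  rn : V -> R;
  rnD : forall x y, rn (x + y) <= rn x + rn y;
  rnZ : forall c x, rn (c *: x) = cn c * rn x;
  rn_eq0 : forall x, rn x = 0 -> x = 0;
  rn_complete : forall u : nat -> V,
    (forall e : R, 0 < e -> exists N, forall m n, (N <= m)%N -> (N <= n)%N ->
      rn (u m - u n) < e) ->
    exists l, forall e : R, 0 < e -> exists N, forall n, (N <= n)%N ->
      rn (u n - l) < e
}.

HB.builders Context R V of Lmodule_isCompleteNormed R V.

Let cnorm (x : V) : R[i] := (rn x)%:C.

Let cnormD x y : cnorm (x + y) <= cnorm x + cnorm y.
Proof. by rewrite -rmorphD lecR rnD. Qed.

Let cnormZ (c : R[i]) x : cnorm (c *: x) = `|c| * cnorm x.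
Proof. by rewrite cnE -rmorphM/= -rnZ. Qed.

Let cnorm_eq0 x : cnorm x = 0 -> x = 0.
Proof. by move=> /(@complexI R); apply: rn_eq0. Qed.

HB.instance Definition _ :=
  Lmodule_isNormed.Build R[i] V cnormD cnormZ cnorm_eq0.

Let cauchy_cvg_norm (F : set_system V) : ProperFilter F -> cauchy F -> cvg F.
Proof.
move=> FF /cauchyP cF.
(* The centres of balls of radius 1/(n+1) that belong to the filter form a Cauchy sequence, and its
   limit is the limit of the filter. *)
have /choice[u hu] : forall n : nat, exists x, F (ball x (n.+1%:R^-1%:C : R[i])).
  by move=> n; apply: cF; rewrite ltcR invr_gt0.
have ballE x (e : R) y : ball x (e%:C : R[i]) y = (rn (x - y) < e) :> Prop.
  by rewrite -ball_normE/= -ltcR.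
have rnN x : rn (- x) = rn x.
  by rewrite -scaleN1r rnZ cnN1 mul1r.
have rnC x y : rn (x - y) = rn (y - x) by rewrite -rnN opprB.
have uu m n : rn (u m - u n) < m.+1%:R^-1 + n.+1%:R^-1.
  have [z []] := filter_ex (filterI (hu m) (hu n)).
  rewrite !ballE => h1 h2.
  have -> : u m - u n = (u m - z) + (z - u n) by rewrite addrA subrK.
  apply: le_lt_trans (rnD _ _) _; rewrite ltrD// rnC//.
have [|l hl] := @rn_complete u.
  move=> e e0; have e2 : 0 < e / 2 by rewrite divr_gt0.
  have [N hN] := inv_succ_lt e2; exists N => m n /hN h1 /hN h2.
  by apply: lt_trans (uu m n) _; rewrite (splitr e) ltrD.
apply/cvg_ex; exists l => A /nbhs_ballP[_ /posC[e e0 ->]] sA.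
apply: filterS sA _.
have e2 : 0 < e / 2 by rewrite divr_gt0.
have [N hN] := inv_succ_lt e2; have [M hM] := hl _ e2.
pose n := maxn N M; apply: filterS (hu n) => z; rewrite !ballE => uz.
have -> : l - z = (l - u n) + (u n - z) by rewrite addrA subrK.
apply: le_lt_trans (rnD _ _) _; rewrite (splitr e) ltrD//.
  by rewrite rnC hM// leq_maxr.
by apply: lt_trans uz _; rewrite hN// leq_maxl.
Qed.

HB.instance Definition _ := Uniform_isComplete.Build V cauchy_cvg_norm.

HB.end.

(** * Positivity in C*-algebras *)

Section CStarBasics.
Context {R : realType} {A : cstarAlgType R}.
Implicit Types a b c h x y z : A.

Lemma cmul0l a : (0 : A) ** a = 0.
Proof. by apply: (addrI (0 ** a)); rewrite -cmulDl !addr0. Qed.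

Lemma cmul0r a : a ** (0 : A) = 0.
Proof. by apply: (addrI (a ** 0)); rewrite -cmulDr !addr0. Qed.

Lemma cmulNl a b : (- a) ** b = - (a ** b).
Proof. by apply: (addrI (a ** b)); rewrite -cmulDl !subrr cmul0l. Qed.

Lemma cmulNr a b : a ** (- b) = - (a ** b).
Proof. by apply: (addrI (a ** b)); rewrite -cmulDr !subrr cmul0r. Qed.

Lemma cmulBl a b c : (a - b) ** c = a ** c - b ** c.
Proof. by rewrite cmulDl cmulNl. Qed.

Lemma cmulBr a b c : c ** (a - b) = c ** a - c ** b.
Proof. by rewrite cmulDr cmulNr. Qed.

Lemma cmul_suml (I : Type) (r : seq I) (P : pred I) (F : I -> A) a :
  (\sum_(i <- r | P i) F i) ** a = \sum_(i <- r | P i) F i ** a.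
Proof. by apply: (big_morph (fun x => x ** a) (fun _ _ => cmulDl _ _ _)); rewrite cmul0l. Qed.

Lemma cmul_sumr (I : Type) (r : seq I) (P : pred I) (F : I -> A) a :
  a ** (\sum_(i <- r | P i) F i) = \sum_(i <- r | P i) a ** F i.
Proof. by apply: (big_morph (fun x => a ** x) (fun _ _ => cmulDr _ _ _)); rewrite cmul0r. Qed.

Lemma star0 : star (0 : A) = 0.
Proof. by apply: (addrI (star 0)); rewrite -starD !addr0. Qed.

Lemma starN a : star (- a) = - star a.
Proof. by apply: (addrI (star a)); rewrite -starD !subrr star0. Qed.

Lemma starB a b : star (a - b) = star a - star b.
Proof. by rewrite starD starN. Qed.

Lemma star1 : star (cone : A) = cone.
Proof.
have h : star (cone ** star cone) = cone ** star (cone : A) by rewrite starM starK.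
by rewrite !cmul1l starK in h.
Qed.

Lemma starZR (r : R) a : star (r%:C *: a) = r%:C *: star a.
Proof. by rewrite starZ conj_Creal// complex_real. Qed.

Lemma star_sum (I : Type) (r : seq I) (P : pred I) (F : I -> A) :
  star (\sum_(i <- r | P i) F i) = \sum_(i <- r | P i) star (F i).
Proof. by apply: (big_morph (@star R A) (@starD R A)); rewrite star0. Qed.

Lemma nrM a b : nr (a ** b) <= nr a * nr b.
Proof. by rewrite -lecR rmorphM/= -!nrE cnorm_mul. Qed.

Lemma nr_starM a : nr (star a ** a) = nr a ^+ 2.
Proof. by apply: (@complexI R); rewrite rmorphXn/= -!nrE cnorm_star. Qed.

Lemma nr_star a : nr (star a) = nr a.
Proof.
suff h b : nr b <= nr (star b) by apply/eqP; rewrite eq_le h -{2}[a]starK h.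
have [b0|b0] := leP (nr b) 0; first exact: le_trans b0 (nr_ge0 _).
by rewrite -(ler_pM2r b0) -expr2 -nr_starM nrM.
Qed.

(** Only an inequality, since the norm of [cone] is 0 in the zero algebra. *)
Lemma nr_cone : nr (cone : A) <= 1.
Proof.
have := nr_starM (cone : A); rewrite star1 cmul1l => h.
have := nr_ge0 (cone : A); nra.
Qed.

Lemma nr_sq h : star h = h -> nr (h ** h) = nr h ^+ 2.
Proof. by move=> hh; rewrite -nr_starM hh. Qed.

Lemma starM_eq0 a : star a ** a = 0 -> a = 0.
Proof.
move=> h; apply: nr_le0; have := nr_starM a; rewrite h nr0 => h'.
have := nr_ge0 a; nra.
Qed.

Lemma sq_eq0 h : star h = h -> h ** h = 0 -> h = 0.
Proof. by move=> hh h0; apply: starM_eq0; rewrite hh. Qed.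

End CStarBasics.

Section SquareRoot.
Context {R : realType} {A : cstarAlgType R}.
Implicit Types a b c x y z : A.

(* The iteration y |-> (x + y^2)/2 converges for all |x| <= 1 because it is
   dominated by the same iteration for the scalar 1. *)
Let half : R[i] := (2^-1 : R)%:C.
Let it x n : A := iter n (fun y => half *: (x + y ** y)) 0.
Let eta n : R := iter n (fun t => (1 + t ^+ 2) / 2) 0.

Let cn_half : cn half = 2^-1.
Proof. by rewrite cnR ger0_norm// invr_ge0. Qed.

Let itS x n : it x n.+1 = half *: (x + it x n ** it x n).
Proof. by []. Qed.

Let etaS n : eta n.+1 = (1 + eta n ^+ 2) / 2.
Proof. by []. Qed.

(** In terms of d = 1 - [eta n] the iteration is d -> d - d^2/2, which keeps d below 2/(n+1); hence
    [eta] increases to 1. *)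
Let eta_bound n : 0 <= eta n /\ 0 <= 1 - eta n <= 2 / n.+1%:R.
Proof.
elim: n => [|n [h0 /andP[h1 h2]]] /=; first by rewrite subr0 ler01 divr1 lexx ler1n.
rewrite -/(eta n); have n0 : (0 : R) < n.+1%:R by [].
have n1 : (0 : R) < n.+2%:R by [].
split; first by rewrite divr_ge0// addr_ge0// sqr_ge0.
have e2 : eta n ^+ 2 = eta n * eta n by rewrite expr2.
apply/andP; split; first nra.
rewrite ler_pdivlMr//; rewrite ler_pdivlMr// in h2.
move: h2; rewrite -[n.+2]add1n natrD => h2.
have h3 : (1 : R) <= n.+1%:R by rewrite ler1n.
have -> : 1 - (1 + eta n ^+ 2) / 2 = (1 - eta n) * (1 + eta n) / 2 :> R by field.
have -> : 1 + eta n = 2 - (1 - eta n) by ring.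
move: h1 h2 h3 h0; set d := 1 - eta n; set m := n.+1%:R => h1 h2 h3 h0.
have d1 : d <= 1 by rewrite /d; lra.
nra.
Qed.

(** Since a a - b b = a (a - b) + (a - b) b without commutativity, each increment is dominated by
    the corresponding increment of [eta], and these telescope. *)
Let it_bound x : nr x <= 1 -> forall n,
  nr (it x n) <= eta n /\ nr (it x n.+1 - it x n) <= eta n.+1 - eta n.
Proof.
move=> x1.
have B n : nr (it x n) <= eta n.
  elim: n => [|n IH] /=; first by rewrite nr0.
  rewrite -/(it x n) -/(eta n) nrZ cn_half mulrC ler_pM2r ?invr_gt0//.
  apply: le_trans (nrD _ _) _; apply: lerD => //.
  by apply: le_trans (nrM _ _) _; rewrite expr2 ler_pM// nr_ge0.
move=> n; split=> //.
elim: n => [|n IH].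
  by rewrite !itS !etaS /= cmul0l addr0 !subr0 nrZ cn_half expr0n/= addr0 mulrC
     ler_pM2r ?invr_gt0.
rewrite (itS x n.+1) (etaS n.+1) [X in nr (_ - X)](itS x n) [X in _ <= _ - X](etaS n).
have -> : half *: (x + it x n.+1 ** it x n.+1) - half *: (x + it x n ** it x n)
  = half *: (it x n.+1 ** (it x n.+1 - it x n) + (it x n.+1 - it x n) ** it x n).
  rewrite -scalerBr; congr (_ *: _); rewrite cmulBl cmulBr addrA subrK.
  by rewrite opprD addrACA subrr add0r.
rewrite nrZ cn_half.
apply: (@le_trans _ _ (2^-1 * (eta n.+1 * (eta n.+1 - eta n) +
   (eta n.+1 - eta n) * eta n))); last first.
  by rewrite le_eqVlt; apply/orP; left; apply/eqP; field.
rewrite ler_pM2l ?invr_gt0//; apply: le_trans (nrD _ _) _; apply: lerD.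
  by apply: le_trans (nrM _ _) _; apply: ler_pM => //; exact: nr_ge0.
by apply: le_trans (nrM _ _) _; apply: ler_pM => //; exact: nr_ge0.
Qed.

Let it_dist x : nr x <= 1 -> forall m n, (n <= m)%N ->
  nr (it x m - it x n) <= eta m - eta n.
Proof.
move=> x1 m n /subnK <-; elim: (m - n)%N => [|k IH].
  by rewrite !add0n !subrr nr0.
rewrite addSn; apply: le_trans (nr_tri _ (it x (k + n)) _) _.
have [_ h] := it_bound x1 (k + n); move: IH h; lra.
Qed.

Let it_cauchy x : nr x <= 1 -> cauchys (it x).
Proof.
move=> x1.
have D m n : (n <= m)%N -> nr (it x m - it x n) <= 2 / n.+1%:R.
  move=> nm; apply: le_trans (it_dist x1 nm) _.
  have [_ /andP[_ h]] := eta_bound n; have [_ /andP[h' _]] := eta_bound m.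
  by apply: le_trans h; rewrite lerD2r; move: h'; lra.
move=> e e0; have e2 : 0 < e / 2 by rewrite divr_gt0.
have [N hN] := inv_succ_lt e2; exists N.
have E k : (N <= k)%N -> 2 / k.+1%:R < e.
  by move=> /hN; rewrite ltr_pdivlMr// mulrC.
move=> m n Nm Nn; have [mn|/ltnW mn] := leqP m n.
  by rewrite nr_dist; apply: le_lt_trans (D _ _ mn) _; exact: E.
by apply: le_lt_trans (D _ _ mn) _; exact: E.
Qed.

Lemma cvs_star (u : nat -> A) l : cvs u l -> cvs (fun n => star (u n)) (star l).
Proof.
move=> ul; apply: (@cvs_lip _ _ _ (@star R A) 1) ul => x y.
by rewrite -starB nr_star mul1r.
Qed.

Lemma cvs_mull (u : nat -> A) l a : cvs u l -> cvs (fun n => a ** u n) (a ** l).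
Proof.
move=> ul; apply: (@cvs_lip _ _ _ (fun x => a ** x) (nr a)) ul => x y.
by rewrite -cmulBr nrM.
Qed.

Lemma cvs_mulr (u : nat -> A) l a : cvs u l -> cvs (fun n => u n ** a) (l ** a).
Proof.
move=> ul; apply: (@cvs_lip _ _ _ (fun x => x ** a) (nr a)) ul => x y.
by rewrite -cmulBl mulrC nrM.
Qed.

(** The limit y satisfies 2 y = x + y^2, so that s = 1 - y squares to 1 - x. The bound on 1 - s
    makes a selfadjoint s positive in the sense of [pos]; the commutation clause holds because the
    iterates are polynomials in x. *)
Lemma sqrt_one_sub x : nr x <= 1 -> exists s : A,
  [/\ s ** s = cone - x, nr (cone - s) <= 1, star x = x -> star s = s &
      forall z, z ** x = x ** z -> z ** s = s ** z].
Proof.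
move=> x1; have [y hy] := cvs_ex (it_cauchy x1).
have y1 : nr y <= 1.
  apply: (cvs_le hy); exists 0%N => n _.
  have [h _] := it_bound x1 n; have [_ /andP[h' _]] := eta_bound n; lra.
have yE : y = half *: (x + y ** y).
  apply/eqP; rewrite -subr_eq0; apply/eqP/nr_small => e e0.
  have e2 : 0 < e / 2 by rewrite divr_gt0.
  have [N hN] := hy _ e2.
  have := hN N (leqnn _); have := hN N.+1 (leqnSn _).
  have [hb _] := it_bound x1 N; have [_ /andP[hb' _]] := eta_bound N.
  have {}hb : nr (it x N) <= 1 by lra.
  rewrite /= -/(it x N) => h1 h2.
  apply: le_trans (nr_tri _ (half *: (x + it x N ** it x N)) _) _.
  rewrite nr_dist (splitr e); apply: lerD; first exact: ltW.
  rewrite -scalerBr nrZ cn_half.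
  rewrite opprD addrACA subrr add0r.
  have -> : it x N ** it x N - y ** y =
    it x N ** (it x N - y) + (it x N - y) ** y by rewrite cmulBl cmulBr addrA subrK.
  have h3 := nrM (it x N) (it x N - y); have h4 := nrM (it x N - y) y.
  have h5 := nrD (it x N ** (it x N - y)) ((it x N - y) ** y).
  have := nr_ge0 (it x N - y); have := nr_ge0 y; have := nr_ge0 (it x N).
  nra.
have yy : y + y = x + y ** y.
  rewrite {1 2}yE -scalerDl /half -rmorphD/=.
  by have -> : (2^-1 + 2^-1 : R) = 1; [field|rewrite scale1r].
exists (cone - y); split.
- rewrite cmulBl cmul1l cmulBr cmul1r opprB addrA.
  have -> : cone - y + y ** y - y = cone + y ** y - (y + y).
    by rewrite opprD addrA; congr (_ - _); rewrite addrAC.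
  by rewrite yy [x + _]addrC opprD addrA addrK.
- by rewrite opprB addrC subrK.
- move=> sx; rewrite starB star1; congr (_ - _).
  apply: (cvs_uniq _ hy); rewrite (_ : it x = (fun n => star (it x n))).
    exact: cvs_star.
  apply: funext; elim=> [|n IH] /=; first by rewrite star0.
  by rewrite -/(it x n) starZR starD starM sx -IH.
- move=> z zx; rewrite cmulBl cmulBr cmul1l cmul1r; congr (_ - _).
  apply: (cvs_uniq (cvs_mull z hy)).
  rewrite (_ : (fun n => _) = (fun n => it x n ** z)); first exact: cvs_mulr.
  apply: funext; elim=> [|n IH] /=; first by rewrite cmul0l cmul0r.
  rewrite -/(it x n) cmulZr cmulZl cmulDr cmulDl zx.
  by rewrite cmulA IH -cmulA IH cmulA.
Qed.

End SquareRoot.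

Section Positivity.
Context {R : realType} {A : cstarAlgType R}.
Implicit Types a b c d h k u v w x y z p q s t : A.

Definition rsc (r : R) : A := r%:C *: cone.

Lemma rscl r a : rsc r ** a = r%:C *: a.
Proof. by rewrite /rsc cmulZl cmul1l. Qed.

Lemma rscr r a : a ** rsc r = r%:C *: a.
Proof. by rewrite /rsc cmulZr cmul1r. Qed.

Lemma star_rsc r : star (rsc r) = rsc r.
Proof. by rewrite /rsc starZR star1. Qed.

Lemma rscD (r1 r2 : R) : rsc (r1 + r2) = rsc r1 + rsc r2.
Proof. by rewrite /rsc rmorphD scalerDl. Qed.

Lemma nr_rsc r : nr (rsc r) <= `|r|.
Proof.
by rewrite nrZR -[leRHS]mulr1 ler_wpM2l// nr_cone.
Qed.

(** Positivity without spectra: for selfadjoint a the bound says that the spectrum lies in [0, 2M].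
    The agreement with [cpos] is [cposP], which rests on Kaplansky's theorem. *)
Definition pos a := star a = a /\ exists2 M : R, 0 < M & nr (rsc M - a) <= M.

Lemma scale_half a : (2^-1 : R)%:C *: (a + a) = a.
Proof.
rewrite -[X in X + X]scale1r -scalerDl scalerA.
have -> : (2^-1 : R)%:C * (1 + 1) = 1; last by rewrite scale1r.
have -> : (1 + 1 : R[i]) = (1 + 1 : R)%:C by rewrite rmorphD rmorph1.
by rewrite -rmorphM/= (_ : 2^-1 * (1 + 1) = 1 :> R) ?rmorph1//; field.
Qed.

Lemma double_eq0 a : a + a = 0 -> a = 0.
Proof. by move=> h; rewrite -[a]scale_half h scaler0. Qed.

Lemma scaleC_sqrt (r : R) a : 0 <= r ->
  (Num.sqrt r)%:C *: ((Num.sqrt r)%:C *: a) = r%:C *: a.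
Proof. by move=> r0; rewrite scalerA -rmorphM/= -expr2 sqr_sqrtr. Qed.

Lemma scaleCK (r : R) a : r != 0 -> r%:C *: (r^-1%:C *: a) = a.
Proof.
by move=> r0; rewrite scalerA -rmorphM/= mulfV// rmorph1 scale1r.
Qed.

Lemma sqrt_scaled (M : R) x : 0 < M -> nr x <= M -> exists s : A,
  [/\ s ** s = rsc M - x, nr (rsc (Num.sqrt M) - s) <= Num.sqrt M,
      star x = x -> star s = s & forall z, z ** x = x ** z -> z ** s = s ** z].
Proof.
move=> M0 xM; have M0' : M != 0 by rewrite gt_eqF.
have [|s [s2 s1 ss sc]] := @sqrt_one_sub _ _ (M^-1%:C *: x).
  rewrite nrZR ger0_norm ?invr_ge0 ?(ltW M0)//.
  by rewrite ler_pdivrMl// mulr1.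
exists ((Num.sqrt M)%:C *: s); split.
- rewrite cmulZl cmulZr scaleC_sqrt ?ltW// s2 scalerBr scaleCK//.
- rewrite /rsc -scalerBr nrZR ger0_norm ?sqrtr_ge0//.
  by rewrite -[leRHS]mulr1 ler_wpM2l ?sqrtr_ge0.
- by move=> sx; rewrite starZR ss// starZR sx.
- by move=> z zx; rewrite cmulZr cmulZl sc// cmulZr cmulZl zx.
Qed.

Lemma pos_root a : pos a -> exists h,
  [/\ pos h, h ** h = a & forall z, z ** a = a ** z -> z ** h = h ** z].
Proof.
move=> [sa [M M0 aM]].
have [s [s2 s1 ss sc]] := sqrt_scaled M0 aM.
exists s; split.
- split; first by apply: ss; rewrite starB star_rsc sa.
  by exists (Num.sqrt M); rewrite ?sqrtr_gt0.
- by rewrite s2 opprB addrC subrK.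
- by move=> z za; apply: sc; rewrite cmulBl cmulBr rscl rscr za.
Qed.

Lemma commute_sum_sq h k : star h = h -> star k = k -> h ** k = k ** h ->
  star (h + 'i *: k) ** (h + 'i *: k) = h ** h + k ** k.
Proof.
move=> sh sk hk; rewrite starD starZ sh sk conjCi.
rewrite cmulDl !cmulDr !cmulZl !cmulZr hk scalerA mulNr -expr2 sqrCi opprK scale1r.
by rewrite addrA -(addrA (h ** h)) -scalerDl subrr scale0r addr0.
Qed.

(** A substitute for functional calculus in two commuting variables: T = h + i k satisfies T* T = M,
    and h is the real part of T. *)
Lemma cartesian_bound (M : R) h k : 0 <= M ->
  star h = h -> star k = k -> h ** k = k ** h ->
  h ** h + k ** k = rsc M -> nr (h ** h) <= M.
Proof.
move=> M0 sh sk hk hkM; set T := h + 'i *: k.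
have T2 : nr T ^+ 2 <= M.
  by rewrite -nr_starM commute_sum_sq// hkM; apply: le_trans (nr_rsc _) _; rewrite ger0_norm.
have hT : nr h <= nr T.
  rewrite -[h]scale_half.
  have -> : h + h = T + star T.
    by rewrite /T starD starZ sh sk conjCi scaleNr addrACA subrr addr0.
  rewrite nrZR ger0_norm ?invr_ge0//.
  have := nrD T (star T); rewrite nr_star; lra.
rewrite nr_sq//; have := nr_ge0 h; have := nr_ge0 T; nra.
Qed.

(** The root s of M - h^2 commutes with h, so s^2 + h^2 = M, and [cartesian_bound] estimates s^2. *)
Lemma sq_sub_bound (M : R) h : 0 < M -> star h = h -> nr (h ** h) <= M ->
  nr (rsc M - h ** h) <= M.
Proof.
move=> M0 sh hM.
have [s [s2 _ ss sc]] := sqrt_scaled M0 hM.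
have {}ss : star s = s by apply: ss; rewrite starM sh.
rewrite -s2; apply: (@cartesian_bound _ s h) => //; first exact: ltW.
  by symmetry; apply: sc; rewrite cmulA.
by rewrite s2 subrK.
Qed.

Lemma pos_star a : pos a -> star a = a. Proof. by case. Qed.

Lemma pos_sq h : star h = h -> pos (h ** h).
Proof.
move=> sh; split; first by rewrite starM sh.
have h0 : 0 < nr (h ** h) + 1 by have := nr_ge0 (h ** h); lra.
by exists (nr (h ** h) + 1) => //; apply: sq_sub_bound => //; lra.
Qed.

(** Any positive bound of the norm can serve as the constant in [pos]; this lets the constants of
    two positive elements be added in [posD]. *)
Lemma pos_bound (M : R) a : pos a -> 0 < M -> nr a <= M -> nr (rsc M - a) <= M.
Proof.
move=> /pos_root[h [[sh _] <- _]] M0 hM; exact: sq_sub_bound.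
Qed.

Lemma pos0 : pos 0.
Proof.
by split; [rewrite star0|exists 1 => //; rewrite subr0 /rsc scale1r nr_cone].
Qed.

Lemma posD a b : pos a -> pos b -> pos (a + b).
Proof.
move=> pa pb; split; first by rewrite starD !pos_star.
have a0 := nr_ge0 a; have b0 := nr_ge0 b.
have Ma : 0 < nr a + 1 by lra.
have Mb : 0 < nr b + 1 by lra.
exists ((nr a + 1) + (nr b + 1)); first lra.
rewrite rscD opprD addrACA; apply: le_trans (nrD _ _) _; apply: lerD.
  by apply: pos_bound => //; lra.
by apply: pos_bound => //; lra.
Qed.

Lemma posZ (r : R) a : 0 <= r -> pos a -> pos (r%:C *: a).
Proof.
move=> r0 /pos_root[h [[sh _] <- _]].
have -> : r%:C *: (h ** h) = ((Num.sqrt r)%:C *: h) ** ((Num.sqrt r)%:C *: h).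
  by rewrite cmulZl cmulZr scaleC_sqrt.
by apply: pos_sq; rewrite starZR sh.
Qed.

(** If a = h^2 and - a = k^2 with commuting roots, then T = h + i k has T* T = 0, so h = - i k;
    being selfadjoint, h equals - h. *)
Lemma pos_antisym a : pos a -> pos (- a) -> a = 0.
Proof.
move=> /pos_root[h [[sh _] ha ch]] /pos_root[k [[sk _] ka ck]].
have hk : h ** k = k ** h.
  by apply: ck; rewrite cmulNl cmulNr -ha cmulA.
have := commute_sum_sq sh sk hk; rewrite ha ka subrr => /starM_eq0 T0.
have {}T0 : h = - ('i *: k) by apply/eqP; rewrite -addr_eq0 T0.
have h0 : h = - h.
  by rewrite -{1}sh {1}T0 starN starZ sk conjCi scaleNr opprK {1}T0 opprK.
by rewrite -ha (double_eq0 (a := h)) ?cmul0l// {1}h0 addNr.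
Qed.

Lemma cartesian d : exists h k, [/\ star h = h, star k = k &
  star d ** d + d ** star d = (2%:R : R)%:C *: (h ** h + k ** k)].
Proof.
exists ((2^-1 : R)%:C *: (d + star d)), ((2^-1 : R)%:C *: ('i *: (d - star d))).
split.
- by rewrite starZR starD starK addrC.
- by rewrite starZR starZ starB starK conjCi scaleNr -scalerN opprB.
rewrite !cmulZl !cmulZr !scalerA !cmulBl !cmulBr !cmulDl !cmulDr.
have -> : 2^-1%:C * 'i * 2^-1%:C * 'i = - (2^-1%:C * 2^-1%:C) :> R[i].
  by rewrite -mulrA mulrACA -(expr2 'i) sqrCi mulrN1.
rewrite scaleNr -scalerBr scalerA -!rmorphM/=.
have -> : 2 * (2^-1 * 2^-1) = 2^-1 :> R by field.
set X := d ** d; set Y := d ** star d; set Z := star d ** d; set U := star d ** star d.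
rewrite -[LHS]scale_half; congr (_ *: _).
have E (a1 a2 a3 a4 a5 a6 a7 a8 : A) : a1 + a2 + (a3 + a4) + (a5 + a6 + (a7 + a8)) =
    (a1 + a8) + (a4 + a6) + ((a3 + a2) + (a5 + a7)).
  by rewrite [LHS](AC (2*2*(2*2)) ((1*8)*(4*6)*((3*2)*(5*7)))).
by rewrite !opprB E !subrr !add0r.
Qed.

End Positivity.

Section Kaplansky.
Context {R : realType} {A : cstarAlgType R}.
Implicit Types a b c d h k u v w x y z p q s t : A.

(** u is |y| - y, twice the negative part of y, with w = |y| the root of y^2. Its positivity is
    proved by comparison with the root s of u^2: the difference t = s - u turns out to be 0. *)
Lemma neg_part y : star y = y -> exists u, [/\ pos u,
  u ** y + u ** y = - (u ** u) & u = 0 -> pos y].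
Proof.
move=> sy.
have [w [pw ww cw]] := pos_root (pos_sq sy).
have sw := pos_star pw.
have yw : y ** w = w ** y by apply: cw; rewrite cmulA.
set u := w - y; set v := w + y.
have su : star u = u by rewrite starB sw sy.
have sv : star v = v by rewrite starD sw sy.
have uv : u ** v = 0 by rewrite cmulBl !cmulDr yw ww [w ** y + _]addrC subrr.
have vu : v ** u = 0 by rewrite -sv -su -starM uv star0.
have uw : u ** w = w ** u by rewrite cmulBl cmulBr yw.
have [s [ps ss cs]] := pos_root (pos_sq su).
have s_s := pos_star ps.
have us : u ** s = s ** u by apply: cs; rewrite cmulA.
have ws : w ** s = s ** w by apply: cs; rewrite cmulA -uw -cmulA -uw cmulA.
have vs : v ** s = s ** v by apply: cs; rewrite cmulA vu cmul0l -cmulA uv cmul0r.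
have sv0 : s ** v = 0.
  apply: sq_eq0; first by rewrite starM s_s sv vs.
  by rewrite -{1}vs -cmulA (cmulA s) ss -cmulA uv !cmul0r.
set t := s - u.
have st_ : star t = t by rewrite starB s_s su.
have tu : t ** u = - (s ** t) by rewrite /t cmulBl cmulBr ss opprB.
have tw : t ** w = w ** t by rewrite /t cmulBl cmulBr ws uw.
(* With the roots r and r' of w and s, the element s t t is the square of r' t, while 2 t w = - s t
   makes it minus twice the square of r t. Antisymmetry then gives r' t = 0. *)
have ts : t ** s = s ** t by rewrite /t cmulBl cmulBr us.
have t2w : t ** w + t ** w = - (s ** t).
  have -> : t ** w + t ** w = t ** u + t ** v.
    by rewrite -!cmulDr; congr (_ ** _); rewrite addrACA addNr addr0.
  by rewrite tu cmulBl uv sv0 subrr addr0.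
have [r [pr rr cr]] := pos_root pw; have sr := pos_star pr.
have [r' [pr' rr' cr']] := pos_root ps; have sr' := pos_star pr'.
have tr : t ** r = r ** t by apply: cr.
have tr' : t ** r' = r' ** t by apply: cr'.
have X : (r ** t) ** (r ** t) = t ** w ** t by rewrite -{1}tr -cmulA (cmulA r) rr cmulA.
have Y : (r' ** t) ** (r' ** t) = s ** t ** t.
  by rewrite -{1}tr' -cmulA (cmulA r') rr' cmulA ts.
have srt : star (r ** t) = r ** t by rewrite starM st_ sr.
have srt' : star (r' ** t) = r' ** t by rewrite starM st_ sr'.
have rt0 : r' ** t = 0.
  apply: sq_eq0 => //; apply: pos_antisym; first exact: pos_sq.
  have -> : - ((r' ** t) ** (r' ** t)) = (r ** t) ** (r ** t) + (r ** t) ** (r ** t).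
    by rewrite X Y -cmulDl t2w cmulNl.
  by apply: posD; exact: pos_sq.
have st0 : s ** t = 0 by rewrite -rr' -cmulA rt0 cmul0r.
have t0 : t = 0.
  by apply: sq_eq0 => //; rewrite {2}/t cmulBr ts st0 tu st0 oppr0 subrr.
have us_ : u = s by symmetry; apply/eqP; rewrite -subr_eq0 -/t t0.
exists u; split.
- by rewrite us_.
- have -> : u ** y + u ** y = u ** v - u ** u.
    rewrite -cmulDr -cmulBr; congr (_ ** _).
    by rewrite /v /u opprB [w + y]addrC addrACA subrr addr0.
  by rewrite uv sub0r.
- by move=> /eqP; rewrite subr_eq0 => /eqP <-.
Qed.

(** Kaplansky's theorem. For u the negative part of y = c* c and d = c u, one has d* d = - u^3/2 = -
    p. The usual next step compares the spectra of d* d and d d*; the extra factor [q2], a root of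
    p, replaces it. *)
Lemma pos_starM c : pos (star c ** c).
Proof.
set y := star c ** c.
have sy : star y = y by rewrite starM starK.
have [u [pu uy u0]] := neg_part sy; apply: u0.
have su := pos_star pu.
have [r [pr rr cr]] := pos_root pu; have sr := pos_star pr.
have ur : u ** r = r ** u by apply: cr.
set q := u ** r.
have sq : star q = q by rewrite starM su sr -ur.
have qq : q ** q = u ** u ** u by rewrite /q -cmulA (cmulA r) -ur -!cmulA rr.
set d := c ** u; set D := star d ** d.
have DE : D = u ** y ** u by rewrite /D /d starM su !cmulA.
have DD : D + D = - (q ** q) by rewrite DE -cmulDl uy cmulNl qq.
set p := (2^-1 : R)%:C *: (q ** q).
have pp : pos p by apply: posZ; [rewrite invr_ge0|exact: pos_sq].
have Dp : D = - p by rewrite /p -scalerN -DD scale_half.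
have [q2 [pq2 q2q2 _]] := pos_root pp; have sq2 := pos_star pq2.
have sp := pos_star pp.
have pq : p ** q2 = q2 ** p by rewrite -q2q2 cmulA.
(* Now e* e = - p^2 and e e* = - s^2 are both negatives of squares, whereas their sum is twice a sum
   of squares by [cartesian]; so p = 0. *)
set e := d ** q2; set s := d ** star d.
have ss : star s = s by rewrite starM starK.
have e1 : star e ** e = - (p ** p).
  by rewrite /e starM sq2 -cmulA (cmulA (star d)) -/D Dp cmulNl cmulNr cmulA -pq -cmulA q2q2.
have e2 : e ** star e = - (s ** s).
  rewrite /e starM sq2 cmulA -(cmulA d) q2q2.
  have -> : p = - D by rewrite Dp opprK.
  by rewrite cmulNr cmulNl /D /s !cmulA.
have [h [k [sh sk hk]]] := cartesian e.
have Ppp : pos (p ** p) by exact: pos_sq.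
have Pss : pos (s ** s) by exact: pos_sq.
have h0 : p ** p + s ** s = 0.
  apply: pos_antisym; first exact: posD.
  by rewrite opprD -e1 -e2 hk; apply: posZ => //; apply: posD; exact: pos_sq.
have p0 : p = 0.
  apply: sq_eq0 => //; apply: pos_antisym => //.
  by rewrite (_ : - _ = s ** s)//; apply/eqP; rewrite eq_sym -addr_eq0 addrC h0.
have q0 : q ** q = 0 by rewrite -[LHS]opprK -DD Dp p0 oppr0 addr0 oppr0.
apply: sq_eq0 => //; apply: sq_eq0; first by rewrite starM su.
by rewrite cmulA -qq q0 cmul0l.
Qed.

Lemma cposP a : cpos a <-> pos a.
Proof.
split=> [[b ->]|/pos_root[h [ph <- _]]]; first exact: pos_starM.
by exists h; rewrite (pos_star ph).
Qed.

Lemma cposD a b : cpos a -> cpos b -> cpos (a + b).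
Proof. by rewrite !cposP; exact: posD. Qed.

Lemma cpos0 : cpos (0 : A). Proof. by rewrite cposP; exact: pos0. Qed.

Lemma cpos_sum (I : Type) (r : seq I) (P : pred I) (F : I -> A) :
  (forall i, P i -> cpos (F i)) -> cpos (\sum_(i <- r | P i) F i).
Proof. by move=> h; apply: big_ind => //; [exact: cpos0|exact: cposD]. Qed.

Lemma cpos_star a : cpos a -> star a = a.
Proof. by rewrite cposP; exact: pos_star. Qed.

Lemma cpos_conj a c : cpos a -> cpos (star c ** a ** c).
Proof. by move=> [b ->]; exists (b ** c); rewrite starM !cmulA. Qed.

Lemma cpos_starM a : cpos (star a ** a). Proof. by exists a. Qed.

Lemma cpos_rsc_sub (M : R) a : cpos a -> 0 < M -> nr a <= M -> cpos (rsc M - a).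
Proof.
rewrite !cposP => pa M0 aM; split; first by rewrite starB star_rsc pos_star.
by exists M => //; rewrite opprB addrC subrK.
Qed.

Lemma pos_le_bound (M : R) a : 0 <= M -> cpos a -> cpos (rsc M - a) -> nr a <= M.
Proof.
move=> M0 /cposP/pos_root[h [ph ha ch]] /cposP/pos_root[k [pk ka ck]].
rewrite -ha; apply: (@cartesian_bound _ _ _ _ k); rewrite ?(pos_star ph) ?(pos_star pk)//.
  by apply: ck; rewrite cmulBl cmulBr rscl rscr -ha cmulA.
by rewrite ha ka addrC subrK.
Qed.

Lemma nr_cposD a b : cpos a -> cpos b -> nr a <= nr (a + b).
Proof.
move=> pa pb; have [h|h] := leP (nr (a + b)) 0.
  have ab := nr_le0 h.
  rewrite (_ : a = 0) ?nr0 ?nr_ge0//; apply: pos_antisym; first exact/cposP.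
  by rewrite (_ : - a = b) -?cposP//; apply/eqP; rewrite eq_sym -addr_eq0 addrC ab.
apply: pos_le_bound => //; first exact: ltW.
have -> : rsc (nr (a + b)) - a = (rsc (nr (a + b)) - (a + b)) + b.
  by rewrite opprD addrA subrK.
by apply: cposD => //; apply: cpos_rsc_sub => //; exact: cposD.
Qed.

Lemma cpos_eq0D a b : cpos a -> cpos b -> a + b = 0 -> a = 0.
Proof. by move=> pa pb ab; apply: nr_le0; have := nr_cposD pa pb; rewrite ab nr0. Qed.

Lemma cposZ (r : R) a : 0 <= r -> cpos a -> cpos (r%:C *: a).
Proof. by rewrite !cposP => ? ?; exact: posZ. Qed.

(** The term b* b completes an inequality to an identity that a representation preserves; the
    contractivity statements [rep_nr] and [action_bound] come from it. *)
Lemma defect a (M : R) : nr a <= M -> exists b, star b ** b = rsc (M ^+ 2) - star a ** a.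
Proof.
move=> aM; have M0 := le_trans (nr_ge0 a) aM.
have [MM|M00] := eqVneq M 0.
  move: aM; rewrite MM => /nr_le0 ->; exists 0.
  by rewrite !cmul0r /rsc expr0n/= rmorph0 scale0r subr0.
have : cpos (rsc (M ^+ 2) - star a ** a).
  apply: cpos_rsc_sub; first exact: cpos_starM.
    by rewrite exprn_gt0// lt_neqAle eq_sym M00.
  by rewrite nr_starM lerXn2r ?nnegrE// nr_ge0.
by move=> [b ->]; exists b.
Qed.

Lemma cvs_nr {V : normedModType R[i]} (u : nat -> V) l (C : R) : cvs u l ->
  exists2 M, C < M & (exists N, forall n, (N <= n)%N -> nr (u n) <= M).
Proof.
move=> ul; have [N hN] := ul 1 ltr01.
have l0 := nr_ge0 l; have := ler_norm C; have := normr_ge0 C => C1 C2.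
exists (`|C| + nr l + 1); first lra.
exists N => n /hN h; have := nr_rev (u n) l; lra.
Qed.

Lemma cpos_cvs (u : nat -> A) l : (forall n, cpos (u n)) -> cvs u l -> cpos l.
Proof.
move=> pu ul; apply/cposP; split.
  apply: cvs_uniq (cvs_star ul) _; rewrite (_ : (fun n => _) = u)//.
  by apply/funext => n; rewrite cpos_star.
have [M M0 [N hN]] := cvs_nr 0 ul; exists M => //.
have hM : cvs (fun n => rsc M - u n) (rsc M - l).
  apply: cvsD; first exact: cvs_cst.
  by apply: (@cvs_lip _ _ _ -%R 1) ul => x y; rewrite mul1r -opprD nrN.
apply: (cvs_le hM); exists N => n Nn.
by apply: pos_bound; [exact/cposP|exact: M0|exact: hN].
Qed.

End Kaplansky.

(** * Hilbert modules and their adjointable operators *)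

Section SemiInner.
Context {R : realType} {D : cstarAlgType R} {V : lmodType R[i]}.
Variables (act : V -> D -> V) (h : V -> V -> D).
Hypothesis hDr : forall x y z, h x (y + z) = h x y + h x z.
Hypothesis hZr : forall (c : R[i]) x y, h x (c *: y) = c *: h x y.
Hypothesis hMr : forall x y d, h x (act y d) = h x y ** d.
Hypothesis hC : forall x y, h y x = star (h x y).
Hypothesis hpos : forall x, cpos (h x x).

Lemma semi_Dl x y z : h (x + y) z = h x z + h y z.
Proof. by rewrite hC hDr starD -!hC. Qed.

Lemma semi_Zl (c : R[i]) x y : h (c *: x) y = c^* *: h x y.
Proof. by rewrite hC hZr starZ -hC. Qed.

Lemma semi_Ml x y d : h (act x d) y = star d ** h x y.
Proof. by rewrite hC hMr starM -hC. Qed.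

Lemma semi_Nr x y : h x (- y) = - h x y.
Proof. by rewrite -scaleN1r hZr scaleN1r. Qed.

Lemma semi_Nl x y : h (- x) y = - h x y.
Proof. by rewrite hC semi_Nr starN -hC. Qed.

(** For m >= |<x, x>| the square of x <x, y> - m y gives m |<x, y>|^2 <= m^2 |<y, y>|. Then m is
    |<x, x>| if this is nonzero, and tends to 0 otherwise. *)
Lemma semi_CS x y : nr (h x y) ^+ 2 <= nr (h x x) * nr (h y y).
Proof.
set a := h x y; set n := nr (h x x).
have n0 : 0 <= n := nr_ge0 _.
have key (m : R) : 0 < m -> n <= m -> m * nr a ^+ 2 <= m ^+ 2 * nr (h y y).
  move=> m0 nm.
  set z := act x a - m%:C *: y.
  have zz : h z z + star a ** (rsc m - h x x) ** a + m%:C *: (star a ** a)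
      = (m ^+ 2)%:C *: h y y.
    rewrite /z semi_Dl !hDr !semi_Nr !semi_Nl !hMr !semi_Ml !hZr !semi_Zl.
    rewrite [h y x]hC -/a conj_Creal ?complex_real//.
    rewrite cmulBr cmulBl rscr cmulZl cmulZr scalerA -rmorphM/= -expr2.
    set p := star a ** h x x ** a; set q := m%:C *: (star a ** a).
    set r := (m ^+ 2)%:C *: h y y.
    have -> : p + - q + (- q + - - r) + (q - p) + q = r + (p - p) + (q - q) + (q - q).
      by rewrite opprK [LHS](AC ((2*2)*2*1) ((4*(1*6))*(5*2)*(7*3))).
    by rewrite !subrr !addr0.
  have P : cpos (m%:C *: (star a ** a)) by apply: cposZ; [exact: ltW|exact: cpos_starM].
  have Q : cpos (h z z + star a ** (rsc m - h x x) ** a).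
    by apply: cposD => //; apply: cpos_conj; exact: cpos_rsc_sub.
  have := nr_cposD P Q; rewrite addrC zz !nrZR nr_starM (ger0_norm (ltW m0)).
  by rewrite ger0_norm// sqr_ge0.
have [n1|n1] := eqVneq n 0; last first.
  have n2 : 0 < n by rewrite lt_neqAle eq_sym n1.
  by have := key n n2 (lexx _); rewrite (expr2 n) -mulrA ler_pM2l.
rewrite n1 mul0r; apply/ler_addgt0Pr => e e0; rewrite add0r.
have yy := nr_ge0 (h y y).
have d0 : 0 < e / (nr (h y y) + 1) by rewrite divr_gt0// ltr_pwDr.
have {}key (m : R) : 0 < m -> nr a ^+ 2 <= m * nr (h y y).
  move=> m0; have := key _ m0; rewrite n1 => /(_ (ltW m0)).
  by rewrite (expr2 m) -mulrA ler_pM2l.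
have H := key _ d0.
apply: le_trans H _; rewrite mulrAC ler_pdivrMr ?ltr_pwDr//.
rewrite ler_pM2l//; lra.
Qed.

Lemma semi_sqrtD x y :
  Num.sqrt (nr (h (x + y) (x + y))) <= Num.sqrt (nr (h x x)) + Num.sqrt (nr (h y y)).
Proof.
set a := Num.sqrt (nr (h x x)); set b := Num.sqrt (nr (h y y)).
have a2 : a ^+ 2 = nr (h x x) by rewrite sqr_sqrtr// nr_ge0.
have b2 : b ^+ 2 = nr (h y y) by rewrite sqr_sqrtr// nr_ge0.
have a0 : 0 <= a := sqrtr_ge0 _.
have b0 : 0 <= b := sqrtr_ge0 _.
rewrite -[leRHS]ger0_norm ?addr_ge0// -sqrtr_sqr ler_wsqrtr//.
rewrite semi_Dl !hDr.
have xy : nr (h x y) <= a * b.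
  have := semi_CS x y; rewrite -a2 -b2 -exprMn; rewrite ler_pXn2r ?nnegrE ?nr_ge0 ?mulr_ge0//.
have yx : nr (h y x) <= a * b by rewrite hC nr_star.
apply: le_trans (nrD _ _) _; have := nrD (h x x) (h x y).
have := nrD (h y x) (h y y); rewrite -a2 -b2 sqrrD; lra.
Qed.

Lemma semi_sqrtZ c x :
  Num.sqrt (nr (h (c *: x) (c *: x))) = cn c * Num.sqrt (nr (h x x)).
Proof.
have cJ : cn c^* = cn c by rewrite /cn norm_conjC.
rewrite hZr semi_Zl !nrZ cJ mulrA -expr2.
by rewrite sqrtrM ?sqr_ge0// sqrtr_sqr ger0_norm ?cn_ge0.
Qed.

End SemiInner.

HB.factory Record Lmodule_isHilbert (R : realType) (D : cstarAlgType R) V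
    of GRing.Lmodule R[i] V := {
  pact : V -> D -> V;
  pdot : V -> V -> D;
  pactDl : forall x y d, pact (x + y) d = pact x d + pact y d;
  pactDr : forall x d e, pact x (d + e) = pact x d + pact x e;
  pactZl : forall (c : R[i]) x d, pact (c *: x) d = c *: pact x d;
  pactZr : forall (c : R[i]) x d, pact x (c *: d) = c *: pact x d;
  pactM : forall x d e, pact x (d ** e) = pact (pact x d) e;
  pact1 : forall x, pact x cone = x;
  pdotDr : forall x y z, pdot x (y + z) = pdot x y + pdot x z;
  pdotZr : forall (c : R[i]) x y, pdot x (c *: y) = c *: pdot x y;
  pdotMr : forall x y d, pdot x (pact y d) = pdot x y ** d;
  pdotC : forall x y, pdot y x = star (pdot x y);
  pdot_pos : forall x, cpos (pdot x x);
  pdot_eq0 : forall x, pdot x x = 0 -> x = 0;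
  pdot_complete : forall u : nat -> V,
    (forall e : R, 0 < e -> exists N, forall m n, (N <= m)%N -> (N <= n)%N ->
      nr (pdot (u m - u n) (u m - u n)) < e) ->
    exists l, forall e : R, 0 < e -> exists N, forall n, (N <= n)%N ->
      nr (pdot (u n - l) (u n - l)) < e
}.

HB.builders Context R D V of Lmodule_isHilbert R D V.

Let pn (x : V) : R := Num.sqrt (nr (pdot x x)).

Let pnD x y : pn (x + y) <= pn x + pn y.
Proof. exact: (semi_sqrtD pdotDr pdotZr pdotMr pdotC pdot_pos). Qed.

Let pnZ (c : R[i]) x : pn (c *: x) = cn c * pn x.
Proof. exact: (semi_sqrtZ pdotZr pdotC). Qed.

Let pn_eq0 x : pn x = 0 -> x = 0.
Proof.
move=> /eqP; rewrite sqrtr_eq0 => /nr_le0; exact: pdot_eq0.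
Qed.

Let pn_lt x (e : R) : 0 < e -> (pn x < e) = (nr (pdot x x) < e ^+ 2).
Proof.
move=> e0; rewrite -{1}[e]ger0_norm ?ltW// -sqrtr_sqr ltr_sqrt// exprn_gt0//.
Qed.

Let pn_complete (u : nat -> V) :
    (forall e : R, 0 < e -> exists N, forall m n, (N <= m)%N -> (N <= n)%N ->
      pn (u m - u n) < e) ->
    exists l, forall e : R, 0 < e -> exists N, forall n, (N <= n)%N ->
      pn (u n - l) < e.
Proof.
move=> cu; have [e e0|l hl] := @pdot_complete u.
  have s0 : 0 < Num.sqrt e by rewrite sqrtr_gt0.
  have [N hN] := cu _ s0; exists N => m n Nm Nn.
  by have := hN m n Nm Nn; rewrite pn_lt// sqr_sqrtr// ltW.
exists l => e e0; have [N hN] := hl _ (exprn_gt0 2 e0).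
by exists N => n Nn; rewrite pn_lt// hN.
Qed.

HB.instance Definition _ :=
  Lmodule_isCompleteNormed.Build R V pnD pnZ pn_eq0 pn_complete.

Let pnorm_sqr (x : V) : `|x| ^+ 2 = `|pdot x x|.
Proof.
rewrite [in LHS]/Num.norm/= -rmorphXn/= sqr_sqrtr ?nr_ge0//.
by rewrite -nrE.
Qed.

HB.instance Definition _ := isHilbertModule.Build R D V
  pactDl pactDr pactZl pactZr pactM pact1 pdotDr pdotZr pdotMr pdotC pdot_pos pnorm_sqr.

HB.end.

Section HilbertBasics.
Context {R : realType} {D : cstarAlgType R} {E : hilbertModType D}.
Implicit Types (x y z : E) (d e : D).

Lemma hdotDl x y z : hdot (x + y) z = hdot x z + hdot y z.
Proof. exact: (semi_Dl hdotDr hdotC). Qed.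

Lemma hdotZl (c : R[i]) x y : hdot (c *: x) y = c^* *: hdot x y.
Proof. exact: (semi_Zl hdotZr hdotC). Qed.

Lemma hdotMl x y d : hdot (ract x d) y = star d ** hdot x y.
Proof. exact: (semi_Ml hdotMr hdotC). Qed.

Lemma hdotNr x y : hdot x (- y) = - hdot x y.
Proof. exact: (semi_Nr hdotZr). Qed.

Lemma hdotNl x y : hdot (- x) y = - hdot x y.
Proof. exact: (semi_Nl hdotZr hdotC). Qed.

Lemma hdotBr x y z : hdot x (y - z) = hdot x y - hdot x z.
Proof. by rewrite hdotDr hdotNr. Qed.

Lemma hdotBl x y z : hdot (x - y) z = hdot x z - hdot y z.
Proof. by rewrite hdotDl hdotNl. Qed.

Lemma hdot0r x : hdot x 0 = 0.
Proof. by rewrite -(subrr x) hdotBr subrr. Qed.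

Lemma hdot0l x : hdot 0 x = 0.
Proof. by rewrite -(subrr x) hdotBl subrr. Qed.

Lemma hdot_sumr (I : Type) (r : seq I) (P : pred I) (F : I -> E) x :
  hdot x (\sum_(i <- r | P i) F i) = \sum_(i <- r | P i) hdot x (F i).
Proof. by apply: (big_morph (hdot x) (hdotDr x)); rewrite hdot0r. Qed.

Lemma hdot_suml (I : Type) (r : seq I) (P : pred I) (F : I -> E) x :
  hdot (\sum_(i <- r | P i) F i) x = \sum_(i <- r | P i) hdot (F i) x.
Proof. by apply: (big_morph (hdot^~ x) (fun _ _ => hdotDl _ _ _)); rewrite hdot0l. Qed.

Lemma nr_hdot x : nr (hdot x x) = nr x ^+ 2.
Proof. by apply: (@complexI R); rewrite rmorphXn/= -!nrE hnorm_sqr. Qed.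

Lemma hdot_eq0 x : hdot x x = 0 -> x = 0.
Proof.
move=> x0; apply/eqP; rewrite -nr_eq0 -sqrf_eq0 -nr_hdot x0.
by rewrite nr0.
Qed.

Lemma hdot_CS x y : nr (hdot x y) <= nr x * nr y.
Proof.
have := semi_CS hdotDr hdotZr hdotMr hdotC (@hdot_pos _ _ E) x y.
by rewrite !nr_hdot -exprMn ler_pXn2r ?nnegrE ?mulr_ge0 ?nr_ge0.
Qed.

Lemma hdot_ext x y : (forall z, hdot z x = hdot z y) -> x = y.
Proof.
move=> h; apply/eqP; rewrite -subr_eq0; apply/eqP/hdot_eq0.
by rewrite hdotBr h subrr.
Qed.

Lemma nr_le_sq x (M : R) : 0 <= M -> nr (hdot x x) <= M ^+ 2 -> nr x <= M.
Proof. by move=> M0; rewrite nr_hdot ler_pXn2r// ?nnegrE ?nr_ge0. Qed.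

Lemma nr_ract x d : nr (ract x d) <= nr x * nr d.
Proof.
apply: nr_le_sq; first by rewrite mulr_ge0 ?nr_ge0.
rewrite hdotMl hdotMr; apply: le_trans (nrM _ _) _.
rewrite nr_star; have h := nrM (hdot x x) d; rewrite nr_hdot in h.
have := nr_ge0 d; nra.
Qed.

Lemma ract0r x : ract x 0 = 0.
Proof. by apply: (addrI (ract x 0)); rewrite -ractDr !addr0. Qed.

Lemma ract0l d : ract (0 : E) d = 0.
Proof. by apply: (addrI (ract 0 d)); rewrite -ractDl !addr0. Qed.

Lemma ractNl x d : ract (- x) d = - ract x d.
Proof. by rewrite -scaleN1r ractZl scaleN1r. Qed.

Lemma ractNr x d : ract x (- d) = - ract x d.
Proof. by rewrite -scaleN1r ractZr scaleN1r. Qed.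

Lemma ractBl x y d : ract (x - y) d = ract x d - ract y d.
Proof. by rewrite ractDl ractNl. Qed.

Lemma ractBr x d e : ract x (d - e) = ract x d - ract x e.
Proof. by rewrite ractDr ractNr. Qed.

Lemma cvs_hdotr (u : nat -> E) l x : cvs u l -> cvs (fun n => hdot x (u n)) (hdot x l).
Proof.
move=> ul; apply: (@cvs_lip _ _ _ (hdot x) (nr x)) ul => y z.
by rewrite -hdotBr hdot_CS.
Qed.

Lemma cvs_hdotl (u : nat -> E) l x : cvs u l -> cvs (fun n => hdot (u n) x) (hdot l x).
Proof.
move=> ul; apply: (@cvs_lip _ _ _ (hdot^~ x) (nr x)) ul => y z.
by rewrite -hdotBl mulrC hdot_CS.
Qed.

Lemma cvs_ractl (u : nat -> E) l d : cvs u l -> cvs (fun n => ract (u n) d) (ract l d).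
Proof.
move=> ul; apply: (@cvs_lip _ _ _ (ract^~ d) (nr d)) ul => y z.
by rewrite -ractBl mulrC nr_ract.
Qed.

End HilbertBasics.

Section ClosedSpan.
Context {R : realType} {V : completeNormedModType R[i]}.
Implicit Types X P : set V.

Lemma clspan_ind X P : (forall x, X x -> P x) -> P 0 ->
  (forall x y, P x -> P y -> P (x + y)) -> (forall c x, P x -> P (c *: x)) ->
  (forall u l, (forall n, P (u n)) -> cvs u l -> P l) ->
  forall x, clspan X x -> P x.
Proof.
move=> XP P0 PD PZ Pcl x /closure_cvs[u hu ux]; apply: Pcl ux => n.
have [m [c [f [fX ->]]]] := hu n.
by elim/big_ind: _ => // i _; apply: PZ; apply: XP.
Qed.

Lemma sub_clspan X x : X x -> clspan X x.
Proof.
move=> Xx; apply: subset_closure; exists 1%N, (fun=> 1), (fun=> x); split=> //.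
by rewrite big_ord1 scale1r.
Qed.

Lemma lspan0 X : lspan X 0.
Proof. by exists 0%N, (fun=> 0), (fun=> 0); split; [case|rewrite big_ord0]. Qed.

Lemma lspanD X x y : lspan X x -> lspan X y -> lspan X (x + y).
Proof.
move=> [n [c [f [fX ->]]]] [m [d [g [gX ->]]]].
exists (n + m)%N, (fun i => match fintype.split i with inl j => c j | inr j => d j end).
exists (fun i => match fintype.split i with inl j => f j | inr j => g j end); split.
  by move=> i; case: (fintype.split i).
rewrite big_split_ord/=; congr (_ + _); apply: eq_bigr => i _.
  by rewrite (unsplitK (inl i)).
by rewrite (unsplitK (inr i)).
Qed.

Lemma lspanZ X a x : lspan X x -> lspan X (a *: x).
Proof.
move=> [n [c [f [fX ->]]]]; exists n, (fun i => a * c i), f; split=> //.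
by rewrite scaler_sumr; apply: eq_bigr => i _; rewrite scalerA.
Qed.

Lemma clspan0 X : clspan X 0.
Proof. exact/subset_closure/lspan0. Qed.

Lemma clspan_cvs X u l : (forall n, clspan X (u n)) -> cvs u l -> clspan X l.
Proof.
move=> hu ul; apply/closureP => e e0; have e2 : 0 < e / 2 by rewrite divr_gt0.
have [N hN] := ul _ e2; have /closureP/(_ _ e2)[y Xy h] := hu N.
exists y => //; apply: le_lt_trans (nr_tri _ (u N) _) _.
by rewrite nr_dist (splitr e) ltrD// hN.
Qed.

Lemma clspanD X x y : clspan X x -> clspan X y -> clspan X (x + y).
Proof.
move=> /closureP hx /closureP hy; apply/closureP => e e0.
have e2 : 0 < e / 2 by rewrite divr_gt0.
have [x' Xx' h] := hx _ e2; have [y' Xy' h'] := hy _ e2.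
exists (x' + y'); first exact: lspanD.
rewrite opprD addrACA; apply: le_lt_trans (nrD _ _) _.
by rewrite (splitr e) ltrD.
Qed.

Lemma clspanZ X a x : clspan X x -> clspan X (a *: x).
Proof.
move=> /closure_cvs[u hu ux]; apply: (@cvs_closure _ _ _ (fun n => a *: u n)).
  by move=> n; apply: lspanZ.
by apply: (@cvs_lip _ _ _ ( *:%R a) (cn a)) ux => y z; rewrite -scalerBr nrZ.
Qed.

Lemma clspanN X x : clspan X x -> clspan X (- x).
Proof. by rewrite -scaleN1r; apply: clspanZ. Qed.

Lemma clspan_min X Y : (forall x, X x -> clspan Y x) -> forall x, clspan X x -> clspan Y x.
Proof.
move=> XY; apply: clspan_ind => //; [exact: clspan0|exact: clspanD| |].
  by move=> c x; apply: clspanZ.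
exact: clspan_cvs.
Qed.

End ClosedSpan.

Lemma clspan_map {R : realType} {V W : completeNormedModType R[i]}
    (X : set V) (Y : set W) (f : V -> W) (C : R) :
  (forall x y, f (x + y) = f x + f y) -> (forall c x, f (c *: x) = c *: f x) ->
  (forall x, nr (f x) <= C * nr x) -> (forall x, X x -> clspan Y (f x)) ->
  forall x, clspan X x -> clspan Y (f x).
Proof.
move=> fD fZ fC XY.
have f0 : f 0 = 0 by rewrite -(scale0r 0) fZ scale0r.
apply: clspan_ind => //.
- by rewrite f0; exact: clspan0.
- by move=> x y hx hy; rewrite fD; exact: clspanD.
- by move=> c x hx; rewrite fZ; exact: clspanZ.
move=> u l hu ul; apply: clspan_cvs hu _; apply: (@cvs_lip _ _ _ f C) ul => x y.
by rewrite -scaleN1r -fZ -fD scaleN1r fC.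
Qed.

Section Adjointable.
Context {R : realType} {D : cstarAlgType R}.

Section Pair.
Context {E F : hilbertModType D} (T : E -> F) (S : F -> E).
Hypothesis TS : adjoint_pair T S.

Lemma adjoint_sym : adjoint_pair S T.
Proof. by move=> x y; rewrite hdotC -TS -hdotC. Qed.

(** Linearity over the scalars and over D comes from the adjoint alone, as a vector is determined by
    its inner products. *)
Lemma padjD x y : T (x + y) = T x + T y.
Proof. by apply: hdot_ext => z; rewrite hdotDr -!adjoint_sym hdotDr. Qed.

Lemma padjZ (c : R[i]) x : T (c *: x) = c *: T x.
Proof. by apply: hdot_ext => z; rewrite hdotZr -!adjoint_sym hdotZr. Qed.

Lemma padjM x d : T (ract x d) = ract (T x) d.
Proof. by apply: hdot_ext => z; rewrite hdotMr -!adjoint_sym hdotMr. Qed.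

Lemma padj0 : T 0 = 0.
Proof. by rewrite -(scale0r 0) padjZ scale0r. Qed.

Lemma padjN x : T (- x) = - T x.
Proof. by rewrite -scaleN1r padjZ scaleN1r. Qed.

Lemma padjB x y : T (x - y) = T x - T y.
Proof. by rewrite padjD padjN. Qed.

Lemma padj_bound (C : R) : 0 <= C -> (forall x, nr (T x) <= C * nr x) ->
  forall y, nr (S y) <= C * nr y.
Proof.
move=> C0 TC y; have := hdot_CS (T (S y)) y; rewrite TS nr_hdot => h.
have := TC (S y); have := nr_ge0 (S y); have := nr_ge0 y => y0 s0 h1.
have h2 : nr (S y) * nr (S y) <= nr (S y) * (C * nr y).
  by rewrite -expr2; apply: le_trans h _; rewrite mulrA [nr (S y) * C]mulrC ler_wpM2r.
have [s00|s00] := eqVneq (nr (S y)) 0; first by rewrite s00 mulr_ge0.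
by move: h2; rewrite ler_pM2l// lt_neqAle eq_sym s00.
Qed.

End Pair.

Lemma adjoint_comp (E F G : hilbertModType D) (T : E -> F) S (T' : F -> G) S' :
  adjoint_pair T S -> adjoint_pair T' S' -> adjoint_pair (T' \o T) (S \o S').
Proof. by move=> h h' x y; rewrite /= h' h. Qed.

Lemma adjoint_id (E : hilbertModType D) : adjoint_pair (@id E) id.
Proof. by []. Qed.

Lemma adjoint_uniq (E F : hilbertModType D) (T : E -> F) S S' :
  adjoint_pair T S -> adjoint_pair T S' -> S =1 S'.
Proof. by move=> h h' y; apply: hdot_ext => z; rewrite -h -h'. Qed.

End Adjointable.

Section StarRepresentation.
Context {R : realType} {D : cstarAlgType R} {A : cstarAlgType R} {E : hilbertModType D}.
Variable phi : A -> E -> E.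
Hypothesis rep : star_rep phi.

Lemma repZD (c : R[i]) a b x : phi (c *: a + b) x = c *: phi a x + phi b x.
Proof. by case: rep. Qed.

Lemma repM a b x : phi (a ** b) x = phi a (phi b x).
Proof. by case: rep. Qed.

Lemma rep_adj a : adjoint_pair (phi a) (phi (star a)).
Proof. by case: rep. Qed.

Lemma repD a b x : phi (a + b) x = phi a x + phi b x.
Proof. by rewrite -[a]scale1r repZD !scale1r. Qed.

Lemma rep0 x : phi 0 x = 0.
Proof. by apply: (addrI (phi 0 x)); rewrite -repD !addr0. Qed.

Lemma repZ (c : R[i]) a x : phi (c *: a) x = c *: phi a x.
Proof. by rewrite -[c *: a]addr0 repZD rep0 addr0. Qed.

Lemma rep_nr a x : nr (phi a x) <= nr a * nr x.
Proof.
have [b bb] := defect (lexx (nr a)).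
apply: nr_le_sq; first by rewrite mulr_ge0 ?nr_ge0.
have -> : hdot (phi a x) (phi a x) = hdot x (phi (star a ** a) x).
  by rewrite rep_adj repM.
have h : hdot x (phi (star a ** a) x) + hdot x (phi (star b ** b) x) =
    ((nr a) ^+ 2)%:C *: hdot x (phi cone x).
  by rewrite -hdotDr -repD bb addrC subrK /rsc repZ hdotZr.
have p1 (c : A) : hdot x (phi (star c ** c) x) = hdot (phi c x) (phi c x).
  by rewrite [RHS]rep_adj repM.
apply: (le_trans (nr_cposD _ (_ : cpos (hdot x (phi (star b ** b) x))))).
- by rewrite p1; exact: hdot_pos.
- by rewrite p1; exact: hdot_pos.
rewrite h nrZR ger0_norm ?sqr_ge0// exprMn ler_wpM2l ?sqr_ge0//.
(* [phi] is not assumed unital: [phi cone] is a projection, and its contractivity is what this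
   identity provides. *)
have e1 : hdot x (phi cone x) = hdot (phi cone x) (phi cone x).
  by rewrite -p1 star1 cmul1l.
apply: le_trans (hdot_CS _ _) _; rewrite expr2 ler_wpM2l ?nr_ge0//.
have := hdot_CS x (phi cone x); rewrite e1 nr_hdot => h1.
have := nr_ge0 x; have := nr_ge0 (phi cone x); nra.
Qed.

End StarRepresentation.

Section StarHomNorm.
Context {R : realType} {A D : cstarAlgType R} (f : starHom A D).

(** A is represented on D through f by left multiplication, so [rep_nr] applies; the value at the
    vector [cone] is f a. *)
Lemma shom_nr a : nr (f a) <= nr a.
Proof.
have rep : star_rep (fun a (x : cself D) => f a ** (x : D) : cself D).
  split.
  - by move=> c b b' x; rewrite linearP cmulDl cmulZl.
  - by move=> b b' x; rewrite shomM cmulA.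
  by move=> b x y; rewrite /hdot/= starM shom_star cmulA.
have := rep_nr rep a (cone : cself D); rewrite cmul1r => h.
apply: le_trans h _; rewrite -[leRHS]mulr1 ler_wpM2l ?nr_ge0//.
exact: (@nr_cone _ D).
Qed.

Lemma cvs_shom (u : nat -> A) l : cvs u l -> cvs (fun n => f (u n)) (f l).
Proof.
move=> ul; apply: (@cvs_lip _ _ _ f 1) ul => x y.
by rewrite -linearB mul1r shom_nr.
Qed.

End StarHomNorm.

Section OperatorAlgebra.
Context {R : realType} {D : cstarAlgType R}.

Definition bounded_adjointable (E : hilbertModType D) (T : E -> E) : Prop :=
  adjointable T /\ exists2 C : R, 0 <= C & forall x, nr (T x) <= C * nr x.

Definition lop_pred (E : hilbertModType D) : {pred (E -> E)} :=
  fun T => `[< bounded_adjointable T >].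

Arguments lop_pred : clear implicits.

Record lop (E : hilbertModType D) := Lop {
  lop_fun :> E -> E;
  lop_subproof : lop_fun \in lop_pred E
}.

HB.instance Definition _ (E : hilbertModType D) := [isSub for @lop_fun E].
HB.instance Definition _ (E : hilbertModType D) := [Choice of lop E by <:].

Lemma lop_predP (E : hilbertModType D) (T : E -> E) : reflect (bounded_adjointable T) (T \in lop_pred E).
Proof. exact: asboolP. Qed.

Lemma lop_submod_closed (E : hilbertModType D) : submod_closed (lop_pred E).
Proof.
split=> [|c T T' /lop_predP[[S TS] [C C0 TC]] /lop_predP[[S' TS'] [C' C0' TC']]].
  apply/lop_predP; split; last by exists 0 => // x; rewrite mul0r nr0.
  by exists (fun=> 0) => x y; rewrite hdot0l hdot0r.
apply/lop_predP; split.
  exists (fun y => c^* *: S y + S' y) => x y.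
  by rewrite hdotDl hdotZl hdotDr hdotZr -TS -TS'.
exists (cn c * C + C'); first by rewrite addr_ge0// mulr_ge0// cn_ge0.
move=> x; apply: le_trans (nrD _ _) _; rewrite mulrDl; apply: lerD => //.
by rewrite nrZ -mulrA ler_wpM2l ?cn_ge0.
Qed.

HB.instance Definition _ (E : hilbertModType D) :=
  GRing.isSubmodClosed.Build R[i] (E -> E) (lop_pred E) (lop_submod_closed E).
HB.instance Definition _ (E : hilbertModType D) := [SubChoice_isSubLmodule of lop E by <:].

Section Norm.
Variable E : hilbertModType D.
Implicit Types T S : lop E.

Lemma lop_ext T S : T =1 S -> T = S.
Proof. by move=> TS; apply: val_inj; apply: funext. Qed.

Lemma lopDE T S x : (T + S) x = T x + S x. Proof. by []. Qed.
Lemma lopZE (c : R[i]) T x : (c *: T) x = c *: T x. Proof. by []. Qed.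
Lemma lopNE T x : (- T) x = - T x. Proof. by []. Qed.
Lemma lopBE T S x : (T - S) x = T x - S x. Proof. by []. Qed.

Lemma lop_adjointable T : adjointable T.
Proof. by case: T => T /= /lop_predP[]. Qed.

Lemma lop_bounded T : exists2 C : R, 0 <= C & forall x, nr (T x) <= C * nr x.
Proof. by case: T => T /= /lop_predP[]. Qed.

Definition opn (T : E -> E) : R := sup [set nr (T x) | x in [set x | nr x <= 1]].

Lemma opn_le (T : E -> E) (C : R) : 0 <= C -> (forall x, nr (T x) <= C * nr x) -> opn T <= C.
Proof.
move=> C0 TC; apply: ge_sup.
  by exists (nr (T 0)), 0 => //=; rewrite nr0.
move=> _ [x /= x1 <-]; apply: le_trans (TC x) _.
by rewrite -[leRHS]mulr1 ler_wpM2l.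
Qed.

Lemma opn_ge0 T : 0 <= opn T.
Proof.
have [C C0 TC] := lop_bounded T.
apply: le_trans (nr_ge0 (T 0)) _; apply: ub_le_sup; last by exists 0 => //=; rewrite nr0.
by exists C => _ [x /= x1 <-]; apply: le_trans (TC x) _; rewrite -[leRHS]mulr1 ler_wpM2l.
Qed.

Lemma opn_bound T x : nr (T x) <= opn T * nr x.
Proof.
have [C C0 TC] := lop_bounded T.
have [S TS] := lop_adjointable T.
have [x0|x0] := eqVneq (nr x) 0.
  by have := TC x; rewrite x0 !mulr0.
have {}x0 : 0 < nr x by rewrite lt_neqAle eq_sym x0 nr_ge0.
rewrite -ler_pdivrMr//; apply: ub_le_sup.
  by exists C => _ [y /= y1 <-]; apply: le_trans (TC y) _; rewrite -[leRHS]mulr1 ler_wpM2l.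
exists ((nr x)^-1%:C *: x) => /=.
  by rewrite nrZR ger0_norm ?invr_ge0 ?nr_ge0// mulVf// gt_eqF.
rewrite (padjZ TS) nrZR ger0_norm ?invr_ge0 ?nr_ge0//.
by rewrite mulrC.
Qed.

Let opnD T S : opn (T + S : lop E) <= opn T + opn S.
Proof.
apply: opn_le; first by rewrite addr_ge0 ?opn_ge0.
move=> x; rewrite lopDE; apply: le_trans (nrD _ _) _.
by rewrite mulrDl lerD ?opn_bound.
Qed.

Let opnZ_le (c : R[i]) T : opn (c *: T : lop E) <= cn c * opn T.
Proof.
apply: opn_le; first by rewrite mulr_ge0 ?opn_ge0 ?cn_ge0.
by move=> x; rewrite lopZE nrZ -mulrA ler_wpM2l ?cn_ge0 ?opn_bound.
Qed.

Let opnZ (c : R[i]) T : opn (c *: T : lop E) = cn c * opn T.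
Proof.
apply/eqP; rewrite eq_le opnZ_le andTb.
have [->|c0] := eqVneq c 0.
  have -> : cn (0 : R[i]) = 0 by apply/eqP; rewrite cn_eq0.
  by rewrite mul0r opn_ge0.
have := opnZ_le c^-1 (c *: T); rewrite scalerA mulVf// scale1r => h.
apply: le_trans (ler_wpM2l (cn_ge0 c) h) _.
by rewrite mulrA -cnM mulfV// cn1 mul1r.
Qed.

Let opn_eq0 T : opn T = 0 -> T = 0.
Proof.
move=> T0; apply: lop_ext => x; apply: nr_le0.
by have := opn_bound T x; rewrite T0 mul0r.
Qed.

Lemma lop_adj_bound T (S : E -> E) : adjoint_pair T S -> forall y, nr (S y) <= opn T * nr y.
Proof. by move=> TS; apply: (padj_bound TS (opn_ge0 T)); exact: opn_bound. Qed.

Let opn_complete (u : nat -> lop E) :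
  (forall e : R, 0 < e -> exists N, forall m n, (N <= m)%N -> (N <= n)%N ->
      opn (u m - u n : lop E) < e) ->
  exists l, forall e : R, 0 < e -> exists N, forall n, (N <= n)%N -> opn (u n - l : lop E) < e.
Proof.
move=> cu.
have cd (d : R) : 0 < d -> exists N, forall m n, (N <= m)%N -> (N <= n)%N ->
    forall x, nr (u m x - u n x) <= d * nr x.
  move=> d0; have [N hN] := cu d d0; exists N => m n Nm Nn x.
  by rewrite -lopBE; apply: le_trans (opn_bound _ _) _; rewrite ler_wpM2r ?nr_ge0// ltW// hN.
have /choice[v uv] n := lop_adjointable (u n).
(* Adjoints satisfy the same estimates, so they converge pointwise too, and their limit is an
   adjoint of the limit operator. *)
have cd' (d : R) : 0 < d -> exists N, forall m n, (N <= m)%N -> (N <= n)%N ->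
    forall x, nr (v m x - v n x) <= d * nr x.
  move=> d0; have [N hN] := cd d d0; exists N => m n Nm Nn.
  apply: (@padj_bound _ _ _ _ (fun x => u m x - u n x)) => [x y||x]; last exact: hN.
    by rewrite hdotBl hdotBr uv uv.
  exact: ltW.
have lim_ex (w : nat -> E -> E) : (forall d : R, 0 < d -> exists N, forall m n,
    (N <= m)%N -> (N <= n)%N -> forall x, nr (w m x - w n x) <= d * nr x) ->
    forall x, exists l, cvs (w^~ x) l.
  move=> cw x; apply: cvs_ex => e e0.
  have d0 : 0 < e / (nr x + 1) by rewrite divr_gt0// ltr_pwDr// nr_ge0.
  have [N hN] := cw _ d0; exists N => m n Nm Nn.
  apply: le_lt_trans (hN m n Nm Nn x) _.
  by rewrite mulrAC ltr_pdivrMr ?ltr_pwDr ?nr_ge0// ltr_pM2l// ltrDl.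
have /choice[l hl] := lim_ex _ cd; have /choice[s hs] := lim_ex _ cd'.
have ls : adjoint_pair l s.
  move=> x y; apply: (cvs_uniq (cvs_hdotl y (hl x))).
  rewrite (_ : (fun n => _) = (fun n => hdot x (v n y))); first exact: cvs_hdotr.
  by apply/funext => n; rewrite uv.
have ul (d : R) : 0 < d -> exists N, forall n, (N <= n)%N ->
    forall x, nr (u n x - l x) <= d * nr x.
  move=> d0; have [N hN] := cd d d0; exists N => n Nn x.
  apply: (@cvs_le _ _ (fun m => u n x - u m x)).
    apply: cvsD; first exact: cvs_cst.
    by apply: (@cvs_lip _ _ _ -%R 1) (hl x) => y z; rewrite mul1r -opprD nrN.
  by exists N => m Nm; apply: hN.
have lb : l \in lop_pred E.
  apply/lop_predP; split; first by exists s.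
  have [N hN] := ul 1 ltr01; exists (opn (u N) + 1); first by rewrite addr_ge0 ?opn_ge0.
  move=> x; have := hN N (leqnn _) x; have := opn_bound (u N) x.
  have := nr_rev (l x) (u N x); rewrite nr_dist; lra.
exists (Lop lb) => e e0.
have e2 : 0 < e / 2 by rewrite divr_gt0.
have [N hN] := ul _ e2; exists N => n Nn.
apply: (@le_lt_trans _ _ (e / 2)); last by rewrite ltr_pdivrMr// mulr_natr mulr2n ltrDl.
by apply: opn_le; [exact: ltW|move=> x; exact: hN].
Qed.

HB.instance Definition _ := Lmodule_isCompleteNormed.Build R (lop E)
  opnD opnZ opn_eq0 opn_complete.

Lemma nr_lopE T : nr T = opn T. Proof. by []. Qed.

Lemma lop_nr T x : nr (T x) <= nr T * nr x. Proof. exact: opn_bound. Qed.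

Lemma lop_nr_le (C : R) T : 0 <= C -> (forall x, nr (T x) <= C * nr x) -> nr T <= C.
Proof. exact: opn_le. Qed.

Lemma lop_comp_subproof T S : (T \o S) \in lop_pred E.
Proof.
apply/lop_predP; split.
  have [T' h] := lop_adjointable T; have [S' h'] := lop_adjointable S.
  by exists (S' \o T'); exact: adjoint_comp h' h.
exists (nr T * nr S); first by rewrite mulr_ge0 ?nr_ge0.
move=> x /=; apply: le_trans (lop_nr _ _) _.
by rewrite -mulrA ler_wpM2l ?nr_ge0// lop_nr.
Qed.

Lemma lop_id_subproof : @id E \in lop_pred E.
Proof. by apply/lop_predP; split; [exists id|exists 1 => // x; rewrite mul1r]. Qed.

Lemma lop_star_subproof T : projT1 (cid (lop_adjointable T)) \in lop_pred E.
Proof.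
apply/lop_predP; case: cid => S TS /=; split; first by exists T; exact: adjoint_sym.
by exists (nr T); [exact: nr_ge0|exact: (lop_adj_bound TS)].
Qed.

Definition lop_mul T S := Lop (lop_comp_subproof T S).
Definition lop_one := Lop lop_id_subproof.
Definition lop_star T := Lop (lop_star_subproof T).

Lemma lop_starP T : adjoint_pair T (lop_star T).
Proof. by rewrite /lop_star/=; case: cid. Qed.

Lemma lop_star_uniq T S : adjoint_pair T S -> lop_star T = S.
Proof. by move=> TS; apply: lop_ext; apply: adjoint_uniq (lop_starP T) TS. Qed.

Fact lop_mulA : associative lop_mul.
Proof. by move=> T S U; apply: lop_ext. Qed.
Fact lop_mul1l : left_id lop_one lop_mul.
Proof. by move=> T; apply: lop_ext. Qed.
Fact lop_mul1r : right_id lop_one lop_mul.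
Proof. by move=> T; apply: lop_ext. Qed.
Fact lop_mulDl T S U : lop_mul (T + S) U = lop_mul T U + lop_mul S U.
Proof. by apply: lop_ext. Qed.
Fact lop_mulDr U T S : lop_mul U (T + S) = lop_mul U T + lop_mul U S.
Proof. by apply: lop_ext => x /=; rewrite (padjD (lop_starP U)). Qed.
Fact lop_mulZl (c : R[i]) T S : lop_mul (c *: T) S = c *: lop_mul T S.
Proof. by apply: lop_ext. Qed.
Fact lop_mulZr (c : R[i]) T S : lop_mul T (c *: S) = c *: lop_mul T S.
Proof. by apply: lop_ext => x /=; rewrite (padjZ (lop_starP T)). Qed.
Fact lop_starD T S : lop_star (T + S) = lop_star T + lop_star S.
Proof.
apply: lop_star_uniq => x y; rewrite lopDE hdotDl !lop_starP lopDE.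
by rewrite hdotDr.
Qed.
Fact lop_starZ (c : R[i]) T : lop_star (c *: T) = c^* *: lop_star T.
Proof.
by apply: lop_star_uniq => x y; rewrite lopZE hdotZl lop_starP lopZE hdotZr.
Qed.
Fact lop_starM T S : lop_star (lop_mul T S) = lop_mul (lop_star S) (lop_star T).
Proof. by apply: lop_star_uniq => x y /=; rewrite !lop_starP. Qed.
Fact lop_starK : involutive lop_star.
Proof. by move=> T; apply: lop_star_uniq; apply: adjoint_sym; exact: lop_starP. Qed.
Fact lop_norm_mul T S : `|lop_mul T S| <= `|T| * `|S|.
Proof.
rewrite !nrE -rmorphM lecR; apply: lop_nr_le; first by rewrite mulr_ge0 ?nr_ge0.
move=> x /=; apply: le_trans (lop_nr _ _) _.
by rewrite -mulrA ler_wpM2l ?nr_ge0// lop_nr.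
Qed.
Lemma lop_star_nr T : nr (lop_star T) <= nr T.
Proof. by apply: lop_nr_le; [exact: nr_ge0|exact: lop_adj_bound (lop_starP T)]. Qed.
Fact lop_norm_star T : `|lop_mul (lop_star T) T| = `|T| ^+ 2.
Proof.
apply/eqP; rewrite eq_le; apply/andP; split.
  apply: le_trans (lop_norm_mul _ _) _; rewrite expr2 ler_wpM2r//.
  by rewrite !nrE lecR lop_star_nr.
rewrite !nrE -rmorphXn lecR/=; set U := lop_mul _ _.
rewrite -[leRHS]sqr_sqrtr ?nr_ge0// ler_pXn2r ?nnegrE ?nr_ge0 ?sqrtr_ge0//.
apply: lop_nr_le; first exact: sqrtr_ge0.
move=> x; apply: nr_le_sq; first by rewrite mulr_ge0 ?sqrtr_ge0 ?nr_ge0.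
rewrite lop_starP exprMn sqr_sqrtr ?nr_ge0//.
apply: le_trans (hdot_CS _ _) _; have := lop_nr U x; have := nr_ge0 x.
rewrite /U/= => x0 h; rewrite mulrC expr2 mulrA ler_wpM2r//.
Qed.

HB.instance Definition _ := isCStarAlgebra.Build R (lop E)
  lop_mulA lop_mul1l lop_mul1r lop_mulDl lop_mulDr lop_mulZl lop_mulZr
  lop_starD lop_starZ lop_starM lop_starK lop_norm_mul lop_norm_star.

Lemma lopME T S x : (T ** S) x = T (S x). Proof. by []. Qed.
Lemma lop1E x : (cone : lop E) x = x. Proof. by []. Qed.
Lemma lop_adj T : adjoint_pair T (star T). Proof. exact: lop_starP. Qed.

End Norm.

Lemma lop_of (E : hilbertModType D) (T S : E -> E) (C : R) : adjoint_pair T S -> 0 <= C ->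
  (forall x, nr (T x) <= C * nr x) -> T \in lop_pred E.
Proof. by move=> TS C0 TC; apply/lop_predP; split; [exists S|exists C]. Qed.

Section Representation.
Context (A : cstarAlgType R) (E : hilbertModType D) (phi : A -> E -> E).
Hypothesis rep : unital_rep phi.

Lemma rep_lop a : phi a \in lop_pred E.
Proof.
have h := rep.1.
by apply: (lop_of (rep_adj h a) (nr_ge0 a)) => x; exact: rep_nr.
Qed.

Let f (a : A) : lop E := Lop (rep_lop a).

Let f_lin : linear f.
Proof. by move=> c a b; apply: lop_ext => x /=; rewrite (repZD rep.1). Qed.

HB.instance Definition _ := GRing.isLinear.Build R[i] A (lop E) *:%R f f_lin.

Let fM a b : f (a ** b) = f a ** f b.
Proof. by apply: lop_ext => x /=; rewrite (repM rep.1). Qed.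
Let f1 : f cone = cone.
Proof. by apply: lop_ext => x /=; rewrite rep.2. Qed.
Let f_star a : f (star a) = star (f a).
Proof. by symmetry; apply: lop_star_uniq; exact: (rep_adj rep.1). Qed.

Definition rep_shom : starHom A (lop E) := StarHom fM f1 f_star.

Lemma rep_shomE a x : rep_shom a x = phi a x. Proof. by []. Qed.

End Representation.

Lemma shom_rep (A : cstarAlgType R) (E : hilbertModType D) (f : starHom A (lop E)) :
  unital_rep (fun a x => f a x).
Proof.
split; last by move=> x; rewrite shom1.
split=> [c a b x|a b x|a]; first by rewrite linearP.
  by rewrite shomM.
by rewrite shom_star; exact: lop_adj.
Qed.

End OperatorAlgebra.

(** * The universal property as a generation principle *)

Section HomComposition.
Context {R : realType}.

Section Comp.
Context {A B C : cstarAlgType R} (g : starHom B C) (f : starHom A B).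

Let h (a : A) : C := g (f a).
Let h_lin : linear h. Proof. by move=> c a b; rewrite /h !linearP. Qed.
HB.instance Definition _ := GRing.isLinear.Build R[i] A C *:%R h h_lin.
Let hM a b : h (a ** b) = h a ** h b. Proof. by rewrite /h !shomM. Qed.
Let h1 : h cone = cone. Proof. by rewrite /h !shom1. Qed.
Let hs a : h (star a) = star (h a). Proof. by rewrite /h !shom_star. Qed.
Definition shom_comp : starHom A C := StarHom hM h1 hs.
Lemma shom_compE a : shom_comp a = g (f a). Proof. by []. Qed.
End Comp.

Section Id.
Context {A : cstarAlgType R}.
Let h (a : A) : A := a.
Let h_lin : linear h. Proof. by []. Qed.
HB.instance Definition _ := GRing.isLinear.Build R[i] A A *:%R h h_lin.
Let hM a b : h (a ** b) = h a ** h b. Proof. by []. Qed.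
Let h1 : h cone = cone. Proof. by []. Qed.
Let hs a : h (star a) = star (h a). Proof. by []. Qed.
Definition shom_id : starHom A A := StarHom hM h1 hs.
Lemma shom_idE a : shom_id a = a. Proof. by []. Qed.
End Id.

End HomComposition.

Section SubAlgebra.
Context {R : realType} {A : cstarAlgType R}.

Record is_subalg (P : set A) : Prop := IsSubalg {
  subalg1 : P cone;
  subalgD : forall a b, P a -> P b -> P (a + b);
  subalgZ : forall (c : R[i]) a, P a -> P (c *: a);
  subalgM : forall a b, P a -> P b -> P (a ** b);
  subalg_star : forall a, P a -> P (star a);
  subalg_cvs : forall u l, (forall n, P (u n)) -> cvs u l -> P l
}.

Definition subalg_pred (P : set A) (H : is_subalg P) : {pred A} := fun x => `[< P x >].
Arguments subalg_pred : clear implicits.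

Record subalg (P : set A) (H : is_subalg P) := SubAlg {
  subalg_val : A;
  subalg_valP : subalg_val \in subalg_pred P H
}.

Section Instances.
Context (P : set A) (H : is_subalg P).

HB.instance Definition _ := [isSub for @subalg_val P H].
HB.instance Definition _ := [Choice of subalg H by <:].

Lemma subalg_submod_closed : submod_closed (subalg_pred P H).
Proof.
split=> [|c a b /asboolP Pa /asboolP Pb]; apply/asboolP.
  by rewrite -(scale0r cone); apply: (subalgZ H); exact: subalg1.
by apply: (subalgD H) => //; exact: (subalgZ H).
Qed.

HB.instance Definition _ :=
  GRing.isSubmodClosed.Build R[i] A (subalg_pred P H) subalg_submod_closed.
HB.instance Definition _ := [SubChoice_isSubLmodule of subalg H by <:].

Implicit Types x y : subalg H.

Let N x : R := nr (val x).
Let ND x y : N (x + y) <= N x + N y. Proof. exact: nrD. Qed.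
Let NZ (c : R[i]) x : N (c *: x) = cn c * N x. Proof. exact: nrZ. Qed.
Let N_eq0 x : N x = 0 -> x = 0.
Proof. by move=> /eqP; rewrite nr_eq0 => /eqP ?; apply: val_inj. Qed.
Let N_complete (u : nat -> subalg H) :
  (forall e : R, 0 < e -> exists n0, forall m n, (n0 <= m)%N -> (n0 <= n)%N ->
      N (u m - u n) < e) ->
  exists l, forall e : R, 0 < e -> exists n0, forall n, (n0 <= n)%N -> N (u n - l) < e.
Proof.
move=> cu; have [l hl] := @cvs_ex _ _ (fun n => val (u n)) cu.
have Pl : l \in subalg_pred P H.
  apply/asboolP; apply: (subalg_cvs H) hl => n; have := subalg_valP (u n).
  by move/asboolP.
by exists (SubAlg Pl).
Qed.

HB.instance Definition _ :=
  Lmodule_isCompleteNormed.Build R (subalg H) ND NZ N_eq0 N_complete.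

Lemma subalg_mul_subproof x y : val x ** val y \in subalg_pred P H.
Proof.
by apply/asboolP; apply: (subalgM H); apply/asboolP; exact: subalg_valP.
Qed.
Lemma subalg_one_subproof : cone \in subalg_pred P H.
Proof. by apply/asboolP; exact: subalg1. Qed.
Lemma subalg_star_subproof x : star (val x) \in subalg_pred P H.
Proof. by apply/asboolP; apply: (subalg_star H); apply/asboolP; exact: subalg_valP. Qed.

Let mul x y := SubAlg (subalg_mul_subproof x y).
Let one := SubAlg subalg_one_subproof.
Let st x := SubAlg (subalg_star_subproof x).

Let mulA : associative mul. Proof. by move=> x y z; apply: val_inj; exact: cmulA. Qed.
Let mul1l : left_id one mul. Proof. by move=> x; apply: val_inj; exact: cmul1l. Qed.
Let mul1r : right_id one mul. Proof. by move=> x; apply: val_inj; exact: cmul1r. Qed.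
Let mulDl x y z : mul (x + y) z = mul x z + mul y z.
Proof. by apply: val_inj; exact: cmulDl. Qed.
Let mulDr x y z : mul x (y + z) = mul x y + mul x z.
Proof. by apply: val_inj; exact: cmulDr. Qed.
Let mulZl (c : R[i]) x y : mul (c *: x) y = c *: mul x y.
Proof. by apply: val_inj; exact: cmulZl. Qed.
Let mulZr (c : R[i]) x y : mul x (c *: y) = c *: mul x y.
Proof. by apply: val_inj; exact: cmulZr. Qed.
Let stD x y : st (x + y) = st x + st y. Proof. by apply: val_inj; exact: starD. Qed.
Let stZ (c : R[i]) x : st (c *: x) = c^* *: st x.
Proof. by apply: val_inj; exact: starZ. Qed.
Let stM x y : st (mul x y) = mul (st y) (st x). Proof. by apply: val_inj; exact: starM. Qed.
Let stK : involutive st. Proof. by move=> x; apply: val_inj; exact: starK. Qed.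
Let norm_mul x y : `|mul x y| <= `|x| * `|y|.
Proof. by rewrite !nrE -rmorphM lecR; exact: nrM. Qed.
Let norm_star x : `|mul (st x) x| = `|x| ^+ 2.
Proof. by rewrite !nrE -rmorphXn/=; congr (_%:C); exact: nr_starM. Qed.

HB.instance Definition _ := isCStarAlgebra.Build R (subalg H)
  mulA mul1l mul1r mulDl mulDr mulZl mulZr stD stZ stM stK norm_mul norm_star.

Let inc x : A := val x.
Let inc_lin : linear inc. Proof. by []. Qed.
HB.instance Definition _ := GRing.isLinear.Build R[i] (subalg H) A *:%R inc inc_lin.
Let incM x y : inc (x ** y) = inc x ** inc y. Proof. by []. Qed.
Let inc1 : inc cone = cone. Proof. by []. Qed.
Let inc_star x : inc (star x) = star (inc x). Proof. by []. Qed.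
Definition subalg_inc : starHom (subalg H) A := StarHom incM inc1 inc_star.

Section Corestrict.
Context (C : cstarAlgType R) (f : starHom C A).
Hypothesis fP : forall c, P (f c).
Let cor_subproof c : f c \in subalg_pred P H. Proof. by apply/asboolP; exact: fP. Qed.
Let cor c := SubAlg (cor_subproof c).
Let cor_lin : linear cor. Proof. by move=> z a b; apply: val_inj; rewrite /= linearP. Qed.
HB.instance Definition _ := GRing.isLinear.Build R[i] C (subalg H) *:%R cor cor_lin.
Let corM a b : cor (a ** b) = cor a ** cor b.
Proof. by apply: val_inj; exact: shomM. Qed.
Let cor1 : cor cone = cone. Proof. by apply: val_inj; exact: shom1. Qed.
Let cor_star a : cor (star a) = star (cor a).
Proof. by apply: val_inj; exact: shom_star. Qed.
Definition subalg_cor : starHom C (subalg H) := StarHom corM cor1 cor_star.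
End Corestrict.

End Instances.

End SubAlgebra.

Section Generation.
Context {R : realType} {B : cstarAlgType R} {A : bool -> cstarAlgType R}.
Context {iota : forall k, starHom B (A k)} {Af : cstarAlgType R}.
Context {inj : forall k, starHom (A k) Af}.
Hypothesis full : is_full_amalgam iota inj.

Lemma full_amalgam_uniq (D : cstarAlgType R) (g g' : starHom Af D) :
  (forall k a, g (inj k a) = g' (inj k a)) -> g =1 g'.
Proof.
move=> gg' x.
have [|g0 _ h] := full.2 D (fun k => shom_comp g (inj k)).
  by move=> b; rewrite !shom_compE full.1.
by rewrite (h g) ?(h g')// => k a; rewrite shom_compE// gg'.
Qed.

(** The universal property applied to the algebra P yields a homomorphism into P; followed by the
    inclusion it agrees with the identity on both [A k], hence everywhere. *)
Lemma full_amalgam_ind (P : set Af) : is_subalg P ->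
  (forall k a, P (inj k a)) -> forall x, P x.
Proof.
move=> H Pinj x.
pose f k := subalg_cor H (Pinj k).
have [|g hg _] := full.2 _ f.
  by move=> b; apply: val_inj; exact: full.1.
suff <- : shom_comp (subalg_inc H) g x = x.
  by apply/asboolP; exact: (subalg_valP (g x)).
rewrite -[RHS]shom_idE; apply: full_amalgam_uniq => k a.
by rewrite shom_compE hg.
Qed.

End Generation.

(** * Completion of modules with a semi-inner product *)

Record preHilbert (R : realType) (D : cstarAlgType R) (V : lmodType R[i]) := PreHilbert {
  ph_act : V -> D -> V;
  ph_dot : V -> V -> D;
  ph_dotDr : forall x y z, ph_dot x (y + z) = ph_dot x y + ph_dot x z;
  ph_dotZr : forall (c : R[i]) x y, ph_dot x (c *: y) = c *: ph_dot x y;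
  ph_dotMr : forall x y d, ph_dot x (ph_act y d) = ph_dot x y ** d;
  ph_dotC : forall x y, ph_dot y x = star (ph_dot x y);
  ph_dot_pos : forall x, cpos (ph_dot x x)
}.

(* The completion is realised by the functions x |-> <x, z> on V. *)
Section Completion.
Context {R : realType} {D : cstarAlgType R} {V : lmodType R[i]} (P : preHilbert D V).
Implicit Types (x y z : V) (u v w : nat -> V) (g : V -> D).

Let h := ph_dot P.
Let hDr x y z : h x (y + z) = h x y + h x z. Proof. exact: ph_dotDr. Qed.
Let hZr (c : R[i]) x y : h x (c *: y) = c *: h x y. Proof. exact: ph_dotZr. Qed.
Let hMr x y d : h x (ph_act P y d) = h x y ** d. Proof. exact: ph_dotMr. Qed.
Let hC x y : h y x = star (h x y). Proof. exact: ph_dotC. Qed.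
Let hpos x : cpos (h x x). Proof. exact: ph_dot_pos. Qed.
Let hDl := semi_Dl hDr hC.
Let hNr := semi_Nr hZr.
Let hNl := semi_Nl hZr hC.
Let hMl := semi_Ml hMr hC.

Let pn x : R := Num.sqrt (nr (h x x)).
Let pn_ge0 x : 0 <= pn x. Proof. exact: sqrtr_ge0. Qed.
Let pnD x y : pn (x + y) <= pn x + pn y.
Proof. exact: (semi_sqrtD hDr hZr hMr hC hpos). Qed.
Let pnZ (c : R[i]) x : pn (c *: x) = cn c * pn x.
Proof. exact: (semi_sqrtZ hZr hC). Qed.
Let pn_sq x : pn x ^+ 2 = nr (h x x). Proof. by rewrite sqr_sqrtr ?nr_ge0. Qed.

Let CS x y : nr (h x y) <= pn x * pn y.
Proof.
have := semi_CS hDr hZr hMr hC hpos x y.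
by rewrite -!pn_sq -exprMn ler_pXn2r ?nnegrE ?mulr_ge0 ?nr_ge0.
Qed.

Let pnM x d : pn (ph_act P x d) <= pn x * nr d.
Proof.
rewrite -(@ler_pXn2r _ 2) ?nnegrE ?mulr_ge0 ?nr_ge0// pn_sq.
rewrite hMr hMl; apply: le_trans (nrM _ _) _.
have h1 := nrM (star d) (h x x); rewrite nr_star -pn_sq in h1.
by have := nr_ge0 d; nra.
Qed.

Let cau u := forall e : R, 0 < e -> exists N, forall m n, (N <= m)%N -> (N <= n)%N ->
  pn (u m - u n) < e.

Let rep g u := cau u /\ forall x, cvs (fun n => h x (u n)) (g x).

Let cau_bound u : cau u -> exists2 C : R, 0 < C & exists N, forall n, (N <= n)%N -> pn (u n) <= C.
Proof.
move=> cu; have [N hN] := cu 1 ltr01; exists (1 + pn (u N)); first by rewrite ltr_pwDl.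
exists N => n Nn; have := pnD (u n - u N) (u N); rewrite subrK.
have := hN n N Nn (leqnn _); lra.
Qed.

Let cauD u v : cau u -> cau v -> cau (fun n => u n + v n).
Proof.
move=> cu cv e e0; have e2 : 0 < e / 2 by rewrite divr_gt0.
have [N hN] := cu _ e2; have [M hM] := cv _ e2.
exists (maxn N M) => m n; rewrite !geq_max => /andP[Nm Mm] /andP[Nn Mn].
rewrite opprD addrACA; apply: le_lt_trans (pnD _ _) _.
by rewrite (splitr e) ltrD ?hN ?hM.
Qed.

Let cauZ (c : R[i]) u : cau u -> cau (fun n => c *: u n).
Proof.
move=> cu e e0; have c1 : 0 < cn c + 1 by rewrite ltr_pwDr// cn_ge0.
have [N hN] := cu _ (divr_gt0 e0 c1); exists N => m n Nm Nn.
rewrite -scalerBr pnZ; have := hN m n Nm Nn; rewrite ltr_pdivlMr//.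
apply: le_lt_trans; rewrite mulrC ler_wpM2l//; lra.
Qed.

Let pnBM x y d : pn (ph_act P x d - ph_act P y d) = pn (ph_act P (x - y) d).
Proof.
suff E : h (ph_act P x d - ph_act P y d) (ph_act P x d - ph_act P y d) =
   h (ph_act P (x - y) d) (ph_act P (x - y) d) by rewrite /pn E.
rewrite hMr hMl !(hDl, hDr, hNl, hNr) !(hMr, hMl).
rewrite !(cmulDr, cmulDl, cmulNr, cmulNl, cmulA).
by rewrite -?cmulA.
Qed.

Let cauM u d : cau u -> cau (fun n => ph_act P (u n) d).
Proof.
move=> cu e e0; have d1 : 0 < nr d + 1 by rewrite ltr_pwDr// nr_ge0.
have [N hN] := cu _ (divr_gt0 e0 d1); exists N => m n Nm Nn.
rewrite pnBM; apply: le_lt_trans (pnM _ _) _.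
have := hN m n Nm Nn; rewrite ltr_pdivlMr//.
by apply: le_lt_trans; rewrite ler_wpM2l// lerDl.
Qed.

Let cauC x : cau (fun=> x).
Proof.
move=> e e0; exists 0%N => m n _ _; rewrite subrr -(scale0r (0 : V)) pnZ.
by rewrite (_ : cn 0 = 0) ?mul0r//; apply/eqP; rewrite cn_eq0.
Qed.

Let cau_dot u v : cau u -> cau v -> cauchys (fun n => h (u n) (v n)).
Proof.
move=> cu cv e e0.
have [C C0 [N0 hC0]] := cau_bound cu; have [C' C0' [N1 hC1]] := cau_bound cv.
have e1 : 0 < e / (C + C') by rewrite divr_gt0// addr_gt0.
have [N hN] := cu _ e1; have [M hM] := cv _ e1.
exists (maxn (maxn N0 N1) (maxn N M)) => m n.
rewrite !geq_max => /andP[/andP[m0 m1] /andP[m2 m3]] /andP[/andP[n0 n1] /andP[n2 n3]].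
have -> : h (u m) (v m) - h (u n) (v n) = h (u m - u n) (v m) + h (u n) (v m - v n).
  by rewrite hDl hNl hDr hNr addrA subrK.
apply: le_lt_trans (nrD _ _) _.
have a1 := CS (u m - u n) (v m); have a2 := CS (u n) (v m - v n).
have b1 := hN m n m2 n2; have b2 := hM m n m3 n3.
have c1 := hC0 n n0; have c2 := hC1 m m1.
rewrite ltr_pdivlMr ?addr_gt0// in b1; rewrite ltr_pdivlMr ?addr_gt0// in b2.
have p1 := pn_ge0 (u m - u n); have p2 := pn_ge0 (v m - v n).
have q1 : pn (u m - u n) * pn (v m) <= pn (u m - u n) * C' by rewrite ler_wpM2l.
have q2 : pn (u n) * pn (v m - v n) <= C * pn (v m - v n) by rewrite ler_wpM2r.
have E : e = e * C' / (C + C') + e * C / (C + C').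
  by rewrite -mulrDl -mulrDr [C' + C]addrC mulfK// gt_eqF// addr_gt0.
rewrite E; apply: ltrD.
  apply: le_lt_trans a1 _; apply: le_lt_trans q1 _.
  by rewrite mulrAC ltr_pM2r// ltr_pdivlMr// addr_gt0.
apply: le_lt_trans a2 _; apply: le_lt_trans q2 _.
by rewrite mulrAC mulrC ltr_pM2r// ltr_pdivlMr// addr_gt0.
Qed.

(** A Cauchy sequence is determined by its weak limit up to null sequences, which is why functions
    can stand for the points of the completion. One argument of <w n, w n> is frozen at a large
    index. *)
Let null_of_weak w : cau w -> (forall x, cvs (fun n => h x (w n)) 0) ->
  forall e : R, 0 < e -> exists N, forall n, (N <= n)%N -> pn (w n) < e.
Proof.
move=> cw w0 e e0; have [C C0 [N0 hC0]] := cau_bound cw.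
have e2 : 0 < e ^+ 2 / 2 by rewrite divr_gt0// exprn_gt0.
have e1 : 0 < e ^+ 2 / 2 / C by rewrite divr_gt0.
have [N1 h1] := cw _ e1; pose N := maxn N0 N1.
have [N2 h2] := w0 (w N) _ e2; exists (maxn N N2) => n.
rewrite !geq_max => /andP[/andP[n0 n1] n2].
rewrite -(@ltr_pXn2r _ 2) ?nnegrE// ?ltW// pn_sq.
have -> : h (w n) (w n) = h (w n - w N) (w n) + h (w N) (w n).
  by rewrite hDl hNl subrK.
apply: le_lt_trans (nrD _ _) _; rewrite (splitr (e ^+ 2)); apply: ltr_leD; last first.
  by have := h2 n n2; rewrite subr0; exact: ltW.
apply: le_lt_trans (CS _ _) _; have := h1 n N n1 (leq_maxr _ _).
rewrite ltr_pdivlMr//; apply: le_lt_trans; rewrite ler_wpM2l//; exact: hC0.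
Qed.

Let rep_dist g u v : rep g u -> rep g v ->
  forall e : R, 0 < e -> exists N, forall n, (N <= n)%N -> pn (u n - v n) < e.
Proof.
move=> [cu ug] [cv vg]; apply: null_of_weak.
  apply: cauD => //.
  by have := cauZ (-1) cv; congr cau; apply/funext => n; rewrite scaleN1r.
move=> x; rewrite -(subrr (g x)).
rewrite (_ : (fun n => _) = (fun n => h x (u n) + - h x (v n))); last first.
  by apply/funext => n; rewrite hDr hNr.
apply: cvsD => //; apply: (@cvs_lip _ _ _ -%R 1) (vg x) => a b.
by rewrite mul1r -opprD nrN.
Qed.

Let repD g g' u u' : rep g u -> rep g' u' -> rep (g + g') (fun n => u n + u' n).
Proof.
move=> [cu ug] [cu' ug']; split; first exact: cauD.
move=> x; rewrite (_ : (fun n => _) = (fun n => h x (u n) + h x (u' n))); last first.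
  by apply/funext => n; rewrite hDr.
exact: cvsD.
Qed.

Let repZ (c : R[i]) g u : rep g u -> rep (c *: g) (fun n => c *: u n).
Proof.
move=> [cu ug]; split; first exact: cauZ.
move=> x; rewrite (_ : (fun n => _) = (fun n => c *: h x (u n))); last first.
  by apply/funext => n; rewrite hZr.
by apply: (@cvs_lip _ _ _ ( *:%R c) (cn c)) (ug x) => a b; rewrite -scalerBr nrZ.
Qed.

Let repM g u d : rep g u -> rep (fun x => g x ** d) (fun n => ph_act P (u n) d).
Proof.
move=> [cu ug]; split; first exact: cauM.
move=> x; rewrite (_ : (fun n => _) = (fun n => h x (u n) ** d)); last first.
  by apply/funext => n; rewrite hMr.
exact: cvs_mulr.
Qed.

Let rep_cst x : rep (fun y => h y x) (fun=> x).
Proof. by split; [exact: cauC|move=> y; exact: cvs_cst]. Qed.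

Definition compl_pred : {pred (V -> D)} := fun g => `[< exists u, rep g u >].

Record compl := Compl { compl_fun : V -> D; compl_funP : compl_fun \in compl_pred }.

HB.instance Definition _ := [isSub for compl_fun].
HB.instance Definition _ := [Choice of compl by <:].

Lemma compl_submod_closed : submod_closed compl_pred.
Proof.
split=> [|c g g' /asboolP[u ug] /asboolP[u' ug']]; apply/asboolP; last first.
  by exists (fun n => c *: u n + u' n); apply: repD => //; exact: repZ.
exists (fun=> 0); have [c0 r0] := rep_cst 0; split=> // x.
have -> : (0 : V -> D) x = h x 0 by rewrite -[in RHS](scale0r 0) hZr scale0r.
exact: r0.
Qed.

HB.instance Definition _ :=
  GRing.isSubmodClosed.Build R[i] (V -> D) compl_pred compl_submod_closed.
HB.instance Definition _ := [SubChoice_isSubLmodule of compl by <:].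

Implicit Types a b c : compl.

Let rp a : nat -> V := projT1 (cid (asboolP _ (compl_funP a))).
Let rpP a : rep (compl_fun a) (rp a).
Proof. by rewrite /rp; case: cid. Qed.

Let dot a b : D := projT1 (cid (cvs_ex (cau_dot (rpP a).1 (rpP b).1))).

Let dotP a b u v : rep (compl_fun a) u -> rep (compl_fun b) v ->
  cvs (fun n => h (u n) (v n)) (dot a b).
Proof.
move=> ua vb; rewrite /dot; case: cid => l /= hl e e0.
have [C C0 [N0 hC0]] := cau_bound ua.1.
have [C' C0' [N1 hC1]] := cau_bound (rpP b).1.
have e3 : 0 < e / 3 by rewrite divr_gt0.
have [N2 hN2] := rep_dist ua (rpP a) (divr_gt0 e3 C0').
have [N3 hN3] := rep_dist vb (rpP b) (divr_gt0 e3 C0).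
have [N4 hN4] := hl _ e3.
exists (maxn (maxn N0 N1) (maxn (maxn N2 N3) N4)) => n.
rewrite !geq_max => /andP[/andP[n0 n1] /andP[/andP[n2 n3] n4]].
have -> : h (u n) (v n) - l = h (u n) (v n - rp b n) + (h (u n - rp a n) (rp b n)
     + (h (rp a n) (rp b n) - l)).
  by rewrite hDr hNr hDl hNl !addrA !subrK.
apply: le_lt_trans (nrD _ _) _.
have E : e = e / 3 + (e / 3 + e / 3) by field.
rewrite E; apply: ltrD.
  apply: le_lt_trans (CS _ _) _; have := hN3 n n3; rewrite ltr_pdivlMr//.
  by apply: le_lt_trans; rewrite mulrC ler_wpM2l// hC0.
apply: le_lt_trans (nrD _ _) _; apply: ltrD; last exact: hN4.
apply: le_lt_trans (CS _ _) _; have := hN2 n n2; rewrite ltr_pdivlMr//.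
by apply: le_lt_trans; rewrite ler_wpM2l// hC1.
Qed.

Let act_subproof a d : (fun x => compl_fun a x ** d) \in compl_pred.
Proof. by apply/asboolP; exists (fun n => ph_act P (rp a n) d); exact: repM. Qed.
Let act a d := Compl (act_subproof a d).

Let actDl a b d : act (a + b) d = act a d + act b d.
Proof. by apply: val_inj; apply/funext => x; exact: cmulDl. Qed.
Let actDr a d d' : act a (d + d') = act a d + act a d'.
Proof. by apply: val_inj; apply/funext => x; exact: cmulDr. Qed.
Let actZl (c : R[i]) a d : act (c *: a) d = c *: act a d.
Proof. by apply: val_inj; apply/funext => x; exact: cmulZl. Qed.
Let actZr (c : R[i]) a d : act a (c *: d) = c *: act a d.
Proof. by apply: val_inj; apply/funext => x; exact: cmulZr. Qed.
Let actM a d d' : act a (d ** d') = act (act a d) d'.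
Proof. by apply: val_inj; apply/funext => x; exact: cmulA. Qed.
Let act1 a : act a cone = a.
Proof. by apply: val_inj; apply/funext => x; exact: cmul1r. Qed.

Let dotDr a b c : dot a (b + c) = dot a b + dot a c.
Proof.
have r : rep (compl_fun (b + c)) _ := repD (rpP b) (rpP c).
apply: (cvs_uniq (dotP (rpP a) r)).
rewrite (_ : (fun n => _) = (fun n => h (rp a n) (rp b n) + h (rp a n) (rp c n))).
  by apply: cvsD; exact: dotP.
by apply/funext => n; rewrite hDr.
Qed.

Let dotZr (z : R[i]) a b : dot a (z *: b) = z *: dot a b.
Proof.
have r : rep (compl_fun (z *: b)) _ := repZ z (rpP b).
apply: (cvs_uniq (dotP (rpP a) r)).
rewrite (_ : (fun n => _) = (fun n => z *: h (rp a n) (rp b n))).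
  apply: (@cvs_lip _ _ _ ( *:%R z) (cn z)) (dotP (rpP a) (rpP b)) => x y.
  by rewrite -scalerBr nrZ.
by apply/funext => n; rewrite hZr.
Qed.

Let dotMr a b d : dot a (act b d) = dot a b ** d.
Proof.
have r : rep (compl_fun (act b d)) _ := repM d (rpP b).
apply: (cvs_uniq (dotP (rpP a) r)).
rewrite (_ : (fun n => _) = (fun n => h (rp a n) (rp b n) ** d)).
  exact: (cvs_mulr _ (dotP (rpP a) (rpP b))).
by apply/funext => n; rewrite hMr.
Qed.

Let dotC a b : dot b a = star (dot a b).
Proof.
apply: (cvs_uniq (dotP (rpP b) (rpP a))).
rewrite (_ : (fun n => _) = (fun n => star (h (rp a n) (rp b n)))).
  exact: (cvs_star (dotP (rpP a) (rpP b))).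
by apply/funext => n; rewrite hC.
Qed.

Let dot_pos a : cpos (dot a a).
Proof. by apply: cpos_cvs (dotP (rpP a) (rpP a)) => n; exact: hpos. Qed.

Let dot_eq0 a : dot a a = 0 -> a = 0.
Proof.
move=> a0; apply: val_inj; apply/funext => x /=.
have [ca ra] := rpP a; apply: (cvs_uniq (ra x)) => e e0.
have := dotP (rpP a) (rpP a); rewrite a0 => da.
have x1 : 0 < pn x + 1 by rewrite ltr_pwDr.
have [N hN] := da ((e / (pn x + 1)) ^+ 2) (exprn_gt0 _ (divr_gt0 e0 x1)).
exists N => n /hN; rewrite !subr0 -pn_sq ltr_pXn2r ?nnegrE// ?ltW ?divr_gt0//.
rewrite ltr_pdivlMr// => H; apply: le_lt_trans (CS _ _) _.
apply: le_lt_trans H; rewrite mulrC ler_wpM2l// lerDl//.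
Qed.

Let emb_subproof x : (fun y => h y x) \in compl_pred.
Proof. by apply/asboolP; exists (fun=> x); exact: rep_cst. Qed.
Let emb x := Compl (emb_subproof x).

Let dot_emb x y : dot (emb x) (emb y) = h x y.
Proof.
by apply: (cvs_uniq (dotP (a := emb x) (b := emb y) (rep_cst x) (rep_cst y))); exact: cvs_cst.
Qed.

Let cN a : R := Num.sqrt (nr (dot a a)).
Let cND a b : cN (a + b) <= cN a + cN b.
Proof. exact: (semi_sqrtD dotDr dotZr dotMr dotC dot_pos). Qed.
Let cNN a : cN (- a) = cN a.
Proof. by rewrite -scaleN1r /cN (semi_sqrtZ dotZr dotC) cnN1 mul1r. Qed.
Let cNC a b : cN (a - b) = cN (b - a). Proof. by rewrite -cNN opprB. Qed.
Let cN_lt a (e : R) : 0 < e -> (nr (dot a a) < e ^+ 2) = (cN a < e).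
Proof.
by move=> e0; rewrite -[RHS](@ltr_pXn2r _ 2)// ?nnegrE ?sqrtr_ge0 ?ltW// sqr_sqrtr// nr_ge0.
Qed.

Let emb_dense_rep a u : rep (compl_fun a) u -> forall e : R, 0 < e ->
  exists N, forall n, (N <= n)%N -> cN (a - emb (u n)) <= e.
Proof.
move=> ua e e0; have [N hN] := ua.1 _ e0; exists N => m Nm.
rewrite -(@ler_pXn2r _ 2)// ?nnegrE ?sqrtr_ge0 ?(ltW e0)// sqr_sqrtr ?nr_ge0//.
have r1 : rep (compl_fun (a - emb (u m))) (fun n => u n - u m).
  have := repD ua (repZ (-1) (rep_cst (u m))).
  congr rep; last by apply/funext => n; rewrite scaleN1r.
  by apply/funext => x; rewrite /= scaleN1r.
apply: (cvs_le (dotP r1 r1)); exists N => n Nn.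
by rewrite -pn_sq ler_pXn2r ?nnegrE ?(ltW e0)//; apply/ltW/hN.
Qed.

Let emb_dense a (e : R) : 0 < e -> exists x, cN (a - emb x) <= e.
Proof.
move=> /(emb_dense_rep (rpP a))[N hN]; exists (rp a N); exact: hN.
Qed.

Let embB x y : emb (x - y) = emb x - emb y.
Proof. by apply: val_inj; apply/funext => z /=; rewrite hDr hNr. Qed.

Let cN_emb x : cN (emb x) = pn x. Proof. by rewrite /cN dot_emb. Qed.

Let dot_complete (u : nat -> compl) :
  (forall e : R, 0 < e -> exists N, forall m n, (N <= m)%N -> (N <= n)%N ->
      nr (dot (u m - u n) (u m - u n)) < e) ->
  exists l, forall e : R, 0 < e -> exists N, forall n, (N <= n)%N ->
      nr (dot (u n - l) (u n - l)) < e.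
Proof.
move=> cu; have /choice[v hv] : forall n : nat, exists x, cN (u n - emb x) <= n.+1%:R^-1.
  by move=> n; apply: emb_dense; rewrite invr_gt0.
have cv : cau v.
  move=> e e0; have e3 : 0 < e / 3 by rewrite divr_gt0.
  have [N hN] := cu _ (exprn_gt0 2 e3); have [M hM] := inv_succ_lt e3.
  exists (maxn N M) => m n; rewrite !geq_max => /andP[m1 m2] /andP[n1 n2].
  rewrite -cN_emb embB.
  have -> : emb (v m) - emb (v n) = (emb (v m) - u m) + ((u m - u n) + (u n - emb (v n))).
    by rewrite !addrA !subrK.
  have E : e = e / 3 + (e / 3 + e / 3) by field.
  apply: le_lt_trans (cND _ _) _; rewrite E; apply: ltrD.
    by rewrite cNC; apply: le_lt_trans (hv m) _; exact: hM.
  apply: le_lt_trans (cND _ _) _; apply: ltrD; first by rewrite -cN_lt// hN.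
  by apply: le_lt_trans (hv n) _; exact: hM.
have cx x : exists l, cvs (fun n => h x (v n)) l.
  by apply: cvs_ex; apply: (cau_dot (u := fun=> x) (cauC x) cv).
have /choice[g hg] := cx.
have gP : g \in compl_pred by apply/asboolP; exists v.
exists (Compl gP) => e e0; have s0 : 0 < Num.sqrt e by rewrite sqrtr_gt0.
have s2 : 0 < Num.sqrt e / 2 by rewrite divr_gt0.
have [N hN] := emb_dense_rep (a := Compl gP) (conj cv hg) s2.
have [M hM] := inv_succ_lt s2; exists (maxn N M) => n.
rewrite geq_max => /andP[/hN h1 /hM h2].
rewrite -[e]sqr_sqrtr ?ltW// cN_lt//.
have -> : u n - Compl gP = (u n - emb (v n)) + (emb (v n) - Compl gP).
  by rewrite addrA subrK.
apply: le_lt_trans (cND _ _) _; rewrite (splitr (Num.sqrt e)); apply: ltr_leD.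
  exact: le_lt_trans (hv n) h2.
by rewrite cNC.
Qed.

HB.instance Definition _ := Lmodule_isHilbert.Build R D compl
  actDl actDr actZl actZr actM act1 dotDr dotZr dotMr dotC dot_pos dot_eq0 dot_complete.

Definition compl_emb x : compl := emb x.

Lemma hdot_compl x y : hdot (compl_emb x) (compl_emb y) = ph_dot P x y.
Proof. exact: dot_emb. Qed.

Lemma compl_embD x y : compl_emb (x + y) = compl_emb x + compl_emb y.
Proof. by apply: val_inj; apply/funext => z /=; rewrite /h ph_dotDr. Qed.

Lemma compl_embZ (c : R[i]) x : compl_emb (c *: x) = c *: compl_emb x.
Proof. by apply: val_inj; apply/funext => z /=; rewrite /h ph_dotZr. Qed.

Lemma compl_embM x d : compl_emb (ph_act P x d) = ract (compl_emb x) d.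
Proof. by apply: val_inj; apply/funext => z /=; rewrite /h ph_dotMr. Qed.

Lemma compl_dense a (e : R) : 0 < e -> exists x, nr (a - compl_emb x) < e.
Proof.
move=> e0; have e2 : 0 < e / 2 by rewrite divr_gt0.
have [x hx] := emb_dense a e2; exists x.
have -> : nr (a - compl_emb x) = cN (a - emb x).
  rewrite -[LHS]ger0_norm ?nr_ge0// -sqrtr_sqr -nr_hdot //.
by apply: le_lt_trans hx _; rewrite ltr_pdivrMr// mulr_natr mulr2n ltrDl.
Qed.

End Completion.

(** * Modules defined by positive kernels *)

Section TotalFamilies.
Context {R : realType} {D : cstarAlgType R}.

Definition fsum (X : Type) (E : hilbertModType D) (e : X -> E) (s : seq (X * D)) : E :=
  \sum_(p <- s) ract (e p.1) p.2.

Definition fopp (X : Type) (s : seq (X * D)) : seq (X * D) :=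
  [seq (p.1, - p.2) | p <- s].

Definition total (X : Type) (E : hilbertModType D) (e : X -> E) : Prop :=
  forall xi (eps : R), 0 < eps -> exists s, nr (xi - fsum e s) < eps.

Section Basics.
Context {X : Type} {E : hilbertModType D} (e : X -> E).

Lemma fsum_cat s t : fsum e (s ++ t) = fsum e s + fsum e t.
Proof. by rewrite /fsum big_cat. Qed.

Lemma fsum_opp s : fsum e (fopp s) = - fsum e s.
Proof.
by rewrite /fsum big_map (big_morph _ (@opprD E) (@oppr0 E)); apply: eq_bigr => p _; rewrite ractNr.
Qed.

Lemma fsum1 x d : fsum e [:: (x, d)] = ract (e x) d.
Proof. by rewrite /fsum big_seq1. Qed.

Lemma fsum_unit x : fsum e [:: (x, cone)] = e x.
Proof. by rewrite fsum1 ract1. Qed.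

Lemma hdot_fsumr xi s : hdot xi (fsum e s) = \sum_(p <- s) hdot xi (e p.1) ** p.2.
Proof. by rewrite /fsum hdot_sumr; apply: eq_bigr => p _; rewrite hdotMr. Qed.

Lemma hdot_fsuml xi s : hdot (fsum e s) xi = \sum_(p <- s) star p.2 ** hdot (e p.1) xi.
Proof. by rewrite /fsum hdot_suml; apply: eq_bigr => p _; rewrite hdotMl. Qed.

Lemma clspan_total : clspan [set z | exists x d, z = ract (e x) d] = setT -> total e.
Proof.
move=> cl xi eps eps0; have : clspan [set z | exists x d, z = ract (e x) d] xi.
  by rewrite cl.
move=> /closureP/(_ _ eps0)[y [n [c [f [fX ->]]]]] h.
have /choice[g fg] : forall i, exists p : X * D, f i = ract (e p.1) p.2.
  by move=> i; have [x [d ->]] := fX i; exists (x, d).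
exists [seq ((g i).1, c i *: (g i).2) | i <- enum 'I_n].
rewrite /fsum big_map big_enum/=.
rewrite (eq_bigr (fun i => c i *: f i))// => i _; by rewrite ractZr -fg.
Qed.

Lemma total_seq xi : total e -> exists s : nat -> seq (X * D), cvs (fun n => fsum e (s n)) xi.
Proof.
move=> te; have /choice[s hs] : forall n : nat, exists s, nr (xi - fsum e s) < n.+1%:R^-1.
  by move=> n; apply: te; rewrite invr_gt0.
exists s => eps eps0; have [N hN] := inv_succ_lt eps0.
by exists N => n /hN; apply: lt_trans; rewrite nr_dist.
Qed.

Lemma total_clspan : total e -> clspan [set z | exists x d, z = ract (e x) d] = setT.
Proof.
move=> te; rewrite -subTset => xi _; have [s hs] := total_seq xi te.
apply: clspan_cvs hs => n; rewrite /fsum.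
elim/big_ind: _ => [|x y|p _]; [exact: clspan0|exact: clspanD|].
by apply: sub_clspan; exists p.1, p.2.
Qed.

Lemma total_ext xi eta : total e -> (forall x, hdot (e x) xi = hdot (e x) eta) -> xi = eta.
Proof.
move=> te h; apply: hdot_ext => z; have [s hs] := total_seq z te.
apply: (cvs_uniq (cvs_hdotl xi hs)).
rewrite (_ : (fun n => _) = (fun n => hdot (fsum e (s n)) eta)); first exact: cvs_hdotl.
by apply/funext => n; rewrite !hdot_fsuml; apply: eq_bigr => p _; rewrite h.
Qed.

(** G is given on formal sums; by the bound, applied to differences, it depends only on the vector
    that a sum represents. *)
Lemma extend_total (V : completeNormedModType R[i]) (G : seq (X * D) -> V) (C : R) :
  total e -> (forall s t, G (s ++ t) = G s + G t) -> (forall s, G (fopp s) = - G s) ->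
  (forall s, nr (G s) <= C * nr (fsum e s)) ->
  exists T : E -> V, (forall s, T (fsum e s) = G s) /\
    (forall x y, nr (T x - T y) <= C * nr (x - y)).
Proof.
move=> te GD GN GC.
have GB s t : nr (G s - G t) <= C * nr (fsum e s - fsum e t).
  by rewrite -GN -GD -fsum_opp -fsum_cat.
have lim xi : exists l, forall s, cvs (fun n => fsum e (s n)) xi -> cvs (fun n => G (s n)) l.
  have [s hs] := total_seq xi te.
  have C1 : 0 < `|C| + 1 by rewrite ltr_pwDr.
  have CB s' t : nr (G s' - G t) <= (`|C| + 1) * nr (fsum e s' - fsum e t).
    apply: le_trans (GB s' t) _; rewrite ler_wpM2r ?nr_ge0//.
    by have := ler_norm C; lra.
  have [|l hl] := @cvs_ex _ _ (fun n => G (s n)).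
    move=> eps eps0; have [N hN] := cvs_cauchy hs (divr_gt0 eps0 C1).
    exists N => m n Nm Nn; apply: le_lt_trans (CB _ _) _.
    by rewrite mulrC -ltr_pdivlMr// hN.
  exists l => t ht eps eps0.
  have e2 : 0 < eps / 2 by rewrite divr_gt0.
  have e3 : 0 < eps / 2 / (`|C| + 1) / 2 by rewrite !divr_gt0.
  have [N1 h1] := hl _ e2; have [N2 h2] := hs _ e3; have [N3 h3] := ht _ e3.
  exists (maxn N1 (maxn N2 N3)) => n; rewrite !geq_max => /andP[/h1 a1 /andP[/h2 a2 /h3 a3]].
  apply: le_lt_trans (nr_tri _ (G (s n)) _) _; rewrite (splitr eps) ltrD//.
  apply: le_lt_trans (CB _ _) _; rewrite mulrC -ltr_pdivlMr//.
  apply: le_lt_trans (nr_tri _ xi _) _; rewrite (nr_dist xi).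
  by rewrite [ltRHS]splitr ltrD.
have /choice[T hT] := lim; exists T; split=> [s|x y].
  by apply: (cvs_uniq _ (cvs_cst (G s))); apply: (hT _ (fun=> s)); exact: cvs_cst.
have [s hs] := total_seq x te; have [t ht] := total_seq y te.
have cB (V' : normedModType R[i]) (u v : nat -> V') a b : cvs u a -> cvs v b ->
    cvs (fun n => u n - v n) (a - b).
  move=> ua vb; apply: cvsD => //; apply: (@cvs_lip _ _ _ -%R 1) vb => a' b'.
  by rewrite mul1r -opprD nrN.
have dxy := cB _ _ _ _ _ hs ht; have dT := cB _ _ _ _ _ (hT _ _ hs) (hT _ _ ht).
(* A negative [C] is possible only if all sums [fsum e s] coincide, and then so do x and y. *)
have [C0|C0] := leP 0 C; last first.
  apply: (cvs_le dT); exists 0%N => n _.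
  have st0 : fsum e (s n) - fsum e (t n) = 0.
    by apply: nr_le0; have := GB (s n) (t n); have := nr_ge0 (G (s n) - G (t n)); nra.
  have E0 : x - y = 0.
    have := cB _ _ _ _ _ hs ht; rewrite (_ : (fun n => _) = fun=> 0).
      by move=> /cvs_uniq; apply; exact: cvs_cst.
    apply/funext => m; apply: nr_le0; have := GB (s m) (t m).
    by have := nr_ge0 (G (s m) - G (t m)); nra.
  by apply: le_trans (GB _ _) _; rewrite st0 E0 !nr0 mulr0.
apply/ler_addgt0Pr => eps eps0.
have C1 : 0 < C + 1 by rewrite ltr_pwDr.
have [N hN] := dxy _ (divr_gt0 eps0 C1).
apply: (cvs_le dT); exists N => n /hN; rewrite ltr_pdivlMr// => h.
apply: le_trans (GB _ _) _.
have := nrD (x - y) (fsum e (s n) - fsum e (t n) - (x - y)).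
rewrite addrC subrK; set a := nr _ ; set b := nr (x - y) => h'.
set c := nr _ in h h'.
have c0 : 0 <= c := nr_ge0 _.
nra.
Qed.

End Basics.

(** A bound for [T0] is enough: that of [S0] follows by pairing y = [fsum S0 t] with sums of [e]
    that converge to y. *)
Lemma extend_adjointable (X Y : Type) (E F : hilbertModType D) (e : X -> E) (f : Y -> F)
    (T0 : X -> F) (S0 : Y -> E) (C : R) : 0 <= C -> total e -> total f ->
  (forall x y, hdot (T0 x) (f y) = hdot (e x) (S0 y)) ->
  (forall s, nr (fsum T0 s) <= C * nr (fsum e s)) ->
  exists T S, [/\ adjoint_pair T S, (forall x, T (e x) = T0 x), (forall y, S (f y) = S0 y)
    & forall x, nr (T x) <= C * nr x].
Proof.
move=> C0 te tf TS TC.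
have fTS s t : hdot (fsum T0 s) (fsum f t) = hdot (fsum e s) (fsum S0 t).
  rewrite !hdot_fsuml; apply: eq_bigr => p _; congr (_ ** _).
  by rewrite !hdot_fsumr; apply: eq_bigr => q _; rewrite TS.
have SC t : nr (fsum S0 t) <= C * nr (fsum f t).
  set y := fsum S0 t; have [y0|y0] := leP (nr y) 0.
    by apply: le_trans y0 _; rewrite mulr_ge0 ?nr_ge0.
  have [s hs] := total_seq y te.
  suff : nr (hdot y y) <= C * nr y * nr (fsum f t).
    by rewrite nr_hdot expr2 mulrAC -[X in _ <= X]mulrC ler_pM2l.
  apply/ler_addgt0Pr => eps eps0.
  have c1 : 0 < C * nr (fsum f t) + 1 by rewrite ltr_pwDr// mulr_ge0 ?nr_ge0.
  have [N hN] := hs _ (divr_gt0 eps0 c1).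
  apply: (cvs_le (cvs_hdotl y hs)); exists N => n /hN; rewrite ltr_pdivlMr// => h.
  rewrite /y -fTS; apply: le_trans (hdot_CS _ _) _.
  have a1 := TC (s n); have a2 := nrD y (fsum e (s n) - y); rewrite addrC subrK in a2.
  have a3 := nr_ge0 (fsum f t).
  have b1 : nr (fsum T0 (s n)) * nr (fsum f t) <= C * nr (fsum e (s n)) * nr (fsum f t).
    by rewrite ler_wpM2r.
  have a4 := nr_ge0 (fsum e (s n) - y).
  have b2 : C * nr (fsum f t) * nr (fsum e (s n)) <=
     C * nr (fsum f t) * (nr y + nr (fsum e (s n) - y)) by rewrite ler_wpM2l ?mulr_ge0.
  nra.
have [T [Te TL]] := extend_total te (fsum_cat T0) (fsum_opp T0) TC.
have [S [Sf SL]] := extend_total tf (fsum_cat S0) (fsum_opp S0) SC.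
exists T, S; split=> [x y|x|y|x].
- have [s hs] := total_seq x te; have [t ht] := total_seq y tf.
  have hT : cvs (fun n => fsum T0 (s n)) (T x).
    by have := cvs_lip TL hs; congr cvs; apply/funext => n /=; rewrite Te.
  have hS : cvs (fun n => fsum S0 (t n)) (S y).
    by have := cvs_lip SL ht; congr cvs; apply/funext => n /=; rewrite Sf.
  have h t' : hdot (T x) (fsum f t') = hdot x (fsum S0 t').
    apply: (cvs_uniq (cvs_hdotl _ hT)); have := cvs_hdotl (fsum S0 t') hs.
    by congr cvs; apply/funext => n; rewrite fTS.
  apply: (cvs_uniq (cvs_hdotr _ ht)); have := cvs_hdotr x hS.
  by congr cvs; apply/funext => n; rewrite h.
- by rewrite -[in LHS](fsum_unit e) Te fsum_unit.
- by rewrite -[in LHS](fsum_unit f) Sf fsum_unit.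
have := TL x (fsum e [::]); rewrite Te /fsum !big_nil !subr0; exact.
Qed.

Section Actions.
Context {A : cstarAlgType R} {X : Type} {E : hilbertModType D} (e : X -> E).
Variable m : A -> X -> X.
Hypothesis te : total e.
Hypothesis mM : forall a b x, e (m (a ** b) x) = e (m a (m b x)).
Hypothesis mL : forall (c : R[i]) a b x, e (m (c *: a + b) x) = c *: e (m a x) + e (m b x).
Hypothesis m1 : forall x, e (m cone x) = e x.
Hypothesis madj : forall a x y, hdot (e (m a x)) (e y) = hdot (e x) (e (m (star a) y)).

Let em a s := fsum (fun x => e (m a x)) s.

Let emL (c : R[i]) a b s : em (c *: a + b) s = c *: em a s + em b s.
Proof.
rewrite /em /fsum scaler_sumr -big_split; apply: eq_bigr => p _ /=.
by rewrite mL ractDl ractZl.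
Qed.

Let emD a b s : em (a + b) s = em a s + em b s.
Proof. by rewrite -[a]scale1r emL !scale1r. Qed.

Let emdot a s t : hdot (em a s) (em a t) = hdot (em cone s) (em (star a ** a) t).
Proof.
rewrite !hdot_fsuml; apply: eq_bigr => p _; congr (_ ** _).
rewrite !hdot_fsumr; apply: eq_bigr => q _; congr (_ ** _).
by rewrite madj mM m1.
Qed.

Let em1 s : em cone s = fsum e s.
Proof. by rewrite /em /fsum; apply: eq_bigr => p _; rewrite m1. Qed.

(** With b the defect of a, <a s, a s> + <b s, b s> = |a|^2 <s, s>; no boundedness of the individual
    maps [m a] is presupposed. *)
Lemma action_bound a s : nr (fsum (fun x => e (m a x)) s) <= nr a * nr (fsum e s).
Proof.
have [b bb] := defect (lexx (nr a)).
apply: nr_le_sq; first by rewrite mulr_ge0 ?nr_ge0.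
rewrite -/(em a s) exprMn -nr_hdot.
apply: (le_trans (nr_cposD (hdot_pos (em a s)) (hdot_pos (em b s)))).
rewrite !emdot -hdotDr -emD bb addrC subrK /rsc -[_ *: cone]addr0 emL.
rewrite [em 0 s](_ : _ = 0) ?addr0; last first.
  by apply: (addrI (em 0 s)); rewrite -emD !addr0.
by rewrite hdotZr nrZR ger0_norm ?sqr_ge0// em1.
Qed.

Lemma action_extends : exists phi : A -> E -> E,
  unital_rep phi /\ forall a x, phi a (e x) = e (m a x).
Proof.
have /choice[phi hphi] : forall a, exists T : E -> E, exists S, adjoint_pair T S /\
   (forall x, T (e x) = e (m a x)) /\ forall x, S (e x) = e (m (star a) x).
  move=> a; have [T [S [TS hT hS _]]] :=
    extend_adjointable (nr_ge0 a) te te (madj a) (action_bound a).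
  by exists T, S.
have pe a x : phi a (e x) = e (m a x) by have [S [_ [-> _]]] := hphi a.
have eq_adj (T T' S S' : E -> E) : adjoint_pair T S -> adjoint_pair T' S' ->
    (forall x, S (e x) = S' (e x)) -> T =1 T'.
  move=> TS TS' SS x; apply: (total_ext te) => y.
  by rewrite -(adjoint_sym TS) -(adjoint_sym TS') SS.
have padj a : adjoint_pair (phi a) (phi (star a)).
  have [S [h [_ hS]]] := hphi a; have [S' [h' [_ hS']]] := hphi (star a).
  move=> x y; rewrite h; congr hdot.
  apply: (eq_adj _ _ _ _ (adjoint_sym h) h' _ y) => z.
  by rewrite pe hS' starK.
exists phi; split=> //; split; last first.
  by apply: eq_adj (padj cone) (@adjoint_id _ _ E) _ => z; rewrite pe star1 m1.
split=> [c a b x|a b x|//].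
  have h : adjoint_pair (fun x => c *: phi a x + phi b x)
     (fun y => c^* *: phi (star a) y + phi (star b) y).
    by move=> y z; rewrite hdotDl hdotZl hdotDr hdotZr !padj.
  apply: (eq_adj _ _ _ _ (padj _) h _ x) => z.
  by rewrite !pe starD starZ mL.
have h : adjoint_pair (phi a \o phi b) (phi (star b) \o phi (star a)).
  by apply: adjoint_comp; exact: padj.
by apply: (eq_adj _ _ _ _ (padj _) h _ x) => z /=; rewrite !pe starM mM.
Qed.

End Actions.

End TotalFamilies.

Record kernel (R : realType) (D : cstarAlgType R) (X : Type) := Kernel {
  kfun :> X -> X -> D;
  kfunC : forall x y, kfun y x = star (kfun x y);
  kfun_pos : forall s : seq (X * D),
    cpos (\sum_(p <- s) \sum_(q <- s) star p.2 ** kfun p.1 q.1 ** q.2)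
}.

Section Kolmogorov.
Context {R : realType} {D : cstarAlgType R} {X : Type} (k : kernel D X).
Implicit Types (s t : seq (X * D)).

Let ev s : X -> D := fun x => \sum_(p <- s) k x p.1 ** p.2.
Let lf s (g : X -> D) : D := \sum_(p <- s) star p.2 ** g p.1.

(** The symmetry of the form. It yields [dotC] below and shows, in [hdot_kemb], that the inner
    product does not depend on the formal sum chosen for its first argument. *)
Let lf_ev s t : lf s (ev t) = star (lf t (ev s)).
Proof.
rewrite /lf /ev star_sum.
under eq_bigr do rewrite cmul_sumr.
under [RHS]eq_bigr do rewrite cmul_sumr star_sum.
rewrite exchange_big; apply: eq_bigr => p _; apply: eq_bigr => q _ /=.
by rewrite !starM starK -kfunC cmulA.
Qed.

Definition prek_pred : {pred (X -> D)} := fun g => `[< exists s, g = ev s >].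
Record prek := Prek { prek_fun : X -> D; prek_funP : prek_fun \in prek_pred }.
HB.instance Definition _ := [isSub for prek_fun].
HB.instance Definition _ := [Choice of prek by <:].

Lemma prek_submod_closed : submod_closed prek_pred.
Proof.
split=> [|c g g' /asboolP[s ->] /asboolP[t ->]]; apply/asboolP.
  by exists [::]; apply/funext => x; rewrite /ev big_nil.
exists ([seq (p.1, c *: p.2) | p <- s] ++ t); apply/funext => x.
rewrite -[LHS]/(c *: ev s x + ev t x) /ev big_cat big_map /= scaler_sumr; congr (_ + _).
by apply: eq_bigr => p _; rewrite cmulZr.
Qed.

HB.instance Definition _ :=
  GRing.isSubmodClosed.Build R[i] (X -> D) prek_pred prek_submod_closed.
HB.instance Definition _ := [SubChoice_isSubLmodule of prek by <:].

Let sq (g : prek) : seq (X * D) := projT1 (cid (asboolP _ (prek_funP g))).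
Let sqE (g : prek) : prek_fun g = ev (sq g). Proof. by rewrite /sq; case: cid. Qed.

Let dot (g g' : prek) : D := lf (sq g) (prek_fun g').

Let dotC g g' : dot g' g = star (dot g g').
Proof. by rewrite /dot !sqE lf_ev. Qed.
Let dotDr (g g' g'' : prek) : dot g (g' + g'') = dot g g' + dot g g''.
Proof.
by rewrite /dot /lf -big_split; apply: eq_bigr => p _; exact: cmulDr.
Qed.
Let dotZr (c : R[i]) (g g' : prek) : dot g (c *: g') = c *: dot g g'.
Proof.
by rewrite /dot /lf scaler_sumr; apply: eq_bigr => p _; exact: cmulZr.
Qed.
Let act_subproof (g : prek) d : (fun x => prek_fun g x ** d) \in prek_pred.
Proof.
apply/asboolP; exists [seq (p.1, p.2 ** d) | p <- sq g]; apply/funext => x.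
rewrite sqE /ev cmul_suml big_map; by apply: eq_bigr => p _; rewrite cmulA.
Qed.
Let act g d := Prek (act_subproof g d).
Let dotMr g g' d : dot g (act g' d) = dot g g' ** d.
Proof. by rewrite /dot /lf cmul_suml; apply: eq_bigr => p _; rewrite cmulA. Qed.
Let dot_pos g : cpos (dot g g).
Proof.
rewrite /dot sqE /lf /ev; have := kfun_pos k (sq g); congr cpos.
by apply: eq_bigr => p _; rewrite cmul_sumr; apply: eq_bigr => q _; rewrite cmulA.
Qed.

Definition prek_hilbert : preHilbert D prek := PreHilbert dotDr dotZr dotMr dotC dot_pos.

Definition kmod : hilbertModType D := compl prek_hilbert.

Let ev_subproof s : ev s \in prek_pred. Proof. by apply/asboolP; exists s. Qed.
Let evp s : prek := Prek (ev_subproof s).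

Definition kemb x : kmod := compl_emb prek_hilbert (evp [:: (x, cone)]).

Lemma hdot_kemb x y : hdot (kemb x) (kemb y) = k x y.
Proof.
rewrite /kemb hdot_compl /= /dot.
have -> : lf (sq (evp [:: (x, cone)])) (prek_fun (evp [:: (y, cone)])) =
   lf [:: (x, cone)] (ev [:: (y, cone)]).
  by rewrite sqE lf_ev -sqE /= -lf_ev -sqE.
by rewrite /lf /ev !big_seq1 /= star1 cmul1l cmul1r.
Qed.

Lemma kemb_total : total kemb.
Proof.
move=> xi eps /(compl_dense xi)[g hg]; exists (sq g).
suff -> : fsum kemb (sq g) = compl_emb prek_hilbert g by [].
have gE : g = \sum_(p <- sq g) act (evp [:: (p.1, cone)]) p.2.
  apply: val_inj; rewrite /= sqE; apply/funext => x.
  rewrite (big_morph (fun g : prek => prek_fun g x) (id1 := 0) (op1 := +%R))//.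
  by apply: eq_bigr => p _; rewrite /= /ev big_seq1 /= cmul1r.
rewrite [in RHS]gE (big_morph (compl_emb prek_hilbert) (id1 := 0) (op1 := +%R)).
- by rewrite /fsum; apply: eq_bigr => p _; rewrite -compl_embM.
- by move=> x y; rewrite compl_embD.
by rewrite -(scale0r (0 : prek)) compl_embZ scale0r.
Qed.

End Kolmogorov.

(** * Paths of vectors *)

Section Creeping.
Context {R : realType}.

(** Compactness of [0, 1] in the form used for boundedness and uniform continuity: the supremum of
    the x with P 0 x is itself reached and cannot be less than 1. *)
Lemma interval_creep (P : R -> R -> Prop) :
  (forall a b c, a <= b -> b <= c -> P a b -> P b c -> P a c) ->
  (forall t, exists2 d : R, 0 < d & forall a b, t - d < a -> a <= t -> t <= b ->
     b < t + d -> P a b) -> P 0 1.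
Proof.
move=> Padd Ploc.
have loc2 t : exists2 d : R, 0 < d & forall a b, t - d < a -> a <= b ->
     b < t + d -> a <= t -> P a t /\ (t <= b -> P t b).
  have [d d0 hd] := Ploc t; exists d => // a b ta ab bt at_; split.
    by apply: hd => //; rewrite ltrDl.
  by move=> tb; apply: hd => //; rewrite gtrBl.
pose S := [set x | 0 <= x <= 1 /\ P 0 x].
have S0 : S 0.
  by split; [rewrite lexx ler01|have [d d0 h] := Ploc 0; apply: h => //; lra].
have S1 : has_ubound S by exists 1 => x [/andP[_ ?] _].
have sS : has_sup S by split => //; exists 0.
have c0 : 0 <= sup S by apply: ub_le_sup.
have c1 : sup S <= 1 by apply: ge_sup; [exists 0|move=> x [/andP[_ ?] _]].
have [d d0 hd] := Ploc (sup S).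
have [x [x01 Px] xc] := sup_adherent d0 sS.
have xs : x <= sup S by apply: ub_le_sup.
set b := Num.min 1 (sup S + d / 2).
have bb : b <= 1 /\ b <= sup S + d / 2 by rewrite /b; split; rewrite ge_min lexx ?orbT.
have sb : sup S <= b by rewrite /b le_min c1; lra.
have Pb : P 0 b.
  apply: (Padd _ x) => //; [by case/andP: x01|exact: le_trans sb|].
  by apply: hd => //; lra.
have bS : b <= sup S by apply: ub_le_sup => //; split => //; lra.
have b1 : b = 1.
  by rewrite /b; case: (leP 1 (sup S + d / 2)) => // h; move: bS; rewrite /b min_r; lra.
by rewrite -b1.
Qed.

Definition clamp (t : R) : R := Num.max 0 (Num.min 1 t).

Lemma clamp_bounds t : 0 <= clamp t <= 1.
Proof. by rewrite /clamp le_max lexx/= ge_max ler01 ge_min lexx. Qed.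

Lemma clamp_id t : 0 <= t <= 1 -> clamp t = t.
Proof. by move=> /andP[t0 t1]; rewrite /clamp min_r// max_r. Qed.

Lemma clampK t : clamp (clamp t) = clamp t.
Proof. by rewrite clamp_id// clamp_bounds. Qed.

Lemma clamp_lip s t : `|clamp s - clamp t| <= `|s - t|.
Proof.
rewrite /clamp; case: (leP 1 s); case: (leP 1 t); case: (leP 0 s); case: (leP 0 t) => *;
 do ?[rewrite max_r; last lra|rewrite max_l; last lra]; 
 rewrite ?subrr ?normr0 ?normr_ge0//; rewrite ler_norml ?ler_normr; 
 (try lra); apply/andP; split; case: (ger0P (s - t)); lra.
Qed.

End Creeping.

Section PathContinuity.
Context {R : realType}.

Definition pcont {V : normedModType R[i]} (f : R -> V) : Prop :=
  forall t (e : R), 0 < e -> exists2 d : R, 0 < d & forall s, `|s - t| < d ->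
    nr (f s - f t) < e.

Lemma pcont_cst {V : normedModType R[i]} (x : V) : pcont (fun=> x).
Proof. by move=> t e e0; exists 1 => // s _; rewrite subrr nr0. Qed.

Lemma pcontD {V : normedModType R[i]} (f g : R -> V) :
  pcont f -> pcont g -> pcont (fun t => f t + g t).
Proof.
move=> hf hg t e e0; have e2 : 0 < e / 2 by rewrite divr_gt0.
have [d d0 h] := hf t _ e2; have [d' d0' h'] := hg t _ e2.
exists (Num.min d d'); first by rewrite lt_min d0.
move=> s; rewrite lt_min => /andP[/h a /h' b].
rewrite opprD addrACA; apply: le_lt_trans (nrD _ _) _.
by rewrite (splitr e) ltrD.
Qed.

Lemma pcont_lip {V W : normedModType R[i]} (F : V -> W) (C : R) (f : R -> V) :
  (forall x y, nr (F x - F y) <= C * nr (x - y)) -> pcont f -> pcont (fun t => F (f t)).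
Proof.
move=> FC hf t e e0; have C1 : 0 < `|C| + 1 by rewrite ltr_pwDr.
have [d d0 h] := hf t _ (divr_gt0 e0 C1); exists d => // s /h.
rewrite ltr_pdivlMr// mulrC => h'; apply: le_lt_trans (FC _ _) _.
apply: le_lt_trans h'; rewrite ler_wpM2r ?nr_ge0//.
by have := ler_norm C; lra.
Qed.

Lemma pcont_bounded {V : normedModType R[i]} (f : R -> V) : pcont f ->
  exists M : R, forall t, 0 <= t <= 1 -> nr (f t) <= M.
Proof.
move=> hf; pose P (a b : R) := exists M : R, forall t, a <= t <= b -> nr (f t) <= M.
apply: (@interval_creep _ P) => [a b c ab bc [M hM] [M' hM']|t].
  exists (Num.max M M') => t /andP[at_ tc]; rewrite le_max.
  have [tb|/ltW tb] := leP t b; first by rewrite hM ?at_.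
  by rewrite hM' ?orbT// tb.
have [d d0 h] := hf t 1 ltr01; exists d => // a b ta at_ tb bt.
exists (nr (f t) + 1) => s /andP[as_ sb].
have : `|s - t| < d by rewrite ltr_norml; apply/andP; split; lra.
by move=> /h; have := nr_rev (f s) (f t); lra.
Qed.

Lemma pcont_unif {V : normedModType R[i]} (f : R -> V) (e : R) : pcont f -> 0 < e ->
  exists2 d : R, 0 < d & forall s t, 0 <= s <= 1 -> `|t - s| < d -> nr (f t - f s) < e.
Proof.
move=> hf e0.
pose P (a b : R) := exists2 d : R, 0 < d & forall s t, a <= s <= b -> `|t - s| < d ->
  nr (f t - f s) < e.
apply: (@interval_creep _ P) => [a b c ab bc [d d0 h] [d' d0' h']|t].
  exists (Num.min d d'); first by rewrite lt_min d0.
  move=> s t /andP[as_ sc]; rewrite lt_min => /andP[td td'].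
  have [sb|/ltW sb] := leP s b; first by apply: h; rewrite ?as_.
  by apply: h'; rewrite ?sb.
have e2 : 0 < e / 2 by rewrite divr_gt0.
have [d d0 h] := hf t _ e2; exists (d / 2); first by rewrite divr_gt0.
move=> a b ta at_ tb bt; exists (d / 2); first by rewrite divr_gt0.
move=> s r /andP[as_ sb]; rewrite ltr_norml => /andP[h1 h2].
apply: le_lt_trans (nr_tri _ (f t) _) _; rewrite (splitr e); apply: ltrD.
  by apply: h; rewrite ltr_norml; apply/andP; split; lra.
by rewrite nr_dist; apply: h; rewrite ltr_norml; apply/andP; split; lra.
Qed.

Lemma pcont_limit {V : normedModType R[i]} (u : nat -> R -> V) (f : R -> V) :
  (forall n, pcont (u n)) ->
  (forall e : R, 0 < e -> exists n, forall t, nr (u n t - f t) < e) -> pcont f.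
Proof.
move=> hu uf t e e0; have e3 : 0 < e / 3 by rewrite divr_gt0.
have [n hn] := uf _ e3; have [d d0 h] := hu n t _ e3; exists d => // s /h hs.
apply: le_lt_trans (nr_tri _ (u n s) _) _.
have E : e = e / 3 + (e / 3 + e / 3) by field.
rewrite E; apply: ltrD; first by rewrite nr_dist.
by apply: le_lt_trans (nr_tri _ (u n t) _) _; apply: ltrD.
Qed.

Lemma pcont_continuous {V : normedModType R[i]} (f : R -> V) (A : set R) :
  pcont f -> {within A, continuous f}.
Proof.
move=> hf; apply: continuous_subspaceT => t B /nbhs_ballP[_ /posC[e e0 ->]] sB.
have [d d0 h] := hf t e e0.
apply/nbhs_ballP; exists d => // s; rewrite -ball_normE/= distrC => /h h'.
by apply: sB; rewrite -ball_normE/= nrE ltcR nr_dist.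
Qed.

Lemma continuous_pcont {V : normedModType R[i]} (f : R -> V) :
  {within `[0, 1], continuous f} -> pcont (fun t => f (clamp t)).
Proof.
move=> /subspace_continuousP hf t e e0.
have c01 : clamp t \in `[0, 1]%R by rewrite in_itv/= clamp_bounds.
have e0' : 0 < e%:C :> R[i] by rewrite ltcR.
have := hf _ c01 _ (nbhsx_ballx (f (clamp t)) _ e0').
rewrite /within/= nbhs_filterE => /nbhs_ballP[d /= d0 sB].
exists d => // s st.
have : ball (clamp t) d (clamp s).
  by rewrite -ball_normE/= distrC; apply: le_lt_trans (clamp_lip _ _) _.
move=> /sB/=; rewrite in_itv/= clamp_bounds => /(_ isT).
by rewrite -ball_normE/= nrE ltcR nr_dist.
Qed.

End PathContinuity.

Record is_csub (R : realType) (V : completeNormedModType R[i]) (S : set V) : Prop := IsCsub {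
  csub0 : S 0;
  csubD : forall x y, S x -> S y -> S (x + y);
  csubZ : forall (c : R[i]) x, S x -> S (c *: x);
  csub_cvs : forall u l, (forall n, S (u n)) -> cvs u l -> S l
}.

(* Paths [0, 1] -> V that end in S, extended to the real line by constants. *)
Section Paths.
Context {R : realType} {V : completeNormedModType R[i]} {S : set V}.

Definition cpath_pred (HS : is_csub S) : {pred (R -> V)} :=
  fun f => `[< [/\ pcont f, forall t, f (clamp t) = f t & S (f 1)] >].
Arguments cpath_pred : clear implicits.

Record cpath (HS : is_csub S) := CPath {
  cpath_fun :> R -> V;
  cpath_subproof : cpath_fun \in cpath_pred HS
}.

Context {HS : is_csub S}.

HB.instance Definition _ := [isSub for @cpath_fun HS].
HB.instance Definition _ := [Choice of cpath HS by <:].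

Lemma cpathP (f : cpath HS) : [/\ pcont f, forall t, f (clamp t) = f t & S (f 1)].
Proof. exact/asboolP/cpath_subproof. Qed.

Lemma cpath_submod_closed : submod_closed (cpath_pred HS).
Proof.
split=> [|c f g /asboolP[f1 f2 f3] /asboolP[g1 g2 g3]]; apply/asboolP; split=> //.
- exact: pcont_cst.
- exact: csub0.
- apply: pcontD => //; apply: (@pcont_lip _ _ _ ( *:%R c) (cn c)) f1 => x y.
  by rewrite -scalerBr nrZ.
- by move=> t; rewrite -[LHS]/(c *: f (clamp t) + g (clamp t)) f2 g2.
- by apply: (csubD HS) => //; apply: (csubZ HS).
Qed.

HB.instance Definition _ :=
  GRing.isSubmodClosed.Build R[i] (R -> V) (cpath_pred HS) cpath_submod_closed.
HB.instance Definition _ := [SubChoice_isSubLmodule of cpath HS by <:].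

Implicit Types f g : cpath HS.

Lemma cpath_ext f g : (forall t, 0 <= t <= 1 -> f t = g t) -> f = g.
Proof.
move=> fg; apply: val_inj; apply/funext => t /=.
have [_ f2 _] := cpathP f; have [_ g2 _] := cpathP g.
by rewrite -(f2 t) -(g2 t); apply/fg/clamp_bounds.
Qed.

Lemma cpath_bounded f : exists M : R, forall t, nr (f t) <= M.
Proof.
have [fc fcl _] := cpathP f; have [M hM] := pcont_bounded fc; exists M => t.
by rewrite -fcl; apply/hM/clamp_bounds.
Qed.

Lemma cpathDE f g t : (f + g) t = f t + g t. Proof. by []. Qed.
Lemma cpathZE (c : R[i]) f t : (c *: f) t = c *: f t. Proof. by []. Qed.
Lemma cpathBE f g t : (f - g) t = f t - g t. Proof. by []. Qed.

Definition pnorm f : R := sup (range (fun t => nr (f t))).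

Lemma pnorm_ge f t : nr (f t) <= pnorm f.
Proof.
apply: ub_le_sup; last by exists t.
by have [M hM] := cpath_bounded f; exists M => _ [s _ <-].
Qed.

Lemma pnorm_le f (M : R) : (forall t, nr (f t) <= M) -> pnorm f <= M.
Proof.
by move=> fM; apply: ge_sup; [exists (nr (f 0)), 0|move=> _ [t _ <-]].
Qed.

Let pnormD f g : pnorm (f + g) <= pnorm f + pnorm g.
Proof.
apply: pnorm_le => t; rewrite cpathDE; apply: le_trans (nrD _ _) _.
by apply: lerD; exact: pnorm_ge.
Qed.

Let pnormZ_le (c : R[i]) f : pnorm (c *: f) <= cn c * pnorm f.
Proof.
by apply: pnorm_le => t; rewrite cpathZE nrZ ler_wpM2l ?cn_ge0 ?pnorm_ge.
Qed.

Let pnormZ (c : R[i]) f : pnorm (c *: f) = cn c * pnorm f.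
Proof.
apply/eqP; rewrite eq_le pnormZ_le andTb.
have [->|c0] := eqVneq c 0.
  have -> : cn (0 : R[i]) = 0 by apply/eqP; rewrite cn_eq0.
  by rewrite mul0r; apply: le_trans (pnorm_ge _ 0); exact: nr_ge0.
have := pnormZ_le c^-1 (c *: f); rewrite scalerA mulVf// scale1r => h.
apply: le_trans (ler_wpM2l (cn_ge0 c) h) _.
by rewrite mulrA -cnM mulfV// cn1 mul1r.
Qed.

Let pnorm_eq0 f : pnorm f = 0 -> f = 0.
Proof.
move=> f0; apply: cpath_ext => t _; apply: nr_le0.
by rewrite -f0 pnorm_ge.
Qed.

Let pnorm_complete (u : nat -> cpath HS) :
  (forall e : R, 0 < e -> exists N, forall m n, (N <= m)%N -> (N <= n)%N ->
      pnorm (u m - u n) < e) ->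
  exists l, forall e : R, 0 < e -> exists N, forall n, (N <= n)%N -> pnorm (u n - l) < e.
Proof.
move=> cu.
have /choice[l hl] : forall t, exists l, cvs (fun n => u n t) l.
  move=> t; apply: cvs_ex => e /cu[N hN]; exists N => m n Nm Nn.
  by apply: le_lt_trans (hN m n Nm Nn); have := pnorm_ge (u m - u n) t; rewrite cpathBE.
have ul (e : R) : 0 < e -> exists N, forall n, (N <= n)%N -> forall t, nr (u n t - l t) <= e.
  move=> e0; have [N hN] := cu e e0; exists N => n Nn t.
  have := cvsD (cvs_cst (u n t)) (@cvs_lip _ _ _ -%R 1 _ _ _ (hl t)).
  move=> /(_ _)/cvs_le; apply.
    by move=> x y; rewrite mul1r -opprD nrN.
  exists N => m Nm /=; rewrite -cpathBE; apply: le_trans (pnorm_ge _ _) _.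
  by apply: ltW; exact: hN.
have lP : l \in cpath_pred HS.
  apply/asboolP; split.
  - apply: (@pcont_limit _ _ (fun n => u n)) => [n|e e0]; first by case: (cpathP (u n)).
    have e2 : 0 < e / 2 by rewrite divr_gt0.
    have [N hN] := ul _ e2; exists N => t; apply: le_lt_trans (hN N (leqnn _) t) _.
    by rewrite ltr_pdivrMr// mulr_natr mulr2n ltrDl.
  - move=> t; apply: (cvs_uniq (hl (clamp t))); have := hl t.
    by congr cvs; apply/funext => n; case: (cpathP (u n)).
  by apply: (csub_cvs HS) (hl 1) => n; case: (cpathP (u n)).
exists (CPath lP) => e e0; have e2 : 0 < e / 2 by rewrite divr_gt0.
have [N hN] := ul _ e2; exists N => n Nn.
apply: (@le_lt_trans _ _ (e / 2)); last by rewrite ltr_pdivrMr// mulr_natr mulr2n ltrDl.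
by apply: pnorm_le => t; exact: hN.
Qed.

HB.instance Definition _ := Lmodule_isCompleteNormed.Build R (cpath HS)
  pnormD pnormZ pnorm_eq0 pnorm_complete.

Lemma cpath_nr f t : nr (f t) <= nr f. Proof. exact: pnorm_ge. Qed.
Lemma cpath_nr_le f (M : R) : (forall t, nr (f t) <= M) -> nr f <= M.
Proof. exact: pnorm_le. Qed.

Lemma cpath_of (F : R -> V) : pcont F -> (forall t, F (clamp t) = F t) -> S (F 1) ->
  F \in cpath_pred HS.
Proof. by move=> ? ? ?; apply/asboolP. Qed.

End Paths.

Lemma csubT (R : realType) (V : completeNormedModType R[i]) : is_csub (@setT V).
Proof. by []. Qed.

Lemma pcont_mul {R : realType} {A : cstarAlgType R} (f g : R -> A) :
  pcont f -> pcont g -> (exists M : R, forall t, nr (f t) <= M) ->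
  pcont (fun t => f t ** g t).
Proof.
move=> hf hg [M hM] t e e0.
have M0 : 0 <= M := le_trans (nr_ge0 _) (hM 0).
have g1 : 0 < nr (g t) + 1 by rewrite ltr_pwDr// nr_ge0.
have M1 : 0 < M + 1 by rewrite ltr_pwDr.
have e2 : 0 < e / 2 by rewrite divr_gt0.
have [d d0 h] := hf t _ (divr_gt0 e2 g1); have [d' d0' h'] := hg t _ (divr_gt0 e2 M1).
exists (Num.min d d'); first by rewrite lt_min d0.
move=> s; rewrite lt_min => /andP[/h a /h' b].
have -> : f s ** g s - f t ** g t = f s ** (g s - g t) + (f s - f t) ** g t.
  by rewrite cmulBr cmulBl addrA subrK.
apply: le_lt_trans (nrD _ _) _; rewrite (splitr e); apply: ltrD.
  apply: le_lt_trans (nrM _ _) _; rewrite ltr_pdivlMr// in b; apply: le_lt_trans b.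
  by rewrite mulrC ler_wpM2l ?nr_ge0//; apply: le_trans (hM s) _; rewrite lerDl.
apply: le_lt_trans (nrM _ _) _; rewrite ltr_pdivlMr// in a; apply: le_lt_trans a.
by rewrite ler_wpM2l ?nr_ge0// lerDl.
Qed.

Section PathAlgebra.
Context {R : realType} (A : cstarAlgType R).

Definition palg : Type := cpath (csubT A).
HB.instance Definition _ := CompleteNormedModule.on palg.

Implicit Types f g : palg.

Lemma palg_mul_subproof f g : (fun t => f t ** g t) \in cpath_pred (csubT A).
Proof.
have [f1 f2 _] := cpathP f; have [g1 g2 _] := cpathP g; apply: cpath_of => //.
- by apply: pcont_mul => //; exact: cpath_bounded.
- by move=> t; rewrite f2 g2.
Qed.
Definition palg_mul f g : palg := CPath (palg_mul_subproof f g).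

Lemma palg_cst_subproof (a : A) : (fun=> a) \in cpath_pred (csubT A).
Proof. by apply: cpath_of => //; exact: pcont_cst. Qed.
Definition palg_cst a : palg := CPath (palg_cst_subproof a).

Lemma palg_star_subproof f : (fun t => star (f t)) \in cpath_pred (csubT A).
Proof.
have [f1 f2 _] := cpathP f; apply: cpath_of => //; last by move=> t; rewrite f2.
by apply: (@pcont_lip _ _ _ (@star R A) 1) f1 => x y; rewrite -starB nr_star mul1r.
Qed.
Definition palg_star f : palg := CPath (palg_star_subproof f).

Let mulA : associative palg_mul.
Proof. by move=> x y z; apply: cpath_ext => t _; exact: cmulA. Qed.
Let mul1l : left_id (palg_cst cone) palg_mul.
Proof. by move=> x; apply: cpath_ext => t _; exact: cmul1l. Qed.
Let mul1r : right_id (palg_cst cone) palg_mul.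
Proof. by move=> x; apply: cpath_ext => t _; exact: cmul1r. Qed.
Let mulDl x y z : palg_mul (x + y) z = palg_mul x z + palg_mul y z.
Proof. by apply: cpath_ext => t _; exact: cmulDl. Qed.
Let mulDr x y z : palg_mul x (y + z) = palg_mul x y + palg_mul x z.
Proof. by apply: cpath_ext => t _; exact: cmulDr. Qed.
Let mulZl (c : R[i]) x y : palg_mul (c *: x) y = c *: palg_mul x y.
Proof. by apply: cpath_ext => t _; exact: cmulZl. Qed.
Let mulZr (c : R[i]) x y : palg_mul x (c *: y) = c *: palg_mul x y.
Proof. by apply: cpath_ext => t _; exact: cmulZr. Qed.
Let stD x y : palg_star (x + y) = palg_star x + palg_star y.
Proof. by apply: cpath_ext => t _; exact: starD. Qed.
Let stZ (c : R[i]) x : palg_star (c *: x) = c^* *: palg_star x.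
Proof. by apply: cpath_ext => t _; exact: starZ. Qed.
Let stM x y : palg_star (palg_mul x y) = palg_mul (palg_star y) (palg_star x).
Proof. by apply: cpath_ext => t _; exact: starM. Qed.
Let stK : involutive palg_star. Proof. by move=> x; apply: cpath_ext => t _; exact: starK. Qed.
Let norm_mul x y : `|palg_mul x y| <= `|x| * `|y|.
Proof.
rewrite !nrE -rmorphM lecR; apply: cpath_nr_le => t.
by apply: le_trans (nrM _ _) _; apply: ler_pM; rewrite ?nr_ge0//; exact: cpath_nr.
Qed.
Let norm_star x : `|palg_mul (palg_star x) x| = `|x| ^+ 2.
Proof.
rewrite !nrE -rmorphXn/=; congr (_%:C); apply/eqP; rewrite eq_le; apply/andP; split.
  apply: cpath_nr_le => t; rewrite /= nr_starM ler_pXn2r ?nnegrE ?nr_ge0//.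
  exact: cpath_nr.
set y := palg_mul _ _; rewrite -[leRHS]sqr_sqrtr ?nr_ge0//.
rewrite ler_pXn2r ?nnegrE ?nr_ge0 ?sqrtr_ge0//; apply: cpath_nr_le => t.
rewrite -(@ler_pXn2r _ 2)// ?nnegrE ?nr_ge0 ?sqrtr_ge0// sqr_sqrtr ?nr_ge0//.
by rewrite -nr_starM; exact: (cpath_nr y t).
Qed.

HB.instance Definition _ := isCStarAlgebra.Build R palg
  mulA mul1l mul1r mulDl mulDr mulZl mulZr stD stZ stM stK norm_mul norm_star.

Section Evaluation.
Variable t : R.
Let ev f : A := f t.
Let ev_lin : linear ev. Proof. by []. Qed.
HB.instance Definition _ := GRing.isLinear.Build R[i] palg A *:%R ev ev_lin.
Let evM x y : ev (x ** y) = ev x ** ev y. Proof. by []. Qed.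
Let ev1 : ev cone = cone. Proof. by []. Qed.
Let ev_star x : ev (star x) = star (ev x). Proof. by []. Qed.
Definition palg_ev : starHom palg A := StarHom evM ev1 ev_star.
End Evaluation.

Lemma palg_is_path_algebra : is_path_algebra palg_ev.
Proof.
split=> [f|f g fg|g gc].
- by apply: pcont_continuous; case: (cpathP f).
- by apply: cpath_ext => t t01; apply: fg; rewrite in_itv.
have gP : (fun t => g (clamp t)) \in cpath_pred (csubT A).
  by apply: cpath_of => [||//]; [exact: continuous_pcont|move=> t; rewrite clampK].
exists (CPath gP) => t; rewrite in_itv/= => t01.
by rewrite /= clamp_id.
Qed.

(** Pointwise square roots need not be assembled into a path: in the form [pos], one constant works
    for all t. *)
Lemma palg_cpos f : (forall t, cpos (f t)) -> cpos f.
Proof.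
move=> pf; apply/cposP; split.
  by apply: cpath_ext => t _; rewrite -[LHS]/(star (f t)) cpos_star.
have M0 : 0 < nr f + 1 by have := nr_ge0 f; lra.
exists (nr f + 1) => //; apply: cpath_nr_le => t.
have -> : (rsc (nr f + 1) - f : palg) t = rsc (nr f + 1) - f t by [].
apply: pos_bound => //; first exact/cposP.
by have := cpath_nr f t; lra.
Qed.

End PathAlgebra.

Section PathModule.
Context {R : realType} {A : cstarAlgType R} {E : hilbertModType A} {S : set E}.

Record is_csubmod : Prop := IsCsubmod {
  csubmod :> is_csub S;
  csubM : forall x a, S x -> S (ract x a)
}.

Context (HS : is_csubmod).

Definition hpath : Type := cpath HS.
HB.instance Definition _ := CompleteNormedModule.on hpath.

Implicit Types f g : hpath.

Lemma pcont_ract (f : R -> E) (a : R -> A) : pcont f -> pcont a ->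
  (exists M : R, forall t, nr (f t) <= M) -> pcont (fun t => ract (f t) (a t)).
Proof.
move=> hf hg [M hM] t e e0.
have M0 : 0 <= M := le_trans (nr_ge0 _) (hM 0).
have g1 : 0 < nr (a t) + 1 by rewrite ltr_pwDr// nr_ge0.
have M1 : 0 < M + 1 by rewrite ltr_pwDr.
have e2 : 0 < e / 2 by rewrite divr_gt0.
have [d d0 h] := hf t _ (divr_gt0 e2 g1); have [d' d0' h'] := hg t _ (divr_gt0 e2 M1).
exists (Num.min d d'); first by rewrite lt_min d0.
move=> s; rewrite lt_min => /andP[/h b /h' c].
have -> : ract (f s) (a s) - ract (f t) (a t) =
    ract (f s) (a s - a t) + ract (f s - f t) (a t).
  by rewrite ractBr ractBl addrA subrK.
apply: le_lt_trans (nrD _ _) _; rewrite (splitr e); apply: ltrD.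
  apply: le_lt_trans (nr_ract _ _) _; rewrite ltr_pdivlMr// in c; apply: le_lt_trans c.
  by rewrite mulrC ler_wpM2l ?nr_ge0//; apply: le_trans (hM s) _; rewrite lerDl.
apply: le_lt_trans (nr_ract _ _) _; rewrite ltr_pdivlMr// in b; apply: le_lt_trans b.
by rewrite ler_wpM2l ?nr_ge0// lerDl.
Qed.

Lemma pcont_hdot (f g : R -> E) : pcont f -> pcont g ->
  (exists M : R, forall t, nr (f t) <= M) -> pcont (fun t => hdot (f t) (g t)).
Proof.
move=> hf hg [M hM] t e e0.
have M0 : 0 <= M := le_trans (nr_ge0 _) (hM 0).
have g1 : 0 < nr (g t) + 1 by rewrite ltr_pwDr// nr_ge0.
have M1 : 0 < M + 1 by rewrite ltr_pwDr.
have e2 : 0 < e / 2 by rewrite divr_gt0.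
have [d d0 h] := hf t _ (divr_gt0 e2 g1); have [d' d0' h'] := hg t _ (divr_gt0 e2 M1).
exists (Num.min d d'); first by rewrite lt_min d0.
move=> s; rewrite lt_min => /andP[/h b /h' c].
have -> : hdot (f s) (g s) - hdot (f t) (g t) =
    hdot (f s) (g s - g t) + hdot (f s - f t) (g t).
  by rewrite hdotBr hdotBl addrA subrK.
apply: le_lt_trans (nrD _ _) _; rewrite (splitr e); apply: ltrD.
  apply: le_lt_trans (hdot_CS _ _) _; rewrite ltr_pdivlMr// in c; apply: le_lt_trans c.
  by rewrite mulrC ler_wpM2l ?nr_ge0//; apply: le_trans (hM s) _; rewrite lerDl.
apply: le_lt_trans (hdot_CS _ _) _; rewrite ltr_pdivlMr// in b; apply: le_lt_trans b.
by rewrite ler_wpM2l ?nr_ge0// lerDl.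
Qed.

Lemma hpath_ract_subproof f (a : palg A) : (fun t => ract (f t) (a t)) \in cpath_pred HS.
Proof.
have [f1 f2 f3] := cpathP f; have [a1 a2 _] := cpathP a; apply: cpath_of.
- by apply: pcont_ract => //; exact: cpath_bounded.
- by move=> t; rewrite f2 a2.
exact: csubM.
Qed.
Definition hpath_ract f a : hpath := CPath (hpath_ract_subproof f a).

Lemma hpath_dot_subproof f g : (fun t => hdot (f t) (g t)) \in cpath_pred (csubT A).
Proof.
have [f1 f2 f3] := cpathP f; have [g1 g2 _] := cpathP g; apply: cpath_of => //.
- by apply: pcont_hdot => //; exact: cpath_bounded.
- by move=> t; rewrite f2 g2.
Qed.
Definition hpath_dot f g : palg A := CPath (hpath_dot_subproof f g).

Let actDl x y a : hpath_ract (x + y) a = hpath_ract x a + hpath_ract y a.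
Proof. by apply: cpath_ext => t _; exact: ractDl. Qed.
Let actDr x a b : hpath_ract x (a + b) = hpath_ract x a + hpath_ract x b.
Proof. by apply: cpath_ext => t _; exact: ractDr. Qed.
Let actZl (c : R[i]) x a : hpath_ract (c *: x) a = c *: hpath_ract x a.
Proof. by apply: cpath_ext => t _; exact: ractZl. Qed.
Let actZr (c : R[i]) x a : hpath_ract x (c *: a) = c *: hpath_ract x a.
Proof. by apply: cpath_ext => t _; exact: ractZr. Qed.
Let actM x a b : hpath_ract x (a ** b) = hpath_ract (hpath_ract x a) b.
Proof. by apply: cpath_ext => t _; exact: ractM. Qed.
Let act1 x : hpath_ract x cone = x.
Proof. by apply: cpath_ext => t _; exact: ract1. Qed.
Let dotDr x y z : hpath_dot x (y + z) = hpath_dot x y + hpath_dot x z.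
Proof. by apply: cpath_ext => t _; exact: hdotDr. Qed.
Let dotZr (c : R[i]) x y : hpath_dot x (c *: y) = c *: hpath_dot x y.
Proof. by apply: cpath_ext => t _; exact: hdotZr. Qed.
Let dotMr x y a : hpath_dot x (hpath_ract y a) = hpath_dot x y ** a.
Proof. by apply: cpath_ext => t _; exact: hdotMr. Qed.
Let dotC x y : hpath_dot y x = star (hpath_dot x y).
Proof. by apply: cpath_ext => t _; exact: hdotC. Qed.
Let dot_pos x : cpos (hpath_dot x x).
Proof. by apply: palg_cpos => t; exact: hdot_pos. Qed.
Let norm_sqr x : `|x| ^+ 2 = `|hpath_dot x x|.
Proof.
rewrite !nrE -rmorphXn/=; congr (_%:C); apply/eqP; rewrite eq_le; apply/andP; split.
  rewrite -[leRHS]sqr_sqrtr ?nr_ge0// ler_pXn2r ?nnegrE ?nr_ge0 ?sqrtr_ge0//.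
  apply: cpath_nr_le => t.
  rewrite -(@ler_pXn2r _ 2)// ?nnegrE ?nr_ge0 ?sqrtr_ge0// sqr_sqrtr ?nr_ge0//.
  by rewrite -nr_hdot; exact: (cpath_nr (hpath_dot x x) t).
apply: cpath_nr_le => t; rewrite /= nr_hdot ler_pXn2r ?nnegrE ?nr_ge0//.
exact: cpath_nr.
Qed.

HB.instance Definition _ := isHilbertModule.Build R (palg A) hpath
  actDl actDr actZl actZr actM act1 dotDr dotZr dotMr dotC dot_pos norm_sqr.

Lemma hpath_hdotE f g t : (hdot f g : palg A) t = hdot (f t) (g t). Proof. by []. Qed.

End PathModule.

(** * Direct sums and positive matrices *)

Section DirectSum.
Context {R : realType} {D : cstarAlgType R} (E F : hilbertModType D).

Definition dsum : Type := (E * F)%type.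
HB.instance Definition _ := GRing.Lmodule.copy dsum (E * F)%type.

Let act (x : dsum) d : dsum := (ract x.1 d, ract x.2 d).
Let dot (x y : dsum) : D := hdot x.1 y.1 + hdot x.2 y.2.

Let actDl x y d : act (x + y) d = act x d + act y d.
Proof. by rewrite /act !ractDl. Qed.
Let actDr x d d' : act x (d + d') = act x d + act x d'.
Proof. by rewrite /act !ractDr. Qed.
Let actZl (c : R[i]) x d : act (c *: x) d = c *: act x d.
Proof. by rewrite /act !ractZl. Qed.
Let actZr (c : R[i]) x d : act x (c *: d) = c *: act x d.
Proof. by rewrite /act !ractZr. Qed.
Let actM x d d' : act x (d ** d') = act (act x d) d'.
Proof. by rewrite /act !ractM. Qed.
Let act1 x : act x cone = x.
Proof. by rewrite /act !ract1; case: x. Qed.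
Let dotDr x y z : dot x (y + z) = dot x y + dot x z.
Proof. by rewrite /dot !hdotDr addrACA. Qed.
Let dotZr (c : R[i]) x y : dot x (c *: y) = c *: dot x y.
Proof. by rewrite /dot !hdotZr scalerDr. Qed.
Let dotMr x y d : dot x (act y d) = dot x y ** d.
Proof. by rewrite /dot !hdotMr cmulDl. Qed.
Let dotC x y : dot y x = star (dot x y).
Proof. by rewrite /dot starD -!hdotC. Qed.
Let dot_pos x : cpos (dot x x).
Proof. by apply: cposD; exact: hdot_pos. Qed.
Let dot_ge1 x : nr x.1 ^+ 2 <= nr (dot x x).
Proof. by rewrite -nr_hdot; apply: nr_cposD; exact: hdot_pos. Qed.
Let dot_ge2 x : nr x.2 ^+ 2 <= nr (dot x x).
Proof. by rewrite -nr_hdot /dot addrC; apply: nr_cposD; exact: hdot_pos. Qed.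
Let dot_eq0 x : dot x x = 0 -> x = 0.
Proof.
move=> x0; have := dot_ge1 x; have := dot_ge2 x; rewrite x0 nr0.
case: x {x0} => x y /= hy hx; congr (_, _); apply: nr_le0.
  by have := nr_ge0 x; nra.
by have := nr_ge0 y; nra.
Qed.
Let dot_complete (u : nat -> dsum) :
  (forall e : R, 0 < e -> exists N, forall m n, (N <= m)%N -> (N <= n)%N ->
      nr (dot (u m - u n) (u m - u n)) < e) ->
  exists l, forall e : R, 0 < e -> exists N, forall n, (N <= n)%N ->
      nr (dot (u n - l) (u n - l)) < e.
Proof.
move=> cu.
have [|l1 h1] := @cvs_ex _ _ (fun n => (u n).1).
  move=> e e0; have [N hN] := cu _ (exprn_gt0 2 e0); exists N => m n Nm Nn.
  rewrite -(@ltr_pXn2r _ 2)// ?nnegrE ?nr_ge0 ?(ltW e0)//.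
  by apply: le_lt_trans (dot_ge1 _) (hN m n Nm Nn).
have [|l2 h2] := @cvs_ex _ _ (fun n => (u n).2).
  move=> e e0; have [N hN] := cu _ (exprn_gt0 2 e0); exists N => m n Nm Nn.
  rewrite -(@ltr_pXn2r _ 2)// ?nnegrE ?nr_ge0 ?(ltW e0)//.
  by apply: le_lt_trans (dot_ge2 _) (hN m n Nm Nn).
exists (l1, l2) => e e0; have s0 : 0 < Num.sqrt (e / 2) by rewrite sqrtr_gt0 divr_gt0.
have [N hN] := h1 _ s0; have [M hM] := h2 _ s0.
exists (maxn N M) => n; rewrite geq_max => /andP[/hN a1 /hM a2].
apply: le_lt_trans (nrD _ _) _; rewrite !nr_hdot (splitr e).
rewrite -[e / 2]sqr_sqrtr ?divr_ge0 ?(ltW e0)//.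
by apply: ltrD; rewrite ltr_pXn2r// ?nnegrE ?nr_ge0 ?sqrtr_ge0.
Qed.

HB.instance Definition _ := Lmodule_isHilbert.Build R D dsum
  actDl actDr actZl actZr actM act1 dotDr dotZr dotMr dotC dot_pos dot_eq0 dot_complete.

Lemma dsum_hdotE (x y : dsum) : hdot x y = hdot x.1 y.1 + hdot x.2 y.2. Proof. by []. Qed.
Lemma dsum_ractE (x : dsum) d : ract x d = (ract x.1 d, ract x.2 d). Proof. by []. Qed.

Lemma dsum_nr1 (x : dsum) : nr x.1 <= nr x.
Proof.
rewrite -(@ler_pXn2r _ 2)// ?nnegrE ?nr_ge0// -(nr_hdot x); exact: dot_ge1.
Qed.
Lemma dsum_nr2 (x : dsum) : nr x.2 <= nr x.
Proof.
rewrite -(@ler_pXn2r _ 2)// ?nnegrE ?nr_ge0// -(nr_hdot x); exact: dot_ge2.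
Qed.

Lemma dsum_nr_inl (x : E) : nr ((x, 0) : dsum) = nr x.
Proof.
apply/eqP; rewrite -(@eqrXn2 _ 2)// ?nr_ge0// -!nr_hdot dsum_hdotE /=.
by rewrite hdot0r addr0.
Qed.

Lemma dsum_nr_inr (y : F) : nr ((0, y) : dsum) = nr y.
Proof.
apply/eqP; rewrite -(@eqrXn2 _ 2)// ?nr_ge0// -!nr_hdot dsum_hdotE /=.
by rewrite hdot0r add0r.
Qed.

Lemma dsum_nr_le (x : E) (y : F) : nr ((x, y) : dsum) <= nr x + nr y.
Proof.
rewrite -(dsum_nr_inl x) -(dsum_nr_inr y).
apply: le_trans (nrD _ _); rewrite le_eqVlt; apply/orP; left; apply/eqP; congr nr.
by congr (_, _); rewrite /= ?addr0 ?add0r.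
Qed.

End DirectSum.

(** Let u be the negative part of T and q^2 = u^3. Then 2 u T u = - q^2, so <q x, q x> and twice the
    value of the form of T at u x are positive with sum 0. *)
Lemma lop_pos {R : realType} {D : cstarAlgType R} {E : hilbertModType D} (T : lop E) :
  star T = T -> (forall x, cpos (hdot x (T x))) -> cpos T.
Proof.
move=> sT Tp; apply/cposP; have [u [pu uT u0]] := neg_part sT; apply: u0.
have su := pos_star pu; have [r [pr rr cr]] := pos_root pu; have sr := pos_star pr.
have ur : u ** r = r ** u by apply: cr.
set q := u ** r.
have sq : star q = q by rewrite starM su sr -ur.
have qq : q ** q = u ** u ** u by rewrite /q -cmulA (cmulA r) -ur -!cmulA rr.
have q0 : q = 0.
  apply: lop_ext => x; apply: hdot_eq0.
  have e1 : hdot (q x) (q x) = hdot (u x) ((u ** u) x).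
    by rewrite lop_adj sq -lopME qq [RHS]lop_adj su -lopME cmulA.
  have e2 : hdot (q x) (q x) + (hdot (u x) (T (u x)) + hdot (u x) (T (u x))) = 0.
    rewrite e1 [hdot (u x) (T _)]lop_adj su -hdotDr -!lopME -lopDE.
    rewrite lop_adj su -lopME -hdotDr -lopDE !cmulA -cmulDl uT.
    by rewrite cmulNl subrr hdot0r.
  by apply: cpos_eq0D e2; [exact: hdot_pos|apply: cposD; exact: Tp].
apply: sq_eq0 => //; apply: sq_eq0; first by rewrite starM su.
by rewrite cmulA -qq q0 !cmul0l.
Qed.

(* A positive matrix over a C*-algebra D has the form d^* d; the root is taken in
   the adjointable operators of D^n. *)
Section PositiveMatrices.
Context {R : realType} {D : cstarAlgType R} (n : nat).

Let dlt (i j : 'I_n) : D := if i == j then cone else 0.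

Let dltC i j : dlt j i = star (dlt i j).
Proof. by rewrite /dlt eq_sym; case: ifP => _; rewrite ?star1 ?star0. Qed.

Let dlt_sumr (F : 'I_n -> D) i : \sum_j dlt i j ** F j = F i.
Proof.
rewrite (bigD1 i)//= big1 ?addr0 /dlt ?eqxx ?cmul1l// => j ji.
by rewrite eq_sym (negbTE ji) cmul0l.
Qed.

Let dlt_pos (s : seq ('I_n * D)) :
  cpos (\sum_(p <- s) \sum_(q <- s) star p.2 ** dlt p.1 q.1 ** q.2).
Proof.
have -> : \sum_(p <- s) \sum_(q <- s) star p.2 ** dlt p.1 q.1 ** q.2 =
   \sum_i star (\sum_(p <- s) dlt i p.1 ** p.2) ** (\sum_(p <- s) dlt i p.1 ** p.2).
  under [RHS]eq_bigr do rewrite star_sum cmul_suml.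
  rewrite [RHS]exchange_big; apply: eq_bigr => p _.
  under [RHS]eq_bigr do rewrite cmul_sumr.
  rewrite [RHS]exchange_big; apply: eq_bigr => q _ /=.
  under eq_bigr do rewrite starM -dltC -cmulA.
  by rewrite -cmul_sumr dlt_sumr cmulA.
by apply: cpos_sum => i _; exact: cpos_starM.
Qed.

Let stdmod := kmod (Kernel dltC dlt_pos).
Let e : 'I_n -> stdmod := kemb (Kernel dltC dlt_pos).
Let ee i j : hdot (e i) (e j) = dlt i j. Proof. exact: hdot_kemb. Qed.

Let expand (x : stdmod) : x = \sum_i ract (e i) (hdot (e i) x).
Proof.
apply: (total_ext (kemb_total (k := _))) => i; rewrite -/(e i) hdot_sumr.
by under eq_bigr do rewrite hdotMr ee; rewrite dlt_sumr.
Qed.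

Let parseval (x y : stdmod) : hdot x y = \sum_i star (hdot (e i) x) ** hdot (e i) y.
Proof. by rewrite {1}[x]expand hdot_suml; apply: eq_bigr => i _; rewrite hdotMl. Qed.

Lemma gram_factor (m : 'I_n -> 'I_n -> D) : (forall i j, m j i = star (m i j)) ->
  (forall c : 'I_n -> D, cpos (\sum_i \sum_j star (c i) ** m i j ** c j)) ->
  exists d : 'I_n -> 'I_n -> D, forall i j, m i j = \sum_l star (d l i) ** d l j.
Proof.
move=> mC mpos.
pose G (x : stdmod) : stdmod := \sum_i ract (e i) (\sum_j m i j ** hdot (e j) x).
have GE x y : hdot x (G y) = \sum_i \sum_j star (hdot (e i) x) ** m i j ** hdot (e j) y.
  rewrite /G hdot_sumr; apply: eq_bigr => i _; rewrite hdotMr cmul_sumr.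
  by apply: eq_bigr => j _; rewrite cmulA -hdotC.
have Gadj : adjoint_pair G G.
  move=> x y; rewrite hdotC !GE star_sum.
  under eq_bigr do rewrite star_sum.
  rewrite [RHS]exchange_big; apply: eq_bigr => i _; apply: eq_bigr => j _ /=.
  by rewrite !starM starK -mC cmulA.
have [C C0 GC] : exists2 C : R, 0 <= C & forall x, nr (G x) <= C * nr x.
  exists (\sum_i nr (e i) * (\sum_j nr (m i j) * nr (e j))).
    by apply: sumr_ge0 => i _; rewrite mulr_ge0 ?nr_ge0// sumr_ge0// => j _; rewrite mulr_ge0 ?nr_ge0.
  move=> x; apply: le_trans (nr_sum _ _ _) _; rewrite mulr_suml; apply: ler_sum => i _.
  apply: le_trans (nr_ract _ _) _; rewrite -mulrA ler_wpM2l ?nr_ge0//.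
  apply: le_trans (nr_sum _ _ _) _; rewrite mulr_suml; apply: ler_sum => j _.
  apply: le_trans (nrM _ _) _; rewrite -mulrA ler_wpM2l ?nr_ge0//; exact: hdot_CS.
pose T : lop stdmod := Lop (lop_of Gadj C0 GC).
have sT : star T = T by apply: lop_star_uniq; exact: Gadj.
have /cposP/pos_root[h [ph hh _]] : cpos T.
  apply: lop_pos => // x; rewrite [T x]/(G x) GE; exact: mpos.
exists (fun l i => hdot (e l) (h (e i))) => i j.
rewrite -parseval lop_adj (pos_star ph) -lopME hh [T _]/(G _) GE.
under eq_bigr do under eq_bigr do rewrite !ee.
rewrite [LHS](_ : _ = \sum_k dlt i k ** m k j); last by rewrite dlt_sumr.
apply: eq_bigr => k _; rewrite -dltC.
under eq_bigr do rewrite -cmulA; rewrite -cmul_sumr; congr (_ ** _).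
rewrite (bigD1 j)//= big1 ?addr0 /dlt ?eqxx ?cmul1r// => l lj.
by rewrite (negbTE lj) cmul0r.
Qed.

(** Complete positivity of *-homomorphisms, by the factorization of m; it transports positive
    kernels along a change of coefficients. *)
Lemma gram_shom (C : cstarAlgType R) (f : starHom D C) (m : 'I_n -> 'I_n -> D) :
  (forall i j, m j i = star (m i j)) ->
  (forall c : 'I_n -> D, cpos (\sum_i \sum_j star (c i) ** m i j ** c j)) ->
  forall c : 'I_n -> C, cpos (\sum_i \sum_j star (c i) ** f (m i j) ** c j).
Proof.
move=> mC mpos c; have [d dE] := gram_factor mC mpos.
have -> : \sum_i \sum_j star (c i) ** f (m i j) ** c j =
   \sum_l star (\sum_i f (d l i) ** c i) ** (\sum_i f (d l i) ** c i).
  under [RHS]eq_bigr do rewrite star_sum cmul_suml.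
  rewrite [RHS]exchange_big; apply: eq_bigr => i _.
  under [RHS]eq_bigr do rewrite cmul_sumr.
  rewrite [RHS]exchange_big; apply: eq_bigr => j _ /=.
  rewrite dE linear_sum cmul_sumr cmul_suml; apply: eq_bigr => l _.
  by rewrite shomM shom_star starM !cmulA.
by apply: cpos_sum => l _; exact: cpos_starM.
Qed.

(** Positivity of the inner product of an internal tensor product: the factorization of m turns the
    form into a sum of squares. *)
Lemma gram_rep (C : cstarAlgType R) (F : hilbertModType C) (phi : D -> F -> F)
    (m : 'I_n -> 'I_n -> D) : star_rep phi ->
  (forall i j, m j i = star (m i j)) ->
  (forall c : 'I_n -> D, cpos (\sum_i \sum_j star (c i) ** m i j ** c j)) ->
  forall y : 'I_n -> F, cpos (\sum_i \sum_j hdot (y i) (phi (m i j) (y j))).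
Proof.
move=> rep mC mpos y; have [d dE] := gram_factor mC mpos.
have phi_sum (I : finType) (x : I -> D) z : phi (\sum_i x i) z = \sum_i phi (x i) z.
  by apply: (big_morph (phi^~ z) (fun _ _ => repD rep _ _ _)); rewrite (rep0 rep).
have -> : \sum_i \sum_j hdot (y i) (phi (m i j) (y j)) =
   \sum_l hdot (\sum_i phi (d l i) (y i)) (\sum_i phi (d l i) (y i)).
  under [RHS]eq_bigr do rewrite hdot_suml.
  rewrite [RHS]exchange_big; apply: eq_bigr => i _.
  under [RHS]eq_bigr do rewrite hdot_sumr.
  rewrite [RHS]exchange_big; apply: eq_bigr => j _ /=.
  rewrite dE phi_sum hdot_sumr; apply: eq_bigr => l _.
  by rewrite (repM rep) (rep_adj rep).
by apply: cpos_sum => l _; exact: hdot_pos.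
Qed.

End PositiveMatrices.

Section ListForms.
Context {R : realType} {D : cstarAlgType R}.

Lemma gram_module_pos (E : hilbertModType D) n (x : 'I_n -> E) (c : 'I_n -> D) :
  cpos (\sum_i \sum_j star (c i) ** hdot (x i) (x j) ** c j).
Proof.
have -> : \sum_i \sum_j star (c i) ** hdot (x i) (x j) ** c j =
   hdot (\sum_i ract (x i) (c i)) (\sum_i ract (x i) (c i)).
  rewrite hdot_suml; apply: eq_bigr => i _; rewrite hdot_sumr; apply: eq_bigr => j _.
  by rewrite hdotMr hdotMl.
exact: hdot_pos.
Qed.

Lemma cpos_seq_form (X : Type) (m : X -> X -> D) (s : seq (X * D)) :
  (forall n (x : 'I_n -> X) (c : 'I_n -> D),
     cpos (\sum_i \sum_j star (c i) ** m (x i) (x j) ** c j)) ->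
  cpos (\sum_(p <- s) \sum_(q <- s) star p.2 ** m p.1 q.1 ** q.2).
Proof.
move=> h; rewrite big_tnth; under eq_bigr do rewrite big_tnth.
exact: (h _ (fun i => (tnth (in_tuple s) i).1) (fun i => (tnth (in_tuple s) i).2)).
Qed.

End ListForms.

Lemma clspan_ext {R : realType} {D : cstarAlgType R} {E : hilbertModType D} (X : set E) u v :
  clspan X = setT -> (forall x, X x -> hdot x u = hdot x v) -> u = v.
Proof.
move=> cl h; apply: hdot_ext => z; have : clspan X z by rewrite cl.
move: z; apply: clspan_ind => //.
- by rewrite !hdot0l.
- by move=> x y hx hy; rewrite !hdotDl hx hy.
- by move=> c x hx; rewrite !hdotZl hx.
move=> w l hw wl; apply: (cvs_uniq (cvs_hdotl u wl)).
by have := cvs_hdotl v wl; congr cvs; apply/funext => n; rewrite hw.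
Qed.

Lemma clspan_csub {R : realType} {V : completeNormedModType R[i]} (X : set V) :
  is_csub (clspan X).
Proof.
split; [exact: clspan0|exact: clspanD|by move=> c x; exact: clspanZ|exact: clspan_cvs].
Qed.

Lemma csub_clspan {R : realType} {V : completeNormedModType R[i]} (X S : set V) :
  is_csub S -> (forall x, X x -> S x) -> forall x, clspan X x -> S x.
Proof.
move=> [S0 SD SZ Sc] XS; exact: clspan_ind.
Qed.

(** * Reduced words in the vertex representations *)

Section Tensors.
Context {R : realType} {D C : cstarAlgType R} {E : hilbertModType D} {F : hilbertModType C}.
Context {phi : D -> F -> F} {Y : set F} {T : hilbertModType C} {j : E -> F -> T}.
Hypothesis rep : unital_rep phi.
Hypothesis HT : is_tensor phi Y j.

Lemma tensor_ext u v :
  (forall x y, Y y -> hdot (j x y) u = hdot (j x y) v) -> u = v.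
Proof. by move=> h; apply: (clspan_ext HT.2) => _ [x [y [Yy ->]]]; exact: h. Qed.

Lemma tensor_hdot x x' y y' : Y y -> Y y' ->
  hdot (j x y) (j x' y') = hdot y (phi (hdot x x') y').
Proof. exact: HT.1. Qed.

Let phi_adj d : adjoint_pair (phi d) (phi (star d)) := rep_adj rep.1 d.

Lemma tensor_Dr x y y' : Y y -> Y y' -> Y (y + y') -> j x (y + y') = j x y + j x y'.
Proof.
move=> Yy Yy' Yyy; apply: tensor_ext => x0 y0 Y0.
by rewrite hdotDr !tensor_hdot// (padjD (phi_adj _)) hdotDr.
Qed.

Lemma tensor_Zr (c : R[i]) x y : Y y -> Y (c *: y) -> j x (c *: y) = c *: j x y.
Proof.
move=> Yy Ycy; apply: tensor_ext => x0 y0 Y0.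
by rewrite hdotZr !tensor_hdot// (padjZ (phi_adj _)) hdotZr.
Qed.

Lemma tensor_Dl x x' y : Y y -> j (x + x') y = j x y + j x' y.
Proof.
move=> Yy; apply: tensor_ext => x0 y0 Y0.
by rewrite hdotDr !tensor_hdot// hdotDr (repD rep.1) hdotDr.
Qed.

Lemma tensor_Zl (c : R[i]) x y : Y y -> j (c *: x) y = c *: j x y.
Proof.
move=> Yy; apply: tensor_ext => x0 y0 Y0.
by rewrite hdotZr !tensor_hdot// hdotZr (repZ rep.1) hdotZr.
Qed.

Lemma tensor_nr x y : Y y -> nr (j x y) <= nr x * nr y.
Proof.
move=> Yy; apply: nr_le_sq; first by rewrite mulr_ge0 ?nr_ge0.
rewrite tensor_hdot//; apply: le_trans (hdot_CS _ _) _.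
have := rep_nr rep.1 (hdot x x) y; rewrite nr_hdot => h.
apply: le_trans (ler_wpM2l (nr_ge0 _) h) _.
by rewrite le_eqVlt; apply/orP; left; apply/eqP; rewrite exprMn; ring.
Qed.

Lemma tensor_csub_l (P : set T) (X : set E) y : is_csub P -> Y y ->
  (forall x, X x -> P (j x y)) -> forall x, clspan X x -> P (j x y).
Proof.
move=> HP Yy XP; apply: clspan_ind => //.
- by rewrite -(scale0r (0 : E)) tensor_Zl//; apply: (csubZ HP); rewrite -[j _ _]scale1r -tensor_Zl// scale1r -(scale0r (0 : E)) tensor_Zl// scale0r; exact: csub0.
- by move=> x x' hx hx'; rewrite tensor_Dl//; exact: (csubD HP).
- by move=> c x hx; rewrite tensor_Zl//; exact: (csubZ HP).
move=> u l hu ul; apply: (csub_cvs HP) hu _.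
apply: (@cvs_lip _ _ _ (fun x => j x y) (nr y)) ul => x x'.
by rewrite -[- j x' y]scaleN1r -tensor_Zl// -tensor_Dl// scaleN1r mulrC tensor_nr.
Qed.

End Tensors.

Section HilbertSums.
Context {R : realType} {D : cstarAlgType R} {I : Type} {P : I -> Prop}.
Context {H : I -> hilbertModType D} {S : hilbertModType D} {inc : forall i, H i -> S}.
Arguments inc : clear implicits.
Hypothesis HS : is_hilbert_sum P inc.

Lemma hsum_iso i x y : P i -> hdot (inc i x) (inc i y) = hdot x y.
Proof. by case: HS => h _ _; exact: h. Qed.

Lemma hsum_orth i j x y : P i -> P j -> i <> j -> hdot (inc i x) (inc j y) = 0.
Proof. by case: HS => _ h _; exact: h. Qed.

Lemma hsum_ext i (f : H i) v : P i -> (forall g : H i, hdot (inc i g) v = hdot g f) ->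
  (forall k (g : H k), P k -> k <> i -> hdot (inc k g) v = 0) -> inc i f = v.
Proof.
move=> Pi h1 h2; case: HS => iso orth cl; apply: (clspan_ext cl) => _ [k [g [Pk ->]]].
have [ki|ki] := pselect (k = i); last by rewrite orth// h2.
by rewrite ki in g Pk *; rewrite iso// h1.
Qed.

Lemma hsum_D i x y : P i -> inc i (x + y) = inc i x + inc i y.
Proof.
move=> Pi; apply: hsum_ext => // [g|k g Pk ki]; first by rewrite !hdotDr !hsum_iso.
by rewrite hdotDr !hsum_orth// addr0.
Qed.

Lemma hsum_Z i (c : R[i]) x : P i -> inc i (c *: x) = c *: inc i x.
Proof.
move=> Pi; apply: hsum_ext => // [g|k g Pk ki]; first by rewrite !hdotZr !hsum_iso.
by rewrite hdotZr !hsum_orth// scaler0.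
Qed.

Lemma hsum_M i x d : P i -> inc i (ract x d) = ract (inc i x) d.
Proof.
move=> Pi; apply: hsum_ext => // [g|k g Pk ki]; first by rewrite !hdotMr !hsum_iso.
by rewrite hdotMr !hsum_orth// cmul0l.
Qed.

Lemma hsum_nr i x : P i -> nr (inc i x) = nr x.
Proof.
by move=> Pi; apply/eqP; rewrite -(@eqrXn2 _ 2)// ?nr_ge0// -!nr_hdot hsum_iso.
Qed.

End HilbertSums.

Section Gns.
Context {R : realType} {B : cstarAlgType R} {A : bool -> cstarAlgType R}.
Context {iota : forall k, starHom B (A k)} {E : forall k, {linear A k -> B}}.
Hypothesis E_cond : forall k, conditional_expectation (iota k) (E k).

Lemma E_iota k b : E k (iota k b) = b.
Proof. by case: (E_cond k) => h _ _; exact: h. Qed.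

Lemma E_bimod k b a b' : E k (iota k b ** a ** iota k b') = b ** E k a ** b'.
Proof. by case: (E_cond k) => _ h _; exact: h. Qed.

Lemma E_pos k a : cpos a -> cpos (E k a).
Proof. by case: (E_cond k) => _ _ h; exact: h. Qed.

Lemma E_l k b a : E k (iota k b ** a) = b ** E k a.
Proof. by have := E_bimod b a cone; rewrite shom1 !cmul1r. Qed.

Lemma E_r k a b : E k (a ** iota k b) = E k a ** b.
Proof. by have := E_bimod cone a b; rewrite shom1 !cmul1l. Qed.

Definition centre k (a : A k) : A k := a - iota k (E k a).

Lemma E_centre k a : E k (centre a) = 0.
Proof. by rewrite linearB E_iota subrr. Qed.

Lemma centreE k (a : A k) : a = centre a + iota k (E k a).
Proof. by rewrite subrK. Qed.

Context {K : forall k, gns E k}.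

Lemma E_star k a : E k (star a) = star (E k a).
Proof.
rewrite -!(gvec_expect (K k)) -hdotC.
by rewrite (rep_adj (grep_unital (K k)).1).
Qed.

Lemma E_nr k a : nr (E k a) <= nr a.
Proof.
have g1 : nr (gvec (K k)) <= 1.
  apply: nr_le_sq => //; rewrite -{2}[gvec _](grep_unital (K k)).2 gvec_expect.
  by rewrite -(shom1 (iota k)) E_iota expr1n nr_cone.
rewrite -(gvec_expect (K k)); apply: le_trans (hdot_CS _ _) _.
have h := rep_nr (grep_unital (K k)).1 a (gvec (K k)).
have := nr_ge0 (gvec (K k)); have := nr_ge0 a; have := nr_ge0 (grep a (gvec (K k))).
nra.
Qed.

(** Tested against the cyclic vectors, this is the right B-linearity of E. It moves coefficients in
    B into the letters of words. *)
Lemma gvec_iota k b : grep (iota k b) (gvec (K k)) = ract (gvec (K k)) b.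
Proof.
apply: (clspan_ext (gvec_cyclic (K k))) => _ [a [b' ->]].
have rep := (grep_unital (K k)).1.
rewrite !hdotMl; congr (_ ** _); rewrite hdotMr.
by rewrite !(rep_adj rep) -(repM rep) !gvec_expect E_r.
Qed.

Lemma gvec_span k a b : ract (grep a (gvec (K k))) b = grep (a ** iota k b) (gvec (K k)).
Proof.
have rep := (grep_unital (K k)).1.
by rewrite (repM rep) gvec_iota (padjM (rep_adj rep a)).
Qed.

End Gns.

(** Linearity and boundedness relative to a set: the tensor maps [wtens x] are controlled only on
    the core of the shorter word. *)
Record lin_on {R : realType} {V W : completeNormedModType R[i]} (Y : set V) (f : V -> W) : Prop :=
  LinOn {
    lin_onD : forall x y, Y x -> Y y -> f (x + y) = f x + f y;
    lin_onZ : forall (c : R[i]) x, Y x -> f (c *: x) = c *: f x;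
    lin_on_bd : exists2 C : R, 0 <= C & forall x, Y x -> nr (f x) <= C * nr x
  }.

Section LinOn.
Context {R : realType}.

Lemma lin_on_sub {V W : completeNormedModType R[i]} (Y Y' : set V) (f : V -> W) :
  (forall x, Y' x -> Y x) -> lin_on Y f -> lin_on Y' f.
Proof.
move=> YY [fD fZ [C C0 fC]]; split=> [x y Yx Yy|c x Yx|]; [|exact/fZ/YY|].
  by apply: fD; exact: YY.
by exists C => // x /YY; exact: fC.
Qed.

Lemma lin_on_comp {U V W : completeNormedModType R[i]} (Y : set U) (Z : set V)
    (f : U -> V) (g : V -> W) : lin_on Y f -> (forall x, Y x -> Z (f x)) -> lin_on Z g ->
  lin_on Y (fun x => g (f x)).
Proof.
move=> [fD fZ [C C0 fC]] YZ [gD gZ [C' C0' gC]]; split.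
- by move=> x y Yx Yy; rewrite fD// gD//; exact: YZ.
- by move=> c x Yx; rewrite fZ// gZ//; exact: YZ.
exists (C' * C) => [|x Yx]; first exact: mulr_ge0.
by apply: le_trans (gC _ (YZ _ Yx)) _; rewrite -mulrA ler_wpM2l// fC.
Qed.

Lemma lin_on_compT {U V W : completeNormedModType R[i]} (Y : set U) (f : U -> V) (g : V -> W) :
  lin_on Y f -> lin_on setT g -> lin_on Y (fun x => g (f x)).
Proof. by move=> lf; exact: lin_on_comp. Qed.

Section Pre.
Context {V W : completeNormedModType R[i]} {Y : set V} (HY : is_csub Y).

Lemma lin_onB (f : V -> W) x y : lin_on Y f -> Y x -> Y y -> f (x - y) = f x - f y.
Proof.
move=> [fD fZ _] Yx Yy; rewrite -scaleN1r fD//; last exact: (csubZ HY).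
by rewrite fZ// scaleN1r.
Qed.

Lemma lin_on0 (f : V -> W) : lin_on Y f -> f 0 = 0.
Proof.
by move=> [_ fZ _]; rewrite -(scale0r (0 : V)) fZ ?scale0r//; exact: csub0.
Qed.

Lemma lin_on_cvs (f : V -> W) u l : lin_on Y f -> (forall n, Y (u n)) -> cvs u l ->
  cvs (fun n => f (u n)) (f l).
Proof.
move=> lf Yu ul e e0; have Yl := csub_cvs HY Yu ul.
have [_ _ [C C0 fC]] := lf.
have C1 : 0 < C + 1 by rewrite ltr_pwDr.
have [N hN] := ul _ (divr_gt0 e0 C1); exists N => n /hN.
have Yn : Y (u n - l) by rewrite -scaleN1r; apply: (csubD HY) => //; exact: (csubZ HY).
rewrite -lin_onB// ltr_pdivlMr// => h; apply: le_lt_trans (fC _ Yn) _.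
by apply: le_lt_trans h; rewrite mulrC ler_wpM2l ?nr_ge0// lerDl.
Qed.

Lemma lin_on_pre (f : V -> W) (P : set W) : lin_on Y f -> is_csub P ->
  is_csub [set y | Y y /\ P (f y)].
Proof.
move=> lf HP; have [fD fZ _] := lf; split.
- by split; [exact: csub0|rewrite lin_on0//; exact: csub0].
- move=> x y [Yx Px] [Yy Py]; split; first exact: (csubD HY).
  by rewrite fD//; exact: (csubD HP).
- move=> c x [Yx Px]; split; first exact: (csubZ HY).
  by rewrite fZ//; exact: (csubZ HP).
move=> u l hu ul; have Yu n : Y (u n) by case: (hu n).
split; first exact: (csub_cvs HY) ul.
by apply: (csub_cvs HP) (lin_on_cvs lf Yu ul) => n; case: (hu n).
Qed.

Lemma lin_on_eq (f g : V -> W) : lin_on Y f -> lin_on Y g ->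
  is_csub [set y | Y y /\ f y = g y].
Proof.
move=> lf lg; have [fD fZ _] := lf; have [gD gZ _] := lg; split.
- by split; [exact: csub0|rewrite !lin_on0].
- move=> x y [Yx fx] [Yy fy]; split; first exact: (csubD HY).
  by rewrite fD// gD// fx fy.
- by move=> c x [Yx fx]; split; [exact: (csubZ HY)|rewrite fZ// gZ// fx].
move=> u l hu ul; have Yu n : Y (u n) by case: (hu n).
split; first exact: (csub_cvs HY) ul.
apply: (cvs_uniq (lin_on_cvs lf Yu ul)); have := lin_on_cvs lg Yu ul.
by congr cvs; apply/funext => n; case: (hu n).
Qed.

End Pre.

(** This and the next two lemmas reduce claims about a closed span to its generators; the variants
    with Y admit maps that are linear only on Y. *)
Lemma csub_preT {V W : completeNormedModType R[i]} (f : V -> W) (P : set W) (X : set V) :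
  lin_on setT f -> is_csub P -> (forall x, X x -> P (f x)) ->
  forall x, clspan X x -> P (f x).
Proof.
move=> lf HP XP x cx; have HS := lin_on_pre (csubT V) lf HP.
by have [] := csub_clspan HS (fun x Xx => conj I (XP x Xx)) cx.
Qed.

Lemma csub_preY {V W : completeNormedModType R[i]} (Y : set V) (f : V -> W) (P : set W)
    (X : set V) : is_csub Y -> lin_on Y f -> is_csub P -> (forall x, X x -> Y x /\ P (f x)) ->
  forall x, clspan X x -> P (f x).
Proof.
move=> HY lf HP XP x cx; have HS := lin_on_pre HY lf HP.
by have [] := csub_clspan HS XP cx.
Qed.

Lemma csub_eqY {V W : completeNormedModType R[i]} (Y : set V) (f g : V -> W)
    (X : set V) : is_csub Y -> lin_on Y f -> lin_on Y g -> (forall x, X x -> Y x /\ f x = g x) ->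
  forall x, clspan X x -> f x = g x.
Proof.
move=> HY lf lg XP x cx; have HS := lin_on_eq HY lf lg.
by have [] := csub_clspan HS XP cx.
Qed.

Lemma lin_on_adj {D : cstarAlgType R} {E F : hilbertModType D} (T : E -> F) S (C : R) :
  adjoint_pair T S -> 0 <= C -> (forall x, nr (T x) <= C * nr x) -> lin_on setT T.
Proof.
move=> TS C0 TC; split; [by move=> x y _ _; exact: (padjD TS)|by move=> c x _; exact: (padjZ TS)|].
by exists C.
Qed.

Lemma lin_on_rep {D A : cstarAlgType R} {E : hilbertModType D} (phi : A -> E -> E) a :
  star_rep phi -> lin_on setT (phi a).
Proof.
by move=> rep; apply: (lin_on_adj (rep_adj rep a) (nr_ge0 a)) => x; exact: rep_nr.
Qed.

Lemma unital_rep_comp {D A A' : cstarAlgType R} {E : hilbertModType D} (phi : A -> E -> E)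
    (f : starHom A' A) : unital_rep phi -> unital_rep (fun a => phi (f a)).
Proof.
move=> [rep r1]; split; last by move=> x; rewrite shom1.
split=> [c a b x|a b x|a]; first by rewrite linearP (repZD rep).
  by rewrite shomM (repM rep).
by rewrite shom_star; exact: rep_adj.
Qed.

Lemma tensor_lin_r {D C : cstarAlgType R} {E : hilbertModType D} {F : hilbertModType C}
    {phi : D -> F -> F} {Y : set F} {T : hilbertModType C} {j : E -> F -> T} x :
  unital_rep phi -> is_tensor phi Y j -> is_csub Y -> lin_on Y (j x).
Proof.
move=> rep HT HY; split.
- by move=> y y' Yy Yy'; apply: (tensor_Dr rep HT) => //; exact: (csubD HY).
- by move=> c y Yy; apply: (tensor_Zr rep HT) => //; exact: (csubZ HY).
by exists (nr x) => [|y Yy]; [exact: nr_ge0|exact: (tensor_nr rep HT)].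
Qed.

Lemma tensor_lin_l {D C : cstarAlgType R} {E : hilbertModType D} {F : hilbertModType C}
    {phi : D -> F -> F} {Y : set F} {T : hilbertModType C} {j : E -> F -> T} y :
  unital_rep phi -> is_tensor phi Y j -> Y y -> lin_on setT (fun x => j x y).
Proof.
move=> rep HT Yy; split.
- by move=> x x' _ _; exact: (tensor_Dl rep HT).
- by move=> c x _; exact: (tensor_Zl rep HT).
by exists (nr y) => [|x _]; [exact: nr_ge0|rewrite mulrC; exact: (tensor_nr rep HT)].
Qed.

Lemma hsum_lin {D : cstarAlgType R} {I : Type} {P : I -> Prop} {H : I -> hilbertModType D}
    {S : hilbertModType D} {inc : forall i, H i -> S} i :
  is_hilbert_sum P inc -> P i -> lin_on setT (@inc i).
Proof.
move=> HS Pi; split; [by move=> x y _ _; exact: (hsum_D HS)|by move=> c x _; exact: (hsum_Z HS)|].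
by exists 1 => // x _; rewrite mul1r (hsum_nr HS).
Qed.

End LinOn.

(* redw E inj i j x: x is a product of elements of the kernels of the expectations,
   taken alternately from the two algebras, the first from A i and the last from A j. *)
Inductive redw {R : realType} {B : cstarAlgType R} {A : bool -> cstarAlgType R}
    (E : forall k, {linear A k -> B}) {Af : cstarAlgType R}
    (inj : forall k, starHom (A k) Af) : bool -> bool -> Af -> Prop :=
| redw1 k a : E k a = 0 -> redw E inj k k (inj k a)
| redwS k j a x : E k a = 0 -> redw E inj (~~ k) j x -> redw E inj k j (inj k a ** x).

Section VertexWords.
Context {R : realType} {B : cstarAlgType R} {A : bool -> cstarAlgType R}.
Context {iota : forall k, starHom B (A k)} {E : forall k, {linear A k -> B}}.
Context {Af : cstarAlgType R} {inj : forall k, starHom (A k) Af}.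
Context {K : forall k, gns E k} {W : words iota K} {H : word_sums W}.
Context { pi : forall k, Af -> whsum H k k -> whsum H k k}.
Arguments pi : clear implicits.
Hypothesis E_cond : forall k, conditional_expectation (iota k) (E k).
Hypothesis pi_vertex : is_vertex_rep inj pi.

Local Notation core := (@word_core R B A E K _ (@wtens R B A iota E K W) _ _).
Local Notation eta k := (gvec (K k)).

Lemma core_csub l s : is_csub (@word_core R B A E K _ (@wtens R B A iota E K W) l s).
Proof. by case: s => [|k s] /=; [exact: csubT|exact: clspan_csub]. Qed.

(** Followed by the letter k, this is the alternating word of length 2n+1 from k to k. By [ew_surj]
    there are no others, so H_(k,k) is graded by n. *)
Fixpoint ew (k : bool) (n : nat) : seq bool :=
  if n is n'.+1 then k :: ~~ k :: ew k n' else [::].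

Lemma word_idx_ew k n : word_idx k k (ew k n).
Proof.
case: n => [|n]; first by rewrite /word_idx /= eqxx.
rewrite /word_idx /= eqxx andbT; elim: n => [|n IH] /=; first by case: k.
by case: k IH => /= ->.
Qed.

Lemma word_idx_ew1 k n : word_idx (~~ k) k (~~ k :: ew k n).
Proof.
have := word_idx_ew k n.+1; rewrite /word_idx /= !eqxx !andbT.
by case/andP.
Qed.

Lemma ew_surj k s : word_idx k k s -> exists n, s = ew k n.
Proof.
have [m] := ubnP (size s); elim: m s => // m IH [_ _|a [|b s]] /=; first by exists 0%N.
  by rewrite /word_idx /= => _ /andP[ak /eqP ka]; move: ak; rewrite ka; case: (k).
rewrite /word_idx /= ltnS => sm /andP[/andP[ab h] /eqP ak].
have bk : b = ~~ k by rewrite -ak; case: a b ab {h ak sm} => [] [].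
have [||n ->] := IH s; first exact: ltn_trans sm.
  rewrite /word_idx bk in h *; case: s h {sm} => [|c s] /=; first by rewrite eqxx.
  by move=> /andP[kc ->] /=; case: k c kc {IH ak bk} => [] [].
by exists n.+1; rewrite /= ak bk.
Qed.

Let head_ew k n : word_idx (head k (ew k n)) k (ew k n).
Proof. by case: n => [|n]; [exact: (word_idx_ew k 0)|exact: (word_idx_ew k n.+1)]. Qed.

Let rep_head k n : unital_rep (fun b =>
  @wact _ _ _ _ _ _ W (head k (ew k n)) k (ew k n) (iota (head k (ew k n)) b)).
Proof. exact: unital_rep_comp (wact_rep _ (head_ew k n)). Qed.

Let rep_head1 k n : unital_rep (fun b =>
  @wact _ _ _ _ _ _ W (~~ k) k (~~ k :: ew k n) (iota (~~ k) b)).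
Proof. exact: unital_rep_comp (wact_rep _ (word_idx_ew1 k n)). Qed.

Let T1 k n := wtens_tensor W (word_idx_ew1 k n).
Let T2 k n : is_tensor
    (fun b => @wact _ _ _ _ _ _ W (~~ k) k (~~ k :: ew k n) (iota (~~ k) b)) core
    (@wtens _ _ _ _ _ _ W k k (~~ k :: ew k n)) :=
  wtens_tensor W (word_idx_ew k n.+1).
Let S1 k := whinc_sum H k k.
Let S2 k := whinc_sum H (~~ k) k.

(** [inc] and [inc1] embed the words of odd and of even length that end in k; [ten1] and [ten2]
    prepend a factor for ~~ k and for k. *)
Let inc k n : word_mod (wfam W) k (ew k n) -> whsum H k k := @whinc _ _ _ _ _ _ _ H k k (ew k n).
Let inc1 k n : word_mod (wfam W) k (~~ k :: ew k n) -> whsum H (~~ k) k :=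
  @whinc _ _ _ _ _ _ _ H (~~ k) k (~~ k :: ew k n).
Let ten1 k n : gmod (K (~~ k)) -> word_mod (wfam W) k (ew k n) ->
    word_mod (wfam W) k (~~ k :: ew k n) := @wtens _ _ _ _ _ _ W k (~~ k) (ew k n).
Let ten2 k n : gmod (K k) -> word_mod (wfam W) k (~~ k :: ew k n) ->
    word_mod (wfam W) k (ew k n.+1) := @wtens _ _ _ _ _ _ W k k (~~ k :: ew k n).

Let inc_lin k n : lin_on setT (@inc k n). Proof. exact: (hsum_lin (S1 k)) (word_idx_ew k n). Qed.
Let inc1_lin k n : lin_on setT (@inc1 k n). Proof. exact: (hsum_lin (S2 k)) (word_idx_ew1 k n). Qed.
Let ten1_linr k n x : lin_on core (@ten1 k n x).
Proof. exact: tensor_lin_r (rep_head k n) (T1 k n) (core_csub k (ew k n)). Qed.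
Let ten1_linl k n h : core h -> lin_on setT (fun x => @ten1 k n x h).
Proof. exact: tensor_lin_l (rep_head k n) (T1 k n). Qed.
Let ten2_linr k n x : lin_on core (@ten2 k n x).
Proof. exact: tensor_lin_r (rep_head1 k n) (T2 k n) (core_csub k (~~ k :: ew k n)). Qed.
Let ten2_linl k n h : core h -> lin_on setT (fun x => @ten2 k n x h).
Proof. exact: tensor_lin_l (rep_head1 k n) (T2 k n). Qed.

Let u_lin k : lin_on setT (@whu _ _ _ _ _ _ _ H k).
Proof.
have [ua uk _] := whu_unitary H k; apply: (lin_on_adj (C := 1) ua) => // x.
rewrite mul1r -(@ler_pXn2r _ 2)// ?nnegrE ?nr_ge0//.
by rewrite -!nr_hdot ua uk.
Qed.

Lemma gcore_csub k : is_csub (@gcore _ _ _ _ K k). Proof. exact: clspan_csub. Qed.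

Lemma gcore_rep k a : E k a = 0 -> @gcore _ _ _ _ K k (grep a (eta k)).
Proof. by move=> a0; apply: sub_clspan; exists a, cone; rewrite ract1. Qed.

Let ten_core1 k n x h : gcore x -> core h -> core (@ten1 k n x h).
Proof. by move=> gx ch; apply: sub_clspan; exists x, h. Qed.

Let ten_core2 k n x h : gcore x -> core h -> core (@ten2 k n x h).
Proof. by move=> gx ch; apply: sub_clspan; exists x, h. Qed.

(** [whu_core] gives this for rho_k(a) eta_k (x) h with E a = 0. Coefficients in B are absorbed into
    a, and both sides are bounded and linear on the core. *)
Let u_inc k n h : core h -> whu (@inc k n h) = inc1 (ten1 (eta (~~ k)) h).
Proof.
case: n h => [h _|n]; first exact: whu_nil.
apply: (csub_eqY (f := fun h => whu (@inc k n.+1 h))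
  (g := fun h => inc1 (@ten1 k n.+1 (eta (~~ k)) h)) (core_csub k (ew k n.+1))).
- exact: lin_on_sub (fun _ _ => I) (lin_on_compT (inc_lin k n.+1) (u_lin k)).
- exact: lin_on_compT (@ten1_linr k n.+1 (eta (~~ k))) (inc1_lin k n.+1).
move=> _ [x [h [gx ch ->]]]; split; first exact: ten_core2.
move: x gx; apply: (csub_eqY (f := fun x => whu (@inc k n.+1 (@ten2 k n x h)))
  (g := fun x => inc1 (@ten1 k n.+1 (eta (~~ k)) (@ten2 k n x h))) (gcore_csub k)).
- exact: lin_on_sub (fun _ _ => I) (lin_on_compT (ten2_linl ch) (lin_on_compT (inc_lin k n.+1) (u_lin k))).
- have c2 x : gcore x -> core (@ten2 k n x h) := fun gx => ten_core2 gx ch.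
  exact: (lin_on_comp (lin_on_sub (fun _ _ => I) (ten2_linl ch)) c2
    (lin_on_compT (@ten1_linr k n.+1 (eta (~~ k))) (inc1_lin k n.+1))).
move=> _ [a [b [a0 ->]]].
have ab0 : E k (a ** iota k b) = 0 by rewrite (E_r E_cond) a0 cmul0l.
rewrite (gvec_span E_cond); split; first exact: gcore_rep.
exact: (whu_core H (word_idx_ew k n.+1) ch ab0).
Qed.

(** [whu_base] at b = 1 says that u removes a leading eta_k, so its inverse inserts one. *)
Let uadj_inc1 k n h : core h -> whu_adj (@inc1 k n h) = @inc k n.+1 (ten2 (eta k) h).
Proof.
move=> ch; have [_ uk vk] := whu_unitary H k.
have := whu_base H cone (word_idx_ew k n.+1) ch.
rewrite !shom1 (grep_unital (K k)).2 (wact_rep W (word_idx_ew1 k n)).2 => h1.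
by rewrite -[RHS]uk; congr whu_adj; symmetry; exact: h1.
Qed.

(* A letter of the opposite algebra creates two tensor factors. *)
Let pi_step k n (a : A (~~ k)) h : E (~~ k) a = 0 -> core h ->
  pi k (inj (~~ k) a) (@inc k n h) = @inc k n.+1 (ten2 (eta k) (ten1 (grep a (eta (~~ k))) h)).
Proof.
move=> a0 ch; have [_ _ ->] := pi_vertex k.
rewrite u_inc// /inc1 (whact_inc H _ _ (word_idx_ew1 k n)) /ten1.
rewrite (wact_cons _ _ (word_idx_ew1 k n))//.
by rewrite -/(inc1 _) uadj_inc1//; apply: ten_core1 => //; exact: gcore_rep.
Qed.

Let pi_same k n (a : A k) x h : core h ->
  pi k (inj k a) (@inc k n.+1 (ten2 x h)) = @inc k n.+1 (ten2 (grep a x) h).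
Proof.
move=> ch; have [_ -> _] := pi_vertex k.
rewrite /inc (whact_inc H _ _ (word_idx_ew k n.+1)).
by congr whinc; rewrite /ten2; exact: (wact_cons a x (word_idx_ew k n.+1) ch).
Qed.

Definition vac k : whsum H k k := whinc H k (s := [::]) (cone : A k).

Lemma vac_norm k : hdot (vac k) (vac k) = (cone : A k).
Proof.
rewrite /vac (hsum_iso (S1 k) _ _ (word_idx_ew k 0)).
by rewrite -[LHS]/(star (cone : A k) ** cone) cmul1r star1.
Qed.

Lemma pi_vac k a : pi k (inj k a) (vac k) = ract (vac k) a.
Proof.
have [_ -> _] := pi_vertex k.
rewrite /vac (whact_inc H _ _ (word_idx_ew k 0)) wact_nil cmul1r.
rewrite -(hsum_M (S1 k) _ _ (word_idx_ew k 0)); congr whinc.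
by rewrite -[RHS]/(cone ** a) cmul1l.
Qed.

Let redw_vac i j x : redw E inj i j x -> forall k, j = ~~ k ->
  (i = ~~ k -> exists n h, core h /\ pi k x (vac k) = @inc k n.+1 (ten2 (eta k) h)) /\
  (i = k -> exists n h, core h /\ pi k x (vac k) = @inc k n.+1 h).
Proof.
elim=> [i0 a a0 k ik|i0 j0 a y a0 ry IH k jk].
  subst i0; split=> [_|ik]; last by exfalso; case: (k) ik.
  exists 0%N, (ten1 (n := 0%N) (grep a (eta (~~ k))) (cone : A k)); split.
    by apply: ten_core1 => //; exact: gcore_rep.
  by rewrite -(pi_step (n := 0%N)).
have rep := (pi_vertex k).
have repk : star_rep (pi k) by case: rep => -[].
have [IH1 IH2] := IH k jk; split=> ik.
  have [|n [h [ch hE]]] := IH2; first by rewrite ik negbK.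
  subst i0.
  exists n.+1, (ten1 (grep a (eta (~~ k))) h); split.
    by apply: ten_core1 => //; exact: gcore_rep.
  by rewrite (repM repk) hE pi_step.
have [|n [h [ch hE]]] := IH1; first by rewrite ik.
subst i0.
exists n, (ten2 (grep a (eta k)) h); split.
  by apply: ten_core2 => //; exact: gcore_rep.
by rewrite (repM repk) hE pi_same.
Qed.

Definition vexp k (x : Af) : A k := hdot (vac k) (pi k x (vac k)).

Lemma vexp_redw i j x k : redw E inj i j x -> j = ~~ k -> vexp k x = 0.
Proof.
move=> rx jk; have [h1 h2] := redw_vac rx jk; rewrite /vexp.
have [n [h ->]] : exists n h, pi k x (vac k) = @inc k n.+1 h.
  have [ik|ik] : i = ~~ k \/ i = k by case: (i) (k) => [] []; [right|left|left|right].
    by have [n [h [_ ->]]] := h1 ik; exists n, (ten2 (eta k) h).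
  by have [n [h [_ ->]]] := h2 ik; exists n, h.
exact: (hsum_orth (S1 k) _ _ (word_idx_ew k 0) (word_idx_ew k n.+1)).
Qed.

Lemma vexp_inj k a : vexp k (inj k a) = a.
Proof. by rewrite /vexp pi_vac hdotMr vac_norm cmul1l. Qed.

Lemma pi_star_rep k : star_rep (pi k). Proof. by case: (pi_vertex k) => -[]. Qed.
Lemma pi_unital k : unital_rep (pi k). Proof. by case: (pi_vertex k). Qed.

Lemma vexp_r k x a : vexp k (x ** inj k a) = vexp k x ** a.
Proof.
rewrite /vexp (repM (pi_star_rep k)) pi_vac (padjM (rep_adj (pi_star_rep k) x)).
by rewrite hdotMr.
Qed.

Lemma vexp_star k x : vexp k (star x) = star (vexp k x).
Proof. by rewrite /vexp -hdotC (rep_adj (pi_star_rep k)). Qed.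

Lemma vexp_D k x y : vexp k (x + y) = vexp k x + vexp k y.
Proof. by rewrite /vexp (repD (pi_star_rep k)) hdotDr. Qed.

Lemma vexp_Z k (c : R[i]) x : vexp k (c *: x) = c *: vexp k x.
Proof. by rewrite /vexp (repZ (pi_star_rep k)) hdotZr. Qed.

Lemma vac_nr k : nr (vac k) <= 1.
Proof. by apply: nr_le_sq => //; rewrite vac_norm expr1n nr_cone. Qed.

Lemma vexp_nr k x : nr (vexp k x) <= nr (rep_shom (pi_unital k) x).
Proof.
rewrite /vexp; apply: le_trans (hdot_CS _ _) _.
have h := lop_nr (rep_shom (pi_unital k) x) (vac k); rewrite rep_shomE in h.
have := vac_nr k; have := nr_ge0 (vac k); have := nr_ge0 (pi k x (vac k)).
have := nr_ge0 (rep_shom (pi_unital k) x); nra.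
Qed.

Definition vspan k : set (whsum H k k) :=
  clspan [set z | exists x a, z = ract (pi k x (vac k)) a].

Let vspan_pi k x z : @vspan k z -> @vspan k (pi k x z).
Proof.
have rep := pi_star_rep k.
move: z; apply: (csub_preT (f := pi k x) (lin_on_rep x rep) (clspan_csub _)).
move=> _ [y [a ->]]; rewrite (padjM (rep_adj rep x)) -(repM rep).
by apply: sub_clspan; exists (x ** y), a.
Qed.

(** By induction on the degree: [pi_step] produces the vectors with leading factor eta_k, [pi_same]
    replaces eta_k by rho_k(a) eta_k, and these are total in K_k. *)
Lemma vac_cyclic k : @vspan k = setT.
Proof.
have G n h : @vspan k (@inc k n h).
  elim: n h => [|n IH] h.
    apply: sub_clspan; exists cone, h; rewrite (pi_unital k).2 /vac.
    rewrite -(hsum_M (S1 k) _ _ (word_idx_ew k 0)); congr whinc.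
    by rewrite -[RHS]/(cone ** h) cmul1l.
  have eta_case h' : core h' -> @vspan k (@inc k n.+1 (ten2 (eta k) h')).
    apply: (csub_preY (f := fun h' => @inc k n.+1 (@ten2 k n (eta k) h'))
      (core_csub k (~~ k :: ew k n))).
    - exact: lin_on_compT (@ten2_linr k n (eta k)) (inc_lin k n.+1).
    - exact: clspan_csub.
    move=> _ [x [h2 [gx ch ->]]]; split; first exact: ten_core1.
    move: x gx; apply: (csub_preY
      (f := fun x => @inc k n.+1 (@ten2 k n (eta k) (@ten1 k n x h2))) (gcore_csub (~~ k))).
    - have c1 x : gcore x -> core (@ten1 k n x h2) := fun gx => ten_core1 gx ch.
      exact: (lin_on_comp (lin_on_sub (fun _ _ => I) (ten1_linl ch)) c1
        (lin_on_compT (@ten2_linr k n (eta k)) (inc_lin k n.+1))).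
    - exact: clspan_csub.
    move=> _ [a [b [a0 ->]]].
    have ab0 : E (~~ k) (a ** iota (~~ k) b) = 0 by rewrite (E_r E_cond) a0 cmul0l.
    rewrite (gvec_span E_cond); split; first exact: gcore_rep.
    by rewrite -/(ten1 _ _) -pi_step//; apply: vspan_pi; exact: IH.
  have : clspan [set z | exists x y, core y /\ z = @ten2 k n x y] h by rewrite (T2 k n).2.
  move: h; apply: (csub_preT (inc_lin k n.+1) (clspan_csub _)).
  move=> _ [x [h [ch ->]]].
  have : clspan [set z | exists a b, z = ract (grep a (eta k)) b] x by rewrite (gvec_cyclic (K k)).
  move: x; apply: (csub_preT (f := fun x => @inc k n.+1 (ten2 x h))).
  - exact: lin_on_compT (ten2_linl ch) (inc_lin k n.+1).
  - exact: clspan_csub.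
  move=> _ [a [b ->]]; rewrite (gvec_span E_cond) -pi_same//.
  by apply: vspan_pi; exact: eta_case.
rewrite -subTset => z _.
have [_ _ cl] := S1 k; have : clspan [set z | exists i x, word_idx k k i /\ z = whinc H k (s := i) x] z.
  by rewrite cl.
apply: clspan_min => {}z [s [x [ws ->]]].
by have [n sn] := ew_surj ws; rewrite sn in x ws *; exact: G.
Qed.

End VertexWords.

Section ReducedWords.
Context {R : realType} {B : cstarAlgType R} {A : bool -> cstarAlgType R}.
Context {iota : forall k, starHom B (A k)} {E : forall k, {linear A k -> B}}.
Context {Af : cstarAlgType R} {inj : forall k, starHom (A k) Af}.
Hypothesis E_cond : forall k, conditional_expectation (iota k) (E k).
Hypothesis Es : forall k a, E k (star a) = star (E k a).
Hypothesis full : is_full_amalgam iota inj.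

Local Notation rw := (redw E inj).

Lemma inj_iota k l b : inj k (iota k b) = inj l (iota l b).
Proof. by case: k l => [] []; rewrite ?full.1. Qed.

Lemma redw_first i j x : rw i j x ->
  (exists a, [/\ E i a = 0, j = i & x = inj i a]) \/
  (exists a y, [/\ E i a = 0, rw (~~ i) j y & x = inj i a ** y]).
Proof. by case=> [k a a0|k l a y a0 ry]; [left; exists a|right; exists a, y]. Qed.

Lemma redw_l i j x b : rw i j x -> rw i j (inj i (iota i b) ** x).
Proof.
case=> [k a a0|k l a y a0 ry].
  by rewrite -shomM; apply: redw1; rewrite (E_l E_cond) a0 cmul0r.
by rewrite cmulA -shomM; apply: redwS => //; rewrite (E_l E_cond) a0 cmul0r.
Qed.

Lemma redw_cat i j x : rw i j x -> forall l y, rw (~~ j) l y -> rw i l (x ** y).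
Proof.
elim=> [k a a0|k l a z a0 rz IH] m y ry; first exact: redwS.
by rewrite -cmulA; apply: redwS => //; exact: IH.
Qed.

Lemma redw_star i j x : rw i j x -> rw j i (star x).
Proof.
elim=> [k a a0|k l a y a0 ry IH].
  by rewrite -shom_star; apply: redw1; rewrite Es a0 star0.
rewrite starM; apply: (redw_cat IH); rewrite negbK -shom_star; apply: redw1.
by rewrite Es a0 star0.
Qed.

Lemma redw_last i j x : rw i j x ->
  (exists a, [/\ E j a = 0, i = j & x = inj j a]) \/
  (exists y a, [/\ rw i (~~ j) y, E j a = 0 & x = y ** inj j a]).
Proof.
move=> /redw_star/redw_first[[a [a0 ij xE]]|[a [y [a0 ry xE]]]].
  left; exists (star a); split=> //; first by rewrite Es a0 star0.
  by rewrite shom_star -xE starK.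
right; exists (star y), (star a); split; first exact: redw_star.
  by rewrite Es a0 star0.
by rewrite shom_star -starM -xE starK.
Qed.

Let words_set : set Af :=
  [set x | (exists b, x = inj true (iota true b)) \/ (exists i j, rw i j x)].

Let S_inj k a : clspan words_set (inj k a).
Proof.
rewrite (centreE (iota := iota) (E := E) a) linearD; apply: clspanD; apply: sub_clspan.
  by right; exists k, k; apply: redw1; rewrite (E_centre E_cond).
by left; exists (E k a); exact: inj_iota.
Qed.

(** A letter that meets a first letter from the same algebra is multiplied with it and centred
    again: the centred part continues the reduced word, and the expectation, being in B, is absorbed
    by the next letter. *)
Let S_injM k a x : clspan words_set x -> clspan words_set (inj k a ** x).
Proof.
move: x; apply: (clspan_map (f := fun x => inj k a ** x) (C := nr (inj k a))).
- exact: cmulDr.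
- by move=> c x; exact: cmulZr.
- exact: nrM.
move=> x [[b ->]|[i [j rx]]]; first by rewrite (inj_iota true k) -shomM; exact: S_inj.
have iotaM b i' j' y : rw i' j' y -> clspan words_set (inj k (iota k b) ** y).
  by move=> ry; apply: sub_clspan; right; exists i', j'; rewrite (inj_iota k i'); exact: redw_l.
have [ik|ik] : i = ~~ k \/ i = k by case: (i) (k) => [] []; [right|left|left|right].
  rewrite (centreE (iota := iota) (E := E) a) linearD cmulDl; apply: clspanD; last exact: iotaM rx.
  apply: sub_clspan; right; exists k, j; apply: redwS; rewrite -?ik//.
  exact: (E_centre E_cond).
move: rx; rewrite ik => /redw_first[[a1 [_ _ ->]]|[a1 [y [_ ry ->]]]].
  by rewrite -shomM; exact: S_inj.
rewrite cmulA -shomM; set a2 := a ** a1.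
rewrite (centreE (iota := iota) (E := E) a2) linearD cmulDl; apply: clspanD; last exact: iotaM ry.
by apply: sub_clspan; right; exists k, j; apply: redwS => //; exact: (E_centre E_cond).
Qed.

Lemma amalgam_redw_ind (P : set Af) : is_csub P -> (forall b, P (inj true (iota true b))) ->
  (forall i j x, rw i j x -> P x) -> forall x, P x.
Proof.
move=> HP Pb Pr x.
suff Sx : clspan words_set x.
  by apply: (csub_clspan HP _ Sx) => y [[b ->]|[i [j ry]]]; [exact: Pb|exact: Pr ry].
(* Left multiplication by y and by its adjoint preserve the closed span of the words; the adjoint is
   included so that [Q] is closed under [star]. *)
pose Q y := (forall z, clspan words_set z -> clspan words_set (y ** z)) /\
  (forall z, clspan words_set z -> clspan words_set (star y ** z)).
suff [h _] : Q x.
  rewrite -[x]cmul1r; apply: h; apply: sub_clspan; left; exists cone.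
  by rewrite !shom1.
apply: (full_amalgam_ind full (P := Q)); last first.
  by move=> k a; split=> z Sz; rewrite -?shom_star; exact: S_injM.
split.
- by split=> z Sz; rewrite ?star1 cmul1l.
- move=> a b [a1 a2] [b1 b2]; split=> z Sz; rewrite ?starD cmulDl; apply: clspanD; by [apply: a1|apply: b1|apply: a2|apply: b2].
- move=> c a [a1 a2]; split=> z Sz; rewrite ?starZ cmulZl; apply: clspanZ; by [apply: a1|apply: a2].
- move=> a b [a1 a2] [b1 b2]; split=> z Sz; rewrite ?starM -cmulA; by [apply: a1; apply: b1|apply: b2; apply: a2].
- by move=> a [a1 a2]; split=> // z Sz; rewrite starK; exact: a1.
move=> u l hu ul; split=> z Sz.
  by apply: clspan_cvs _ (cvs_mulr z ul) => n; case: (hu n) => + _; exact.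
by apply: clspan_cvs _ (cvs_mulr z (cvs_star ul)) => n; case: (hu n) => _; exact.
Qed.

End ReducedWords.

(** * Norm bounds from dense sets of vectors *)

Section DenseBound.
Context {R : realType}.

(** Bernoulli's inequality together with n <= 2^n. *)
Lemma pow2_bounded (r C : R) : 0 <= r -> (forall n, r ^+ (2 ^ n) <= C) -> r <= 1.
Proof.
move=> r0 h; rewrite leNgt; apply/negP => r1.
have bern n : 1 + n%:R * (r - 1) <= r ^+ n.
  elim: n => [|n IH]; first by rewrite mul0r addr0 expr0.
  rewrite exprS -[n.+1]add1n natrD.
  have n0 : (0 : R) <= n%:R by [].
  have h1 : r * (1 + n%:R * (r - 1)) <= r * r ^+ n by rewrite ler_wpM2l.
  apply: le_trans h1; have := mulr_ge0 n0 (sqr_ge0 (r - 1)); rewrite expr2; lra.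
have r2 : 0 < r - 1 by rewrite subr_gt0.
have [n hn] : exists n : nat, C / (r - 1) < n%:R.
  by exists (Num.truncn (C / (r - 1))).+1; exact: truncnS_gt.
rewrite ltr_pdivrMr// in hn.
have := bern (2 ^ n)%N; have := h n.
have : n%:R <= (2 ^ n)%:R :> R by rewrite ler_nat ltnW// ltn_expl.
move=> h1 h2 h3; nra.
Qed.

Context {D Af L : cstarAlgType R} {F : hilbertModType D}.
Context {sigma : Af -> F -> F} (ell : starHom Af L).
Hypothesis rep : star_rep sigma.

Definition ell_bounded (z : F) : Prop :=
  exists2 C : R, 0 <= C & forall x, nr (sigma x z) <= C * nr (ell x).

Lemma ell_boundedD y z : ell_bounded y -> ell_bounded z -> ell_bounded (y + z).
Proof.
move=> [C C0 hC] [C' C0' hC']; exists (C + C'); first exact: addr_ge0.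
move=> x; rewrite (padjD (rep_adj rep x)); apply: le_trans (nrD _ _) _.
by rewrite mulrDl lerD.
Qed.

Lemma ell_boundedZ (c : R[i]) z : ell_bounded z -> ell_bounded (c *: z).
Proof.
move=> [C C0 hC]; exists (cn c * C); first by rewrite mulr_ge0 ?cn_ge0.
by move=> x; rewrite (padjZ (rep_adj rep x)) nrZ -mulrA ler_wpM2l ?cn_ge0.
Qed.

Lemma ell_boundedM d z : ell_bounded z -> ell_bounded (ract z d).
Proof.
move=> [C C0 hC]; exists (C * nr d); first by rewrite mulr_ge0 ?nr_ge0.
move=> x; rewrite (padjM (rep_adj rep x)); apply: le_trans (nr_ract _ _) _.
by rewrite mulrAC ler_wpM2r ?nr_ge0.
Qed.

Lemma ell_bounded_rep a z : ell_bounded z -> ell_bounded (sigma a z).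
Proof.
move=> [C C0 hC]; exists (C * nr (ell a)); first by rewrite mulr_ge0 ?nr_ge0.
move=> x; rewrite -(repM rep); apply: le_trans (hC _) _.
by rewrite shomM -mulrA ler_wpM2l// mulrC nrM.
Qed.

(* |T z|^(2^n) <= |z|^(2^n - 1) |T^(2^n) z| for T selfadjoint, so only the growth
   of the powers matters and the constants C disappear. *)
Lemma ell_bounded_contract z : ell_bounded z -> forall x, nr (sigma x z) <= nr (ell x) * nr z.
Proof.
move=> [C C0 hC] x; set t := nr (ell x) ^+ 2.
have [z0|z0] := leP (nr z) 0.
  rewrite (nr_le0 z0) (padj0 (rep_adj rep x)) nr0 mulr0//.
have [t0|t0] := leP (nr (ell x)) 0.
  by have := hC x; have := nr_ge0 (ell x); have := nr_ge0 (sigma x z); nra.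
pose T n := iter n (fun y : Af => y ** y) (star x ** x).
have Ts n : star (T n) = T n.
  by elim: n => [|n IH] /=; rewrite starM ?starK// IH.
have Tl n : nr (ell (T n)) <= t ^+ (2 ^ n).
  elim: n => [|n IH] /=; first by rewrite expr1 shomM shom_star nr_starM.
  rewrite shomM expnS mulnC exprM expr2; apply: le_trans (nrM _ _) _.
  by apply: ler_pM => //; exact: nr_ge0.
have sq n : nr (sigma (T n) z) ^+ 2 <= nr z * nr (sigma (T n.+1) z).
  rewrite -nr_hdot (rep_adj rep) Ts -(repM rep); exact: hdot_CS.
set b := nr (sigma (T 0%N) z) / (nr z * t).
have tp : 0 < t by rewrite exprn_gt0.
have b0 : 0 <= b by rewrite divr_ge0 ?nr_ge0// mulr_ge0// ltW.
have grow n : (nr (sigma (T 0%N) z) / nr z) ^+ (2 ^ n) <= nr (sigma (T n) z) / nr z.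
  elim: n => [|n IH]; first by rewrite expr1.
  rewrite expnS mulnC exprM.
  have h1 : ((nr (sigma (T 0%N) z) / nr z) ^+ (2 ^ n)) ^+ 2 <= (nr (sigma (T n) z) / nr z) ^+ 2.
    by rewrite ler_pXn2r// nnegrE ?exprn_ge0// divr_ge0 ?nr_ge0// ltW.
  apply: le_trans h1 _; rewrite expr_div_n expr2 -expr2 ler_pdivlMr// mulrAC ler_pdivrMr ?exprn_gt0//.
  have := sq n; rewrite (expr2 (nr z)) => h2.
  have z1 : 0 <= nr z := ltW z0.
  nra.
have b1 : b <= 1.
  apply: (@pow2_bounded _ (C / nr z)) => // n.
  have := grow n; have hT := hC (T n); have hl := Tl n.
  have -> : b = nr (sigma (T 0%N) z) / nr z / t by rewrite /b invfM mulrA.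
  move=> h; rewrite expr_div_n ler_pdivrMr ?exprn_gt0//; apply: le_trans h _.
  rewrite mulrAC ler_pM2r ?invr_gt0//; apply: le_trans hT _.
  by rewrite ler_wpM2l.
move: b1; rewrite ler_pdivrMr ?mulr_gt0// mul1r => h.
apply: nr_le_sq; first by rewrite mulr_ge0 ?nr_ge0.
rewrite (rep_adj rep) -(repM rep); apply: le_trans (hdot_CS _ _) _.
apply: le_trans (ler_wpM2l (ltW z0) h) _.
by rewrite /t exprMn le_eqVlt; apply/orP; left; apply/eqP; ring.
Qed.

(** The constants of [ell_bounded] vary with the vector and would be lost in a limit. Finite
    combinations of X are bounded with the constant 1 by [ell_bounded_contract], and this bound
    passes to the closure. *)
Lemma dense_bound (X : set F) : (forall z, X z -> ell_bounded z) -> clspan X = setT ->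
  forall x z, nr (sigma x z) <= nr (ell x) * nr z.
Proof.
move=> XC cl x z; have : clspan X z by rewrite cl.
move=> /closure_cvs[u hu uz].
have lx := lin_on_rep x rep.
have h := lin_on_cvs (csubT F) lx (fun=> I) uz.
apply/ler_addgt0Pr => e e0.
have L1 : 0 < nr (ell x) + 1 by rewrite ltr_pwDr// nr_ge0.
have [N hN] := uz _ (divr_gt0 e0 L1).
apply: (cvs_le h); exists N => n /hN; rewrite ltr_pdivlMr// => hn.
have ub : ell_bounded (u n).
  have [m [c [f [fX ->]]]] := hu n.
  elim/big_ind: _ => [|y y'|i _]; [|exact: ell_boundedD|].
    exists 0 => // y; rewrite (padj0 (rep_adj rep y)) nr0 mul0r//.
  by apply: ell_boundedZ; apply: XC.
apply: le_trans (ell_bounded_contract ub x) _.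
have := nrD z (u n - z); rewrite addrC subrK => h1.
have := nr_ge0 (ell x); have := nr_ge0 (u n - z); nra.
Qed.

End DenseBound.

(** * Extension of homomorphisms by continuity, and rank one operators *)

Section HomExtension.
Context {R : realType} {Af T L : cstarAlgType R} (ell : starHom Af T) (g : starHom Af L).
Hypothesis ell_dense : dense (range ell).
Hypothesis bound : forall x, nr (g x) <= nr (ell x).

Lemma dense_range_cvs t : exists u : nat -> Af, cvs (fun n => ell (u n)) t.
Proof.
have /denseP dl := ell_dense.
have /choice[u hu] : forall n : nat, exists x, nr (t - ell x) < n.+1%:R^-1.
  by move=> n; have [|_ [x _ <-] h] := dl t n.+1%:R^-1; [rewrite invr_gt0|exists x].
exists u => e /inv_succ_lt[N hN]; exists N => n /hN; apply: lt_trans.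
by rewrite nr_dist.
Qed.

Let lim t : exists l, forall u, cvs (fun n => ell (u n)) t -> cvs (fun n => g (u n)) l.
Proof.
have [u hu] := dense_range_cvs t.
have gB x y : nr (g x - g y) <= nr (ell x - ell y) by rewrite -!linearB bound.
have [|l hl] := @cvs_ex _ _ (fun n => g (u n)).
  move=> e e0; have [N hN] := cvs_cauchy hu e0; exists N => m n Nm Nn.
  by apply: le_lt_trans (gB _ _) _; exact: hN.
exists l => v hv e e0; have e3 : 0 < e / 3 by rewrite divr_gt0.
have [N1 h1] := hl _ e3; have [N2 h2] := hu _ e3; have [N3 h3] := hv _ e3.
exists (maxn N1 (maxn N2 N3)) => n; rewrite !geq_max => /andP[/h1 a1 /andP[/h2 a2 /h3 a3]].
have E : e = (e / 3 + e / 3) + e / 3 by field.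
apply: le_lt_trans (nr_tri _ (g (u n)) _) _; rewrite E ltrD//.
apply: le_lt_trans (gB _ _) _; apply: le_lt_trans (nr_tri _ t _) _.
by rewrite (nr_dist t) ltrD.
Qed.

Let G t : L := projT1 (cid (lim t)).
Let GP t u : cvs (fun n => ell (u n)) t -> cvs (fun n => g (u n)) (G t).
Proof. by rewrite /G; case: cid => l /= h; exact: h. Qed.

Let G_ext t l u : cvs (fun n => ell (u n)) t -> cvs (fun n => g (u n)) l -> G t = l.
Proof. by move=> /GP h1 h2; exact: cvs_uniq h1 h2. Qed.

Let G_lin : linear G.
Proof.
move=> c s t; have [u hu] := dense_range_cvs s; have [v hv] := dense_range_cvs t.
have Z (V : normedModType R[i]) (w : nat -> V) l : cvs w l -> cvs (fun n => c *: w n) (c *: l).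
  move=> wl; apply: (@cvs_lip _ _ _ ( *:%R c) (cn c)) wl => x y.
  by rewrite -scalerBr nrZ.
apply: (G_ext (u := fun n => c *: u n + v n)).
  have := cvsD (Z _ _ _ hu) hv; congr cvs; apply/funext => n; by rewrite linearP.
have := cvsD (Z _ _ _ (GP hu)) (GP hv); congr cvs; apply/funext => n; by rewrite linearP.
Qed.

HB.instance Definition _ := GRing.isLinear.Build R[i] T L *:%R G G_lin.

Let cvsM (C : cstarAlgType R) (a b : nat -> C) x y : cvs a x -> cvs b y ->
  cvs (fun n => a n ** b n) (x ** y).
Proof.
move=> ha hb e e0.
have [M M0 [N0 hM]] := cvs_nr 0 ha.
have y1 : 0 < nr y + 1 by rewrite ltr_pwDr// nr_ge0.
have e2 : 0 < e / 2 by rewrite divr_gt0.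
have [N1 h1] := ha _ (divr_gt0 e2 y1); have [N2 h2] := hb _ (divr_gt0 e2 M0).
exists (maxn N0 (maxn N1 N2)) => n; rewrite !geq_max => /andP[/hM a0 /andP[/h1 a1 /h2 a2]].
have -> : a n ** b n - x ** y = a n ** (b n - y) + (a n - x) ** y.
  by rewrite cmulBr cmulBl addrA subrK.
apply: le_lt_trans (nrD _ _) _; rewrite (splitr e); apply: ltrD.
  apply: le_lt_trans (nrM _ _) _; rewrite ltr_pdivlMr// in a2; apply: le_lt_trans a2.
  by rewrite mulrC ler_wpM2l ?nr_ge0.
apply: le_lt_trans (nrM _ _) _; rewrite ltr_pdivlMr// in a1; apply: le_lt_trans a1.
by rewrite ler_wpM2l ?nr_ge0// lerDl.
Qed.

Let GM s t : G (s ** t) = G s ** G t.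
Proof.
have [u hu] := dense_range_cvs s; have [v hv] := dense_range_cvs t.
apply: (G_ext (u := fun n => u n ** v n)).
  have := cvsM hu hv; congr cvs; apply/funext => n; by rewrite shomM.
have := cvsM (GP hu) (GP hv); congr cvs; apply/funext => n; by rewrite shomM.
Qed.

Let G_ell x : G (ell x) = g x.
Proof. by apply: (G_ext (u := fun=> x)); exact: cvs_cst. Qed.

Let G1 : G cone = cone. Proof. by rewrite -(shom1 ell) G_ell shom1. Qed.

Let G_star t : G (star t) = star (G t).
Proof.
have [u hu] := dense_range_cvs t.
apply: (G_ext (u := fun n => star (u n))).
  have := cvs_star hu; congr cvs; apply/funext => n; by rewrite shom_star.
have := cvs_star (GP hu); congr cvs; apply/funext => n; by rewrite shom_star.
Qed.

Definition shom_ext : starHom T L := StarHom GM G1 G_star.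
Lemma shom_extE x : shom_ext (ell x) = g x. Proof. exact: G_ell. Qed.

End HomExtension.

Section RankOne.
Context {R : realType} {D : cstarAlgType R} {E : hilbertModType D}.

Lemma rank1_adj (F : hilbertModType D) (x : F) (y : E) :
  adjoint_pair (fun z => ract x (hdot y z)) (fun z => ract y (hdot x z)).
Proof. by move=> z w; rewrite hdotMl hdotMr -hdotC. Qed.

Lemma rank1_bound (F : hilbertModType D) (x : F) (y z : E) :
  nr (ract x (hdot y z)) <= nr x * nr y * nr z.
Proof.
by apply: le_trans (nr_ract _ _) _; rewrite -mulrA ler_wpM2l ?nr_ge0// hdot_CS.
Qed.

Definition rank1 (x y : E) : lop E :=
  Lop (lop_of (rank1_adj x y) (mulr_ge0 (nr_ge0 x) (nr_ge0 y)) (rank1_bound x y)).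

Lemma rank1E x y z : rank1 x y z = ract x (hdot y z). Proof. by []. Qed.

Lemma star_rank1 x y : star (rank1 x y) = rank1 y x.
Proof. by apply: lop_star_uniq; exact: rank1_adj. Qed.

Lemma lop_rank1 (T : lop E) x y : T ** rank1 x y = rank1 (T x) y.
Proof. by apply: lop_ext => z; rewrite lopME !rank1E (padjM (lop_adj T)). Qed.

Lemma rank1_lop (T : lop E) x y : rank1 x y ** T = rank1 x (star T y).
Proof.
by apply: lop_ext => z; rewrite lopME !rank1E -{1}[T]starK -lop_adj.
Qed.

Lemma rank1M x y z w : rank1 x y ** rank1 z w = rank1 (ract x (hdot y z)) w.
Proof. by rewrite lop_rank1. Qed.

Lemma rank1_act x y d : rank1 (ract x d) y = rank1 x (ract y (star d)).
Proof.
by apply: lop_ext => z; rewrite !rank1E hdotMl starK ractM.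
Qed.

End RankOne.

Record vertex_data (R : realType) := VertexData {
  vB : cstarAlgType R;
  vA : bool -> cstarAlgType R;
  viota : forall k, starHom vB (vA k);
  vE : forall k, {linear vA k -> vB};
  vAf : cstarAlgType R;
  vinj : forall k, starHom (vA k) vAf;
  vK : forall k, gns vE k;
  vW : words viota vK;
  vH : word_sums vW;
  vpi : forall k, vAf -> whsum vH k k -> whsum vH k k;
  vAv : cstarAlgType R;
  vlam : starHom vAf vAv;
  vE_cond : forall k, conditional_expectation (viota k) (vE k);
  vfull : is_full_amalgam viota vinj;
  vpi_vertex : is_vertex_rep vinj vpi;
  vcompletion : is_separation_completion (vertex_norm vpi) vlam
}.

(** * The rotated representations *)

Section ShomConj.
Context {R : realType} {A L : cstarAlgType R} (f : starHom A L) (u : L).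
Hypotheses (uu : star u ** u = cone) (uu' : u ** star u = cone).
Let h a := u ** f a ** star u.
Let h_lin : linear h.
Proof. by move=> c a b; rewrite /h linearP cmulDr cmulDl cmulZr cmulZl. Qed.
HB.instance Definition _ := GRing.isLinear.Build R[i] A L *:%R h h_lin.
Let hM a b : h (a ** b) = h a ** h b.
Proof. by rewrite /h shomM -!cmulA (cmulA (star u) u) uu cmul1l. Qed.
Let h1 : h cone = cone. Proof. by rewrite /h shom1 cmul1r. Qed.
Let hs a : h (star a) = star (h a).
Proof. by rewrite /h !starM starK shom_star cmulA. Qed.
Definition shom_conj : starHom A L := StarHom hM h1 hs.
Lemma shom_conjE a : shom_conj a = u ** f a ** star u. Proof. by []. Qed.
End ShomConj.

Section VertexData.
Context {R : realType} (d : vertex_data R).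

Local Notation B := (vB d).
Local Notation A := (vA d).
Local Notation iota := (viota d).
Local Notation E := (vE d).
Local Notation Af := (vAf d).
Local Notation inj := (vinj d).
Local Notation pi := (vpi (v := d)).
Local Notation lam := (vlam d).
Local Notation rw := (redw E inj).

Let E_cond := vE_cond d.
Let full := vfull d.
Let piv := vpi_vertex d.
Let Es k a : E k (star a) = star (E k a). Proof. exact: (E_star (K := vK d)). Qed.

Definition pih k : starHom Af (lop (whsum (vH d) k k)) := rep_shom (pi_unital piv k).

Definition vac_ k : whsum (vH d) k k := vac (H := vH d) k.
(* The compression of pi_k to the vacuum vector, with values in A k. *)
Definition vx k (x : Af) : A k := hdot (vac_ k) (pih k x (vac_ k)).

Lemma vx_inj k a : vx k (inj k a) = a. Proof. exact: (vexp_inj piv). Qed.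
Lemma vx_r k x a : vx k (x ** inj k a) = vx k x ** a. Proof. exact: (vexp_r piv). Qed.
Lemma vx_star k x : vx k (star x) = star (vx k x). Proof. exact: (vexp_star piv). Qed.
Lemma vx_redw i x k : rw i (~~ k) x -> vx k x = 0.
Proof. by move=> rx; exact: (vexp_redw E_cond piv rx). Qed.
Lemma vx_lin k : lin_on setT (vx k).
Proof.
split.
- by move=> x y _ _; exact: (vexp_D piv).
- by move=> c x _; exact: (vexp_Z piv).
by exists 1 => // x _; rewrite mul1r; apply: le_trans (vexp_nr piv k x) _; exact: shom_nr.
Qed.

Lemma pih_lam k x : nr (pih k x) <= nr (lam x).
Proof.
have [h _] := vcompletion d; have -> : nr (lam x) = vertex_norm pi x by rewrite /nr h.
have E0 k' : nr (pih k' x) = opnorm (@vpi _ d k' x).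
  rewrite nr_lopE /opn /opnorm; congr sup; apply/seteqP; split=> _ [z /= z1 <-];
  by exists z => //; move: z1; rewrite nrE -(rmorph1 (real_complex R)) lecR.
by rewrite E0 /vertex_norm le_max; case: k; rewrite lexx ?orbT.
Qed.

Lemma lam_pih (x : Af) (M : R) : (forall k, nr (pih k x) <= M) -> nr (lam x) <= M.
Proof.
have [h _] := vcompletion d; have -> : nr (lam x) = vertex_norm pi x by rewrite /nr h.
have E0 k' : nr (pih k' x) = opnorm (@vpi _ d k' x).
  rewrite nr_lopE /opn /opnorm; congr sup; apply/seteqP; split=> _ [z /= z1 <-];
  by exists z => //; move: z1; rewrite nrE -(rmorph1 (real_complex R)) lecR.
by move=> hM; rewrite /vertex_norm ge_max -!E0 !hM.
Qed.

Lemma vx_lam k x : nr (vx k x) <= nr (lam x).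
Proof. by apply: le_trans (vexp_nr piv k x) _; exact: pih_lam. Qed.

Lemma vac_span k :
  clspan [set z | exists x a, z = ract (pih k x (vac_ k)) a] = setT.
Proof. exact: (vac_cyclic E_cond piv). Qed.

Definition EB (x : Af) : B := E true (vx true x).

Lemma EB_lin : lin_on setT EB.
Proof.
apply: (lin_on_compT (vx_lin true)); split=> [x y _ _|c x _|].
- exact: linearD.
- by rewrite linearZ.
exists 1 => // x _; rewrite mul1r; exact: (E_nr (K := vK d) E_cond).
Qed.

Lemma EB_lam x : nr (EB x) <= nr (lam x).
Proof. by apply: le_trans (E_nr (K := vK d) E_cond _) (vx_lam _ _). Qed.

Definition iB : starHom B Af := shom_comp (inj true) (iota true).
Lemma iBE k b : iB b = inj k (iota k b).
Proof. by rewrite shom_compE; exact: (inj_iota full). Qed.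

Lemma EB_iota b : EB (iB b) = b.
Proof. by rewrite /EB (iBE true) vx_inj (E_iota E_cond). Qed.

Lemma EB_1 : EB cone = cone.
Proof. by rewrite -(shom1 iB) EB_iota. Qed.

Lemma EB_r x b : EB (x ** iB b) = EB x ** b.
Proof. by rewrite /EB (iBE true) vx_r (E_r E_cond). Qed.

Lemma EB_star x : EB (star x) = star (EB x).
Proof. by rewrite /EB vx_star Es. Qed.

(** A word that ends in [A false] is already killed by [vx true]. From one that ends in [A true] the
    last letter is split off; what remains is killed in the same way, unless the word is a single
    letter, which lies in the kernel of E. *)
Lemma EB_redw i j x : rw i j x -> EB x = 0.
Proof.
rewrite /EB; case: j => rx; last first.
  by rewrite (vx_redw (k := true) rx) linear0.
have [[a [a0 _ ->]]|[y [a [ry a0 ->]]]] := redw_last Es rx.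
  by rewrite vx_inj.
by rewrite vx_r (vx_redw (k := true) ry) cmul0l linear0.
Qed.

(** Complete positivity of [EB]: the coefficients are moved inside E by the bimodule property, where
    they meet a Gram matrix of vacuum translates. *)
Lemma EB_gram n (x : 'I_n -> Af) (c : 'I_n -> B) :
  cpos (\sum_i \sum_j star (c i) ** EB (star (x i) ** x j) ** c j).
Proof.
have -> : \sum_i \sum_j star (c i) ** EB (star (x i) ** x j) ** c j =
  E true (\sum_i \sum_j star (iota true (c i)) **
    hdot (pih true (x i) (vac_ true)) (pih true (x j) (vac_ true)) ** iota true (c j)).
  rewrite linear_sum; apply: eq_bigr => i _; rewrite linear_sum; apply: eq_bigr => j _.
  rewrite -shom_star (E_bimod E_cond) /EB /vx.
  congr (_ ** E true _ ** _); rewrite shomM shom_star lopME.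
  by rewrite [RHS]lop_adj.
apply: (E_pos E_cond); exact: gram_module_pos.
Qed.

Section Fock.
Context {Q : cstarAlgType R} (q : starHom Af Q).

Definition mu : starHom B Q := shom_comp q iB.

Let kk (x y : Af) : Q := mu (EB (star x ** y)).
Let kkC x y : kk y x = star (kk x y).
Proof. by rewrite /kk -shom_star -EB_star starM starK. Qed.
Let kk_pos (s : seq (Af * Q)) :
  cpos (\sum_(p <- s) \sum_(r <- s) star p.2 ** kk p.1 r.1 ** r.2).
Proof.
apply: cpos_seq_form => n x c; apply: gram_shom; last exact: EB_gram.
by move=> i j; rewrite -EB_star starM starK.
Qed.

(** Stated as an existence claim so that only the total family and its inner products are visible
    afterwards. *)
Let KQ_ex : exists (F : hilbertModType Q) (e : Af -> F), total e /\
  forall x y, hdot (e x) (e y) = mu (EB (star x ** y)).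
Proof.
exists (kmod (Kernel kkC kk_pos)), (kemb (Kernel kkC kk_pos)).
by split; [exact: kemb_total|exact: hdot_kemb].
Qed.

Definition KQ : hilbertModType Q := projT1 (cid KQ_ex).
Definition eK : Af -> KQ := projT1 (cid (projT2 (cid KQ_ex))).
Lemma hdot_eK x y : hdot (eK x) (eK y) = mu (EB (star x ** y)).
Proof. exact: (projT2 (cid (projT2 (cid KQ_ex)))).2. Qed.
Lemma eK_total : total eK. Proof. exact: (projT2 (cid (projT2 (cid KQ_ex)))).1. Qed.

Lemma eK_lin : lin_on setT eK.
Proof.
have EBD x y : EB (x + y) = EB x + EB y by exact: (lin_onD EB_lin).
have EBZ (c : R[i]) x : EB (c *: x) = c *: EB x by exact: (lin_onZ EB_lin).
split=> [x y _ _|c x _|].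
- apply: (total_ext eK_total) => z; rewrite hdotDr !hdot_eK cmulDr EBD.
  by rewrite linearD.
- apply: (total_ext eK_total) => z; rewrite hdotZr !hdot_eK cmulZr EBZ.
  by rewrite linearZ.
exists 1 => // x _; rewrite mul1r; apply: nr_le_sq; first exact: nr_ge0.
rewrite hdot_eK; apply: le_trans (shom_nr _ _) _; apply: le_trans (EB_lam _) _.
by apply: le_trans (shom_nr _ _) _; rewrite nr_starM.
Qed.

Lemma eK_iota x b : eK (x ** iB b) = ract (eK x) (mu b).
Proof.
apply: (total_ext eK_total) => z.
by rewrite hdotMr !hdot_eK cmulA EB_r shomM.
Qed.

Lemma kap_ex : exists phi : Af -> KQ -> KQ,
  unital_rep phi /\ forall a x, phi a (eK x) = eK (a ** x).
Proof.
apply: (action_extends (m := fun a x => a ** x)).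
- exact: eK_total.
- by move=> a b x; rewrite cmulA.
- by move=> c a b x; rewrite cmulDl cmulZl (lin_onD eK_lin)// (lin_onZ eK_lin).
- by move=> x; rewrite cmul1l.
by move=> a x y; rewrite !hdot_eK starM -cmulA.
Qed.

Definition kap : starHom Af (lop KQ) := rep_shom (projT2 (cid kap_ex)).1.
Lemma kapE a x : kap a (eK x) = eK (a ** x).
Proof. exact: (projT2 (cid kap_ex)).2. Qed.

(** All generators come from [eK cone], where |a [eK cone]|^2 is the norm of the image of [EB] (a*
    a) in Q, at most |lam a|^2. *)
Lemma kap_lam x z : nr (kap x z) <= nr (lam x) * nr z.
Proof.
apply: (dense_bound (shom_rep kap).1 (X := [set z | exists y c, z = ract (eK y) c])).
  move=> _ [y [c ->]]; apply: (ell_boundedM (shom_rep kap).1).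
  rewrite -[y]cmul1r -kapE; apply: (ell_bounded_rep (shom_rep kap).1).
  exists 1 => // a; rewrite mul1r kapE cmul1r; apply: nr_le_sq; first exact: nr_ge0.
  rewrite hdot_eK; apply: le_trans (shom_nr _ _) _; apply: le_trans (EB_lam _) _.
  by rewrite shomM shom_star nr_starM.
exact: total_clspan eK_total.
Qed.

Definition MQ : hilbertModType Q := dsum (cself Q) KQ.
Definition v1 : MQ := ((cone : cself Q), 0).
Definition v2 : MQ := (0, eK cone).
Definition inK (z : KQ) : MQ := (0, z).

Let sig_fun (a : Af) (m : MQ) : MQ := ((q a ** (m.1 : Q) : cself Q), kap a m.2).
Let sig_rep : unital_rep sig_fun.
Proof.
have kr := shom_rep kap.
split; last by move=> m; rewrite /sig_fun shom1 cmul1l kr.2; case: m.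
split=> [c a b m|a b m|a m m'].
- congr (_, _) => /=; first by rewrite linearP cmulDl cmulZl.
  exact: (repZD kr.1).
- congr (_, _); last exact: (repM kr.1).
  by rewrite shomM -[LHS]cmulA.
rewrite !dsum_hdotE /=; congr (_ + _); last exact: (rep_adj kr.1).
by rewrite -[LHS]/(star (q a ** m.1) ** m'.1) starM -shom_star -cmulA.
Qed.

Definition sig : starHom Af (lop MQ) := rep_shom sig_rep.
Lemma sigE a (m : MQ) : sig a m = (((q a ** (m.1 : Q)) : cself Q), kap a m.2).
Proof. by []. Qed.

Lemma sig_v1 a : sig a v1 = ract v1 (q a).
Proof.
rewrite sigE dsum_ractE; congr (_, _).
  by rewrite -[LHS]/(q a ** cone) -[RHS]/(cone ** q a) cmul1r cmul1l.
by rewrite -[LHS]/(kap a 0) -[RHS]/(ract (0 : KQ) (q a)) (padj0 (lop_adj _)) ract0l.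
Qed.

Lemma sig_inK a x : sig a (inK (eK x)) = inK (eK (a ** x)).
Proof. by rewrite /inK sigE -kapE; congr (_, _); exact: cmul0r. Qed.

Lemma v2E : v2 = inK (eK cone). Proof. by []. Qed.
Lemma sig_v2 a : sig a v2 = inK (eK a). Proof. by rewrite v2E sig_inK cmul1r. Qed.

Lemma inK_ract z c : ract (inK z) c = inK (ract z c).
Proof. by rewrite dsum_ractE /= ract0l. Qed.

Lemma sig_v2_iota b : sig (iB b) v2 = ract v2 (mu b).
Proof. by rewrite sig_v2 v2E inK_ract -eK_iota cmul1l. Qed.

Lemma hdot_v11 : hdot v1 v1 = cone.
Proof. by rewrite dsum_hdotE /= hdot0r addr0 -[LHS]/(star cone ** cone) star1 cmul1l. Qed.
Lemma hdot_v22 : hdot v2 v2 = cone.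
Proof. by rewrite dsum_hdotE /= hdot0r add0r hdot_eK star1 cmul1l EB_1 shom1. Qed.
Lemma hdot_v12 : hdot v1 v2 = 0.
Proof. by rewrite dsum_hdotE /= hdot0r hdot0l addr0. Qed.
Lemma hdot_v21 : hdot v2 v1 = 0.
Proof. by rewrite hdotC hdot_v12 star0. Qed.

Lemma hdot_v1_inK z : hdot v1 (inK z) = 0.
Proof. by rewrite dsum_hdotE /= hdot0r hdot0l addr0. Qed.
Lemma hdot_v2_inK x : hdot v2 (inK (eK x)) = mu (EB x).
Proof. by rewrite dsum_hdotE /= hdot0r add0r hdot_eK star1 cmul1l. Qed.

Definition PV : lop MQ := rank1 v1 v1 + rank1 v2 v2.
Definition NV : lop MQ := rank1 v2 v1 - rank1 v1 v2.

Let r0 (x : MQ) : rank1 0 x = 0.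
Proof. by apply: lop_ext => z; rewrite rank1E ract0l. Qed.

Let rM := (@rank1M _ _ MQ, hdot_v11, hdot_v12, hdot_v21, hdot_v22,
  @ract1 _ _ MQ, @ract0r _ _ MQ, r0).

Lemma PV_PV : PV ** PV = PV.
Proof. by rewrite /PV cmulDl !cmulDr !rM addr0 add0r. Qed.
Lemma PV_NV : PV ** NV = NV.
Proof. by rewrite /PV /NV cmulDl !cmulBr !rM sub0r subr0 addrC. Qed.
Lemma NV_PV : NV ** PV = NV.
Proof. by rewrite /PV /NV cmulBl !cmulDr !rM addr0 add0r. Qed.
Lemma NV_NV : NV ** NV = - PV.
Proof. by rewrite /PV /NV cmulBl !cmulBr !rM sub0r subr0 opprD addrC. Qed.
Lemma star_PV : star PV = PV. Proof. by rewrite /PV starD !star_rank1. Qed.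
Lemma star_NV : star NV = - NV. Proof. by rewrite /NV starB !star_rank1 opprB. Qed.

(** The rotation with cosine C and sine S in the plane of v1 and v2, and the identity on its
    complement: [PV] is the projection onto the plane, and [NV] the quarter turn v1 -> v2 -> -
    v1. *)
Definition Uc (C S : R) : lop MQ := cone + (C - 1)%:C *: PV + S%:C *: NV.

Lemma star_Uc C S : star (Uc C S) = Uc C (- S).
Proof.
by rewrite /Uc !starD !starZR star1 star_PV star_NV scalerN rmorphN scaleNr.
Qed.

Lemma Uc_mul C S C' S' : Uc C S ** Uc C' S' = Uc (C * C' - S * S') (C * S' + S * C').
Proof.
rewrite /Uc !cmulDl !cmulDr !cmul1l !cmul1r !cmulZl !cmulZr.
rewrite PV_PV PV_NV NV_PV NV_NV !scalerN !scalerA -!rmorphM/=.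
set p := PV; set n := NV.
have -> : (C * C' - S * S' - 1)%:C *: p =
   (C' - 1)%:C *: p + (C - 1)%:C *: p + ((C - 1) * (C' - 1))%:C *: p - (S * S')%:C *: p.
  by rewrite -!scalerDl -scalerBl -!rmorphD -rmorphB/=; congr (_%:C *: _); ring.
have -> : (C * S' + S * C')%:C *: n =
   S'%:C *: n + ((C - 1) * S')%:C *: n + S%:C *: n + (S * (C' - 1))%:C *: n.
  by rewrite -!scalerDl -!rmorphD/=; congr (_%:C *: _); ring.
set a1 := (C' - 1)%:C *: p; set a2 := (C - 1)%:C *: p.
set a3 := ((C - 1) * (C' - 1))%:C *: p; set a4 := (S * S')%:C *: p.
set b1 := S'%:C *: n; set b2 := ((C - 1) * S')%:C *: n; set b3 := S%:C *: n.
set b4 := (S * (C' - 1))%:C *: n.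
rewrite [LHS](AC (3*3*3) (1*(2*4*5*9)*(3*6*7*8))).
by [].
Qed.

Lemma Uc_1 : Uc 1 0 = cone.
Proof. by rewrite /Uc subrr rmorph0 !scale0r !addr0. Qed.

Section Rotation.
Context {C S : R} (CS : C ^+ 2 + S ^+ 2 = 1).

Lemma Uc_unitary_l : star (Uc C S) ** Uc C S = cone.
Proof.
rewrite star_Uc Uc_mul.
have -> : C * C - - S * S = 1 by rewrite -CS; ring.
have -> : C * S + - S * C = 0 by ring.
exact: Uc_1.
Qed.
Lemma Uc_unitary_r : Uc C S ** star (Uc C S) = cone.
Proof.
rewrite star_Uc Uc_mul.
have -> : C * C - S * - S = 1 by rewrite -CS; ring.
have -> : C * - S + S * C = 0 by ring.
exact: Uc_1.
Qed.

(** Both v1 and v2 satisfy b v = v [mu] b, so the rank one operators between them commute with B.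
    This is what keeps the conjugated [A false] compatible with [A true] over B. *)
Lemma Uc_B b : Uc C S ** sig (iB b) = sig (iB b) ** Uc C S.
Proof.
have sv1 b' : sig (iB b') v1 = ract v1 (mu b') by rewrite sig_v1.
have c v w : (forall b', sig (iB b') v = ract v (mu b')) ->
   (forall b', sig (iB b') w = ract w (mu b')) -> rank1 v w ** sig (iB b) = sig (iB b) ** rank1 v w.
  move=> hv hw; rewrite rank1_lop lop_rank1 hv -!shom_star hw rank1_act.
  by rewrite shom_star.
rewrite /Uc !cmulDl !cmulDr cmul1l cmul1r !cmulZl !cmulZr /PV /NV.
by rewrite cmulDl cmulDr cmulBl cmulBr !c//; exact: sig_v2_iota.
Qed.

Definition Uk (k : bool) : lop MQ := if k then cone else Uc C S.
Lemma Uk_l k : star (Uk k) ** Uk k = cone.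
Proof. by case: k; rewrite /= ?star1 ?cmul1l// Uc_unitary_l. Qed.
Lemma Uk_r k : Uk k ** star (Uk k) = cone.
Proof. by case: k; rewrite /= ?star1 ?cmul1l// Uc_unitary_r. Qed.

(* sgm is the left action of Af on MQ, with A false conjugated by the rotation Uc C S
   of the plane spanned by v1 and v2. *)
Lemma sgm_ex : exists g : starHom Af (lop MQ),
  forall k a, g (inj k a) = Uk k ** sig (inj k a) ** star (Uk k).
Proof.
have [|g hg _] := full.2 _ (fun k => shom_conj (shom_comp sig (inj k)) (Uk_l k) (Uk_r k)).
  move=> b; rewrite !shom_conjE !shom_compE star1 cmul1l cmul1r.
  rewrite -/(iB b) -!(iBE _ b) -shom_compE.
  by rewrite Uc_B -cmulA Uc_unitary_r cmul1r.
by exists g => k a; rewrite hg shom_conjE shom_compE.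
Qed.

Definition sgm : starHom Af (lop MQ) := projT1 (cid sgm_ex).
Lemma sgmE k a : sgm (inj k a) = Uk k ** sig (inj k a) ** star (Uk k).
Proof. by rewrite /sgm; case: cid. Qed.

(** The orthonormal basis of the plane adapted to [A k]: on [pk k] this algebra acts through q from
    the right, while a letter takes [pk' k] out of the plane, to a word in K. Both are real
    combinations of v1 and v2. *)
Definition pk k : MQ := Uk k v1.
Definition pk' k : MQ := Uk k v2.
Definition vec (a b : R) : MQ := a%:C *: v1 + b%:C *: v2.

Lemma vec_10 : vec 1 0 = v1.
Proof. by rewrite /vec rmorph0 rmorph1 scale1r scale0r addr0. Qed.
Lemma vec_01 : vec 0 1 = v2.
Proof. by rewrite /vec rmorph0 rmorph1 scale1r scale0r add0r. Qed.

Lemma PV_v1 : PV v1 = v1.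
Proof. by rewrite /PV lopDE !rank1E hdot_v11 hdot_v21 ract1 ract0r addr0. Qed.
Lemma PV_v2 : PV v2 = v2.
Proof. by rewrite /PV lopDE !rank1E hdot_v12 hdot_v22 ract1 ract0r add0r. Qed.
Lemma NV_v1 : NV v1 = v2.
Proof. by rewrite /NV lopBE !rank1E hdot_v11 hdot_v21 ract1 ract0r subr0. Qed.
Lemma NV_v2 : NV v2 = - v1.
Proof. by rewrite /NV lopBE !rank1E hdot_v12 hdot_v22 ract1 ract0r sub0r. Qed.

Lemma Uc_v1 C' S' : Uc C' S' v1 = vec C' S'.
Proof.
rewrite /Uc !lopDE !lopZE lop1E PV_v1 NV_v1 /vec; congr (_ + _).
by rewrite -{1}[v1]scale1r -scalerDl; congr (_ *: _); rewrite -(rmorph1 (real_complex R)) -rmorphD/= addrC subrK.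
Qed.
Lemma Uc_v2 C' S' : Uc C' S' v2 = vec (- S') C'.
Proof.
rewrite /Uc !lopDE !lopZE lop1E PV_v2 NV_v2 /vec scalerN rmorphN scaleNr addrC; congr (_ + _).
by rewrite -{1}[v2]scale1r -scalerDl; congr (_ *: _); rewrite -(rmorph1 (real_complex R)) -rmorphD/= addrC subrK.
Qed.

Lemma vec_vec a b a' b' x y : x%:C *: vec a b + y%:C *: vec a' b' =
  vec (x * a + y * a') (x * b + y * b').
Proof.
rewrite /vec !scalerDr !scalerA -!rmorphM addrACA -!scalerDl -!rmorphD //.
Qed.

Lemma pk_vec k : exists a b, pk k = vec a b.
Proof.
by case: k; [exists 1, 0; rewrite vec_10; exact: lop1E|exists C, S; exact: Uc_v1].
Qed.

Lemma pk'_vec k : exists a b, pk' k = vec a b.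
Proof.
by case: k; [exists 0, 1; rewrite vec_01; exact: lop1E|exists (- S), C; exact: Uc_v2].
Qed.

Lemma vec_pk k a b : exists x y : R, vec a b = x%:C *: pk k + y%:C *: pk' k.
Proof.
case: k; first by exists a, b; rewrite -[pk true]/((cone : lop MQ) v1) -[pk' true]/((cone : lop MQ) v2) !lop1E.
exists (C * a + S * b), (C * b - S * a).
rewrite -[pk false]/(Uc C S v1) -[pk' false]/(Uc C S v2) Uc_v1 Uc_v2 vec_vec; congr vec.
  by rewrite -[a]mul1r -[in LHS]CS; ring.
by rewrite -[b]mul1r -[in LHS]CS; ring.
Qed.

Lemma hdot_pk k : hdot (pk k) (pk k) = cone.
Proof. by rewrite /pk lop_adj -lopME Uk_l lop1E hdot_v11. Qed.
Lemma hdot_pk' k : hdot (pk' k) (pk' k) = cone.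
Proof. by rewrite /pk' lop_adj -lopME Uk_l lop1E hdot_v22. Qed.
Lemma hdot_pk'_pk k : hdot (pk' k) (pk k) = 0.
Proof. by rewrite /pk' /pk lop_adj -lopME Uk_l lop1E hdot_v21. Qed.

Lemma star_Uk_Uk k m : star (Uk k) (Uk k m) = m.
Proof. by rewrite -lopME Uk_l lop1E. Qed.

Lemma sgm_pk k a : sgm (inj k a) (pk k) = ract (pk k) (q (inj k a)).
Proof.
rewrite sgmE !lopME star_Uk_Uk sig_v1.
by rewrite (padjM (lop_adj (Uk k))).
Qed.

Lemma Uc_inK C' S' x : EB x = 0 -> Uc C' S' (inK (eK x)) = inK (eK x).
Proof.
move=> x0; rewrite /Uc !lopDE !lopZE lop1E /PV /NV lopDE lopBE !rank1E.
rewrite hdot_v1_inK hdot_v2_inK x0 linear0 !ract0r subrr addr0 !scaler0 !addr0 //.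
Qed.

Lemma Uk_inK k x : EB x = 0 -> Uk k (inK (eK x)) = inK (eK x).
Proof. by case: k => x0; [exact: lop1E|exact: Uc_inK]. Qed.

Lemma star_Uk_inK k x : EB x = 0 -> star (Uk k) (inK (eK x)) = inK (eK x).
Proof.
case: k => x0; first by rewrite [star _]star1 lop1E.
by rewrite [star _]star_Uc; exact: Uc_inK.
Qed.

Lemma sgm_pk' k a : E k a = 0 -> sgm (inj k a) (pk' k) = inK (eK (inj k a)).
Proof.
move=> a0; rewrite sgmE !lopME star_Uk_Uk sig_v2 Uk_inK//.
exact: EB_redw (redw1 inj a0).
Qed.

(** The part of K generated by words with first letter in [A i]. It is orthogonal to the plane, so
    the rotation is not felt there and letters from the other algebra just lengthen the words. *)
Definition Mo i : set MQ :=
  clspan [set z | exists j y c, rw i j y /\ z = ract (inK (eK y)) c].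

Lemma Mo_vec i m a b : Mo i m -> hdot (vec a b) m = 0.
Proof.
move=> mo; suff [h1 h2] : hdot v1 m = 0 /\ hdot v2 m = 0.
  by rewrite /vec hdotDl !hdotZl h1 h2 !scaler0 addr0.
move: m mo; apply: clspan_ind.
- move=> _ [j [y [c [ry ->]]]]; rewrite !hdotMr hdot_v1_inK hdot_v2_inK (EB_redw ry).
  by rewrite linear0 !cmul0l.
- by rewrite !hdot0r.
- by move=> x y [x1 x2] [y1 y2]; rewrite !hdotDr x1 x2 y1 y2 addr0.
- by move=> c x [x1 x2]; rewrite !hdotZr x1 x2 scaler0.
move=> u l hu ul; split.
  apply: (cvs_uniq (cvs_hdotr _ ul)); rewrite (_ : (fun n => _) = (fun=> 0)); first exact: cvs_cst.
  by apply/funext => n; case: (hu n).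
apply: (cvs_uniq (cvs_hdotr _ ul)); rewrite (_ : (fun n => _) = (fun=> 0)); first exact: cvs_cst.
by apply/funext => n; case: (hu n).
Qed.

Lemma lop_lin (T : lop MQ) : lin_on setT T.
Proof. exact: lin_on_adj (lop_adj T) (nr_ge0 T) (lop_nr T). Qed.

Lemma Mo_ract i m c : Mo i m -> Mo i (ract m c).
Proof.
move: m; apply: clspan_ind.
- move=> _ [j [y [c' [ry ->]]]]; rewrite -ractM; apply: sub_clspan.
  by exists j, y, (c' ** c).
- by rewrite ract0l; exact: clspan0.
- by move=> x y hx hy; rewrite ractDl; exact: clspanD.
- by move=> z x hx; rewrite ractZl; exact: clspanZ.
by move=> u l hu ul; apply: clspan_cvs hu (cvs_ractl c ul).
Qed.

Lemma Mo_step k a m : E k a = 0 -> Mo (~~ k) m -> Mo k (sgm (inj k a) m).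
Proof.
move=> a0; move: m; apply: (csub_preT (f := sgm (inj k a)) (lop_lin _) (clspan_csub _)).
move=> _ [j [y [c [ry ->]]]]; rewrite (padjM (lop_adj _)) sgmE !lopME.
rewrite star_Uk_inK ?(EB_redw ry)// sig_inK.
have ray := redwS a0 ry; rewrite Uk_inK ?(EB_redw ray)//.
by apply: sub_clspan; exists j, (inj k a ** y), c.
Qed.

Lemma Mo_inK k a : E k a = 0 -> Mo k (inK (eK (inj k a))).
Proof.
by move=> a0; apply: sub_clspan; exists k, (inj k a), cone; rewrite ract1; split=> //; exact: redw1.
Qed.

(** The basic computation. Each letter splits the current vector of the plane along its adapted
    basis: the part along [pk k] stays in the plane and collects the letter in q, the part along
    [pk' k] leaves for [Mo] and never returns. The constant c is the product of the cosines met on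
    the way. *)
Lemma sgm_redw i j x a b : rw i j x ->
  exists (c : R) m, Mo i m /\ sgm x (vec a b) = ract (c%:C *: pk i) (q x) + m.
Proof.
elim=> [k y y0|k l y z y0 rz [c [m [mo hm]]]].
  have [s [t ->]] := vec_pk k a b.
  exists s, (t%:C *: inK (eK (inj k y))); split; first by apply: clspanZ; exact: Mo_inK.
  rewrite (padjD (lop_adj _)) !(padjZ (lop_adj _)) sgm_pk sgm_pk'//.
  by rewrite ractZl.
have [a' [b' pE]] := pk_vec (~~ k); have [s [t stE]] := vec_pk k a' b'.
exists (c * s), (ract ((c * t)%:C *: inK (eK (inj k y))) (q z) + sgm (inj k y) m); split.
  apply: clspanD; last exact: Mo_step.
  by apply: Mo_ract; apply: clspanZ; exact: Mo_inK.
rewrite shomM lopME hm (padjD (lop_adj _)) (padjM (lop_adj _)) (padjZ (lop_adj _)).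
rewrite pE stE (padjD (lop_adj _)) !(padjZ (lop_adj _)) sgm_pk sgm_pk'//.
by rewrite scalerDr !scalerA -!rmorphM ractDl shomM ractM addrA !ractZl.
Qed.

(** The span Y contains the plane, and a rotation changes a vector only within the plane, so Y is
    invariant under the rotations. Undoing the conjugation makes it invariant under [sig], for which
    v1 and v2 generate the module. *)
Lemma sgm_cyclic :
  clspan [set z | exists y a b c, z = ract (sgm y (vec a b)) c] = setT.
Proof.
set Y := clspan _.
have Yv a b c : Y (ract (vec a b) c).
  by apply: sub_clspan; exists cone, a, b, c; rewrite shom1 lop1E.
have Ys y m : Y m -> Y (sgm y m).
  move: m; apply: (csub_preT (f := sgm y) (lop_lin _) (clspan_csub _)).
  move=> _ [z [a [b [c ->]]]]; rewrite (padjM (lop_adj _)) -lopME -shomM.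
  by apply: sub_clspan; exists (y ** z), a, b, c.
have Yr a b m : Y (rank1 (vec a b) m m) by rewrite rank1E; exact: Yv.
have YU C' S' m : Y m -> Y (Uc C' S' m).
  move=> Ym; rewrite /Uc !lopDE !lopZE /PV /NV lopDE lopBE !rank1E.
  apply: clspanD; first apply: clspanD => //.
    by apply: clspanZ; apply: clspanD; [rewrite -vec_10|rewrite -vec_01]; exact: Yv.
  by apply: clspanZ; apply: clspanD; [rewrite -{1}vec_01|apply: clspanN; rewrite -{1}vec_10]; exact: Yv.
have YUk k m : Y m -> Y (Uk k m) by case: k => Ym; [rewrite lop1E|exact: YU].
have YUk' k m : Y m -> Y (star (Uk k) m).
  by case: k => Ym; [rewrite [star _]star1 lop1E|rewrite [star _]star_Uc; exact: YU].
have sigE' k a : sig (inj k a) = star (Uk k) ** sgm (inj k a) ** Uk k.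
  rewrite sgmE !cmulA Uk_l cmul1l -cmulA Uk_l cmul1r //.
have Yinj k a m : Y m -> Y (sig (inj k a) m).
  by move=> Ym; rewrite sigE' !lopME; apply: YUk'; apply: Ys; exact: YUk.
have Ysig x : (forall m, Y m -> Y (sig x m)) /\ (forall m, Y m -> Y (sig (star x) m)).
  move: x; apply: (full_amalgam_ind full); last first.
    by move=> k a; rewrite -shom_star; split=> m; exact: Yinj.
  split.
  - by split=> m; rewrite ?star1 shom1.
  - move=> a b [a1 a2] [b1 b2]; split=> m Ym; rewrite ?starD linearD lopDE.
      by apply: clspanD; [exact: a1|exact: b1].
    by apply: clspanD; [exact: a2|exact: b2].
  - move=> c a [a1 a2]; split=> m Ym; rewrite ?starZ linearZ lopZE; apply: clspanZ.
      exact: a1.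
    exact: a2.
  - move=> a b [a1 a2] [b1 b2]; split=> m Ym; rewrite ?starM shomM lopME.
      by apply: a1; exact: b1.
    by apply: b2; exact: a2.
  - by move=> a [a1 a2]; split=> // m Ym; rewrite starK; exact: a1.
  have lim u l m : (forall n, Y m -> Y (sig (u n) m)) -> cvs u l -> Y m -> Y (sig l m).
    move=> hu ul Ym; apply: (@clspan_cvs _ _ _ (fun n => sig (u n) m)) => [n|]; first exact: hu.
    apply: (@cvs_lip _ _ _ (fun a => sig a m) (nr m)) ul => a b.
    rewrite -lopBE -linearB mulrC; apply: le_trans (lop_nr _ _) _.
    by rewrite ler_wpM2r ?nr_ge0 ?shom_nr.
  move=> u l hu ul; split=> m; first by apply: (lim u) => // n; case: (hu n) => + _; exact.
  by apply: (lim (fun n => star (u n))); [move=> n; case: (hu n) => _; exact|exact: cvs_star].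
rewrite -subTset => -[c z] _.
have -> : (c, z) = ract v1 (c : Q) + inK z :> MQ.
  rewrite dsum_ractE /= ract0l; congr (_, _); rewrite /= ?addr0 ?add0r//.
  by rewrite -[RHS]/((cone : Q) ** c) cmul1l.
apply: clspanD; first by rewrite -vec_10; exact: Yv.
have [s hs] := total_seq z eK_total.
apply: (@clspan_cvs _ _ _ (fun n => inK (fsum eK (s n)))); last first.
  apply: (@cvs_lip _ _ _ inK 1) hs => x y; rewrite mul1r.
  have -> : inK x - inK y = inK (x - y) by congr (_, _); rewrite /= subr0.
  by rewrite dsum_nr_inr.
move=> n; elim: (s n) => [|[x c'] t IH].
  by rewrite /fsum big_nil; exact: clspan0.
have -> : inK (fsum eK ((x, c') :: t)) = ract (sig x v2) c' + inK (fsum eK t).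
  rewrite sig_v2 inK_ract /fsum big_cons /=.
  by congr (_, _); rewrite /= addr0.
apply: clspanD => //; rewrite -(padjM (lop_adj (sig x))); apply: (Ysig x).1.
by rewrite -vec_01; exact: Yv.
Qed.

End Rotation.
End Fock.
End VertexData.

Lemma kolmogorov {R : realType} {D : cstarAlgType R} {X : Type} (k : kernel D X) :
  exists (F : hilbertModType D) (e : X -> F), total e /\ forall x y, hdot (e x) (e y) = k x y.
Proof. by exists (kmod k), (kemb k); split; [exact: kemb_total|exact: hdot_kemb]. Qed.

(** * Factorization through the vertex-reduced free product *)

Section TensorExistence.
Context {R : realType} {D C : cstarAlgType R} {E : hilbertModType D} {F : hilbertModType C}.
Context {phi : D -> F -> F}.
Hypothesis rep : unital_rep phi.

(** The module of the kernel <y, phi(<x, x'>) y'> on pairs; [gram_rep] is its positivity. *)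
Lemma tensor_exists : exists (T : hilbertModType C) (j : E -> F -> T), is_tensor phi setT j.
Proof.
pose k (p q : E * F) : C := hdot p.2 (phi (hdot p.1 q.1) q.2).
have kC x y : k y x = star (k x y).
  by rewrite /k -hdotC (rep_adj rep.1) -hdotC.
have kp (s : seq ((E * F) * C)) : cpos (\sum_(p <- s) \sum_(q <- s) star p.2 ** k p.1 q.1 ** q.2).
  apply: cpos_seq_form => n x c.
  have -> : \sum_i \sum_j star (c i) ** k (x i) (x j) ** c j =
     \sum_i \sum_j hdot (ract (x i).2 (c i)) (phi (hdot (x i).1 (x j).1) (ract (x j).2 (c j))).
    apply: eq_bigr => i _; apply: eq_bigr => j _.
    by rewrite (padjM (rep_adj rep.1 _)) hdotMl hdotMr cmulA.
  apply: (gram_rep rep.1 (m := fun i j => hdot (x i).1 (x j).1)) => [i j|c'].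
    exact: hdotC.
  exact: gram_module_pos.
have [T [e [te he]]] := kolmogorov (Kernel kC kp).
exists T, (fun x y => e (x, y)).
split=> [x x' y y' _ _|]; first by rewrite he.
rewrite -(total_clspan te); congr clspan; apply/seteqP; split=> [_ [x [y [_ ->]]]|_ [[x y] [c ->]]].
  by exists (x, y), cone; rewrite ract1.
exists x, (ract y c); split=> //.
apply: (total_ext te) => -[x' y']; rewrite hdotMr !he /= /k /=.
by rewrite (padjM (rep_adj rep.1 _)) hdotMr.
Qed.

End TensorExistence.

Section TensorAction.
Context {R : realType} {D C A : cstarAlgType R} {E : hilbertModType D} {F : hilbertModType C}.
Context {phi : D -> F -> F} {T : hilbertModType C} {j : E -> F -> T}.
Hypothesis rep : unital_rep phi.
Hypothesis HT : is_tensor phi setT j.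

Lemma tensor_ract x y c : ract (j x y) c = j x (ract y c).
Proof.
apply: (tensor_ext HT) => x' y' _; rewrite hdotMr !(tensor_hdot HT)//.
by rewrite (padjM (rep_adj rep.1 _)) hdotMr.
Qed.

Lemma tensor_balanced x d y : j (ract x d) y = j x (phi d y).
Proof.
apply: (tensor_ext HT) => x' y' _; rewrite !(tensor_hdot HT)//.
by rewrite hdotMr (repM rep.1).
Qed.

Lemma tensor_total : total (fun p : E * F => j p.1 p.2).
Proof.
apply: clspan_total; rewrite -HT.2; congr clspan.
apply/seteqP; split=> [_ [[x y] [c ->]]|_ [x [y [_ ->]]]].
  by exists x, (ract y c); rewrite tensor_ract.
by exists (x, y), cone; rewrite ract1.
Qed.

Lemma tensor_action (psi : A -> E -> E) : unital_rep psi ->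
  exists tau : A -> T -> T, unital_rep tau /\ forall a x y, tau a (j x y) = j (psi a x) y.
Proof.
move=> rpsi.
have [||||tau [rt ht]] := @action_extends _ _ A _ _ (fun p : E * F => j p.1 p.2)
  (fun a p => (psi a p.1, p.2)) tensor_total.
- by move=> a b x; rewrite /= (repM rpsi.1).
- move=> c a b x; rewrite /= (repZD rpsi.1) (tensor_Dl rep HT)//.
  by rewrite (tensor_Zl rep HT).
- by move=> x; rewrite /= rpsi.2.
- by move=> a x y; rewrite /= !(tensor_hdot HT)// (rep_adj rpsi.1).
exists tau; split=> // a x y; exact: (ht a (x, y)).
Qed.

End TensorAction.

(** A diagonal coefficient suffices, because |sigma(x) z|^2 is the norm of the coefficient of z at
    x* x. *)
Lemma ell_bounded_form {R : realType} {D Af L : cstarAlgType R} {F : hilbertModType D}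
    {sigma : Af -> F -> F} (ell : starHom Af L) (z : F) : star_rep sigma ->
  (exists2 C : R, 0 <= C & forall x, nr (hdot z (sigma x z)) <= C * nr (ell x)) ->
  ell_bounded (sigma := sigma) ell z.
Proof.
move=> rep [C C0 hC]; exists (Num.sqrt C); first exact: sqrtr_ge0.
move=> x; apply: nr_le_sq; first by rewrite mulr_ge0 ?sqrtr_ge0 ?nr_ge0.
rewrite (rep_adj rep) -(repM rep) exprMn sqr_sqrtr//; apply: le_trans (hC _) _.
by rewrite shomM shom_star nr_starM.
Qed.

Lemma CS01 {R : realType} : (0 : R) ^+ 2 + 1 ^+ 2 = 1.
Proof. by rewrite expr0n expr1n add0r. Qed.

Section Bounds.
Context {R : realType} (d : vertex_data R).

Local Notation B := (vB d).
Local Notation A := (vA d).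
Local Notation iota := (viota d).
Local Notation E := (vE d).
Local Notation Af := (vAf d).
Local Notation inj := (vinj d).
Local Notation lam := (vlam d).
Local Notation rw := (redw E inj).

Let E_cond := vE_cond d.
Let full := vfull d.
Let Es k a : E k (star a) = star (E k a). Proof. exact: (E_star (K := vK d)). Qed.

Lemma vx_l k a x : vx k (inj k a ** x) = a ** vx k x.
Proof.
by rewrite -[LHS]starK -vx_star starM -shom_star vx_r starM starK vx_star starK.
Qed.

Lemma vx_redw_l k l x : rw (~~ k) l x -> vx k x = 0.
Proof. by move=> /(redw_star Es)/vx_redw h; rewrite -[x]starK vx_star h star0. Qed.

(** The product has at least two letters: after a first letter in [A k] is pulled out, a word
    starting in the other algebra remains. *)
Lemma vx_cat k j i l y z : rw j i y -> rw (~~ i) l z -> vx k (y ** z) = 0.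
Proof.
move=> ry rz; have [jk|jk] : j = k \/ j = ~~ k.
- by case: (j) (k) => [] []; [left|right|right|left].
- rewrite {}jk in ry; have [[a [_ ik ->]]|[a [y' [_ ry' ->]]]] := redw_first ry.
    by rewrite ik in rz; rewrite vx_l (vx_redw_l rz) cmul0r.
  by rewrite -cmulA vx_l (vx_redw_l (redw_cat ry' rz)) cmul0r.
by rewrite jk in ry; exact: vx_redw_l (redw_cat ry rz).
Qed.

Lemma vx_redw_cases k i j x : rw i j x ->
  (exists a, i = k /\ x = inj k a) \/ vx k x = 0.
Proof.
move=> rx; have [ik|ik] : i = k \/ i = ~~ k.
- by case: (i) (k) => [] []; [left|right|right|left].
- rewrite {}ik in rx *; have [[a [_ _ ->]]|[a [y [_ ry ->]]]] := redw_first rx.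
    by left; exists a.
  by right; rewrite vx_l (vx_redw_l ry) cmul0r.
by rewrite ik in rx; right; exact: vx_redw_l rx.
Qed.

Lemma redw_eq (V : completeNormedModType R[i]) (f g : Af -> V) : lin_on setT f -> lin_on setT g ->
  (forall b, f (iB d b) = g (iB d b)) -> (forall i j x, rw i j x -> f x = g x) -> f =1 g.
Proof.
move=> lf lg fgB fgw x; have HS := lin_on_eq (csubT Af) lf lg.
have h := amalgam_redw_ind E_cond full HS.
by case: (h (fun b => conj I (fgB b)) (fun i j y ry => conj I (fgw i j y ry)) x).
Qed.

Lemma hdot_rep_lin (D : cstarAlgType R) (F : hilbertModType D) (g : starHom Af (lop F)) y z :
  lin_on setT (fun x => hdot y (g x z)).
Proof.
split=> [x x' _ _|c x _|]; first by rewrite linearD lopDE hdotDr.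
  by rewrite linearZ lopZE hdotZr.
exists (nr y * nr z) => [|x _]; first by rewrite mulr_ge0 ?nr_ge0.
apply: le_trans (hdot_CS _ _) _; rewrite -mulrA ler_wpM2l ?nr_ge0//.
apply: le_trans (lop_nr _ _) _; rewrite mulrC ler_wpM2l ?nr_ge0//; exact: shom_nr.
Qed.

Section Full.
Let CS := @CS01 R.
Let q : starHom Af Af := shom_id.
Let tau := sgm q CS.
Let p k := pk (C := 0) (S := 1) q k.

Let p_orth k : hdot (p k) (p (~~ k)) = 0.
Proof.
have h k' : p k' = if k' then v1 q else v2 q.
  case: k'; first exact: lop1E.
  by rewrite /p /pk /Uk Uc_v1 vec_01.
by rewrite !h; case: k; rewrite ?hdot_v12 ?hdot_v21.
Qed.

(** By [sgm_redw] the image of p k lies in p (~~ k) Q + [Mo] (~~ k), and at the exchange p k is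
    orthogonal to p (~~ k) as well. This is special to the quarter turn. *)
Let p_redw k l x : rw (~~ k) l x -> hdot (p k) (tau x (p k)) = 0.
Proof.
move=> rx; have [a [b pE]] := pk_vec (C := 0) (S := 1) q k.
have [c [m [mo hm]]] := sgm_redw q CS a b rx.
rewrite [X in tau x X]pE /tau hm hdotDr hdotMr hdotZr p_orth scaler0 cmul0l add0r.
by rewrite [p k]pE (Mo_vec a b mo).
Qed.

Let p_norm k : hdot (p k) (p k) = cone. Proof. exact: (hdot_pk q CS). Qed.

(** Words that start in [A (~~ k)] have coefficient 0. A first letter in [A k] can be moved through
    the inner product to the left, where it acts on p k by right multiplication. *)
Let p_vx k x : hdot (p k) (tau x (p k)) = inj k (vx k x).
Proof.
have pinj a : tau (inj k a) (p k) = ract (p k) (inj k a) by exact: sgm_pk.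
move: x; apply: redw_eq; first exact: hdot_rep_lin.
- apply: (lin_on_compT (vx_lin d k)); split=> [x y _ _|c x _|].
  + exact: linearD.
  + exact: linearZ.
  by exists 1 => // x _; rewrite mul1r shom_nr.
- by move=> b; rewrite (iBE k) pinj hdotMr p_norm cmul1l vx_inj.
move=> i j x rx; have [ik|ik] : i = k \/ i = ~~ k.
- by case: (i) (k) => [] []; [left|right|right|left].
- rewrite {}ik in rx; have [[a [_ _ ->]]|[a [y [_ ry ->]]]] := redw_first rx.
    by rewrite pinj hdotMr p_norm cmul1l vx_inj.
  rewrite vx_l (vx_redw_l ry) cmul0r linear0 shomM lopME -[tau (inj k a)]starK -lop_adj.
  by rewrite -shom_star -shom_star pinj hdotMl (p_redw ry) cmul0r.
rewrite ik in rx; rewrite (vx_redw_l rx) linear0; exact: p_redw rx.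
Qed.

(** p true = v1 and p false = v2 span the plane, and both coefficients are of the form
    [inj k (vx k x)], which [lam] dominates. *)
Lemma sgm_full_bound x m : nr (tau x m) <= nr (lam x) * nr m.
Proof.
have rep := (shom_rep tau).1; apply: (dense_bound (ell := lam) rep _ (sgm_cyclic q CS)).
move=> _ [y [a [b [c ->]]]]; apply: (ell_boundedM rep); apply: (ell_bounded_rep rep).
have bk k : ell_bounded (sigma := fun x m => tau x m) lam (p k).
  apply: (ell_bounded_form rep); exists 1 => // z; rewrite mul1r p_vx.
  apply: le_trans (shom_nr _ _) _; exact: vx_lam.
have -> : vec q a b = a%:C *: p true + b%:C *: p false.
  by rewrite /vec /p /pk lop1E /Uk Uc_v1 vec_01.
by apply: (ell_boundedD rep); apply: (ell_boundedZ rep); exact: bk.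
Qed.

End Full.

End Bounds.

Lemma lop0E {R : realType} {D : cstarAlgType R} {E : hilbertModType D} (x : E) :
  (0 : lop E) x = 0.
Proof. by []. Qed.

Section Reduced.
Context {R : realType} (d : vertex_data R).

Local Notation B := (vB d).
Local Notation A := (vA d).
Local Notation iota := (viota d).
Local Notation E := (vE d).
Local Notation Af := (vAf d).
Local Notation Av := (vAv d).
Local Notation inj := (vinj d).
Local Notation lam := (vlam d).
Local Notation rw := (redw E inj).

Let E_cond := vE_cond d.
Let full := vfull d.
Let Es k a : E k (star a) = star (E k a). Proof. exact: (E_star (K := vK d)). Qed.
Let lam_dense : dense (range lam) := (vcompletion d).2.

Definition piA k : starHom Av (lop (whsum (vH d) k k)) := shom_ext lam_dense (@pih_lam _ d k).
Lemma piA_lam k x : piA k (lam x) = pih d k x. Proof. exact: shom_extE. Qed.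

Lemma piA_norming t (M : R) : (forall k, nr (piA k t) <= M) -> nr t <= M.
Proof.
move=> hM; have [u hu] := dense_range_cvs lam_dense t.
apply/ler_addgt0Pr => e e0; have [N hN] := hu _ e0.
apply: (cvs_le hu); exists N => n /hN hn; apply: lam_pih => k.
rewrite -piA_lam; have := nrD (piA k t) (piA k (lam (u n) - t)).
rewrite -linearD addrC subrK => h; apply: le_trans h _; apply: lerD => //.
by apply: le_trans (shom_nr _ _) _; exact: ltW.
Qed.

Context {C S : R} (CS : C ^+ 2 + S ^+ 2 = 1).
Let tau := sgm lam CS.
Let p i := pk (C := C) (S := S) lam i.
Let p' i := pk' (C := C) (S := S) lam i.

Section Fibre.
Variable k : bool.
Local Notation H := (whsum (vH d) k k).
Local Notation vac := (vac_ d k).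
Let repk : unital_rep (fun a (h : H) => piA k a h) := shom_rep (piA k).

Context {T : hilbertModType (A k)} {j : MQ lam -> H -> T}.
Hypothesis HT : is_tensor (fun a (h : H) => piA k a h) setT j.
Context {psi : Af -> T -> T}.
Hypothesis rpsi : unital_rep psi.
Hypothesis psi_j : forall a x y, psi a (j x y) = j (tau a x) y.

Let bounded z := ell_bounded (sigma := psi) lam z.

Let hdot_psi m h x : hdot (j m h) (psi x (j m h)) = hdot h (piA k (hdot m (tau x m)) h).
Proof. by rewrite psi_j (tensor_hdot HT). Qed.

Let coef_lin m h : lin_on setT (fun x => hdot h (piA k (hdot m (tau x m)) h)).
Proof.
have l1 := hdot_rep_lin tau m m.
apply: (lin_on_compT (g := fun t => hdot h (piA k t h)) l1); split=> [x y _ _|c x _|].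
- by rewrite linearD lopDE hdotDr.
- by rewrite linearZ lopZE hdotZr.
exists (nr h ^+ 2) => [|x _]; first exact: sqr_ge0.
apply: le_trans (hdot_CS _ _) _; rewrite expr2 -mulrA ler_wpM2l ?nr_ge0//.
apply: le_trans (lop_nr _ _) _; rewrite mulrC ler_wpM2l ?nr_ge0//; exact: shom_nr.
Qed.

Let p_norm i : hdot (p i) (p i) = cone. Proof. exact: (hdot_pk lam CS). Qed.
Let p'_norm i : hdot (p' i) (p' i) = cone. Proof. exact: (hdot_pk' lam CS). Qed.
Let p'p i : hdot (p' i) (p i) = 0. Proof. exact: (hdot_pk'_pk lam CS). Qed.

Let p_iB i b : tau (iB d b) (p i) = ract (p i) (lam (iB d b)).
Proof. by rewrite (iBE i); exact: sgm_pk. Qed.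

Let p'_iB i b : tau (iB d b) (p' i) = ract (p' i) (lam (iB d b)).
Proof.
rewrite (iBE i) /tau sgmE !lopME star_Uk_Uk// -(iBE i) sig_v2_iota.
by rewrite (padjM (lop_adj _)).
Qed.

Let hdot_pk_real m i : (exists a b, m = vec lam a b) ->
  exists s : R[i], hdot m (p i) = s *: cone.
Proof.
move=> [a [b ->]]; have [a' [b' hp]] := pk_vec (C := C) (S := S) lam i.
rewrite /p hp /vec !hdotDl !hdotDr !hdotZl !hdotZr hdot_v11 hdot_v12 hdot_v21 hdot_v22.
rewrite !scaler0 addr0 add0r !scalerA -scalerDl; by eexists.
Qed.

Let word_coef m i l x : (exists a b, m = vec lam a b) -> rw i l x ->
  exists c, hdot m (tau x m) = (c *: hdot m (p i)) ** lam x.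
Proof.
move=> [a [b ->]] rx; have [c [m' [mo hm]]] := sgm_redw lam CS a b rx.
by exists c%:C; rewrite /tau hm hdotDr (Mo_vec a b mo) addr0 hdotMr hdotZr.
Qed.

(** At a general angle the coefficient of p k at a word is still a scalar multiple of [lam x]. Its
    vacuum coefficient contains the factor [vx k x], which vanishes except for single letters of
    [A k], and for those the scalar is 1. *)
Let base_p x : hdot vac (piA k (hdot (p k) (tau x (p k))) vac) = vx k x.
Proof.
move: x; apply: redw_eq; [exact: coef_lin|exact: vx_lin|move=> b|move=> i l x rx].
  by rewrite p_iB hdotMr p_norm cmul1l piA_lam.
have [a [b pE]] := pk_vec (C := C) (S := S) lam k.
have [[y [ik ->]]|x0] := vx_redw_cases k rx.
  rewrite -[LHS]/(hdot vac (piA k (hdot (p k) (sgm lam CS (inj k y) (p k))) vac)).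
  by rewrite sgm_pk hdotMr p_norm cmul1l piA_lam.
have [c ->] := word_coef (ex_intro _ a (ex_intro _ b pE)) rx.
have [s hs] := hdot_pk_real i (ex_intro _ a (ex_intro _ b pE)).
rewrite hs x0 scalerA cmulZl cmul1l linearZ lopZE piA_lam hdotZr.
by rewrite -/(vx k x) x0 scaler0.
Qed.

Let p'_coef0 i l x : rw i l x -> hdot (p' i) (tau x (p' i)) = 0.
Proof.
have [a [b pE]] := pk'_vec (C := C) (S := S) lam i.
move=> /(word_coef (ex_intro _ a (ex_intro _ b pE)))[c ->].
by rewrite p'p scaler0 cmul0l.
Qed.

(** The coefficient of p' i vanishes at words that start or end in [A i], since p' i is orthogonal
    to p i. At the other words it is a scalar multiple of [lam x], and the hypothesis on h removes
    it; only [EB] remains. *)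
Let base_p' i h x : (forall y, rw (~~ i) (~~ i) y -> hdot h (pih d k y h) = 0) ->
  hdot h (piA k (hdot (p' i) (tau x (p' i))) h) = hdot h (pih d k (iB d (EB x)) h).
Proof.
move=> hy; move: x; apply: redw_eq; first exact: coef_lin.
- have l1 := EB_lin d.
  have l2 : lin_on setT (iB d).
    split=> [x y _ _|c x _|]; [exact: linearD|exact: linearZ|].
    by exists 1 => // x _; rewrite mul1r shom_nr.
  exact: (lin_on_compT (lin_on_compT l1 l2) (hdot_rep_lin (pih d k) h h)).
- by move=> b; rewrite p'_iB hdotMr p'_norm cmul1l piA_lam EB_iota.
move=> i' l x rx; rewrite (EB_redw rx) !linear0 lop0E hdot0r.
have neqE a b : a = b \/ a = ~~ b by case: a b => [] []; [left|right|right|left].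
have [ii|ii] := neqE i' i.
  by rewrite ii in rx; rewrite (p'_coef0 rx) linear0 lop0E hdot0r.
have [li|li] := neqE l i.
  rewrite li in rx; have := p'_coef0 (redw_star Es rx).
  rewrite shom_star -lop_adj hdotC => /(f_equal star); rewrite starK star0 => ->.
  by rewrite linear0 lop0E hdot0r.
rewrite ii li in rx; have [a [b pE]] := pk'_vec (C := C) (S := S) lam i.
have [c ->] := word_coef (ex_intro _ a (ex_intro _ b pE)) rx.
have [s ->] := hdot_pk_real (~~ i) (ex_intro _ a (ex_intro _ b pE)).
by rewrite scalerA cmulZl cmul1l linearZ lopZE piA_lam hdotZr hy// scaler0.
Qed.

Let bounded_p' i h : (forall y, rw (~~ i) (~~ i) y -> hdot h (pih d k y h) = 0) ->
  bounded (j (p' i) h).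
Proof.
move=> hy; apply: (ell_bounded_form rpsi.1); exists (nr h ^+ 2); first exact: sqr_ge0.
move=> x; rewrite hdot_psi base_p'//; apply: le_trans (hdot_CS _ _) _.
rewrite expr2 -mulrA ler_wpM2l ?nr_ge0//; apply: le_trans (lop_nr _ _) _.
rewrite mulrC ler_wpM2l ?nr_ge0//; apply: le_trans (shom_nr _ _) _.
by apply: le_trans (shom_nr _ _) _; exact: EB_lam.
Qed.

Let bounded_vec i h a b : bounded (j (p i) h) -> bounded (j (p' i) h) ->
  bounded (j (vec lam a b) h).
Proof.
have [s [t ->]] := vec_pk lam CS i a b.
move=> hp hp'; rewrite (tensor_Dl repk HT)// !(tensor_Zl repk HT)//.
by apply: (ell_boundedD rpsi.1); apply: (ell_boundedZ rpsi.1).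
Qed.

Let bounded_vac a b : bounded (j (vec lam a b) vac).
Proof.
apply: (@bounded_vec k).
  apply: (ell_bounded_form rpsi.1); exists 1 => // x; rewrite hdot_psi base_p mul1r.
  exact: vx_lam.
by apply: bounded_p' => y ry; exact: vx_redw_l ry.
Qed.

(** Induction on g = y g', with y in [A i]. Along p i, balancing the tensor product moves y to the
    left factor, which reduces the claim to g'. Along p' i, the hypothesis of [base_p'] holds: for a
    reduced y from ~~ i to ~~ i, g* y g is reduced of length at least three, so its vacuum
    coefficient is 0. *)
Let bounded_word i l g : rw i l g -> forall a b, bounded (j (vec lam a b) (pih d k g vac)).
Proof.
have step i' y h : E i' y = 0 -> (forall a b, bounded (j (vec lam a b) h)) ->
    bounded (j (p i') (pih d k (inj i' y) h)).
  move=> y0 hb; have [a [b pE]] := pk_vec (C := C) (S := S) lam i'.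
  rewrite -piA_lam -(tensor_balanced repk HT) -(sgm_pk lam CS) -psi_j.
  by rewrite /p pE; apply: (ell_bounded_rep rpsi.1); exact: hb.
have vanish i' l' g' : rw i' l' g' -> forall y, rw (~~ i') (~~ i') y ->
    hdot (pih d k g' vac) (pih d k y (pih d k g' vac)) = 0.
  move=> rg y ry; rewrite lop_adj -shom_star -!lopME -!shomM.
  rewrite -[LHS]/(vx k _).
  rewrite -cmulA; apply: (vx_cat k (redw_star Es rg)); apply: (redw_cat ry); rewrite negbK; exact: rg.
elim=> [i' y y0|i' l' y z y0 rz IH] a b; apply: (@bounded_vec i').
- exact: step.
- exact/bounded_p'/vanish/redw1.
- by rewrite shomM lopME; exact: step.
- exact/bounded_p'/vanish/(redwS y0 rz).
Qed.

Lemma fibre_bound x z : nr (psi x z) <= nr (lam x) * nr z.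
Proof.
pose X : set T := [set z | exists y a b g c, z = psi y (j (vec lam a b) (ract (pih d k g vac) c)) /\
  forall a b, bounded (j (vec lam a b) (pih d k g vac))].
apply: (dense_bound (ell := lam) rpsi.1 (X := X)).
  move=> _ [y [a [b [g [c [-> hb]]]]]]; apply: (ell_bounded_rep rpsi.1).
  by rewrite -(tensor_ract repk HT); apply: (ell_boundedM rpsi.1); exact: hb.
have XP := clspan_csub X.
have Xr t c : clspan X t -> clspan X (ract t c).
  move: t; apply: (csub_preT (f := fun t => ract t c)) => //.
    split=> [x' y _ _|c' x' _|]; [exact: ractDl|exact: ractZl|].
    by exists (nr c) => [|x' _]; [exact: nr_ge0|rewrite mulrC nr_ract].
  move=> _ [y [a [b [g [c' [-> hb]]]]]]; apply: sub_clspan.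
  exists y, a, b, g, (c' ** c); split=> //.
  by rewrite -(padjM (rep_adj rpsi.1 y)) (tensor_ract repk HT) ractM.
have base y a b g : clspan X (psi y (j (vec lam a b) (pih d k g vac))).
  (* Boundedness is known only for g in B or a reduced word; linearity in g places all other
     translates of the vacuum in the closed span of X. *)
  have lin : lin_on setT (fun g => psi y (j (vec lam a b) (pih d k g vac))).
    have l1 := tensor_lin_r (vec lam a b) repk HT (csubT _).
    have l2 : lin_on setT (fun g => pih d k g vac).
      split=> [x' y' _ _|c' x' _|]; first by rewrite linearD lopDE.
        by rewrite linearZ lopZE.
      exists (nr vac) => [|x' _]; first exact: nr_ge0.
      by apply: le_trans (lop_nr _ _) _; rewrite mulrC ler_wpM2l ?nr_ge0 ?shom_nr.
    exact: (lin_on_compT (lin_on_compT l2 l1) (lin_on_rep y rpsi.1)).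
  have HS := lin_on_pre (csubT Af) lin XP.
  have h := amalgam_redw_ind E_cond full HS.
  case: (h _ _ g) => // [b'|i l g' rg]; split=> //.
    rewrite (inj_iota full true k) -[inj k _]cmul1l.
    have -> : pih d k (cone ** inj k (iota k b')) vac = ract (pih d k cone vac) (iota k b').
      by rewrite cmul1l shom1 lop1E; exact: (pi_vac (vpi_vertex d)).
    apply: sub_clspan; exists y, a, b, cone, (iota k b'); split=> //.
    by move=> a' b''; rewrite shom1 lop1E; exact: bounded_vac.
  apply: sub_clspan; exists y, a, b, g', cone; rewrite ract1; split=> //.
  exact: (bounded_word rg).
have step y a b h : clspan X (psi y (j (vec lam a b) h)).
  have : clspan [set z | exists x c, z = ract (pih d k x vac) c] h by rewrite vac_span.
  move: h; apply: (csub_preT (f := fun h => psi y (j (vec lam a b) h))) => //.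
    exact: (lin_on_compT (tensor_lin_r _ repk HT (csubT _)) (lin_on_rep y rpsi.1)).
  move=> _ [g [c ->]]; rewrite -(tensor_ract repk HT) (padjM (rep_adj rpsi.1 y)).
  exact/Xr/base.
rewrite -subTset => t _; have : clspan [set z | exists x y, setT y /\ z = j x y] t by rewrite HT.2.
apply: (csub_clspan XP) => _ [m [h [_ ->]]].
have : clspan [set z | exists y a b c, z = ract (sgm lam CS y (vec lam a b)) c] m.
  by rewrite sgm_cyclic.
apply: (tensor_csub_l repk HT XP) => // _ [y [a [b [c ->]]]].
by rewrite (tensor_balanced repk HT) -psi_j.
Qed.

End Fibre.

(** Write <tau x m, tau x m> = e* e with e in A. The representations [piA k] determine the norm of
    e, and |[piA k] e h| is the norm of (tau x m) (x) h, where [fibre_bound] applies. *)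
Lemma sgm_reduced_bound x m : nr (tau x m) <= nr (lam x) * nr m.
Proof.
have [e eE] := hdot_pos (tau x m).
have L0 : 0 <= nr (lam x) * nr m by rewrite mulr_ge0 ?nr_ge0.
apply: nr_le_sq => //; rewrite eE nr_starM ler_pXn2r ?nnegrE ?nr_ge0//.
apply: piA_norming => k; apply: lop_nr_le => // h.
have repk : unital_rep (fun a (h : whsum (vH d) k k) => piA k a h) := shom_rep (piA k).
have [T [j HT]] := tensor_exists (E := MQ lam) repk.
have [psi [rpsi hpsi]] := tensor_action repk HT (shom_rep tau).
have := fibre_bound HT rpsi hpsi x (j m h); rewrite hpsi => hb.
apply: nr_le_sq; first by rewrite mulr_ge0 ?nr_ge0.
have -> : hdot (piA k e h) (piA k e h) = hdot (j (tau x m) h) (j (tau x m) h).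
  by rewrite (tensor_hdot HT)// eE shomM shom_star lopME -lop_adj.
rewrite nr_hdot ler_pXn2r ?nnegrE ?mulr_ge0 ?nr_ge0//; apply: le_trans hb _.
by rewrite -mulrA ler_wpM2l ?nr_ge0// (tensor_nr repk HT).
Qed.

End Reduced.

(** * Compact operators and Kasparov cycles *)

Section Separability.
Context {R : realType}.

(** [Rel e z c] means that the code c describes z with precision e. One vector is chosen for each
    pair of a precision and a code, so no approximating vector has to be constructed. *)
Lemma sep_codes {V : normedModType R[i]} {C : countType} (Rel : R -> V -> C -> Prop) (M : R) :
  (forall e z, 0 < e -> exists c, Rel e z c) ->
  (forall e y z c, 0 < e -> Rel e y c -> Rel e z c -> nr (y - z) <= M * e) -> separable V.
Proof.
(* The default 0 is taken for codes that describe no vector. *)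
move=> h1 h2; pose s (p : nat * C) : V := xget 0 [set z | Rel p.1.+1%:R^-1 z p.2].
exists (range s); first exact: (card_le_trans (card_image_le _ _) (countableP _)).
apply/denseP => z e e0; have M1 : 0 < `|M| + 1 by rewrite ltr_pwDr.
have [N hN] := inv_succ_lt (divr_gt0 e0 M1).
have d0 : 0 < N.+1%:R^-1 :> R by rewrite invr_gt0.
have [c hc] := h1 _ z d0; exists (s (N, c)); first by exists (N, c).
have hs : Rel N.+1%:R^-1 (s (N, c)) c by apply: (@xgetI _ 0 [set z | Rel N.+1%:R^-1 z c] z).
apply: le_lt_trans (h2 _ _ _ _ d0 hc hs) _.
have := hN N (leqnn _); rewrite ltr_pdivlMr// => h; set dd := N.+1%:R^-1 in d0 h *.
have h' : M * dd <= `|M| * dd by rewrite ler_wpM2r ?ler_norm// ltW.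
apply: le_lt_trans h' _; apply: le_lt_trans h; rewrite mulrC mulrDr mulr1.
lra.
Qed.

Lemma sep_seq {V : normedModType R[i]} : separable V ->
  exists s : nat -> V, forall x (e : R), 0 < e -> exists n, nr (x - s n) < e.
Proof.
move=> [S /countable_injP[f finj] /denseP dS].
exists (fun n => xget 0 [set x | S x /\ f x = n]) => x e /(dS x)[y Sy xy].
exists (f y); have [Sz fz] := @xgetI _ 0 [set x | S x /\ f x = f y] y (conj Sy erefl).
suff <- : y = xget 0 [set x | S x /\ f x = f y] by [].
by apply: finj; rewrite ?inE.
Qed.

Lemma sep_dsum {D : cstarAlgType R} (E F : hilbertModType D) :
  separable E -> separable F -> separable (dsum E F).
Proof.
move=> /sep_seq[s hs] /sep_seq[t ht].
pose Rel (e : R) (z : dsum E F) (c : nat * nat) := nr (z.1 - s c.1) < e /\ nr (z.2 - t c.2) < e.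
apply: (@sep_codes _ _ Rel 4) => [e z e0|e y z c e0 [y1 y2] [z1 z2]].
  by have [n hn] := hs z.1 e e0; have [m hm] := ht z.2 e e0; exists (n, m).
have -> : y - z = (y.1 - z.1, y.2 - z.2) by [].
apply: le_trans (dsum_nr_le _ _) _.
have := nr_tri y.1 (s c.1) z.1; have := nr_tri y.2 (t c.2) z.2.
rewrite [nr (s _ - _)]nr_dist [nr (t _ - _)]nr_dist; lra.
Qed.

Lemma sep_total {D : cstarAlgType R} {V : completeNormedModType R[i]} {E : hilbertModType D}
    (e : V -> E) : separable V -> separable D -> lin_on setT e -> total e -> separable E.
Proof.
move=> /sep_seq[s hs] /sep_seq[t ht] le te.
have [C C0 hC] := lin_on_bd le.
pose code (c : seq (nat * nat)) := [seq (s p.1, t p.2) | p <- c].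
pose Rel (r : R) (z : E) c := nr (z - fsum e (code c)) <= r.
apply: (@sep_codes _ _ Rel 2) => [r z r0|r y z c r0 hy hz]; last first.
  move: hy hz; rewrite /Rel.
  by have := nr_tri y (fsum e (code c)) z; rewrite [nr (fsum _ _ - _)]nr_dist; lra.
have r2 : 0 < r / 2 by rewrite divr_gt0.
have [l hl] := te z _ r2.
suff [c hc] : exists c, nr (fsum e l - fsum e (code c)) <= r / 2.
  exists c; apply: le_trans (nr_tri _ (fsum e l) _) _.
  by rewrite [leRHS]splitr; apply: lerD => //; exact: ltW.
elim: l (r / 2) r2 {hl} => [|[v d] l IH] r' r0'.
  by exists [::]; rewrite /fsum !big_nil subrr nr0 ltW.
have r2 : 0 < r' / 2 by rewrite divr_gt0.
have [c hc] := IH _ r2.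
have d1 : 0 < C * (nr d + 1) + 1 by rewrite ltr_pwDr// mulr_ge0// addr_ge0 ?nr_ge0.
have v1' : 0 < C * nr v + 1 by rewrite ltr_pwDr// mulr_ge0 ?nr_ge0.
have e1 : 0 < Num.min 1 (r' / 4 / (C * nr v + 1)) by rewrite lt_min ltr01 !divr_gt0.
have e2 : 0 < r' / 4 / (C * (nr d + 1) + 1) by rewrite !divr_gt0.
have [m] := ht d _ e1; rewrite lt_min => /andP[hm1]; rewrite ltr_pdivlMr// => hm2.
have [n] := hs v _ e2; rewrite ltr_pdivlMr// => hn.
exists ((n, m) :: c); rewrite /fsum /= !big_cons -/(fsum e l) -/(fsum e (code c)) /=.
set a := ract _ _; set b := ract _ _.
have -> : a + fsum e l - (b + fsum e (code c)) = (a - b) + (fsum e l - fsum e (code c)).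
  by rewrite opprD addrACA.
apply: le_trans (nrD _ _) _.
suff : nr (a - b) <= r' / 2 by lra.
have -> : a - b = ract (e v) (d - t m) + ract (e (v - s n)) (t m).
  by rewrite (lin_onB (csubT V) le)// ractBr ractBl addrA subrK.
apply: le_trans (nrD _ _) _.
have a1 : nr (ract (e v) (d - t m)) <= C * nr v * nr (d - t m).
  by apply: le_trans (nr_ract _ _) _; rewrite ler_wpM2r ?nr_ge0 ?hC.
have a2 : nr (ract (e (v - s n)) (t m)) <= C * nr (v - s n) * nr (t m).
  by apply: le_trans (nr_ract _ _) _; rewrite ler_wpM2r ?nr_ge0 ?hC.
have tm : nr (t m) <= nr d + 1.
  by have := nr_rev (t m) d; rewrite nr_dist in hm1; lra.
have a3 : C * nr (v - s n) * nr (t m) <= C * nr (v - s n) * (nr d + 1).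
  by rewrite ler_wpM2l// mulr_ge0 ?nr_ge0.
have := nr_ge0 (d - t m); have := nr_ge0 (v - s n); nra.
Qed.

(** A path is coded by the mesh of a grid on which it varies by less than r, and by indices of
    approximants at the grid points. Two paths with the same code differ by at most 4 r: two
    variations and two approximations. *)
Lemma sep_hpath {A : cstarAlgType R} {E : hilbertModType A} {S : set E} (HS : is_csubmod (S := S)) :
  separable E -> separable (hpath HS).
Proof.
move=> /sep_seq[s hs].
pose Rel (r : R) (f : hpath HS) (c : nat * seq nat) :=
  (forall x y, 0 <= x <= 1 -> `|y - x| <= c.1.+1%:R^-1 -> nr (f y - f x) < r) /\
  forall i, (i <= c.1.+1)%N -> nr (f (i%:R / c.1.+1%:R) - s (nth 0%N c.2 i)) < r.
apply: (@sep_codes _ _ Rel 4) => [r f r0|r f g [m c] r0 [/= f1 f2] [/= g1 g2]].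
  have [fc _ _] := cpathP f; have [d d0 hd] := pcont_unif fc r0.
  have [N hN] := inv_succ_lt d0.
  have /choice[k hk] : forall i : nat, exists n, nr (f (i%:R / N.+1%:R) - s n) < r.
    by move=> i; exact: hs.
  (* The grid points i/(N+1) have 0 <= i <= N+1, hence N+2 entries. *)
  exists (N, mkseq k N.+2); split=> /= [x y x01 xy|i iN].
    by apply: hd => //; apply: le_lt_trans xy _; exact: hN.
  by rewrite nth_mkseq.
have near (t : R) : 0 <= t <= 1 ->
    exists2 i : nat, (i <= m.+1)%N & `|t - i%:R / m.+1%:R| <= m.+1%:R^-1.
  move=> /andP[t0 t1]; have m0 : (0 : R) < m.+1%:R by rewrite ltr0n.
  have tm0 : 0 <= t * m.+1%:R by rewrite mulr_ge0// ltW.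
  have /andP[] := truncn_itv tm0; set i := Num.truncn _ => i1 i2; exists i.
    rewrite -(ler_nat R); apply: le_trans i1 _.
    by rewrite -[leRHS]mul1r ler_wpM2r// ltW.
  clearbody i; rewrite -[leRHS]mul1r -[t in leLHS](@mulfK _ m.+1%:R)// ?gt_eqF// -mulrBl normrM.
  rewrite [`|_^-1|]ger0_norm ?invr_ge0 ?(ltW m0)// ler_wpM2r ?invr_ge0 ?(ltW m0)//.
  rewrite ger0_norm ?subr_ge0// lerBlDl; apply: ltW.
  by rewrite natr1.
apply: cpath_nr_le => t.
have [_ fcl _] := cpathP f; have [_ gcl _] := cpathP g.
have -> : (f - g) t = f (clamp t) - g (clamp t) by rewrite fcl gcl.
have t01 := clamp_bounds t; have [i im hi] := near _ t01.
have i01 : 0 <= (i%:R / m.+1%:R : R) <= 1.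
  by apply/andP; split; [exact: divr_ge0|rewrite ler_pdivrMr ?ltr0n// mul1r ler_nat].
have := f1 _ _ i01 hi; have := g1 _ _ i01 hi; have := f2 _ im; have := g2 _ im.
set u := f _; set v := g _; set u' := f _; set v' := g _; set p := s _ => a1 a2 a3 a4.
have := nr_tri u' u v'; have := nr_tri u p v'; have := nr_tri p v v'.
by rewrite [nr (p - v)]nr_dist [nr (v - v')]nr_dist; lra.
Qed.

End Separability.

Section CompactOperators.
Context {R : realType} {D : cstarAlgType R}.

Lemma compact_rank1 (E F : hilbertModType D) (x : F) (y : E) :
  compact_op (fun z => ract x (hdot y z)).
Proof.
split; first by exists (fun z => ract y (hdot x z)); exact: rank1_adj.
move=> e e0; exists 1%N, (fun=> x), (fun=> y) => z.
by rewrite big_ord1 subrr normr0 mulr_ge0// ltW.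
Qed.

Lemma compact_0 (E F : hilbertModType D) : compact_op (fun _ : E => (0 : F)).
Proof.
have := compact_rank1 (0 : F) (0 : E); congr compact_op; apply/funext => z.
by rewrite ract0l.
Qed.

Context {E : hilbertModType D}.

Definition cpt : set (lop E) := clspan [set T | exists x y, T = rank1 x y].

Lemma cpt_csub : is_csub cpt. Proof. exact: clspan_csub. Qed.

Lemma cpt_rank1 x y : cpt (rank1 x y). Proof. by apply: sub_clspan; exists x, y. Qed.

Lemma cptN T : cpt T -> cpt (- T). Proof. exact: clspanN. Qed.

Lemma cptB T S : cpt T -> cpt S -> cpt (T - S).
Proof. by move=> hT hS; apply: clspanD => //; exact: clspanN. Qed.

Let mul_lin (S : lop E) : lin_on setT (fun T => S ** T) /\ lin_on setT (fun T => T ** S).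
Proof.
split; split=> [x y _ _|c x _|]; rewrite ?cmulDr ?cmulDl ?cmulZr ?cmulZl//.
  by exists (nr S) => [|x _]; [exact: nr_ge0|exact: nrM].
by exists (nr S) => [|x _]; [exact: nr_ge0|rewrite mulrC; exact: nrM].
Qed.

Lemma cpt_mull S T : cpt T -> cpt (S ** T).
Proof.
move: T; apply: (csub_preT (f := fun T => S ** T) (mul_lin S).1 cpt_csub).
by move=> _ [x [y ->]]; rewrite lop_rank1; exact: cpt_rank1.
Qed.

Lemma cpt_mulr S T : cpt T -> cpt (T ** S).
Proof.
move: T; apply: (csub_preT (f := fun T => T ** S) (mul_lin S).2 cpt_csub).
by move=> _ [x [y ->]]; rewrite rank1_lop; exact: cpt_rank1.
Qed.

Lemma cpt_star T : cpt T -> cpt (star T).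
Proof.
move: T; apply: clspan_ind.
- by move=> _ [x [y ->]]; rewrite star_rank1; exact: cpt_rank1.
- by rewrite star0; exact: clspan0.
- by move=> x y hx hy; rewrite starD; exact: clspanD.
- by move=> c x hx; rewrite starZ; exact: clspanZ.
by move=> u l hu ul; apply: clspan_cvs hu (cvs_star ul).
Qed.

Lemma cpt_compact T : cpt T -> compact_op T.
Proof.
move=> cT; split; first by exists (star T); exact: lop_adj.
move=> _ /posC[e e0 ->]; move/closureP: cT => /(_ e e0)[_ [n [c [f [fX ->]]]]] h.
have /choice[x hx] : forall i, exists p : E * E, f i = rank1 p.1 p.2.
  by move=> i; have [x [y ->]] := fX i; exists (x, y).
exists n, (fun i => c i *: (x i).1), (fun i => (x i).2) => z.
rewrite (_ : \sum_(i < n) _ = (\sum_(i < n) c i *: f i) z); last first.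
  rewrite (big_morph (fun S : lop E => S z) (id1 := 0) (op1 := +%R))//.
  by apply: eq_bigr => i _; rewrite hx lopZE rank1E ractZl.
rewrite -lopBE !nrE -rmorphM lecR; apply: le_trans (lop_nr _ _) _.
by rewrite ler_wpM2r ?nr_ge0// ltW.
Qed.

(** The mechanism behind the compact commutators: F commutes exactly with the unrotated action, and
    by [cpt_conj] the rotation changes that action by compact operators. *)
Lemma cpt_comm F T S : F ** T = T ** F -> cpt (S - T) -> cpt (F ** S - S ** F).
Proof.
move=> FT h; have -> : F ** S - S ** F = F ** (S - T) - (S - T) ** F.
  by rewrite cmulBr cmulBl FT opprB addrA subrK.
by apply: cptB; [exact: cpt_mull|exact: cpt_mulr].
Qed.

Lemma cpt_conj U T : cpt (U - cone) -> U ** star U = cone -> cpt (U ** T ** star U - T).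
Proof.
move=> hU uu; have -> : U ** T ** star U - T = (U - cone) ** T ** star U + T ** star (U - cone).
  by rewrite starB star1 cmulBr !cmulBl cmul1l cmul1r addrA addrNK.
by apply: clspanD; [do 2 apply: cpt_mulr|apply: cpt_mull; exact: cpt_star].
Qed.

End CompactOperators.

Section DirectSumOperators.
Context {R : realType} {D : cstarAlgType R} {E F : hilbertModType D}.

Let dm (S : lop E) (T : lop F) (z : dsum E F) : dsum E F := (S z.1, T z.2).

Let dm_adj S T : adjoint_pair (dm S T) (dm (star S) (star T)).
Proof. by move=> x y; rewrite !dsum_hdotE /= !lop_adj. Qed.

Let dm_bound S T z : nr (dm S T z) <= (nr S + nr T) * nr z.
Proof.
apply: le_trans (dsum_nr_le _ _) _; rewrite mulrDl; apply: lerD.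
  by apply: le_trans (lop_nr _ _) _; rewrite ler_wpM2l ?nr_ge0 ?dsum_nr1.
by apply: le_trans (lop_nr _ _) _; rewrite ler_wpM2l ?nr_ge0 ?dsum_nr2.
Qed.

Definition dlop S T : lop (dsum E F) :=
  Lop (lop_of (dm_adj S T) (addr_ge0 (nr_ge0 S) (nr_ge0 T)) (dm_bound S T)).

Lemma dlopE S T (z : dsum E F) : dlop S T z = (S z.1, T z.2). Proof. by []. Qed.

Lemma dlop_star S T : star (dlop S T) = dlop (star S) (star T).
Proof. by apply: lop_star_uniq; exact: dm_adj. Qed.

Lemma dlopM S T S' T' : dlop S T ** dlop S' T' = dlop (S ** S') (T ** T').
Proof. by apply: lop_ext. Qed.

Lemma dlop1 : dlop cone cone = cone.
Proof. by apply: lop_ext => -[x y]; rewrite dlopE !lop1E. Qed.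

Context {A : cstarAlgType R} (g : starHom A (lop E)) (h : starHom A (lop F)).

Let f a := dlop (g a) (h a).
Let f_lin : linear f.
Proof. by move=> c a b; apply: lop_ext => z; rewrite /f !linearP. Qed.
HB.instance Definition _ := GRing.isLinear.Build R[i] A (lop (dsum E F)) *:%R f f_lin.
Let fM a b : f (a ** b) = f a ** f b. Proof. by rewrite /f dlopM !shomM. Qed.
Let f1 : f cone = cone. Proof. by rewrite /f !shom1 dlop1. Qed.
Let fs a : f (star a) = star (f a). Proof. by rewrite /f dlop_star !shom_star. Qed.
Definition dshom : starHom A (lop (dsum E F)) := StarHom fM f1 fs.
Lemma dshomE a : dshom a = dlop (g a) (h a). Proof. by []. Qed.

(** The two bounds are not added: vectors with one zero component satisfy the bound and span, so
    [dense_bound] returns the same constant on the whole sum. *)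
Lemma dshom_bound (L : cstarAlgType R) (ell : starHom A L) :
  (forall a x, nr (g a x) <= nr (ell a) * nr x) ->
  (forall a y, nr (h a y) <= nr (ell a) * nr y) ->
  forall a z, nr (dshom a z) <= nr (ell a) * nr z.
Proof.
move=> hg hh; pose X := [set z : dsum E F | z.1 = 0 \/ z.2 = 0].
apply: (dense_bound (shom_rep dshom).1 (X := X)) => [[x y] [/= ->|/= ->]|].
- exists (nr y); first exact: nr_ge0.
  move=> a; rewrite -[X in nr X]/((g a 0, h a y) : dsum E F) (padj0 (lop_adj _)).
  by rewrite dsum_nr_inr mulrC.
- exists (nr x); first exact: nr_ge0.
  move=> a; rewrite -[X in nr X]/((g a x, h a 0) : dsum E F) (padj0 (lop_adj _)).
  by rewrite dsum_nr_inl mulrC.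
rewrite -subTset => -[x y] _; have -> : (x, y) = (x, 0) + (0, y) :> dsum E F.
  by congr (_, _); rewrite /= ?addr0 ?add0r.
by apply: clspanD; apply: sub_clspan; [right|left].
Qed.

End DirectSumOperators.

Section DenseGeneration.
Context {R : realType} {B : cstarAlgType R} {A : bool -> cstarAlgType R}.
Context {iota : forall k, starHom B (A k)} {Af T : cstarAlgType R}.
Context {inj : forall k, starHom (A k) Af} {ell : starHom Af T}.
Hypothesis full : is_full_amalgam iota inj.
Hypothesis ell_dense : dense (range ell).

Lemma amalgam_dense_ind (P : set T) : is_subalg P ->
  (forall k a, P (ell (inj k a))) -> forall t, P t.
Proof.
move=> HP Pg t; have [u ut] := dense_range_cvs ell_dense t.
apply: (subalg_cvs HP) ut => n; move: (u n).
apply: (full_amalgam_ind full (P := [set x | P (ell x)])) => //; split=> /=.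
- by rewrite shom1; exact: subalg1.
- by move=> a b Pa Pb; rewrite linearD; exact: (subalgD HP).
- by move=> c a Pa; rewrite linearZ; exact: (subalgZ HP).
- by move=> a b Pa Pb; rewrite shomM; exact: (subalgM HP).
- by move=> a Pa; rewrite shom_star; exact: (subalg_star HP).
by move=> v l hv vl; apply: (subalg_cvs HP) hv (cvs_shom ell vl).
Qed.

Context {D : cstarAlgType R} {N : hilbertModType D} (gam F : lop N) (v : N).
Context (Th : starHom T (lop N)).

Definition opcycle : Defs.cycle T D := @Cycle R T D N gam (fun a x => Th a x) F.

Hypotheses (gam_sa : star gam = gam) (gam_sq : gam ** gam = cone).
Hypotheses (F_sa : star F = F) (F_gam : F ** gam = - (gam ** F)).
Hypothesis F_sq : F ** F = cone - rank1 v v.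
Hypothesis gam_Th : forall k a, gam ** Th (ell (inj k a)) = Th (ell (inj k a)) ** gam.
Hypothesis F_Th : forall k a,
  cpt (F ** Th (ell (inj k a)) - Th (ell (inj k a)) ** F).

Let gam_comm t : gam ** Th t = Th t ** gam.
Proof.
move: t; apply: amalgam_dense_ind => //; split=> /=.
- by rewrite shom1 cmul1l cmul1r.
- by move=> a b ha hb; rewrite linearD cmulDl cmulDr ha hb.
- by move=> c a ha; rewrite linearZ cmulZl cmulZr ha.
- by move=> a b ha hb; rewrite shomM cmulA ha -[LHS]cmulA hb cmulA.
- by move=> a ha; rewrite shom_star -{1}gam_sa -starM -ha starM gam_sa.
move=> u l hu ul; apply: (cvs_uniq (cvs_mull gam (cvs_shom Th ul))).
have := cvs_mulr gam (cvs_shom Th ul); congr cvs; apply/funext => n; by rewrite hu.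
Qed.

(** The elements whose commutator with F is compact form a closed *-subalgebra; closure under
    adjoints uses that F is selfadjoint. Hence the two algebras [A k] suffice. *)
Lemma opcycle_cpt t : cpt (F ** Th t - Th t ** F).
Proof.
move: t; apply: amalgam_dense_ind => //; split=> /=.
- by rewrite shom1 cmul1l cmul1r subrr; exact: (csub0 cpt_csub).
- move=> a b ha hb; rewrite linearD cmulDl cmulDr opprD addrACA.
  exact: (csubD cpt_csub).
- by move=> c a ha; rewrite linearZ cmulZl cmulZr -scalerBr; exact: (csubZ cpt_csub).
- move=> a b ha hb; rewrite shomM.
  have -> : F ** (Th a ** Th b) - Th a ** Th b ** F =
      (F ** Th a - Th a ** F) ** Th b + Th a ** (F ** Th b - Th b ** F).
    by rewrite cmulBl cmulBr !cmulA addrA subrK.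
  by apply: (csubD cpt_csub); [exact: cpt_mulr|exact: cpt_mull].
- move=> a /cpt_star/cptN; congr cpt.
  by rewrite starB !starM F_sa -shom_star opprB.
move=> u l hu ul; apply: (csub_cvs cpt_csub) hu _.
have cN (w : nat -> lop N) m : cvs w m -> cvs (fun n => - w n) (- m).
  by apply: (@cvs_lip _ _ _ -%R 1) => x y; rewrite mul1r -opprD nrN.
exact: cvsD (cvs_mull _ (cvs_shom Th ul)) (cN _ _ (cvs_mulr _ (cvs_shom Th ul))).
Qed.

Lemma opcycle_kasparov : separable N -> is_kasparov opcycle.
Proof.
move=> sepN; split=> //=.
- split; first by move=> x y; rewrite lop_adj gam_sa.
  by move=> x; rewrite -lopME gam_sq lop1E.
- split; first exact: (shom_rep Th).1.
  by move=> a x; rewrite -!lopME gam_comm.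
- by move=> x; rewrite -!lopME F_gam lopNE.
exists F; first by move=> x y; rewrite lop_adj F_sa.
move=> a; split.
- have := cpt_compact (@opcycle_cpt a); congr compact_op.
- have h : cpt (- (rank1 v v ** Th a)) by apply/cptN/cpt_mulr/cpt_rank1.
  have := cpt_compact h; congr compact_op; apply/funext => x.
  by rewrite -!lopME F_sq -lopBE cmulBl cmul1l addrAC subrr sub0r.
have := @compact_0 _ _ N N; congr compact_op; apply/funext => x.
by rewrite subrr.
Qed.

End DenseGeneration.

(** * Change of coefficients along a homomorphism *)

Section ChangeOfCoefficients.
Context {R : realType} {D D' : cstarAlgType R} (f : starHom D D').

(** The map u -> u (x) 1 into the tensor product of E with D' along f, without reference to a tensor
    product; [coeff_tensor] recovers the latter when the image generates E'. *)
Definition coeff_map (E : hilbertModType D) (E' : hilbertModType D') (L : E -> E') : Prop :=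
  forall u v, hdot (L u) (L v) = f (hdot u v).

Section Properties.
Context {E : hilbertModType D} {E' : hilbertModType D'} {L : E -> E'}.
Hypothesis HL : coeff_map L.

(** The defect of additivity is a combination of values of L and orthogonal to all of them, hence to
    itself. The next lemmas argue alike. *)
Lemma coeffD u v : L (u + v) = L u + L v.
Proof.
apply/eqP; rewrite -subr_eq0; apply/eqP/hdot_eq0; set w := _ - _.
have h z : hdot (L z) w = 0 by rewrite hdotBr hdotDr !HL -linearD -linearB -hdotDr subrr linear0.
by rewrite {1}/w hdotBl hdotDl !h addr0 subr0.
Qed.

Lemma coeffZ (c : R[i]) u : L (c *: u) = c *: L u.
Proof.
apply/eqP; rewrite -subr_eq0; apply/eqP/hdot_eq0; set w := _ - _.
have h z : hdot (L z) w = 0 by rewrite hdotBr hdotZr !HL hdotZr linearZ subrr.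
by rewrite {1}/w hdotBl hdotZl !h scaler0 subr0.
Qed.

Lemma coeffN u : L (- u) = - L u.
Proof. by rewrite -scaleN1r coeffZ scaleN1r. Qed.

Lemma coeffM u d : L (ract u d) = ract (L u) (f d).
Proof.
apply/eqP; rewrite -subr_eq0; apply/eqP/hdot_eq0; set w := _ - _.
have h z : hdot (L z) w = 0 by rewrite hdotBr hdotMr !HL hdotMr shomM subrr.
by rewrite {1}/w hdotBl hdotMl !h cmul0r subr0.
Qed.

Lemma coeff_nr u : nr (L u) <= nr u.
Proof. by apply: nr_le_sq; rewrite ?nr_ge0// HL -nr_hdot shom_nr. Qed.

Lemma coeff_lin : lin_on setT L.
Proof.
split=> [u v _ _|c u _|]; [exact: coeffD|exact: coeffZ|].
by exists 1 => // u _; rewrite mul1r coeff_nr.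
Qed.

End Properties.

Lemma coeff_shom : coeff_map (E := cself D) (E' := cself D') f.
Proof. by move=> u v; rewrite -[RHS]/(f (star (u : D) ** (v : D))) shomM shom_star. Qed.

Lemma coeff_dsum (E F : hilbertModType D) (E' F' : hilbertModType D') (L : E -> E') (M : F -> F') :
  coeff_map L -> coeff_map M ->
  coeff_map (fun z : dsum E F => (L z.1, M z.2) : dsum E' F').
Proof. by move=> HL HM u v; rewrite !dsum_hdotE /= HL HM linearD. Qed.

Lemma coeff_total (X : Type) (E : hilbertModType D) (E' : hilbertModType D') (e : X -> E)
    (e' : X -> E') : total e ->
  (forall x y, hdot (e' x) (e' y) = f (hdot (e x) (e y))) ->
  exists L : E -> E', coeff_map L /\ forall x, L (e x) = e' x.
Proof.
move=> te he; pose G s := fsum e' [seq (p.1, f p.2) | p <- s].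
have GG s t : hdot (G s) (G t) = f (hdot (fsum e s) (fsum e t)).
  rewrite /G !hdot_fsuml big_map linear_sum; apply: eq_bigr => p _ /=.
  rewrite shomM shom_star !hdot_fsumr big_map linear_sum; congr (_ ** _).
  by apply: eq_bigr => q _ /=; rewrite he shomM.
have [|||L [LG LL]] := @extend_total _ _ _ _ e E' G 1 te.
- by move=> s t; rewrite /G map_cat fsum_cat.
- move=> s; rewrite /G -fsum_opp /fopp -!map_comp; congr fsum.
  by apply: eq_map => p /=; rewrite linearN.
- move=> s; rewrite mul1r; apply: nr_le_sq; rewrite ?nr_ge0// GG -nr_hdot.
  exact: shom_nr.
exists L; split=> [u v|x]; last first.
  by rewrite -[in LHS](fsum_unit e) LG /G /= shom1 fsum_unit.
have [s hs] := total_seq u te; have [t ht] := total_seq v te.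
have h s' : hdot (G s') (L v) = f (hdot (fsum e s') v).
  have h1 : cvs (fun n => hdot (G s') (G (t n))) (hdot (G s') (L v)).
    by apply: cvs_hdotr; have := cvs_lip LL ht; congr cvs; apply/funext => n /=; rewrite LG.
  apply: (cvs_uniq h1); have := cvs_shom f (cvs_hdotr (fsum e s') ht).
  by congr cvs; apply/funext => n; rewrite GG.
have h1 : cvs (fun n => hdot (G (s n)) (L v)) (hdot (L u) (L v)).
  by apply: cvs_hdotl; have := cvs_lip LL hs; congr cvs; apply/funext => n /=; rewrite LG.
apply: (cvs_uniq h1); have := cvs_shom f (cvs_hdotl v hs).
by congr cvs; apply/funext => n; rewrite h.
Qed.

Lemma coeff_tensor (E : hilbertModType D) (E' : hilbertModType D') (L : E -> E') :
  coeff_map L -> clspan [set z | exists u c, z = ract (L u) c] = setT ->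
  is_tensor (fun d (c : cself D') => f d ** (c : D') : cself D') setT
    (fun u (c : cself D') => ract (L u) (c : D')).
Proof.
move=> HL cl; split=> [u u' c c' _ _|].
  rewrite hdotMr hdotMl HL -[RHS]/(star (c : D') ** (f (hdot u u') ** (c' : D'))).
  by rewrite cmulA.
rewrite -cl; congr clspan; apply/seteqP; split=> [_ [u [c [_ ->]]]|_ [u [c ->]]].
  by exists u, c.
by exists u, c.
Qed.

End ChangeOfCoefficients.

Lemma dlop_rank1 {R : realType} {D : cstarAlgType R} {E F : hilbertModType D} (x y : E) :
  dlop (rank1 x y) (0 : lop F) = rank1 ((x, 0) : dsum E F) (y, 0).
Proof.
apply: lop_ext => z; rewrite dlopE !rank1E dsum_hdotE dsum_ractE /= hdot0l addr0 ract0l.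
by [].
Qed.

Lemma dense_lin_ext {R : realType} {A T : cstarAlgType R} (ell : starHom A T)
    {V : completeNormedModType R[i]} (f g : T -> V) : dense (range ell) ->
  lin_on setT f -> lin_on setT g -> (forall x, f (ell x) = g (ell x)) -> f =1 g.
Proof.
move=> dl lf lg fg t; have [u ut] := dense_range_cvs dl t.
have hf := lin_on_cvs (csubT T) lf (fun=> I) ut; have hg := lin_on_cvs (csubT T) lg (fun=> I) ut.
by apply: (cvs_uniq hf); move: hg; congr cvs; apply/funext => n; rewrite fg.
Qed.

Lemma dlopD {R : realType} {D : cstarAlgType R} {E F : hilbertModType D}
    (S S' : lop E) (T T' : lop F) : dlop S T + dlop S' T' = dlop (S + S') (T + T').
Proof. by apply: lop_ext. Qed.

Lemma dlopZ {R : realType} {D : cstarAlgType R} {E F : hilbertModType D} (c : R[i])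
    (S : lop E) (T : lop F) : c *: dlop S T = dlop (c *: S) (c *: T).
Proof. by apply: lop_ext. Qed.

(** * The inverse cycle *)

Section FockCycle.
Context {R : realType} {d : vertex_data R}.
Local Notation Af := (vAf d).
Local Notation inj := (vinj d).

Section Module.
Context {Q : cstarAlgType R} (q : starHom Af Q).

Lemma sep_KQ : separable Af -> separable Q -> separable (KQ q).
Proof. by move=> sA sQ; apply: (sep_total sA sQ (eK_lin q)); exact: eK_total. Qed.

Definition NQ : hilbertModType Q := dsum (MQ q) (KQ q).

Lemma sep_NQ : separable Af -> separable Q -> separable NQ.
Proof.
move=> sA sQ; have sK := sep_KQ sA sQ.
by apply: sep_dsum => //; apply: sep_dsum.
Qed.

Definition gamN : lop NQ := dlop cone (- cone).
Lemma gamN_sa : star gamN = gamN.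
Proof. by rewrite dlop_star starN !star1. Qed.
Lemma gamN_sq : gamN ** gamN = cone.
Proof. by rewrite dlopM cmulNl cmulNr opprK !cmul1l dlop1. Qed.
Lemma gamNE (z : NQ) : gamN z = (z.1, - z.2). Proof. by []. Qed.

Let FN_fun (z : NQ) : NQ := ((0, z.2) : MQ q, z.1.2 : KQ q).
Let FN_adj : adjoint_pair FN_fun FN_fun.
Proof.
move=> x y; rewrite !(dsum_hdotE (E := MQ q)) !(dsum_hdotE (F := KQ q)) /=.
by rewrite hdot0l hdot0r !add0r addrC.
Qed.
Let FN_bound z : nr (FN_fun z) <= 2 * nr z.
Proof.
apply: le_trans (dsum_nr_le _ _) _; rewrite dsum_nr_inr.
have h1 := dsum_nr2 z; have h2 := dsum_nr1 z; have h3 := dsum_nr2 z.1; lra.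
Qed.
Definition FN : lop NQ := Lop (lop_of FN_adj (ler0n R 2) FN_bound).
Lemma FNE (z : NQ) : FN z = ((0, z.2) : MQ q, z.1.2 : KQ q). Proof. by []. Qed.
Lemma FN_sa : star FN = FN. Proof. by apply: lop_star_uniq; exact: FN_adj. Qed.
Lemma FN_gam : FN ** gamN = - (gamN ** FN).
Proof.
apply: lop_ext => z; rewrite lopNE !lopME !FNE !gamNE /=; congr (_, _).
  by congr (_, _); rewrite /= ?oppr0.
by rewrite /= opprK.
Qed.

Definition v1N : NQ := (v1 q, 0).

Lemma hdot_v1N (z : NQ) : hdot v1N z = (z.1.1 : Q).
Proof.
rewrite !dsum_hdotE /= !hdot0l !addr0 -[LHS]/(star cone ** (z.1.1 : Q)).
by rewrite star1 cmul1l.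
Qed.

Lemma ract_v1N (c : Q) : ract v1N c = (((c : cself Q), 0) : MQ q, 0).
Proof.
rewrite !dsum_ractE /= !ract0l; congr ((_, _), _).
by rewrite -[LHS]/(cone ** c) cmul1l.
Qed.

Lemma FN_sq : FN ** FN = cone - rank1 v1N v1N.
Proof.
apply: lop_ext => z; rewrite lopBE lopME !FNE lop1E rank1E hdot_v1N ract_v1N /=.
case: z => [[c x] y] /=.
by congr ((_, _), _); rewrite /= ?subrr ?subr0.
Qed.

Definition DN : starHom Af (lop NQ) := dshom (sig q) (kap q).
Lemma DNE x (z : NQ) : DN x z = (sig q x z.1, kap q x z.2). Proof. by []. Qed.

Lemma FN_DN x : FN ** DN x = DN x ** FN.
Proof.
apply: lop_ext => z; rewrite !lopME FNE !DNE FNE; congr (_, _).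
by rewrite sigE; congr (_, _); rewrite cmul0r.
Qed.

Lemma gamN_dlop S T : gamN ** dlop S T = dlop S T ** gamN.
Proof. by rewrite !dlopM cmul1l cmul1r cmulNl cmulNr cmul1l cmul1r. Qed.

Definition v2N : NQ := (v2 q, 0).

Definition UN C S : lop NQ := dlop (Uc q C S) cone.

Lemma UNE C S : UN C S = cone + (C - 1)%:C *: (rank1 v1N v1N + rank1 v2N v2N) +
  S%:C *: (rank1 v2N v1N - rank1 v1N v2N).
Proof.
have e : (cone : lop NQ) = dlop cone cone by rewrite dlop1.
have n (x y : MQ q) : - rank1 ((x, 0) : NQ) (y, 0) = dlop (- rank1 x y) 0.
  by rewrite -dlop_rank1 -scaleN1r dlopZ scaleN1r scaler0.
have r (x y : MQ q) : rank1 ((x, 0) : NQ) (y, 0) = dlop (rank1 x y) 0 by rewrite dlop_rank1.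
by rewrite {}n !{}r {}e !dlopD !dlopZ !dlopD !addr0 !scaler0 !addr0.
Qed.

Section Angle.
Context {C S : R} (CS : C ^+ 2 + S ^+ 2 = 1).

Definition UkN k : lop NQ := dlop (Uk (C := C) (S := S) q k) cone.

Lemma UkN_r k : UkN k ** star (UkN k) = cone.
Proof. by rewrite dlop_star dlopM Uk_r// star1 cmul1l dlop1. Qed.

Lemma UkN_cpt k : cpt (UkN k - cone).
Proof.
case: k; first by rewrite /UkN /= dlop1 subrr; exact: (csub0 cpt_csub).
have e (o x y : lop NQ) : o + x + y - o = x + y by rewrite [LHS]addrAC [o + x]addrC addrK.
rewrite -[UkN false]/(UN C S) UNE e; have c := @cpt_csub _ _ NQ.
apply: (csubD c); apply: (csubZ c); last apply: cptB; try exact: cpt_rank1.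
by apply: (csubD c); exact: cpt_rank1.
Qed.

Definition ThN : starHom Af (lop NQ) := dshom (sgm q CS) (kap q).

Lemma ThNE k a : ThN (inj k a) = UkN k ** DN (inj k a) ** star (UkN k).
Proof.
rewrite /ThN /DN !dshomE /UkN dlop_star !dlopM sgmE.
by rewrite star1 cmul1l cmul1r.
Qed.

Lemma ThN_cpt k a : cpt (FN ** ThN (inj k a) - ThN (inj k a) ** FN).
Proof.
apply: (cpt_comm (FN_DN (inj k a))); rewrite ThNE.
by apply: cpt_conj; [exact: UkN_cpt|exact: UkN_r].
Qed.

Context {T : cstarAlgType R} {ell : starHom Af T}.
Hypothesis ell_dense : dense (range ell).
Hypothesis sgm_bound : forall x m, nr (sgm q CS x m) <= nr (ell x) * nr m.
Hypothesis kap_bound : forall x y, nr (kap q x y) <= nr (ell x) * nr y.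

Lemma ThN_bound x : nr (ThN x) <= nr (ell x).
Proof. by apply: lop_nr_le; [exact: nr_ge0|exact: (dshom_bound sgm_bound kap_bound)]. Qed.

Definition ThQ : starHom T (lop NQ) := shom_ext ell_dense ThN_bound.
Lemma ThQE x : ThQ (ell x) = ThN x. Proof. exact: shom_extE. Qed.

(** The acting algebra T and the coefficients Q are kept apart. The pairs ([ell], q) in use are
    (lambda, id) for the inverse, and (id, id) and (lambda, lambda) for the two products. *)
Definition fock_cycle : Defs.cycle T Q := opcycle gamN FN ThQ.

Lemma fock_cpt t : cpt (FN ** ThQ t - ThQ t ** FN).
Proof.
apply: (opcycle_cpt (vfull d) ell_dense FN_sa) => k a.
by rewrite ThQE; exact: ThN_cpt.
Qed.

Lemma fock_kasparov : separable Af -> separable Q -> is_kasparov fock_cycle.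
Proof.
move=> sA sQ; apply: (opcycle_kasparov (vfull d) ell_dense (v := v1N)).
- exact: gamN_sa.
- exact: gamN_sq.
- exact: FN_sa.
- exact: FN_gam.
- exact: FN_sq.
- by move=> k a; rewrite ThQE; exact: gamN_dlop.
- by move=> k a; rewrite ThQE; exact: ThN_cpt.
exact: sep_NQ.
Qed.

End Angle.

Lemma sgm_angle C S (CS : C ^+ 2 + S ^+ 2 = 1) C' S' (CS' : C' ^+ 2 + S' ^+ 2 = 1) :
  C = C' -> S = S' -> sgm q CS = sgm q CS'.
Proof. by move=> CC SS; subst C' S'; rewrite (eq_irrelevance CS CS'). Qed.

Lemma sgm_10 C S (CS : C ^+ 2 + S ^+ 2 = 1) x : C = 1 -> S = 0 -> sgm q CS x = sig q x.
Proof.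
move=> C1 S0; move: x; apply: (full_amalgam_uniq (vfull d)) => k a.
have UkE k' : Uk (C := C) (S := S) q k' = cone.
  by case: k' => //=; rewrite C1 S0 Uc_1.
by rewrite sgmE UkE star1 cmul1l cmul1r.
Qed.

End Module.
End FockCycle.

(** * The homotopy to the identity *)

Section PathOperators.
Context {R : realType} {A : cstarAlgType R} {E : hilbertModType A} {S : set E}.
Context (HS : is_csubmod (S := S)).

Definition cst_path (z : E) (Sz : S z) : hpath HS :=
  CPath (cpath_of (HS := HS) (pcont_cst z) (fun=> erefl) Sz).

Section Constant.
Context (T : lop E) (TS : forall z, S z -> S (T z)) (TS' : forall z, S z -> S (star T z)).

Let app_subproof (U : lop E) (US : forall z, S z -> S (U z)) (f : hpath HS) :
  (fun t => U (f t)) \in cpath_pred HS.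
Proof.
have [f1 f2 f3] := cpathP f; apply: cpath_of; last exact: US.
  apply: (@pcont_lip _ _ _ U (nr U)) f1 => x y.
  by rewrite -(padjB (lop_adj U)) lop_nr.
by move=> t; rewrite f2.
Qed.

Let app U US f : hpath HS := CPath (@app_subproof U US f).

Let app_adj : adjoint_pair (app TS) (app TS').
Proof. by move=> f g; apply: cpath_ext => t _; rewrite !hpath_hdotE; exact: lop_adj. Qed.

Let app_bound f : nr (app TS f) <= nr T * nr f.
Proof.
apply: cpath_nr_le => t; apply: le_trans (lop_nr _ _) _.
by rewrite ler_wpM2l ?nr_ge0 ?cpath_nr.
Qed.

Definition hop : lop (hpath HS) := Lop (lop_of app_adj (nr_ge0 T) app_bound).
Lemma hopE f t : hop f t = T (f t). Proof. by []. Qed.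
End Constant.

Lemma path_adj (V V' : lop (hpath HS)) (T : R -> lop E) :
  (forall f t, V f t = T t (f t)) -> (forall f t, V' f t = star (T t) (f t)) -> star V = V'.
Proof.
move=> hV hV'; apply: lop_star_uniq => f g; apply: cpath_ext => t _.
by rewrite !hpath_hdotE hV hV' lop_adj.
Qed.

Section ConstantRep.
Context {C : cstarAlgType R} (g : starHom C (lop E)).
Hypothesis gS : forall c z, S z -> S (g c z).

Let gS' c z : S z -> S (star (g c) z). Proof. by rewrite -shom_star; exact: gS. Qed.
Let h c := hop (gS c) (gS' c).

Let h_rep : unital_rep (fun c f => h c f).
Proof.
split; last by move=> f; apply: cpath_ext => t _; rewrite hopE shom1 lop1E.
split=> [c a b f|a b f|a].
- by apply: cpath_ext => t _; rewrite cpathDE cpathZE !hopE linearP.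
- by apply: cpath_ext => t _; rewrite !hopE shomM.
move=> f f'; apply: cpath_ext => t _.
by rewrite !hpath_hdotE !hopE lop_adj shom_star.
Qed.

Definition hop_shom : starHom C (lop (hpath HS)) := rep_shom h_rep.
Lemma hop_shomE c f t : hop_shom c f t = g c (f t). Proof. by []. Qed.
End ConstantRep.

End PathOperators.

Section RotationAngle.
Context {R : realType}.
Implicit Types s t : R.

(** [tau] is the tangent of half the angle, so [Ct] = (1 - tau^2)/(1 + tau^2) and [St] = 2 tau/(1 +
    tau^2) run from the exchange at t = 0 to the identity at t = 1. The factorizations [St] = tau g
    and 1 - [Ct] = tau^2 g, with g = [gtau], are what the path module needs. *)
Definition tau t : R := 1 - clamp t.
Definition gtau t : R := 2 / (1 + tau t ^+ 2).
Definition Ct t : R := gtau t - 1.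
Definition St t : R := tau t * gtau t.

Let den_gt0 t : 0 < 1 + tau t ^+ 2. Proof. by rewrite ltr_pwDl// sqr_ge0. Qed.

Lemma gtauE t : gtau t * (1 + tau t ^+ 2) = 2.
Proof. by rewrite /gtau mulfVK// gt_eqF. Qed.

Lemma tau_sq_gtau t : tau t ^+ 2 * gtau t = 2 - gtau t.
Proof. by have := gtauE t; lra. Qed.

Lemma CSt t : Ct t ^+ 2 + St t ^+ 2 = 1.
Proof.
rewrite /Ct /St exprMn; have h := gtauE t; have h' := tau_sq_gtau t.
have -> : tau t ^+ 2 * gtau t ^+ 2 = (tau t ^+ 2 * gtau t) * gtau t by ring.
by rewrite h'; ring.
Qed.

Lemma tau_lip s t : `|tau s - tau t| <= `|s - t|.
Proof.
have -> : tau s - tau t = clamp t - clamp s by rewrite /tau; ring.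
by rewrite distrC clamp_lip.
Qed.

Lemma tau_bounds t : 0 <= tau t <= 1.
Proof. by rewrite /tau; have /andP[] := clamp_bounds t => *; apply/andP; split; lra. Qed.

(** The constant 4 is the product of the bounds 2 for [gtau s * gtau t / 2] and 2 for
    [tau t + tau s]. *)
Lemma gtau_lip s t : `|gtau s - gtau t| <= 4 * `|s - t|.
Proof.
have hs := den_gt0 s; have ht := den_gt0 t.
have -> : gtau s - gtau t = gtau s * gtau t / 2 * (tau t + tau s) * (tau t - tau s).
  by rewrite /gtau; field; rewrite !gt_eqF.
have g2 u : 0 <= gtau u <= 2.
  rewrite /gtau divr_ge0 ?(ltW (den_gt0 u))//= ler_pdivrMr// ler_peMr//.
  by rewrite lerDl sqr_ge0.
have /andP[a1 a2] := g2 s; have /andP[b1 b2] := g2 t.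
have /andP[c1 c2] := tau_bounds s; have /andP[d1 d2] := tau_bounds t.
have h1 : 0 <= gtau s * gtau t <= 4 by apply/andP; split; nra.
rewrite normrM; apply: ler_pM => //; last by rewrite distrC tau_lip.
case/andP: h1 => e1 e2; rewrite ger0_norm; last by apply: mulr_ge0; lra.
by nra.
Qed.

Lemma tau0 : tau 0 = 1. Proof. by rewrite /tau clamp_id ?lexx ?ler01// subr0. Qed.
Lemma tau1 : tau 1 = 0. Proof. by rewrite /tau clamp_id ?lexx ?ler01// subrr. Qed.
Lemma tau_clamp t : tau (clamp t) = tau t. Proof. by rewrite /tau clampK. Qed.
Lemma gtau_clamp t : gtau (clamp t) = gtau t. Proof. by rewrite /gtau tau_clamp. Qed.
Lemma gtau0 : gtau 0 = 1. Proof. by rewrite /gtau tau0 expr1n divff// pnatr_eq0. Qed.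
Lemma gtau1 : gtau 1 = 2. Proof. by rewrite /gtau tau1 expr0n addr0 divr1. Qed.

Lemma pcont_scale {V : normedModType R[i]} (h : R -> R) (C : R) (v : V) :
  (forall s t, `|h s - h t| <= C * `|s - t|) -> pcont (fun t => (h t)%:C *: v).
Proof.
move=> hC t e e0; have C1 : 0 < `|C| * nr v + 1 by rewrite ltr_pwDr// mulr_ge0 ?nr_ge0.
exists (e / (`|C| * nr v + 1)); first exact: divr_gt0.
move=> s; rewrite ltr_pdivlMr// => h'; rewrite -scalerBl -rmorphB nrZR /=.
apply: le_lt_trans h'; apply: (@le_trans _ _ (C * `|s - t| * nr v)).
  by rewrite ler_wpM2r ?nr_ge0.
have h1 : C * `|s - t| <= `|C| * `|s - t| by rewrite ler_wpM2r// ler_norm.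
have h2 := ler_wpM2r (nr_ge0 v) h1; apply: le_trans h2 _.
have := normr_ge0 (s - t); lra.
Qed.

End RotationAngle.

Section Homotopy.
Context {R : realType} {d : vertex_data R}.
Local Notation Af := (vAf d).
Local Notation inj := (vinj d).
Context {Q : cstarAlgType R} (q : starHom Af Q).
Hypothesis q_dense : dense (range q).
Hypothesis sgm_bound : forall (C S : R) (CS : C ^+ 2 + S ^+ 2 = 1) x m,
  nr (sgm q CS x m) <= nr (q x) * nr m.
Hypothesis kap_bound : forall x y, nr (kap q x y) <= nr (q x) * nr y.

Local Notation N := (NQ q).
Local Notation Tht t := (ThN q (CSt t)).

(** The summand Q of (Q + K) + K, in which the paths have to end. It is invariant under the
    unrotated action, under F and the grading, but under the rotations of the path only at t = 1,
    where the rotation is trivial. *)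
Definition fibre1 : set N := [set z | z.1.2 = 0 /\ z.2 = 0].

Lemma fibre1_csub : is_csubmod (S := fibre1).
Proof.
split; first split.
- by [].
- by move=> x y [x1 x2] [y1 y2]; split; rewrite /= ?x1 ?x2 ?y1 ?y2 addr0.
- by move=> c x [x1 x2]; split; rewrite /= ?x1 ?x2 scaler0.
- move=> u l hu ul; split.
    apply: (@cvs_uniq _ _ (fun n => (u n).1.2)).
      move=> e /ul[M hM]; exists M => n /hM; apply: le_lt_trans.
      exact: le_trans (dsum_nr2 (u n - l).1) (dsum_nr1 (u n - l)).
    rewrite (_ : (fun n => _) = fun=> 0); first exact: cvs_cst.
    by apply/funext => n; case: (hu n).
  apply: (@cvs_uniq _ _ (fun n => (u n).2)).
    by move=> e /ul[M hM]; exists M => n /hM; apply: le_lt_trans; exact: (dsum_nr2 (u n - l)).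
  rewrite (_ : (fun n => _) = fun=> 0); first exact: cvs_cst.
  by apply/funext => n; case: (hu n).
by move=> x a [x1 x2]; split; rewrite dsum_ractE /= ?x1 ?x2 ract0l.
Qed.

Definition W : hilbertModType (palg Q) := hpath fibre1_csub.

Let gamN_fibre1 z : fibre1 z -> fibre1 (gamN q z).
Proof. by move=> [z1 z2]; split; rewrite gamNE /= ?z1 ?z2 ?oppr0. Qed.
Let gamN_fibre1' z : fibre1 z -> fibre1 (star (gamN q) z).
Proof. by rewrite gamN_sa; exact: gamN_fibre1. Qed.
Definition gamW : lop W := hop fibre1_csub gamN_fibre1 gamN_fibre1'.

Let FN_fibre1 z : fibre1 z -> fibre1 (FN q z).
Proof. by move=> [z1 z2]; split; rewrite FNE /= ?z1 ?z2. Qed.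
Let FN_fibre1' z : fibre1 z -> fibre1 (star (FN q) z).
Proof. by rewrite FN_sa; exact: FN_fibre1. Qed.
Definition FW : lop W := hop fibre1_csub FN_fibre1 FN_fibre1'.

Let DN_fibre1 x z : fibre1 z -> fibre1 (DN q x z).
Proof.
move=> [z1 z2]; have k0 := padj0 (lop_adj (kap q x)).
split; first exact: etrans (congr1 (kap q x) z1) k0.
exact: etrans (congr1 (kap q x) z2) k0.
Qed.
Definition DW : starHom Af (lop W) := hop_shom fibre1_csub DN_fibre1.

Let v1N_fibre1 : fibre1 (v1N q). Proof. by []. Qed.
Definition v1W : W := cst_path fibre1_csub v1N_fibre1.

Let w2_subproof : (fun t => (tau t)%:C *: v2N q) \in cpath_pred fibre1_csub.
Proof.
apply: cpath_of.
- apply: (@pcont_scale _ _ tau 1) => s t; by rewrite mul1r tau_lip.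
- by move=> t; rewrite tau_clamp.
by rewrite tau1 scale0r; exact: (csub0 fibre1_csub).
Qed.
Definition w2W : W := CPath w2_subproof.

Let g_subproof : (fun t => (gtau t)%:C *: (cone : Q)) \in cpath_pred (csubT Q).
Proof.
apply: cpath_of => //; last by move=> t; rewrite gtau_clamp.
exact: (@pcont_scale _ _ gtau 4 _ gtau_lip).
Qed.
Definition gW : palg Q := CPath g_subproof.

(* The rotation by t differs from 1 by a finite rank operator of the path module:
   v2 itself is not a path ending in fibre1, but tau *: v2 is, and every coefficient
   involving v2 is divisible by tau. *)
Definition UW (s : R[i]) : lop W :=
  cone + s *: (rank1 (ract w2W gW) v1W - rank1 (ract v1W gW) w2W)
  - rank1 (2%:R *: v1W - ract v1W gW) v1W - rank1 (ract w2W gW) w2W.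

Let rW (r : R) (x : N) : ract x (r%:C *: (cone : Q)) = r%:C *: x.
Proof. by rewrite ractZr ract1. Qed.

(** With g = C + 1, the coefficient of a is g - 2 = C - 1 by construction. That of b is - r^2 g,
    equal to it by the relation between g and r, and the mixed terms receive r g, the sine. *)
Let rotation_comb (V : lmodType R[i]) (z a b c e : V) (s g r : R) : r ^+ 2 * g = 2 - g ->
  z + s%:C *: (g%:C *: (r%:C *: c) - r%:C *: (g%:C *: e)) - (2%:R *: a - g%:C *: a)
    - r%:C *: (g%:C *: (r%:C *: b)) =
  z + (g - 1 - 1)%:C *: (a + b) + (s * (r * g))%:C *: (c - e).
Proof.
move=> h; have -> : - (2%:R *: a - g%:C *: a) = (g - 1 - 1)%:C *: a.
  by rewrite opprB -scalerBl; congr (_ *: _); rewrite !rmorphB rmorph1 -addrA -opprD.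
have -> : - (r%:C *: (g%:C *: (r%:C *: b))) = (g - 1 - 1)%:C *: b.
  rewrite -scaleNr !scalerA -rmorphN -!rmorphM /=; congr (_%:C *: _).
  by transitivity (- (r ^+ 2 * g)); [ring|rewrite h; ring].
have -> : s%:C *: (g%:C *: (r%:C *: c) - r%:C *: (g%:C *: e)) = (s * (r * g))%:C *: (c - e).
  by rewrite !scalerBr !scalerA -!rmorphM /=; congr (_%:C *: _ - _%:C *: _); ring.
by rewrite [_ *: (a + b)]scalerDr -[LHS]addrA [LHS]addrAC.
Qed.

(** The parameter s is 1 for the rotation and -1 for its adjoint, and only changes the sign of the
    sine. *)
Lemma UWE (s : R) f t : UW s%:C f t = UN q (Ct t) (s * St t) (f t).
Proof.
have -> : UW s%:C f t = f t + s%:C *: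
  (ract (ract ((tau t)%:C *: v2N q) ((gtau t)%:C *: (cone : Q))) (hdot (v1N q) (f t)) -
   ract (ract (v1N q) ((gtau t)%:C *: (cone : Q))) (hdot ((tau t)%:C *: v2N q) (f t))) -
  ract (2%:R *: v1N q - ract (v1N q) ((gtau t)%:C *: (cone : Q))) (hdot (v1N q) (f t)) -
  ract (ract ((tau t)%:C *: v2N q) ((gtau t)%:C *: (cone : Q)))
    (hdot ((tau t)%:C *: v2N q) (f t)) by [].
have cj (r : R) : (r%:C)^* = r%:C by rewrite conj_Creal// complex_real.
rewrite UNE !(lopDE, lopZE, lopBE) lop1E !rank1E !rW !hdotZl !cj !ractZr ractBl !ractZl.
by rewrite rotation_comb ?tau_sq_gtau.
Qed.

Let UN_star C S : star (UN q C S) = UN q C (- S).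
Proof. by rewrite dlop_star star_Uc star1. Qed.

Let UW_star : star (UW 1%:C) = UW (-1)%:C.
Proof.
apply: (path_adj (T := fun t => UN q (Ct t) (St t))) => f t; rewrite UWE ?mul1r//.
by rewrite UN_star mulN1r.
Qed.

Definition UkW (k : bool) : lop W := if k then cone else UW 1%:C.

Lemma UkWE k f t : UkW k f t = UkN (C := Ct t) (S := St t) q k (f t).
Proof.
case: k; first by rewrite [UkN _ _]dlop1 !lop1E.
by rewrite [LHS]UWE mul1r.
Qed.

Lemma UkW_starE k f t : star (UkW k) f t = star (UkN (C := Ct t) (S := St t) q k) (f t).
Proof.
case: k; first by rewrite [UkN _ _]dlop1 [star _]star1 star1 !lop1E.
by rewrite [star (UkW _)]UW_star UWE mulN1r [star _]UN_star.
Qed.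

Lemma UkW_r k : UkW k ** star (UkW k) = cone.
Proof.
apply: lop_ext => f; apply: cpath_ext => t _.
by rewrite lopME UkWE UkW_starE -lopME UkN_r ?lop1E//; exact: CSt.
Qed.

Lemma UkW_l k : star (UkW k) ** UkW k = cone.
Proof.
apply: lop_ext => f; apply: cpath_ext => t _.
rewrite lopME UkW_starE UkWE -lopME dlop_star dlopM Uk_l; last exact: CSt.
by rewrite star1 cmul1l dlop1 !lop1E.
Qed.

Lemma UkW_cpt k : cpt (UkW k - cone).
Proof.
have c := @cpt_csub _ _ W.
case: k; first by rewrite subrr; exact: (csub0 c).
have e (o x y z : lop W) : o + x - y - z - o = x - y - z.
  by rewrite -!addrA [LHS]addrC -!addrA addNr addr0.
rewrite [UkW false]/(UW 1%:C) /UW e.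
apply: cptB; last exact: cpt_rank1.
apply: cptB; last exact: cpt_rank1.
by apply: (csubZ c); apply: cptB; exact: cpt_rank1.
Qed.

Lemma ThW_ex : exists g : starHom Af (lop W),
  forall k a, g (inj k a) = UkW k ** DW (inj k a) ** star (UkW k).
Proof.
have [|g hg _] := (vfull d).2 _ (fun k => shom_conj (shom_comp DW (inj k)) (UkW_l k) (UkW_r k)).
  move=> b; rewrite !shom_conjE !shom_compE.
  apply: lop_ext => f; apply: cpath_ext => t _.
  (* The agreement of the two conjugated actions over B is inherited from each fibre, where the
     rotated representation already exists. *)
  have h k a : (UkW k ** DW (inj k a) ** star (UkW k)) f t = Tht t (inj k a) (f t).
    by rewrite !lopME UkWE hop_shomE UkW_starE ThNE.
  by rewrite !h (inj_iota (vfull d) true false).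
by exists g => k a; rewrite hg shom_conjE shom_compE.
Qed.

Definition ThW : starHom Af (lop W) := projT1 (cid ThW_ex).
Lemma ThW_inj k a : ThW (inj k a) = UkW k ** DW (inj k a) ** star (UkW k).
Proof. by rewrite /ThW; case: cid. Qed.

Lemma ThWE x f t : ThW x f t = Tht t x (f t).
Proof.
pose P x := forall f t, ThW x f t = Tht t x (f t).
suff [h _] : P x /\ P (star x) by exact: h.
have Pcvs u l : (forall n, P (u n)) -> cvs u l -> P l.
  move=> hu ul f' t'.
  have h1 : cvs (fun n => ThW (u n) f' t') (ThW l f' t').
    apply: (@cvs_lip _ _ _ (fun x => ThW x f' t') (nr f')) ul => y z.
    have -> : ThW y f' t' - ThW z f' t' = ThW (y - z) f' t' by rewrite linearB.
    have h2 : nr (ThW (y - z) f' t') <= nr (ThW (y - z) f') := cpath_nr _ _.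
    by apply: le_trans h2 _; apply: le_trans (lop_nr _ _) _; rewrite mulrC ler_wpM2l ?nr_ge0 ?shom_nr.
  have h2 : cvs (fun n => Tht t' (u n) (f' t')) (Tht t' l (f' t')).
    apply: (@cvs_lip _ _ _ (fun x => Tht t' x (f' t')) (nr (f' t'))) ul => y z.
    rewrite -lopBE -linearB; apply: le_trans (lop_nr _ _) _.
    by rewrite mulrC ler_wpM2l ?nr_ge0 ?shom_nr.
  have e : (fun n => ThW (u n) f' t') = (fun n => Tht t' (u n) (f' t')).
    by apply/funext => n; exact: hu.
  by rewrite e in h1; exact: cvs_uniq h1 h2.
move: x; apply: (full_amalgam_ind (vfull d) (P := [set x | P x /\ P (star x)])).
  split=> /=.
  - by rewrite star1; split=> f' t'; rewrite !shom1 !lop1E.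
  - move=> a b [a1 a2] [b1 b2]; split=> f' t'.
      by rewrite !linearD !lopDE cpathDE a1 b1.
    by rewrite starD !linearD !lopDE cpathDE a2 b2.
  - move=> c a [a1 a2]; split=> f' t'.
      by rewrite !linearZ !lopZE cpathZE a1.
    by rewrite starZ !linearZ !lopZE cpathZE a2.
  - move=> a b [a1 a2] [b1 b2]; split=> f' t'.
      by rewrite !shomM !lopME a1 b1.
    by rewrite starM !shomM !lopME b2 a2.
  - by move=> a [a1 a2]; split=> //; rewrite starK.
  move=> u l hu ul; split; first by apply: (Pcvs u) => // n; case: (hu n).
  by apply: (Pcvs (fun n => star (u n))) (cvs_star ul) => n; case: (hu n).
move=> k a /=; have h b : P (inj k b).
  by move=> f' t'; rewrite ThW_inj !lopME UkWE hop_shomE UkW_starE ThNE !lopME.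
by split=> //; rewrite -shom_star.
Qed.

(** The norm of a path is the supremum over its fibres, so the bound on [sgm] enters at all angles
    of the path with one constant. *)
Lemma ThW_bound x : nr (ThW x) <= nr (q x).
Proof.
apply: lop_nr_le => [|f]; first exact: nr_ge0.
have fn t : nr (f t) <= nr f := cpath_nr _ _.
apply: (@cpath_nr_le _ _ _ fibre1_csub) => t; rewrite ThWE; apply: le_trans (lop_nr _ _) _.
apply: ler_pM; rewrite ?nr_ge0//.
by apply: ThN_bound => // y m; exact: sgm_bound.
Qed.

Definition ThWQ : starHom Q (lop W) := shom_ext q_dense ThW_bound.
Lemma ThWQE x : ThWQ (q x) = ThW x. Proof. exact: shom_extE. Qed.

Definition path_cycle : Defs.cycle Q (palg Q) := opcycle gamW FW ThWQ.

Lemma path_kasparov : separable Af -> separable Q -> is_kasparov path_cycle.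
Proof.
move=> sA sQ; apply: (opcycle_kasparov (vfull d) q_dense (v := v1W)).
- by apply: (path_adj (T := fun=> gamN q)) => f t; rewrite hopE ?gamN_sa.
- by apply: lop_ext => f; apply: cpath_ext => t _; rewrite lopME !hopE -lopME gamN_sq !lop1E.
- by apply: (path_adj (T := fun=> FN q)) => f t; rewrite hopE ?FN_sa.
- apply: lop_ext => f; apply: cpath_ext => t _.
  by rewrite lopNE !lopME !hopE -!lopME FN_gam.
- apply: lop_ext => f; apply: cpath_ext => t _.
  by rewrite lopME !hopE -lopME FN_sq.
- move=> k a; rewrite ThWQE; apply: lop_ext => f; apply: cpath_ext => t _.
  by rewrite !lopME hopE !ThWE hopE -!lopME gamN_dlop.
- move=> k a; rewrite ThWQE ThW_inj; apply: (cpt_comm (T := DW (inj k a))).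
    apply: lop_ext => f; apply: cpath_ext => t _.
    have e g : DW (inj k a) g t = DN q (inj k a) (g t) by exact: hop_shomE.
    by rewrite !lopME e [LHS]hopE e [FW f t]hopE -!lopME FN_DN.
  by apply: cpt_conj; [exact: UkW_cpt|exact: UkW_r].
by apply: sep_hpath; exact: sep_NQ.
Qed.

End Homotopy.

Lemma hom_kasparov {R : realType} {A D : cstarAlgType R} (f : starHom A D) :
  separable D -> is_kasparov (hom_cycle f).
Proof.
move=> sD; split=> //=.
- split; last by [].
  split=> [c a b x|a b x|a x y].
  + by rewrite linearP cmulDl cmulZl.
  + by rewrite shomM -[LHS]cmulA.
  by rewrite -[LHS]/(star (f a ** (x : D)) ** (y : D)) starM shom_star -cmulA.
- by move=> x; rewrite oppr0.
exists (fun=> 0) => [x y|a]; first by rewrite hdot0l hdot0r.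
split.
- have := @compact_0 _ _ (cself D) (cself D); congr compact_op; apply/funext => x.
  by rewrite cmul0r subrr.
(* As D is unital, left multiplication by - f a is the rank one operator x -> (- f a) <1, x>; thus
   the operator 0 is admissible. *)
- have := @compact_rank1 _ _ (cself D) (cself D) (- f a : D) (cone : D).
  congr compact_op; apply/funext => x.
  rewrite sub0r -[LHS]/((- f a) ** (star cone ** (x : D))).
  by rewrite star1 cmul1l cmulNl.
have := @compact_0 _ _ (cself D) (cself D); congr compact_op; apply/funext => x.
by rewrite subrr.
Qed.

Lemma shom_app_lin {R : realType} {A D : cstarAlgType R} {N : hilbertModType D}
    (Th : starHom A (lop N)) (z : N) : lin_on setT (fun a => Th a z).
Proof.
split=> [a b _ _|c a _|]; rewrite ?linearD ?linearZ//.
exists (nr z) => [|a _]; first exact: nr_ge0.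
by apply: le_trans (lop_nr _ _) _; rewrite mulrC ler_wpM2l ?nr_ge0 ?shom_nr.
Qed.

Section HomotopyClass.
Context {R : realType} {d : vertex_data R}.
Local Notation Af := (vAf d).
Context {Q : cstarAlgType R} (q : starHom Af Q).
Hypothesis q_dense : dense (range q).
Hypothesis sgm_bound : forall (C S : R) (CS : C ^+ 2 + S ^+ 2 = 1) x m,
  nr (sgm q CS x m) <= nr (q x) * nr m.
Hypothesis kap_bound : forall x y, nr (kap q x y) <= nr (q x) * nr y.

Let w := path_cycle q_dense sgm_bound kap_bound.
Let z := fock_cycle q_dense (sgm_bound CS01) kap_bound.

Let eval_lin t : lin_on setT (fun f : W q => f t).
Proof.
split=> [f g _ _|c f _|]; [exact: cpathDE|exact: cpathZE|].
by exists 1 => // f _; rewrite mul1r; exact: cpath_nr.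
Qed.

(** Any vector is the initial value of a path that [tau] scales down to 0, so the fibre at 0 is the
    whole module. *)
Let surj0 (y : NQ q) : exists f : W q, f 0 = y.
Proof.
have P : (fun t => (tau t)%:C *: y) \in cpath_pred (fibre1_csub q).
  apply: cpath_of.
  - by apply: (@pcont_scale _ _ tau 1) => s t; rewrite mul1r tau_lip.
  - by move=> t; rewrite tau_clamp.
  by rewrite tau1 scale0r; exact: (csub0 (fibre1_csub q)).
by exists (CPath P); rewrite /= tau0 scale1r.
Qed.

Lemma path_at_0 : is_pushforward (palg_ev Q 0) w z.
Proof.
exists (fun (f : W q) (c : cself Q) => ract (f 0) (c : Q)); split.
- apply: (coeff_tensor (f := palg_ev Q 0) (L := fun f : W q => f 0)) => //.
  rewrite -subTset => y _; have [f <-] := surj0 y.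
  by apply: sub_clspan; exists f, cone; rewrite ract1.
- by move=> f c; exact: (padjM (lop_adj (gamN q))).
- move=> a f c; apply: etrans (padjM (lop_adj _) (f 0) (c : Q)) _.
  apply: (congr1 (fun y : NQ q => ract y (c : Q))).
  move: a; apply: (dense_lin_ext q_dense) => [||x].
  + exact: shom_app_lin.
  + exact: (lin_on_compT (shom_app_lin _ f) (eval_lin 0)).
  rewrite ThQE -[RHS]/((ThWQ q_dense sgm_bound kap_bound (q x) f : W q) 0).
  rewrite ThWQE ThWE /ThN !dshomE.
  rewrite (sgm_angle q CS01 (CSt 0)) //.
    by rewrite /Ct gtau0 subrr.
  by rewrite /St tau0 gtau0 mulr1.
by move=> f c; exact: (padjM (lop_adj (FN q))).
Qed.

(** At the end only the summand Q is left, with the unrotated action, which there is left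
    multiplication, and with F = 0. The degenerate summand K + K has disappeared with the end
    condition on paths. *)
Lemma path_at_1 : is_pushforward (palg_ev Q 1) w (hom_cycle idfun).
Proof.
have fib (f : W q) : (f 1).1.2 = 0 /\ (f 1).2 = 0 by case: (cpathP f).
exists (fun (f : W q) (c : cself Q) => ((f 1).1.1 : Q) ** (c : Q)); split.
- apply: (coeff_tensor (f := palg_ev Q 1) (L := fun f : W q => ((f 1).1.1 : cself Q))).
    move=> u v; rewrite -[RHS]/(hdot (u 1) (v 1)) !dsum_hdotE.
    by have [-> ->] := fib u; rewrite !hdot0l !addr0.
  rewrite -subTset => c _; have nf : fibre1 (((c, 0) : MQ q, 0) : NQ q) by [].
  by apply: sub_clspan; exists (cst_path (fibre1_csub q) nf), cone; rewrite ract1.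
- by [].
- move=> a f c; rewrite -[LHS]/(a ** (((f 1).1.1 : Q) ** (c : Q))) cmulA; congr (_ ** _).
  move: a; apply: (dense_lin_ext q_dense) => [||x].
  + split=> [a b _ _|e a _|]; [exact: cmulDl|exact: cmulZl|].
    by exists (nr ((f 1).1.1 : Q)) => [|a _]; [exact: nr_ge0|rewrite mulrC; exact: nrM].
  + apply: (lin_on_compT (lin_on_compT (shom_app_lin _ f) (eval_lin 1))
      (g := fun y : NQ q => (y.1.1 : Q))).
    split=> // ; exists 1 => // y _; rewrite mul1r.
    exact: le_trans (dsum_nr1 y.1) (dsum_nr1 y).
  rewrite -[RHS]/((ThWQ q_dense sgm_bound kap_bound (q x) f : W q) 1).1.1.
  rewrite ThWQE ThWE /ThN dshomE dlopE /= sgm_10 ?sigE//.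
    by rewrite /Ct gtau1; ring.
  by rewrite /St tau1 mul0r.
by move=> f c; rewrite -[RHS]/((0 : Q) ** (c : Q)) cmul0l.
Qed.

Lemma fock_idfun : separable Af -> separable Q -> kk_eq z (hom_cycle idfun).
Proof.
move=> sA sQ; split; first exact: fock_kasparov.
  exact: (hom_kasparov (@shom_id _ Q)).
exists (palg Q), (palg_ev Q); split; first exact: palg_is_path_algebra.
exists w; split; [exact: path_kasparov|exact: path_at_0|exact: path_at_1].
Qed.

End HomotopyClass.

(** * The two Kasparov products *)

Section Products.
Context {R : realType} {d : vertex_data R}.
Local Notation Af := (vAf d).
Local Notation inj := (vinj d).

Section Precomposition.
Context {Q : cstarAlgType R} {q : starHom Af Q} {T T' : cstarAlgType R}.
Context {ell : starHom Af T} {ell' : starHom Af T'} {C S : R} {CS : C ^+ 2 + S ^+ 2 = 1}.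
Context (dn : dense (range ell)) (dn' : dense (range ell')).
Context (sb : forall x m, nr (sgm q CS x m) <= nr (ell x) * nr m).
Context (kb : forall x y, nr (kap q x y) <= nr (ell x) * nr y).
Context (sb' : forall x m, nr (sgm q CS x m) <= nr (ell' x) * nr m).
Context (kb' : forall x y, nr (kap q x y) <= nr (ell' x) * nr y).
Context (f : starHom T T') (f_ell : forall x, f (ell x) = ell' x).
Hypotheses (sepAf : separable Af) (sepQ : separable Q).

Let Th' := ThQ dn' sb' kb'.

Let Th_f a y : ThQ dn sb kb a y = Th' (f a) y.
Proof.
move: a; apply: (dense_lin_ext dn) => [||x].
- exact: shom_app_lin.
- exact: (shom_app_lin (shom_comp Th' f)).
by rewrite ThQE f_ell ThQE.
Qed.

(** The tensor product of T' with the module over T' is the module itself, by a (x) y -> a y. The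
    connection condition is then the compactness of the commutators of F with T'. *)
Lemma product_precomp :
  is_kasparov_product (hom_cycle f) (fock_cycle dn' sb' kb') (fock_cycle dn sb kb).
Proof.
split; first exact: fock_kasparov.
have rep := shom_rep Th'.
exists (fun (a : cself T') (y : NQ q) => Th' (a : T') y); split.
- split=> [a a' y y' _ _|].
    rewrite lop_adj -shom_star -lopME -shomM //.
  rewrite -subTset => y _; apply: sub_clspan; exists (cone : T'), y; split=> //.
  by rewrite shom1 lop1E.
- by have [_ _ [_ h] _ _] := fock_kasparov dn' sb' kb' sepAf sepQ; exact: h.
- by move=> a b y; rewrite [LHS]Th_f -lopME -shomM.
- move=> a; split.
    have := cpt_compact (cptN (@fock_cpt _ _ _ q _ _ CS _ _ dn' sb' kb' a)).
    by congr compact_op; apply/funext => y; rewrite lopNE lopBE opprB !lopME.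
  exists (fun y => Th' (star (a : T')) y), (fun y => Th' (star (a : T')) y); split.
  + exact: (rep_adj rep.1).
  + exact: (rep_adj rep.1).
  have := cpt_compact (@fock_cpt _ _ _ q _ _ CS _ _ dn' sb' kb' (star (a : T'))).
  by congr compact_op.
(* The first cycle has operator 0, so G = 0 and the positivity condition is satisfied trivially. *)
exists (fun=> 0); split.
- by exists (fun=> 0) => x y; rewrite hdot0l hdot0r.
- by move=> v y; rewrite -[RHS]/(Th' 0 y) linear0.
move=> a; exists (fun=> 0), (fun=> 0); split.
  by move=> x y; rewrite hdot0l hdot0r.
have := @compact_0 _ _ (NQ q) (NQ q); congr compact_op; apply/funext => v.
rewrite subr0 add0r [X in _ = X](_ : _ = ThQ dn sb kb a (FN q 0))//.
by rewrite (padj0 (lop_adj (FN q))) (padj0 (lop_adj _)).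
Qed.

End Precomposition.

Section Pushforward.
Context {Q Q' : cstarAlgType R} {q : starHom Af Q} {q' : starHom Af Q'}.
Context (f : starHom Q Q') (f_q : forall x, f (q x) = q' x).

Let LK_ex := coeff_total (f := f) (e := eK q) (e' := eK q') (@eK_total _ _ _ q).

(** The change of coefficients multiplies inner products by f, and f q = q' identifies the two
    families of generators; the maps on M and N are assembled from it. *)
Let LK_sub : exists L : KQ q -> KQ q', coeff_map f L /\ forall x, L (eK q x) = eK q' x.
Proof. by apply: LK_ex => x y; rewrite !hdot_eK /mu !shom_compE -f_q. Qed.

Definition LK : KQ q -> KQ q' := projT1 (cid LK_sub).
Lemma LK_coeff : coeff_map f LK. Proof. by rewrite /LK; case: cid => L []. Qed.
Lemma LK_eK x : LK (eK q x) = eK q' x. Proof. by rewrite /LK; case: cid => L [_] /=. Qed.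

Definition LM (m : MQ q) : MQ q' := ((f m.1 : cself Q'), LK m.2).
Lemma LM_coeff : coeff_map f LM.
Proof. exact: coeff_dsum (coeff_shom f) LK_coeff. Qed.

Definition LN (z : NQ q) : NQ q' := (LM z.1, LK z.2).
Lemma LN_coeff : coeff_map f LN.
Proof. exact: coeff_dsum LM_coeff LK_coeff. Qed.

Let LK0 : LK 0 = 0. Proof. exact: (lin_on0 (csubT _) (coeff_lin LK_coeff)). Qed.

Lemma LM_v1 : LM (v1 q) = v1 q'.
Proof. by rewrite /LM; congr (_, _); [exact: shom1|exact: LK0]. Qed.
Lemma LM_v2 : LM (v2 q) = v2 q'.
Proof. by rewrite /LM; congr (_, _); [exact: linear0|exact: LK_eK]. Qed.

Let LK_kap x y : LK (kap q x y) = kap q' x (LK y).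
Proof.
have : clspan [set z | exists u c, z = ract (eK q u) c] y.
  by rewrite (total_clspan (@eK_total _ _ _ q)).
have lk (Q0 : cstarAlgType R) (q0 : starHom Af Q0) : lin_on setT (kap q0 x).
  exact: lin_on_rep x (shom_rep (kap q0)).1.
move: y; apply: (csub_eqY (f := fun y => LK (kap q x y)) (g := fun y => kap q' x (LK y)) (csubT _)).
- exact: lin_on_compT (lk _ q) (coeff_lin LK_coeff).
- exact: lin_on_compT (coeff_lin LK_coeff) (lk _ q').
move=> _ [u [c ->]]; split=> //.
rewrite (padjM (lop_adj (kap q x))) kapE !(coeffM LK_coeff) !LK_eK.
by rewrite (padjM (lop_adj (kap q' x))) kapE.
Qed.

Let LM_sig x m : LM (sig q x m) = sig q' x (LM m).
Proof. by rewrite /LM !sigE; congr (_, _); [rewrite shomM f_q|exact: LK_kap]. Qed.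

Let LM_rank1 v w v' w' m : LM v = v' -> LM w = w' -> LM (rank1 v w m) = rank1 v' w' (LM m).
Proof. by move=> <- <-; rewrite !rank1E (coeffM LM_coeff) LM_coeff. Qed.

Let LM_Uc C S m : LM (Uc q C S m) = Uc q' C S (LM m).
Proof.
rewrite /Uc /PV /NV !(lopDE, lopZE, lopNE) !lop1E.
rewrite !(coeffD LM_coeff, coeffZ LM_coeff, coeffN LM_coeff).
by rewrite !(LM_rank1 _ LM_v1 LM_v1, LM_rank1 _ LM_v1 LM_v2, LM_rank1 _ LM_v2 LM_v1,
  LM_rank1 _ LM_v2 LM_v2).
Qed.

Section Angle.
Context {C S : R} (CS : C ^+ 2 + S ^+ 2 = 1).

Let LM_Uk k m : LM (Uk (C := C) (S := S) q k m) = Uk (C := C) (S := S) q' k (LM m).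
Proof. by case: k; [rewrite !lop1E|exact: LM_Uc]. Qed.

Let LM_Uk_star k m :
  LM (star (Uk (C := C) (S := S) q k) m) = star (Uk (C := C) (S := S) q' k) (LM m).
Proof. by case: k; [rewrite ![star _]star1 !lop1E|rewrite ![star _]star_Uc LM_Uc]. Qed.

Lemma LM_sgm x m : LM (sgm q CS x m) = sgm q' CS x (LM m).
Proof.
pose P x := forall m, LM (sgm q CS x m) = sgm q' CS x (LM m).
suff [h _] : P x /\ P (star x) by exact: h.
have Pcvs u l : (forall n, P (u n)) -> cvs u l -> P l.
  move=> hu ul m'.
  have h1 := lin_on_cvs (csubT _) (lin_on_compT (shom_app_lin (sgm q CS) m') (coeff_lin LM_coeff))
    (fun=> I) ul.
  have h2 := lin_on_cvs (csubT _) (shom_app_lin (sgm q' CS) (LM m')) (fun=> I) ul.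
  have e : (fun n => LM (sgm q CS (u n) m')) = (fun n => sgm q' CS (u n) (LM m')).
    by apply/funext => n; exact: hu.
  by rewrite e in h1; exact: cvs_uniq h1 h2.
move: x; apply: (full_amalgam_ind (vfull d) (P := [set x | P x /\ P (star x)])).
  split=> /=.
  - by rewrite star1; split=> m'; rewrite !shom1 !lop1E.
  - move=> a b [a1 a2] [b1 b2]; split=> m'.
      by rewrite !linearD !lopDE (coeffD LM_coeff) a1 b1.
    by rewrite starD !linearD !lopDE (coeffD LM_coeff) a2 b2.
  - move=> c a [a1 a2]; split=> m'.
      by rewrite !linearZ !lopZE (coeffZ LM_coeff) a1.
    by rewrite starZ !linearZ !lopZE (coeffZ LM_coeff) a2.
  - move=> a b [a1 a2] [b1 b2]; split=> m'.
      by rewrite !shomM !lopME a1 b1.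
    by rewrite starM !shomM !lopME b2 a2.
  - by move=> a [a1 a2]; split=> //; rewrite starK.
  move=> u l hu ul; split; first by apply: (Pcvs u) => // n; case: (hu n).
  by apply: (Pcvs (fun n => star (u n))) (cvs_star ul) => n; case: (hu n).
move=> k a /=; have h b : P (inj k b).
  by move=> m'; rewrite !sgmE !lopME LM_Uk LM_sig LM_Uk_star.
by split=> //; rewrite -shom_star.
Qed.

Lemma LN_span : clspan [set z | exists u c, z = ract (LN u) c] = setT.
Proof.
set X := [set z | _]; rewrite -subTset => -[[c x] y] _.
have -> : ((c, x), y) = ract (v1N q') (c : Q') + (inK x, 0) + (0, y) :> NQ q'.
  rewrite ract_v1N; congr ((_, _), _); rewrite /= ?addr0 ?add0r//.
have LM0 : LM 0 = 0 by exact: (lin_on0 (csubT _) (coeff_lin LM_coeff)).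
have spanK : clspan [set z | exists u c, z = ract (eK q' u) c] = setT.
  exact: total_clspan (@eK_total _ _ _ q').
apply: clspanD; first apply: clspanD.
- apply: sub_clspan; exists (v1N q), c; congr ract.
  by rewrite /LN; congr (_, _); [rewrite LM_v1|rewrite LK0].
- have : clspan [set z | exists u c, z = ract (eK q' u) c] x by rewrite spanK.
  move: x; apply: (csub_preT (f := fun x => (inK x, 0) : NQ q')).
  + split=> [u v _ _|s u _|]; first by congr ((_, _), _); rewrite /= addr0.
      by congr ((_, _), _); rewrite /= scaler0.
    by exists 1 => // u _; rewrite mul1r dsum_nr_inl dsum_nr_inr.
  + exact: clspan_csub.
  move=> _ [u [s ->]]; apply: sub_clspan; exists ((inK (eK q u), 0) : NQ q), s.
  have -> : LN (inK (eK q u), 0) = (inK (eK q' u), 0).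
    by congr ((_, _), _); [exact: linear0|exact: LK_eK|exact: LK0].
  by rewrite [RHS]dsum_ractE ract0l inK_ract.
have : clspan [set z | exists u c, z = ract (eK q' u) c] y by rewrite spanK.
move: y; apply: (csub_preT (f := fun y => (0, y) : NQ q')).
- split=> [u v _ _|s u _|]; first by congr (_, _); rewrite /= addr0.
    by congr (_, _); rewrite /= scaler0.
  by exists 1 => // u _; rewrite mul1r dsum_nr_inr.
- exact: clspan_csub.
move=> _ [u [s ->]]; apply: sub_clspan; exists ((0, eK q u) : NQ q), s.
have -> : LN (0, eK q u) = (0, eK q' u) by congr (_, _); [exact: LM0|exact: LK_eK].
by rewrite [RHS]dsum_ractE ract0l.
Qed.

Context {T : cstarAlgType R} {ell : starHom Af T} (dn : dense (range ell)).
Context (sb : forall x m, nr (sgm q CS x m) <= nr (ell x) * nr m).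
Context (kb : forall x y, nr (kap q x y) <= nr (ell x) * nr y).
Context (sb' : forall x m, nr (sgm q' CS x m) <= nr (ell x) * nr m).
Context (kb' : forall x y, nr (kap q' x y) <= nr (ell x) * nr y).
Hypotheses (sepAf : separable Af) (sepQ' : separable Q').

Let Th := ThQ dn sb kb.
Let Th' := ThQ dn sb' kb'.

Let LN_Th t z : LN (Th t z) = Th' t (LN z).
Proof.
move: t; apply: (dense_lin_ext dn) => [||x].
- exact: lin_on_compT (shom_app_lin Th z) (coeff_lin LN_coeff).
- exact: (shom_app_lin Th' (LN z)).
by rewrite !ThQE /ThN !dshomE !dlopE /LN LM_sgm LK_kap.
Qed.

Let LN_FN z : LN (FN q z) = FN q' (LN z).
Proof. by rewrite !FNE /LN /LM /= linear0. Qed.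

Let LN_gam z : LN (gamN q z) = gamN q' (LN z).
Proof. by rewrite !gamNE /LN /= (coeffN LK_coeff). Qed.

(** Here the second cycle has operator 0 and F (x) 1 is again the F of the larger coefficients, so
    the same module with the new coefficients represents the product. *)
Lemma product_pushforward :
  is_kasparov_product (fock_cycle dn sb kb) (hom_cycle f) (fock_cycle dn sb' kb').
Proof.
split; first exact: fock_kasparov.
exists (fun (z : NQ q) (c : cself Q') => ract (LN z) (c : Q')); split.
- exact: (coeff_tensor LN_coeff LN_span).
- move=> z c; apply: etrans (padjM (lop_adj (gamN q')) (LN z) (c : Q')) _.
  by rewrite -LN_gam.
- move=> a z c; apply: etrans (padjM (lop_adj (Th' a)) (LN z) (c : Q')) _.
  by rewrite -LN_Th.
- move=> z; split.
    (* Because Q' is unital, a module map from Q' is determined by its value at 1 and has rank one;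
       both connection conditions are of this kind. *)
    have := @compact_rank1 _ _ (cself Q') (NQ q') (- FN q' (LN (gamN q z))) (cone : Q').
    congr compact_op; apply/funext => c.
    rewrite ract0r sub0r -[hdot _ _]/(star cone ** (c : Q')) star1 cmul1l ractNl.
    by congr (- _); apply/esym; exact: (padjM (lop_adj (FN q')) (LN (gamN q z)) (c : Q')).
  exists (fun y => hdot (LN z) y : cself Q'), (fun y => hdot (LN (gamN q z)) y : cself Q'); split.
  + by move=> c y; rewrite hdotMl.
  + by move=> c y; rewrite hdotMl.
  have := @compact_rank1 _ _ (NQ q') (cself Q') (- cone : Q') (FN q' (LN (gamN q z))).
  congr compact_op; apply/funext => y.
  rewrite sub0r -[LHS]/((- cone) ** hdot (FN q' (LN (gamN q z))) y) cmulNl cmul1l.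
  by rewrite lop_adj FN_sa.
exists (FN q'); split.
- by exists (star (FN q')); exact: lop_adj.
- move=> z c; apply: etrans (padjM (lop_adj (FN q')) (LN z) (c : Q')) _.
  by rewrite -LN_FN.
(* The root of 2 comes from G F + F G = 2 F^2 = 2 - 2 [rank1 (v1N q') (v1N q')]: up to a compact
   operator the positive part is 2 a a*. *)
move=> a; pose s : R[i] := (Num.sqrt 2)%:C.
have ss : s * s = 2%:R by rewrite -rmorphM /= -expr2 sqr_sqrtr// rmorph_nat.
exists (fun v => (s *: Th' (star a)) v), (fun v => (s *: Th' a) v); split.
  move=> x y; rewrite lop_adj starZ -shom_star starK.
  by rewrite conj_Creal// complex_real.
have h : cpt (- (2%:R *: (Th' a ** rank1 (v1N q') (v1N q') ** Th' (star a)))).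
  by apply/cptN/(csubZ cpt_csub)/cpt_mulr/cpt_mull/cpt_rank1.
have := cpt_compact h; congr compact_op; apply/funext => v.
rewrite -[RHS]/(Th' a (FN q' (FN q' (Th' (star a) v)) + FN q' (FN q' (Th' (star a) v))) -
  (s *: Th' a) ((s *: Th' (star a)) v)).
set u := Th' (star a) v; set P := rank1 (v1N q') (v1N q').
have -> : FN q' (FN q' u) = u - P u by rewrite -lopME FN_sq lopBE lop1E.
have -> : (s *: Th' a) ((s *: Th' (star a)) v) = 2%:R *: Th' a u.
  by rewrite !lopZE (padjZ (lop_adj (Th' a))) scalerA ss.
have e (x : NQ q') : Th' a (x + x) = 2%:R *: Th' a x.
  by rewrite (padjD (lop_adj (Th' a))) scaler_nat mulr2n.
rewrite lopNE lopZE !lopME -/u e.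
by rewrite (padjB (lop_adj (Th' a))) scalerBr addrAC subrr sub0r.
Qed.

End Angle.
End Pushforward.
End Products.

Lemma shom_lop_bound {R : realType} {A D : cstarAlgType R} {N : hilbertModType D}
    (g : starHom A (lop N)) x m : nr (g x m) <= nr x * nr m.
Proof. by apply: le_trans (lop_nr _ _) _; rewrite ler_wpM2r ?nr_ge0 ?shom_nr. Qed.

Lemma vertex_kk_invertible {R : realType} (d : vertex_data R) :
  separable (vAf d) -> separable (vAv d) -> kk_invertible (hom_cycle (vlam d)).
Proof.
move=> sAf sAv; pose i : starHom (vAf d) (vAf d) := shom_id.
have dlam : dense (range (vlam d)) by have [] := vcompletion d.
have di : dense (range i).
  by apply/denseP => x e e0; exists x; [exists x|rewrite subrr nr0].
have sb x m : nr (sgm i CS01 x m) <= nr (vlam d x) * nr m.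
  exact: sgm_full_bound.
have kb x y : nr (kap i x y) <= nr (vlam d x) * nr y by exact: kap_lam.
have sbi (C S : R) (CS : C ^+ 2 + S ^+ 2 = 1) x m :
  nr (sgm i CS x m) <= nr (i x) * nr m by exact: shom_lop_bound.
have kbi x y : nr (kap i x y) <= nr (i x) * nr y by exact: shom_lop_bound.
have sbl (C S : R) (CS : C ^+ 2 + S ^+ 2 = 1) x m :
  nr (sgm (vlam d) CS x m) <= nr (vlam d x) * nr m by exact: sgm_reduced_bound.
have kbl x y : nr (kap (vlam d) x y) <= nr (vlam d x) * nr y by exact: kap_lam.
split; first exact: hom_kasparov.
exists (fock_cycle dlam sb kb); first exact: fock_kasparov.
split.
  (* [lambda] followed by the inverse: [Af] acts on a module over itself, so the bounds are the
     contractivity of representations. *)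
  exists (fock_cycle di (sbi _ _ CS01) kbi); last exact: fock_idfun.
  exact: product_precomp.
(* The inverse followed by [lambda]: the coefficients are now the vertex-reduced algebra, and the
   homotopy to the identity uses [sgm_reduced_bound] at all its angles. *)
exists (fock_cycle dlam (sbl _ _ CS01) kbl); last exact: fock_idfun.
exact: product_pushforward.
Qed.

Theorem theorem3p1 (R : realType)
  (B : cstarAlgType R) (A : bool -> cstarAlgType R)
  (iota : forall k, starHom B (A k))
  (E : forall k, {linear A k -> B})
  (Af : cstarAlgType R) (inj : forall k, starHom (A k) Af)
  (K : forall k, gns E k) (W : words iota K) (H : word_sums W)
  (pi : forall k, Af -> whsum H k k -> whsum H k k)
  (Av : cstarAlgType R) (lambda : starHom Af Av)
  (sepB : separable B) (sepA : forall k, separable (A k))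
  (sepAf : separable Af) (sepAv : separable Av)
  (iota_inj : forall k, injective (iota k))
  (E_cond : forall k, conditional_expectation (iota k) (E k))
  (Af_full : is_full_amalgam iota inj)
  (pi_vertex : is_vertex_rep inj pi)
  (Av_completion : is_separation_completion (vertex_norm pi) lambda) :
  kk_invertible (hom_cycle lambda).
Proof.
exact: (vertex_kk_invertible
  (d := VertexData E_cond Af_full pi_vertex Av_completion) sepAf sepAv).
Qed.
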